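(* Let $\beta \in (0, \pi/2]$ and $\nu > 0$, and let $\theta$ be a minimizer of $E_\beta$ over $\mathcal{A}$. Then $$\theta \in C^2(\mathbb{R}^+) \cap C^1(\overline{\mathbb{R}^+}) \cap W^{1,\infty}(\mathbb{R}^+)$$ and, for all $x > 0$, $$\theta''(x) = \sin\theta(x)\cos\theta(x) + \frac{\nu}{2\pi}\cdot\frac{\sin(\theta(x)-\beta)\cos(\theta(x)-\beta)}{x} + \frac{\nu}{2\pi}\cos(\theta(x)-\beta)\left( \mathrm{p.v.}\!\int_0^\infty \frac{\sin(\theta(x)-\beta) - \sin(\theta(y)-\beta)}{(x-y)^2}\,dy \right).$$ In addition, $|\theta'(0)| = \sin\beta$ and $\lim_{x\to 0^+} |\theta''(x)| = \infty$.
   Context: Notation: $\mathbb{R}^+ = (0,\infty)$ and $\overline{\mathbb{R}^+} = [0,\infty)$; all functions are real valued; $\mathrm{p.v.}\!\int$ denotes the Cauchy principal value of the integral (at the singularity $y=x$). $\mathring{H}^1_0(\mathbb{R}^+)$ is the Hilbert space obtained as the completion of $C^\infty_c(\mathbb{R}^+)$ with respect to the norm $\|u\|^2_{\mathring{H}^1_0(\mathbb{R}^+)} := \int_0^\infty |u'|^2\,dx$; its elements are identified with continuous functions on $[0,\infty)$ vanishing at $x=0$. For $\beta \in (0,\pi/2]$ the admissible class is $$\mathcal{A} := \{ \theta \in C(\overline{\mathbb{R}^+}) : \theta - \beta \in \mathring{H}^1_0(\mathbb{R}^+) \}.$$ For $\beta\in(0,\pi/2]$, $\eta_\beta : \mathbb{R}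 \to [0,\beta]$ is a fixed smooth cutoff function with $\eta_\beta(x) = \beta$ for $x \le 0$, $\eta_\beta(x) = 0$ for $x \ge 1$, and $\eta_\beta'(x) \le 0$ for all $x \in \mathbb{R}$. For $\beta \in (0,\pi/2]$, $\nu>0$ and $\theta \in \mathcal{A}$ the renormalized energy is $$E_\beta(\theta) = \int_0^\infty \left( \tfrac12 |\theta'|^2 + \tfrac12 \sin^2\theta + \frac{\nu}{4\pi}\cdot\frac{\sin^2(\theta-\beta) - \sin^2(\eta_\beta - \beta)}{x} \right) dx + \frac{\nu}{8\pi}\int_0^\infty\int_0^\infty \frac{(\sin(\theta(x)-\beta) - \sin(\theta(y)-\beta))^2}{(x-y)^2}\,dx\,dy - \frac{\nu}{8\pi}\int_0^\infty\int_0^\infty \frac{(\sin(\eta_\beta(x)-\beta) - \sin(\eta_\beta(y)-\beta))^2}{(x-y)^2}\,dx\,dy.$$ The integrand of the first integral is bounded from below by an integrable function not depending on $\theta$, the second term is nonnegative, and the last term is a finite constant, so $E_\beta(\theta) \in (-\infty,+\infty]$ is well defined on $\mathcal{A}$. A minimizer of $E_\beta$ over $\mathcal A$ is a $\theta\in\mathcal A$ with $E_\beta(\theta)=\inf_{\tilde\theta\in\mathcal A}E_\beta(\tilde\theta)$ (this infimum is finite). *)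

(* Defs.v *)
From HB Require Import structures.
From mathcomp Require Import all_boot all_order all_algebra.
From mathcomp Require Import all_classical all_reals all_analysis.

Set Implicit Arguments.
Unset Strict Implicit.
Unset Printing Implicit Defensive.

Import Order.TTheory GRing.Theory Num.Theory.
Import numFieldNormedType.Exports.

Local Open Scope ring_scope.
Local Open Scope classical_set_scope.

(* Functions on (0,+oo) or on [0,+oo) are represented by total functions R -> R;
   the values at negative arguments play no role. *)
Definition Rpos (R : realType) : set R := `]0, +oo[.
Definition Rnneg (R : realType) : set R := `[0, +oo[.
Arguments Rpos R : clear implicits.
Arguments Rnneg R : clear implicits.

Definition smooth (R : realType) (f : R -> R) : Prop :=
  forall (n : nat) (x : R), derivable f^`(n) x 1.

(* C^oo_c(0,+oo), extended by zero to R. *)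
Definition test_fun (R : realType) (phi : R -> R) : Prop :=
  smooth phi /\
  exists a b : R, 0 < a /\ forall x, ~~ (a <= x <= b) -> phi x = 0.

Definition H10norm (R : realType) (u : R -> R) : R :=
  Num.sqrt (\int[@lebesgue_measure R]_(x in Rpos R) (derive1 u x) ^+ 2).

(* The completion of C^oo_c(0,+oo) for H10norm, realised as functions on
   [0,+oo).  As `|phi x - phi y| <= Num.sqrt `|x - y| * H10norm phi on test
   functions, an H10norm-Cauchy sequence converges locally uniformly on [0,+oo)
   to a continuous function vanishing at 0, which determines its class in the
   completion. *)
Definition H10 (R : realType) (u : R -> R) : Prop :=
  exists phi : nat -> R -> R,
    [/\ forall n, test_fun (phi n),
        forall e : R, 0 < e -> exists N : nat, forall m n : nat,
          (N <= m)%N -> (N <= n)%N -> H10norm (phi m \- phi n) < e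
      & forall x, 0 <= x -> phi n x @[n --> \oo] --> u x].

Definition admissible (R : realType) (beta : R) (theta : R -> R) : Prop :=
  {within Rnneg R, continuous theta} /\ H10 (fun x => theta x - beta).

Definition is_wderiv (R : realType) (u g : R -> R) : Prop :=
  [/\ locally_integrable (Rpos R) u, locally_integrable (Rpos R) g
    & forall phi, test_fun phi ->
        \int[@lebesgue_measure R]_(x in Rpos R) (u x * derive1 phi x) =
        - \int[@lebesgue_measure R]_(x in Rpos R) (g x * phi x)].

(* A representative of the weak derivative on (0,+oo), which is unique up to
   almost everywhere equality there (0 if there is no weak derivative). *)
Definition wderiv (R : realType) (u : R -> R) : R -> R :=
  xget (cst 0) [set g | is_wderiv u g].

Definition is_cutoff (R : realType) (beta : R) (eta : R -> R) : Prop :=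
  [/\ smooth eta,
      forall x, 0 <= eta x <= beta,
      forall x, x <= 0 -> eta x = beta,
      forall x, 1 <= x -> eta x = 0
    & forall x, eta^`() x <= 0].

Definition nonlocal_energy (R : realType) (beta : R) (u : R -> R) : \bar R :=
  (\int[@lebesgue_measure R]_(x in Rpos R)
   \int[@lebesgue_measure R]_(y in Rpos R)
     ((sin (u x - beta) - sin (u y - beta)) ^+ 2 / (x - y) ^+ 2)%:E)%E.

(* Over admissible theta this is never of the form +oo - oo: the negative part of
   the first integrand is integrable, the second term is nonnegative and, for a
   cutoff eta, the last term is finite. *)
Definition energy (R : realType) (beta nu : R) (eta theta : R -> R) : \bar R :=
  (\int[@lebesgue_measure R]_(x in Rpos R)
     (2^-1 * (wderiv theta x) ^+ 2 + 2^-1 * (sin (theta x)) ^+ 2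
      + nu / (4 * pi)
        * (((sin (theta x - beta)) ^+ 2 - (sin (eta x - beta)) ^+ 2) / x))%:E
   + (nu / (8 * pi))%:E * nonlocal_energy beta theta
   - (nu / (8 * pi))%:E * nonlocal_energy beta eta)%E.

Definition is_minimizer (R : realType) (beta nu : R) (eta theta : R -> R) :
    Prop :=
  admissible beta theta /\
  energy beta nu eta theta =
    ereal_inf [set energy beta nu eta t | t in admissible beta].

Definition C2_pos (R : realType) (f : R -> R) : Prop :=
  forall x : R, 0 < x ->
    [/\ derivable f x 1, derivable f^`() x 1 & {for x, continuous f^`(2)}].

(* Difference quotients restricted to [0,+oo): the usual derivative at x > 0 and
   the right derivative at 0. *)
Definition diff_quot_nneg (R : realType) (f : R -> R) (x : R) : set_system R :=
  (f y - f x) / (y - x) @[y --> within (Rnneg R) x^'].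

Definition derive_nneg (R : realType) (f : R -> R) (x : R) : R :=
  lim (diff_quot_nneg f x).

Definition C1_nneg (R : realType) (f : R -> R) : Prop :=
  (forall x : R, 0 <= x -> cvg (diff_quot_nneg f x)) /\
  {within Rnneg R, continuous (derive_nneg f)}.

Definition Linfty_pos (R : realType) (f : R -> R) : Prop :=
  measurable_fun (Rpos R) f /\
  exists C : R, \forall x \ae @lebesgue_measure R, Rpos R x -> `|f x| <= C.

Definition W1infty_pos (R : realType) (f : R -> R) : Prop :=
  Linfty_pos f /\ exists2 g : R -> R, is_wderiv f g & Linfty_pos g.

(* l is the principal value at the singularity y = x of the integral of f over
   (0,+oo); the truncated integrals are required to converge absolutely, since
   the real-valued integral \int is total and takes a junk value otherwise. *)
Definition is_pv (R : realType) (f : R -> R) (x l : R) : Prop :=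
  let D (e : R) := Rpos R `&` [set y | e <= `|y - x|] in
  (forall e : R, 0 < e ->
     (@lebesgue_measure R).-integrable (D e) (EFin \o f)) /\
  \int[@lebesgue_measure R]_(y in D e) f y @[e --> 0^'+] --> l.

(* Main.v *)
Require Import Defs.
From HB Require Import structures.
From mathcomp Require Import all_boot all_order all_algebra.
From mathcomp Require Import all_classical all_reals all_analysis.
From mathcomp Require Import measurable_realfun.
From mathcomp Require Import ring lra.

(** Extending [theta - beta] by zero to the negative axis gives a function [w] with
    a square integrable weak derivative [g], by completeness of L^2; comparison
    with a smooth competitor shows that a minimizer has finite nonlocal energy.
    Second order bounds on the energy along [w + t phi] yield the weak
    Euler-Lagrange equation.

    With [u := sin w], the nonlocal term tested against [psi] is the integral over
    [h > 0] of [h ^- 2] times the integral of [psi * (2 u - u(. + h) - u(. - h))].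
    Cutting at [h = 1], the far part is bounded, and the near part is the integral
    of [psi'] against a truncated logarithmic potential of [u].  That potential is
    Hoelder continuous because [w], having finite energy, is 1/2-Hoelder.  Hence
    [g + nu / (2 pi) * cos w * potential] has a locally integrable weak derivative,
    so [g] is Hoelder continuous.  The half-Laplacian of [u] is then given by an
    absolutely convergent integral, continuous on the open half-line, and the weak
    equation gives [theta''] pointwise.

    Multiplying the equation by [theta'] and integrating over the half-line gives
    [theta'(0) ^ 2 = sin beta ^ 2], because the nonlocal term contributes nothing
    (a Pohozaev identity): for each [h], the integral of [u'(x) (2 u(x) - u(x + h) -
    u(x - h))] over [[0, M]] is a boundary term supported in [[M, M + h]], which
    vanishes as [M] grows.  Finally [theta'(0) != 0] produces a corner of [u] at the
    origin, where the half-Laplacian diverges logarithmically. *)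

Import Order.TTheory GRing.Theory Num.Theory.
Import numFieldNormedType.Exports.

Local Open Scope ring_scope.
Local Open Scope classical_set_scope.

Set Implicit Arguments.
Unset Strict Implicit.

(** * Lebesgue integrals on the line and on the plane *)

Section Integral.
Context {R : realType}.
Implicit Types (f g h : R -> R).
Local Notation mu := (@lebesgue_measure R).

(** The obstacle is that [w] is at first only 1/2-Hoelder: [h ^- 2 * sym_diff u x h] is then of size
    [h ^ (-3/2)], and the half-Laplacian need not converge. Moving one derivative to the test
    function replaces the weight [h ^- 2] by its integral [1/s - 1], against which a 1/2-Hoelder
    increment is integrable with room to spare. Half of the exponent pays for the singularity and
    half survives in space, whence the exponent 1/4 throughout. Once [g] is in that class, symmetric
    second differences are of order [h ^ (5/4)] and the half-Laplacian converges away from the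
    origin, where the extension by zero has a corner.

    The extension by zero has a meaning of its own: the [1/x] term of the energy is exactly the
    interaction of the half-line with the negative axis, so the local [1/x] term and the principal
    value merge into one half-Laplacian on the line, and no boundary term arises at the origin.
    Double integrals are written in [x] and the increment [h]; translation invariance and Fubini
    then take the place of fractional Sobolev spaces. *)

Definition itg f : Prop := mu.-integrable setT (EFin \o f).
Definition It f : R := \int[mu]_x f x.

Lemma aeS (P Q : R -> Prop) : (forall x, P x -> Q x) ->
  {ae mu, forall x, P x} -> {ae mu, forall x, Q x}.
Proof. by move=> PQ; apply: filterS; first exact: (ae_filter_ringOfSetsType mu). Qed.

Lemma aeI (P Q : R -> Prop) : {ae mu, forall x, P x} ->
  {ae mu, forall x, Q x} -> {ae mu, forall x, P x /\ Q x}.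
Proof. by move=> p q; apply: filterI; first exact: (ae_filter_ringOfSetsType mu). Qed.

Lemma itg_meas f : itg f -> measurable_fun setT f.
Proof. by move=> /(measurable_int mu)/measurable_EFinP. Qed.

Lemma itg_le g f : measurable_fun setT f -> (forall x, `|f x| <= g x) ->
  itg g -> itg f.
Proof.
move=> mf fg ig; apply: (le_integrable measurableT _ _ ig).
  exact/measurable_EFinP.
by move=> x _ /=; rewrite lee_fin (le_trans (fg x))// ler_norm.
Qed.

Lemma eq_itg f g : (forall x, f x = g x) -> itg f -> itg g.
Proof. by move=> /funext ->. Qed.

Lemma eq_It f g : (forall x, f x = g x) -> It f = It g.
Proof. by move=> /funext ->. Qed.

Lemma itgD f g : itg f -> itg g -> itg (fun x => f x + g x).
Proof. by move=> ? ?; exact: (@integrableD _ _ _ mu _ _ (EFin \o f) (EFin \o g)). Qed.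

Lemma itgZ k f : itg f -> itg (fun x => k * f x).
Proof. by move=> ?; exact: (@integrableZl _ _ _ mu _ _ k (EFin \o f)). Qed.

Lemma itgN f : itg f -> itg (fun x => - f x).
Proof. by move=> ?; exact: (@integrableN _ _ _ mu _ (EFin \o f)). Qed.

Lemma itgB f g : itg f -> itg g -> itg (fun x => f x - g x).
Proof. by move=> ? ?; apply: itgD => //; exact: itgN. Qed.

Lemma itg0 : itg (fun=> 0).
Proof. exact: integrable0. Qed.

Lemma itg_norm f : itg f -> itg (fun x => `|f x|).
Proof. by move=> fi; exact: (@integrable_norm _ _ _ mu setT f). Qed.

Lemma itgMb h C f : measurable_fun setT h -> (forall x, `|h x| <= C) ->
  itg f -> itg (fun x => h x * f x).
Proof.
move=> mh hC fi; apply: (itg_le (g := fun x => C * `|f x|)).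
- by apply: measurable_funM => //; exact: itg_meas.
- by move=> x; rewrite normrM ler_wpM2r.
- by apply: itgZ; exact: itg_norm.
Qed.

Lemma ItD f g : itg f -> itg g -> It (fun x => f x + g x) = It f + It g.
Proof. by move=> ? ?; rewrite /It RintegralD. Qed.

Lemma ItB f g : itg f -> itg g -> It (fun x => f x - g x) = It f - It g.
Proof. by move=> ? ?; rewrite /It RintegralB. Qed.

Lemma ItZ k f : itg f -> It (fun x => k * f x) = k * It f.
Proof. by move=> ?; rewrite /It RintegralZl. Qed.

Lemma ItN f : itg f -> It (fun x => - f x) = - It f.
Proof.
move=> fi; rewrite -mulN1r -ItZ//.
by apply: eq_It => x; rewrite mulN1r.
Qed.

Lemma It0 : It (fun=> 0) = 0.
Proof. by rewrite /It Rintegral_cst// mul0r. Qed.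

Lemma It_le f g : itg f -> itg g -> (forall x, f x <= g x) -> It f <= It g.
Proof. by move=> ? ? fg; apply: le_Rintegral. Qed.

Lemma It_ge0 f : (forall x, 0 <= f x) -> 0 <= It f.
Proof. by move=> f0; apply: Rintegral_ge0. Qed.

Lemma It_norm f : itg f -> `|It f| <= It (fun x => `|f x|).
Proof. by move=> ?; apply: le_normr_Rintegral. Qed.

Lemma It_norm_le g f : measurable_fun setT f -> itg g ->
  (forall x, `|f x| <= g x) -> `|It f| <= It g.
Proof.
move=> mf ig fg; have fi : itg f by exact: itg_le ig.
by apply: (le_trans (It_norm fi)); apply: It_le => //; exact: itg_norm.
Qed.

Lemma ItE f : itg f -> (It f)%:E = (\int[mu]_x (f x)%:E)%E.
Proof. by move=> fi; rewrite /It fineK//; exact: integrable_fin_num. Qed.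

Lemma itg_ge0P f : measurable_fun setT f -> (forall x, 0 <= f x) ->
  (\int[mu]_x (f x)%:E < +oo)%E -> itg f.
Proof.
move=> mf f0 foo; apply/integrableP; split; first exact/measurable_EFinP.
by under eq_integral => x _ do rewrite /= ger0_norm//.
Qed.

Lemma ae_eq_It f g : measurable_fun setT f -> measurable_fun setT g ->
  {ae mu, forall x, f x = g x} -> It f = It g.
Proof.
move=> mf mg fg; rewrite /It/Rintegral; congr fine.
apply: ae_eq_integral => //; [exact/measurable_EFinP|exact/measurable_EFinP|].
by apply: aeS fg => x -> _.
Qed.

Lemma itg_ae_eq f g : measurable_fun setT g ->
  {ae mu, forall x, f x = g x} -> itg f -> itg g.
Proof.
move=> mg fg fi; have mf := itg_meas fi.
move/integrableP : fi => [_ foo]; apply/integrableP; split.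
  exact/measurable_EFinP.
rewrite (_ : (\int[mu]_x `|(EFin \o g) x|)%E = (\int[mu]_x `|(EFin \o f) x|)%E)//.
apply: ae_eq_integral => //.
- by apply: measurableT_comp => //; exact/measurable_EFinP.
- by apply: measurableT_comp => //; exact/measurable_EFinP.
- by apply: aeS fg => x /= <- _.
Qed.

Lemma It_dom (f_ : nat -> R -> R) f g :
  (forall n, measurable_fun setT (f_ n)) ->
  (forall x, f_ n x @[n --> \oo] --> f x) ->
  (forall n x, `|f_ n x| <= g x) -> itg g ->
  itg f /\ It (f_ n) @[n --> \oo] --> It f.
Proof.
move=> mf ff fg ig.
have [i1 i2 i3] : [/\ mu.-integrable setT (EFin \o f),
  [sequence \int[mu]_(x in setT) (`|(f_ n x)%:E - (f x)%:E|)]_n @ \oo --> 0%E &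
  [sequence \int[mu]_(x in setT) ((f_ n x)%:E)]_n @ \oo -->
    (\int[mu]_(x in setT) (f x)%:E)%E]%E.
  apply: (@dominated_convergence _ _ _ mu setT measurableT
     (fun n => EFin \o f_ n) (EFin \o f) (EFin \o g)) => //.
  - by move=> n; apply/measurable_EFinP; exact: mf.
  - apply/measurable_EFinP; apply: (measurable_fun_cvg (h := f_)) => //.
  - apply: aeW => x _; apply/fine_cvgP; split; last exact: ff.
    by apply: nearW.
  - by apply: aeW => x n _; rewrite lee_fin.
split => //.
rewrite /It/Rintegral; apply: fine_cvg; rewrite fineK//.
exact: integrable_fin_num.
Qed.

Lemma measurable_shift (c : R) : measurable_fun setT (fun x : R => x + c).
Proof. by apply: measurable_funD => //; exact: measurable_id. Qed.

Lemma lebesgue_measure_shift (c : R) (A : set R) : measurable A ->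
  pushforward mu (fun x : measurableTypeR R => (x + c : measurableTypeR R)) A = mu A.
Proof.
move=> mA.
have mphi : measurable_fun [set: measurableTypeR R]
  (fun x : measurableTypeR R => (x + c : measurableTypeR R)) := measurable_shift c.
pose phi : {mfun measurableTypeR R >-> measurableTypeR R} :=
  HB.pack (fun x : measurableTypeR R => (x + c : measurableTypeR R))
    (isMeasurableFun.Build _ _ _ _ _ mphi).
apply/esym/(lebesgue_measure_unique (mu := pushforward mu phi)) => //=.
move=> _ [[a b]] _ <-; rewrite /pushforward.
rewrite (_ : _ @^-1` _ = `]a - c, b - c]%classic); last first.
  by apply/seteqP; split => x /=; rewrite !in_itv/= ltrBlDr lerBrDr. 
rewrite !lebesgue_measure_itv/= !lte_fin -!EFinD ltrD2r.
case: ifPn => // _; congr (_%:E).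
by rewrite opprB addrA subrK.
Qed.

Lemma ge0_integral_shift (c : R) (F : R -> \bar R) : measurable_fun setT F ->
  (forall x, 0 <= F x)%E ->
  (\int[mu]_x F (x + c)%R = \int[mu]_x F x)%E.
Proof.
move=> mF F0.
have ms : measurable_fun [set: measurableTypeR R]
  (fun x : measurableTypeR R => (x + c : measurableTypeR R)) := measurable_shift c.
have := @ge0_integral_pushforward _ _ (measurableTypeR R) (measurableTypeR R) R
  _ ms mu setT F measurableT mF (fun x _ => F0 x).
rewrite preimage_setT => <-; apply: eq_measure_integral => A mA _.
exact: lebesgue_measure_shift.
Qed.

Lemma meas_shift (c : R) f : measurable_fun setT f ->
  measurable_fun setT (fun x : R => f (x + c)).
Proof. by move=> mf; apply: (measurableT_comp mf); exact: measurable_shift. Qed.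

Lemma itg_shift (c : R) f : itg f -> itg (fun x => f (x + c)).
Proof.
move=> fi; have mf := itg_meas fi; move/integrableP : fi => [_ foo].
apply/integrableP; split; first by apply/measurable_EFinP; exact: meas_shift.
rewrite (ge0_integral_shift c (F := fun x => `|(f x)%:E|%E))//.
by apply: measurableT_comp => //; exact/measurable_EFinP.
Qed.

Lemma It_shift (c : R) f : measurable_fun setT f -> It (fun x => f (x + c)) = It f.
Proof.
move=> mf; have mf' : measurable_fun setT (EFin \o f) by exact/measurable_EFinP.
have E (G H : R -> \bar R) : measurable_fun setT G -> (forall x, 0 <= G x)%E ->
    (forall x, H x = G (x + c)) -> (\int[mu]_x H x = \int[mu]_x G x)%E.
  move=> mG G0 HG; rewrite -(ge0_integral_shift c mG G0).
  by apply: eq_integral => x _; exact: HG.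
rewrite /It /Rintegral; congr fine; rewrite [LHS]integralE [RHS]integralE.
congr (_ - _)%E.
- by apply: E => //; [exact: measurable_funepos|move=> x; rewrite !funeposE].
- by apply: E => //; [exact: measurable_funeneg|move=> x; rewrite !funenegE].
Qed.

End Integral.

Section DoubleIntegral.
Context {R : realType}.
Implicit Types (F : R -> R -> R) (f g : R -> R).
Local Notation mu := (@lebesgue_measure R).

Definition meas2 F : Prop :=
  measurable_fun setT (fun z : measurableTypeR R * measurableTypeR R => F z.1 z.2).
Definition itg2 F : Prop :=
  (mu \x mu)%E.-integrable setT
    (fun z : measurableTypeR R * measurableTypeR R => (F z.1 z.2)%:E).

Lemma meas2_1 F x : meas2 F -> measurable_fun setT (F x).
Proof.
move=> mF.
exact: (measurable_fun_pair2 (x : measurableTypeR R) mF).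
Qed.

Lemma meas2C F : meas2 F -> meas2 (fun x y => F y x).
Proof.
move=> mF.
exact: (measurableT_comp mF (@measurable_swap _ _ (measurableTypeR R) (measurableTypeR R))).
Qed.

Lemma meas2_fst f : measurable_fun setT f -> meas2 (fun x _ => f x).
Proof. by move=> mf; apply: (measurableT_comp mf); exact: measurable_fst. Qed.

Lemma meas2_snd f : measurable_fun setT f -> meas2 (fun _ y => f y).
Proof. by move=> mf; apply: (measurableT_comp mf); exact: measurable_snd. Qed.

Lemma meas2_add f : measurable_fun setT f -> meas2 (fun x y => f (x + y)).
Proof.
move=> mf; apply: (measurableT_comp mf).
by apply: measurable_funD; [exact: measurable_fst|exact: measurable_snd].
Qed.

Lemma meas2_sub f : measurable_fun setT f -> meas2 (fun x y => f (x - y)).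
Proof.
move=> mf; apply: (measurableT_comp mf).
by apply: measurable_funB; [exact: measurable_fst|exact: measurable_snd].
Qed.

Lemma itg2_meas F : itg2 F -> meas2 F.
Proof. by move=> /(measurable_int _)/measurable_EFinP. Qed.

Lemma itg2_le F G : meas2 F -> (forall x y, `|F x y| <= G x y) -> itg2 G -> itg2 F.
Proof.
move=> mF FG iG; apply: (le_integrable measurableT _ _ iG).
  exact/measurable_EFinP.
by move=> [x y] _ /=; rewrite lee_fin (le_trans (FG x y))// ler_norm.
Qed.

Lemma itg2_iter F g : meas2 F -> (forall x, itg (F x)) ->
  (forall x, It (fun y => `|F x y|) <= g x) -> itg g -> itg2 F.
Proof.
move=> mF Fi Fg ig; apply/integrable12ltyP; first exact/measurable_EFinP.
have gi := ItE ig.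
rewrite (@le_lt_trans _ _ (\int[mu]_x (g x)%:E)%E)//; last by rewrite -gi ltry.
apply: ge0_le_integral => //.
- by move=> x _; exact: integral_ge0.
- apply: (measurable_fun_fubini_tonelli_F
    (fun z : measurableTypeR R * measurableTypeR R => `|(F z.1 z.2)%:E|%E)) => //.
  apply: measurableT_comp => //; exact/measurable_EFinP.
- by apply/measurable_EFinP; exact: itg_meas.
- move=> x _; rewrite -[leLHS]/(\int[mu]_y (`|F x y|)%:E)%E -ItE//.
    by rewrite lee_fin.
  exact: itg_norm.
Qed.

Lemma itg2_ge0P F : meas2 F -> (forall x y, 0 <= F x y) ->
  (\int[mu]_x \int[mu]_y (F x y)%:E < +oo)%E -> itg2 F.
Proof.
move=> mF F0 Foo; apply/integrable12ltyP; first exact/measurable_EFinP.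
apply: le_lt_trans Foo; rewrite le_eqVlt; apply/orP; left; apply/eqP.
apply: eq_integral => x _; apply: eq_integral => y _ /=.
by rewrite ger0_norm.
Qed.

Lemma itg2_prod F f g : meas2 F -> itg f -> itg g ->
  (forall x y, `|F x y| <= f x * g y) -> itg2 F.
Proof.
move=> mF fi gi Ffg.
have Fi x : itg (F x).
  by apply: (itg_le (g := fun y => f x * g y)); [exact: meas2_1|exact: Ffg|exact: itgZ].
apply: (itg2_iter (g := fun x => f x * It g)) => //.
- move=> x; rewrite -ItZ//; apply: It_le => //; first exact: itg_norm.
  exact: itgZ.
- apply: (eq_itg (f := fun x => It g * f x)); last exact: itgZ.
  by move=> x; rewrite mulrC.
Qed.

Lemma itg2_fst F : itg2 F -> itg (fun x => It (F x)).
Proof.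
move=> Fi; have /= h := integrable_fubini_F Fi.
have mI : measurable_fun setT (fun x => It (F x)).
  apply: (measurableT_comp (fine_measurable measurableT)).
  exact: (measurable_int mu h).
apply/integrableP; split; first exact/measurable_EFinP.
move/integrableP : h => [mh]; apply: le_lt_trans.
apply: ge0_le_integral; [by []|by []| | |].
- by apply: measurableT_comp; [by []|exact/measurable_EFinP].
- by apply: measurableT_comp.
(* Where the inner integral is infinite, [fine] returns [0], which only decreases the absolute
   value. *)
- move=> x _ /=; rewrite /It/Rintegral /fubini_F/=.
  by case: (\int[mu]_y (F x y)%:E)%E => [r| |] /=; rewrite ?normr0 ?leey ?lexx.
Qed.

Lemma It_itg2 F : itg2 F ->
  It (fun x => It (F x)) = fine (\int[mu]_x \int[mu]_y (F x y)%:E)%E.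
Proof.
move=> Fi; have /= h := integrable_fubini_F Fi.
rewrite [LHS]/It/Rintegral; congr fine; apply: ae_eq_integral => //.
- by apply/measurable_EFinP; exact: (itg_meas (itg2_fst Fi)).
- exact: (measurable_int mu h).
have := integrable_ae measurableT h; apply: aeS => x /(_ I) /= fx _.
by rewrite /It/Rintegral fineK.
Qed.

Lemma itg2C F : itg2 F -> itg2 (fun x y => F y x).
Proof.
move=> Fi; have mF := itg2_meas Fi; apply/integrable12ltyP.
  by apply/measurable_EFinP; exact: meas2C.
have mF' : measurable_fun setT
    (fun z : measurableTypeR R * measurableTypeR R => (F z.1 z.2)%:E).
  exact/measurable_EFinP.
exact: (integrable21ltyP _ _ mF').1 Fi.
Qed.

Lemma It_fubini F : itg2 F ->
  It (fun x => It (F x)) = It (fun y => It (fun x => F x y)).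
Proof.
move=> Fi; rewrite (It_itg2 Fi) (It_itg2 (itg2C Fi)); congr fine.
exact: (Fubini Fi).
Qed.

Lemma itg2D F G : itg2 F -> itg2 G -> itg2 (fun x y => F x y + G x y).
Proof.
move=> Fi Gi; exact: (integrableD measurableT Fi Gi).
Qed.

Lemma itg2Z k F : itg2 F -> itg2 (fun x y => k * F x y).
Proof. by move=> Fi; exact: (integrableZl measurableT k Fi). Qed.

End DoubleIntegral.

Section Intervals.
Context {R : realType}.
Implicit Types (f g F G : R -> R) (a b c x y : R).
Local Notation mu := (@lebesgue_measure R).

Lemma cvgn_ge (u : nat -> R) (l c : R) : u n @[n --> \oo] --> l ->
  (forall n, c <= u n) -> c <= l.
Proof.
move=> ul cu; rewrite -(cvg_lim _ ul)//; apply: limr_ge; last exact: nearW.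
by apply/cvg_ex; exists l.
Qed.

Lemma It_fatou (f_ : nat -> R -> R) f C : (forall n, itg (f_ n)) ->
  (forall n x, 0 <= f_ n x) -> (forall x, f_ n x @[n --> \oo] --> f x) ->
  (forall n, It (f_ n) <= C) -> itg f /\ It f <= C.
Proof.
move=> fi f0 ff fC.
have mf : measurable_fun setT f.
  by apply: (measurable_fun_cvg (h := f_)) => // n; exact: itg_meas.
have f0' x : 0 <= f x.
  by apply: (cvgn_ge (ff x)) => n; exact: f0.
have fle : (\int[mu]_x (f x)%:E <= C%:E)%E.
  have h := @fatou _ _ _ mu setT measurableT (fun n => EFin \o f_ n)
    (fun n => (measurable_EFinP _ _).2 (itg_meas (fi n)))
    (fun n x _ => f0 n x).
  apply: le_trans (le_trans h _).
    rewrite le_eqVlt; apply/orP; left; apply/eqP; apply: eq_integral => x _.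
    have fx : (f_ n x)%:E @[n --> \oo] --> (f x)%:E.
      by apply/fine_cvgP; split; [apply: nearW|exact: ff].
    by rewrite is_cvg_limn_einfE; [apply/esym/cvg_lim|apply/cvg_ex; eexists; exact: fx].
  rewrite limn_einf_lim; apply: lime_le; first exact: is_cvg_einfs.
  apply: nearW => n; apply: (@le_trans _ _ (\int[mu]_x ((EFin \o f_ n) x))%E).
    by apply: ereal_inf_lbound; exists n => /=.
  by rewrite -ItE// lee_fin.
have fi' : itg f.
  apply: itg_ge0P => //; apply: le_lt_trans fle _; exact: ltry.
by split => //; rewrite -lee_fin ItE.
Qed.

(** Conditions enter as real factors and not as domains of integration: every integral is then over
    the whole line, and a condition on two variables is a kernel to which Fubini applies
    directly. *)
Definition ind (P : bool) : R := if P then 1 else 0.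

Lemma meas_itv (i : interval R) : measurable_fun setT (fun x => ind (x \in i)).
Proof.
rewrite (_ : (fun x => _) = \1_[set` i]); first exact: measurable_indic.
by apply/funext => x; rewrite indicE mem_setE /ind; case: ifP.
Qed.

Lemma meas_cc a b : measurable_fun setT (fun x => ind (a <= x <= b)).
Proof.
by have := meas_itv (`[a, b])%O; under eq_fun do rewrite in_itv.
Qed.

Lemma meas_lt a : measurable_fun setT (fun x => ind (a < x)).
Proof.
by have := meas_itv (`]a, +oo[)%O; under eq_fun do rewrite in_itv/= andbT.
Qed.

Lemma meas_le a : measurable_fun setT (fun x => ind (x <= a)).
Proof.
by have := meas_itv (`]-oo, a])%O; under eq_fun do rewrite in_itv.
Qed.

(* The Lebesgue integral over [[a, b]]; it is [0], not minus the reversed integral,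
   when [b < a]. *)
Definition II a b f := It (fun x => ind (a <= x <= b) * f x).

Lemma It_itv (i : interval R) f :
  \int[mu]_(x in [set` i]) f x = It (fun x => ind (x \in i) * f x).
Proof.
rewrite Rintegral_mkcond; apply: eq_It => x; rewrite patchE mem_setE.
by rewrite /ind; case: ifP => _; rewrite ?mul1r ?mul0r.
Qed.

Lemma itg_itv (i : interval R) f :
  mu.-integrable [set` i] (EFin \o f) <-> itg (fun x => ind (x \in i) * f x).
Proof.
have -> : (fun x => ind (x \in i) * f x) = f \_ [set` i].
  apply/funext => x; rewrite patchE mem_setE.
  by rewrite /ind; case: ifP => _; rewrite ?mul1r ?mul0r.
rewrite /itg -restrict_EFin.
have mi : measurable [set` i] by exact: measurable_itv.
split.
  by move=> h; apply/integrable_restrict => //=; rewrite setTI.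
by move/integrable_restrict => /=; rewrite setTI; apply.
Qed.

Lemma II_E a b f : II a b f = \int[mu]_(x in `[a, b]) f x.
Proof. by rewrite It_itv; apply: eq_It => x; rewrite in_itv. Qed.

Lemma itg_cc a b f : mu.-integrable `[a, b] (EFin \o f) <->
  itg (fun x => ind (a <= x <= b) * f x).
Proof.
by rewrite itg_itv; split; apply: eq_itg => x; rewrite in_itv.
Qed.

Lemma itg_ind a b : itg (fun x => ind (a <= x <= b)).
Proof.
have : itg (fun x => ind (a <= x <= b) * (cst 1 x : R)).
  apply/itg_cc; apply: measurable_bounded_integrable => //.
  - by rewrite /= lebesgue_measure_itv/=; case: ifPn => _; rewrite ?ltry// -EFinD ltry.
  - exact: bounded_cst.
by apply: eq_itg => x; rewrite mulr1.
Qed.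

Lemma II_cst a b (k : R) : a <= b -> II a b (fun=> k) = (b - a) * k.
Proof.
move=> ab; rewrite II_E Rintegral_cst//= lebesgue_measure_itv/= lte_fin.
move: ab; rewrite le_eqVlt => /predU1P[->|ab].
  by rewrite ltxx/= mulr0 subrr mul0r.
by rewrite ab -EFinD/= mulrC.
Qed.

Lemma It_ind a b : a <= b -> It (fun x => ind (a <= x <= b)) = b - a.
Proof.
move=> ab; rewrite -[RHS]mulr1 -(II_cst 1 ab); apply: eq_It => x.
by rewrite mulr1.
Qed.

Lemma itg_bnd a b (C : R) f : measurable_fun setT f ->
  (forall x, a <= x <= b -> `|f x| <= C) ->
  itg (fun x => ind (a <= x <= b) * f x).
Proof.
move=> mf fC; apply: (itg_le (g := fun x => C * ind (a <= x <= b))).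
- by apply: measurable_funM => //; exact: meas_cc.
- move=> x; have [h|h] := boolP (a <= x <= b); rewrite /ind ?mul1r ?mulr1; first exact: fC.
  by rewrite mul0r mulr0 normr0.
- by apply: itgZ; exact: itg_ind.
Qed.

Lemma cont_meas f : continuous f -> measurable_fun setT f.
Proof. exact: continuous_measurable_fun. Qed.

Lemma cont_bnd a b f : {within `[a, b], continuous f} ->
  exists2 C, 0 <= C & forall x, a <= x <= b -> `|f x| <= C.
Proof.
move=> cf; have [ab|ab] := leP a b; last first.
  by exists 0 => // x xab; have := lt_le_trans ab (le_trans (andP xab).1 (andP xab).2); rewrite ltxx.
have cnf : {within `[a, b], continuous (fun x => `|f x|)}.
  move=> x; apply: (continuous_comp (cf x)); exact: norm_continuous.
have [c _ fc] := EVT_max ab cnf.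
by exists `|f c| => // x xab; apply: fc; rewrite in_itv.
Qed.

Lemma itg_cont a b f : {within `[a, b], continuous f} ->
  itg (fun x => ind (a <= x <= b) * f x).
Proof.
move=> cf; apply/itg_cc; apply: continuous_compact_integrable => //.
exact: segment_compact.
Qed.

Lemma contT_within (A : set R) f : continuous f -> {within A, continuous f}.
Proof. by move=> cf; apply: continuous_subspaceT. Qed.

Lemma FTC2 F f a b : a <= b ->
  {within `[a, b], continuous f} -> {within `[a, b], continuous F} ->
  (forall x, a < x < b -> is_derive x 1 F (f x)) ->
  II a b f = F b - F a.
Proof.
rewrite le_eqVlt => /predU1P[-> _ _ _|ab cf cF dF].
  by rewrite II_E set_itv1 Rintegral_set1 subrr.
have d : derivable_oo_LRcontinuous F a b.
  have /(continuous_within_itvP _ ab)[_ l r] := cF.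
  split => // x; rewrite in_itv/= => xab; exact: (@ex_derive _ _ _ _ _ _ _ (dF x xab)).
have e : {in (`]a, b[)%O, F^`() =1 f}.
  by move=> x; rewrite in_itv/= => xab; rewrite derive1E; apply: derive_val; exact: dF.
by rewrite II_E /Rintegral (continuous_FTC2 ab cf d e).
Qed.

Lemma II_split a b c f : a <= b -> b <= c ->
  itg (fun x => ind (a <= x <= c) * f x) -> II a c f = II a b f + II b c f.
Proof.
move=> ab bc fi.
have i1 : itg (fun x => ind (a <= x <= b) * f x).
  apply: (itg_le _ _ (itg_norm fi)).
    rewrite (_ : (fun x => _) = (fun x => ind (a <= x <= b) * (ind (a <= x <= c) * f x))).
      by apply: measurable_funM; [exact: meas_cc|exact: itg_meas].
    apply/funext => x; have [/andP[ax xb]|] := boolP (a <= x <= b); rewrite /ind; last by rewrite !mul0r.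
    by rewrite ax (le_trans xb bc)/= !mul1r.
  move=> x; have [/andP[ax xb]|] := boolP (a <= x <= b); rewrite /ind.
    by rewrite ax (le_trans xb bc)/= mul1r.
  by rewrite mul0r normr0.
have i2 : itg (fun x => ind (b <= x <= c) * f x).
  apply: (itg_le _ _ (itg_norm fi)).
    rewrite (_ : (fun x => _) = (fun x => ind (b <= x <= c) * (ind (a <= x <= c) * f x))).
      by apply: measurable_funM; [exact: meas_cc|exact: itg_meas].
    apply/funext => x; have [/andP[bx xc]|] := boolP (b <= x <= c); rewrite /ind; last by rewrite !mul0r.
    by rewrite xc (le_trans ab bx)/= !mul1r.
  move=> x; have [/andP[bx xc]|] := boolP (b <= x <= c); rewrite /ind.
    by rewrite xc (le_trans ab bx)/= mul1r.
  by rewrite mul0r normr0.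
rewrite /II -ItD//; apply: ae_eq_It.
- exact: itg_meas.
- by apply: measurable_funD; exact: itg_meas.
exists [set b]; split; [exact: measurable_set1|exact: lebesgue_measure_set1|].
move=> x /= nx; apply: contrapT => xb; apply: nx; move/eqP : xb => xb.
case: (ltgtP x b) xb => // xb _ /=.
- by rewrite /ind (le_trans (ltW xb) bc) mul0r addr0.
- by rewrite /ind (le_trans ab (ltW xb))/= mul0r add0r.
Qed.

End Intervals.

Section Improper.
Context {R : realType}.
Implicit Types (f g F G : R -> R) (a b c x y : R).
Local Notation mu := (@lebesgue_measure R).

Lemma ind_ge0 (P : bool) : 0 <= ind P :> R.
Proof. by rewrite /ind; case: P. Qed.

Lemma ind_le1 (P : bool) : ind P <= 1 :> R.
Proof. by rewrite /ind; case: P. Qed.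

Lemma norm_ind (P : bool) (y : R) : `|ind P * y| = ind P * `|y|.
Proof. by rewrite normrM (ger0_norm (ind_ge0 P)). Qed.

(** Fatou turns the uniform bound on the exhausting intervals into integrability; the limit function
    then dominates the truncated ones, and dominated convergence identifies the value. *)
Lemma itg_improper (P : R -> bool) (a b : nat -> R) f (C L : R) :
  (forall n x, a n <= x <= b n -> P x) ->
  (forall x, P x -> \forall n \near \oo, a n <= x <= b n) ->
  (forall x, P x -> 0 <= f x) ->
  (forall n, itg (fun x => ind (a n <= x <= b n) * f x)) ->
  (forall n, II (a n) (b n) f <= C) ->
  II (a n) (b n) f @[n --> \oo] --> L ->
  itg (fun x => ind (P x) * f x) /\ It (fun x => ind (P x) * f x) = L.
Proof.
move=> aP Pa f0 fi fC fL.
have pt x : ind (a n <= x <= b n) * f x @[n --> \oo] --> ind (P x) * f x.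
  apply: cvg_near_cst.
  have [Px|nPx] := boolP (P x).
    by apply: filterS (Pa x Px) => n ->.
  apply: nearW => n; have [h|//] := boolP (a n <= x <= b n).
  by move: nPx; rewrite (aP _ _ h).
have [if_ _] : itg (fun x => ind (P x) * f x) /\ It (fun x => ind (P x) * f x) <= C.
  apply: (It_fatou (f_ := fun n x => ind (a n <= x <= b n) * f x)) => //.
  move=> n x; have [h|h] := boolP (a n <= x <= b n); rewrite /ind ?mul0r ?mul1r//.
  exact: f0 (aP _ _ h).
split => //.
have hb n x : `|ind (a n <= x <= b n) * f x| <= ind (P x) * f x.
  have [h1|h1] := boolP (a n <= x <= b n); rewrite /ind ?mul0r ?mul1r.
    by rewrite (aP _ _ h1) mul1r ger0_norm//; apply: f0 (aP _ _ h1).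
  by rewrite normr0; case: ifPn => [/f0|]; rewrite ?mul1r ?mul0r.
have [_ h] := It_dom (fun n => itg_meas (fi n)) pt hb if_.
exact: (cvg_unique _ h fL).
Qed.

Lemma itg_inv2_itv a b : 0 < a -> a <= b ->
  itg (fun h => ind (a <= h <= b) * h ^- 2) /\ II a b (fun h => h ^- 2) = a^-1 - b^-1.
Proof.
move=> a0 ab.
have c : {within `[a, b], continuous (fun h : R => h ^- 2)}.
  apply: continuous_in_subspaceT => h; rewrite inE/= in_itv/= => /andP[ah _].
  apply: cvgV; first by rewrite expf_neq0// gt_eqF// (lt_le_trans a0).
  exact: exprn_continuous.
split; first exact: itg_cont.
 transitivity (- b^-1 - - a^-1); last by ring.
apply: (FTC2 (F := fun h => - h^-1) ab c).
  apply: continuous_in_subspaceT => h; rewrite inE/= in_itv/= => /andP[ah _].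
  by apply: cvgN; apply: cvgV; first by rewrite gt_eqF// (lt_le_trans a0).
move=> h /andP[ah _]; have h0 : h != 0 by rewrite gt_eqF// (lt_trans a0).
have d := is_deriveN (is_deriveV (f := id) h0 (is_derive_id h 1)).
by apply: (is_derive_eq d); rewrite scaler1 opprK.
Qed.

Lemma itg_inv2 a : 0 < a ->
  itg (fun h => ind (a <= h) * h ^- 2) /\ It (fun h => ind (a <= h) * h ^- 2) = a^-1.
Proof.
move=> a0.
have E n : II a (a + n%:R) (fun h => h ^- 2) = a^-1 - (a + n%:R)^-1.
  by apply: (itg_inv2_itv a0 _).2; rewrite lerDl.
apply: (itg_improper (a := fun=> a) (b := fun n => a + n%:R) (C := a^-1)).
- by move=> n x /andP[].
- move=> x ax; near=> n; rewrite ax/= -lerBlDl; near: n; exact: nbhs_infty_ger.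
- by move=> x ax; rewrite invr_ge0 exprn_ge0// (le_trans (ltW a0)).
- by move=> n; apply: (itg_inv2_itv a0 _).1; rewrite lerDl.
- by move=> n; rewrite E gerBl invr_ge0 addr_ge0// ltW.
- under eq_fun do rewrite E.
  have h : (a + n%:R)^-1 @[n --> \oo] --> (0 : R).
    apply/gtr0_cvgV0; first by apply: nearW => n; rewrite ltr_pwDl.
    apply/cvgryPge => A; near=> n; rewrite -lerBlDl.
    by near: n; exact: nbhs_infty_ger.
  by have := cvgB (cvg_cst a^-1) h; rewrite subr0; apply.
Unshelve. all: by end_near. Qed.

(** The fourth root is the modulus of continuity of all slopes below; its exponent is half of the
    1/2 that finite energy provides. *)
Definition qrt (h : R) := Num.sqrt (Num.sqrt h).

Lemma qrt_ge0 h : 0 <= qrt h.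
Proof. exact: sqrtr_ge0. Qed.

Lemma qrt4 h : 0 <= h -> qrt h ^+ 4 = h.
Proof.
by move=> h0; rewrite (exprM _ 2 2) sqr_sqrtr ?sqrtr_ge0// sqr_sqrtr.
Qed.

Lemma qrt2 h : qrt h ^+ 2 = Num.sqrt h.
Proof. by rewrite sqr_sqrtr ?sqrtr_ge0. Qed.

Lemma qrt_gt0 h : 0 < h -> 0 < qrt h.
Proof. by move=> h0; rewrite !sqrtr_gt0. Qed.

Lemma qrt_le x y : x <= y -> qrt x <= qrt y.
Proof. by move=> xy; rewrite ler_wsqrtr// ler_wsqrtr. Qed.

Lemma qrt_continuous : continuous qrt.
Proof.
move=> x; apply: (continuous_comp (@sqrt_continuous R x)).
exact: sqrt_continuous.
Qed.

Lemma qrt_le1 h : h <= 1 -> qrt h <= 1.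
Proof. by move=> h1; rewrite (le_trans (qrt_le h1))// /qrt !sqrtr1. Qed.

Lemma cvg_invS : n.+1%:R^-1 @[n --> \oo] --> (0 : R).
Proof.
apply/gtr0_cvgV0; first exact: nearW.
apply/cvgryPge => A; near=> n; rewrite -natr1 (@le_trans _ _ n%:R)// ?lerDl//.
by near: n; exact: nbhs_infty_ger.
Unshelve. all: by end_near. Qed.

(** Limit of the continuous functions [h / (h ^+ 2 + 1/(n+1))], which also take the value [0] at the
    origin, in agreement with [0^-1 = 0]. *)
Lemma meas_inv : measurable_fun setT (fun h : R => h^-1).
Proof.
apply: (measurable_fun_cvg (h := fun (n : nat) (h : R) => h * (h ^+ 2 + n.+1%:R^-1)^-1)).
  move=> n; apply: cont_meas => h; apply: cvgM; first exact: cvg_id.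
  apply: cvgV; first by rewrite gt_eqF// ltr_wpDl// ?sqr_ge0// invr_gt0.
  by apply: cvgD; [exact: exprn_continuous|exact: cvg_cst].
move=> h _; have [->|h0] := eqVneq h 0.
  by rewrite invr0; apply: cvg_near_cst; apply: nearW => n; rewrite mul0r.
have n2 : h ^+ 2 + 0 != 0 by rewrite addr0 expf_neq0.
have <- : h / (h ^+ 2 + 0) = h^-1 by field.
apply: cvgM; first exact: cvg_cst.
apply: cvgV => //; apply: cvgD cvg_invS; exact: cvg_cst.
Qed.

(** The integrand is [h ^ (-3/4)], with primitive [4 * qrt h]. It is the common majorant of all
    singular kernels near [h = 0]. *)
Lemma itg_qrt : itg (fun h : R => ind (0 < h <= 1) * (qrt h / h)).
Proof.
have dq (h : R) : 0 < h -> is_derive h 1 (fun y => 4 * qrt y) (qrt h / h).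
  move=> h0; have sh0 : 0 < Num.sqrt h by rewrite sqrtr_gt0.
  have d1 := is_derive1_comp (f := Num.sqrt) (g := Num.sqrt)
    (is_derive1_sqrt sh0) (is_derive1_sqrt h0).
  have d := is_deriveZ 4 d1.
  apply: (is_derive_eq d); rewrite -/(qrt h) -qrt2.
  have q0 := qrt_gt0 h0; have E : h = qrt h ^+ 4 by rewrite qrt4// ltW.
  rewrite [X in _ = _ / X]E /GRing.scale/=.
  by field; exact: lt0r_neq0.
pose a n : R := (n.+1%:R)^-1.
have a0 n : 0 < a n by rewrite invr_gt0.
have a1 n : a n <= 1 by rewrite invf_le1// ler1n.
have cc n : {within `[a n, 1], continuous (fun h => qrt h / h)}.
  apply: continuous_in_subspaceT => h; rewrite inE/= in_itv/= => /andP[ah _].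
  apply: cvgM; first exact: qrt_continuous.
  by apply: cvgV => //; rewrite gt_eqF// (lt_le_trans _ ah).
have E n : II (a n) 1 (fun h => qrt h / h) = 4 * qrt 1 - 4 * qrt (a n).
  apply: (FTC2 (F := fun y => 4 * qrt y) (a1 n) (cc n)).
    apply: contT_within => x; apply: cvgM; first exact: cvg_cst.
    exact: qrt_continuous.
  by move=> x /andP[ax _]; apply: dq; exact: lt_trans ax.
have [] := @itg_improper (fun h => 0 < h <= 1) a (fun=> 1) (fun h => qrt h / h) 4 4.
- by move=> n x /andP[ax ->]; rewrite (lt_le_trans _ ax).
- move=> x /andP[x0 ->]; near=> n; rewrite andbT /a -[leRHS]invrK lef_pV2 ?posrE ?invr_gt0//.
  by rewrite -natr1 (@le_trans _ _ n%:R)// ?lerDl//; near: n; exact: nbhs_infty_ger.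
- by move=> x /andP[x0 _]; rewrite divr_ge0 ?qrt_ge0// ltW.
- by move=> n; exact: itg_cont.
- by move=> n; rewrite E /qrt !sqrtr1 mulr1 gerBl mulr_ge0 ?qrt_ge0.
- under eq_fun do rewrite E.
  have h' : qrt (a n) @[n --> \oo] --> qrt 0.
    by apply: continuous_cvg => //; [exact: qrt_continuous|exact: cvg_invS].
  have H : 4 * qrt 1 - 4 * qrt (a n) @[n --> \oo] --> 4 * qrt 1 - 4 * qrt 0.
    by apply: cvgB; [exact: cvg_cst|apply: cvgM; [exact: cvg_cst|exact: h']].
  have e : 4 * qrt 1 - 4 * qrt 0 = 4 by rewrite /qrt !sqrtr1 !sqrtr0; ring.
  by rewrite e in H.
by [].
Unshelve. all: by end_near. Qed.

(** The integrand is [h ^ (-3/2)], with primitive [-2 / sqrt h]; it controls large translations in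
    the Pohozaev estimate. *)
Lemma itg_sqrt2 : itg (fun h : R => ind (1 <= h) * (Num.sqrt h * h ^- 2)).
Proof.
have ds (h : R) : 0 < h -> is_derive h 1 (fun y => - 2 * (Num.sqrt y)^-1) (Num.sqrt h * h ^- 2).
  move=> h0; have sh0 : 0 < Num.sqrt h by rewrite sqrtr_gt0.
  have n0 : Num.sqrt h != 0 by rewrite gt_eqF.
  have d := is_deriveZ (- 2) (is_deriveV n0 (is_derive1_sqrt h0)).
  have E : h = Num.sqrt h ^+ 2 by rewrite sqr_sqrtr// ltW.
  apply: (is_derive_eq d); rewrite /GRing.scale/= [X in _ = _ / (X ^+ 2)]E.
  by field.
pose b n : R := 1 + n%:R.
have b1 n : 1 <= b n by rewrite lerDl.
have nz (h : R) : 1 <= h -> h != 0 by move=> h1; rewrite gt_eqF// (lt_le_trans _ h1).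
have cc n : {within `[1, b n], continuous (fun h => Num.sqrt h * h ^- 2)}.
  apply: continuous_in_subspaceT => h; rewrite inE/= in_itv/= => /andP[h1 _].
  apply: cvgM; first exact: sqrt_continuous.
  by apply: cvgV; [rewrite expf_neq0// nz|exact: exprn_continuous].
have E n : II 1 (b n) (fun h => Num.sqrt h * h ^- 2) =
    - 2 * (Num.sqrt (b n))^-1 - - 2 * (Num.sqrt 1)^-1.
  apply: (FTC2 (F := fun y => - 2 * (Num.sqrt y)^-1) (b1 n) (cc n)).
    apply: continuous_in_subspaceT => h; rewrite inE/= in_itv/= => /andP[h1 _].
    apply: cvgM; first exact: cvg_cst.
    apply: cvgV; last exact: sqrt_continuous.
    by rewrite gt_eqF// sqrtr_gt0 (lt_le_trans _ h1).
  by move=> x /andP[x1 _]; apply: ds; exact: lt_trans x1.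
have [] := @itg_improper (fun h => 1 <= h) (fun=> 1) b (fun h => Num.sqrt h * h ^- 2) 2 2.
- by move=> n x /andP[].
- move=> x x1; near=> n; rewrite x1/= /b -lerBlDl; near: n; exact: nbhs_infty_ger.
- by move=> x x1; rewrite mulr_ge0 ?sqrtr_ge0// invr_ge0 exprn_ge0// (le_trans _ x1).
- by move=> n; exact: itg_cont.
- move=> n; rewrite E sqrtr1; have : 0 <= (Num.sqrt (b n))^-1 by rewrite invr_ge0 sqrtr_ge0.
  lra.
- under eq_fun do rewrite E.
  have h : (b n)^-1 @[n --> \oo] --> (0 : R).
    apply/gtr0_cvgV0; first by apply: nearW => n; rewrite (lt_le_trans _ (b1 n)).
    by apply/cvgryPge => A; near=> n; rewrite /b -lerBlDl; near: n; exact: nbhs_infty_ger.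
  have h' : Num.sqrt (b n)^-1 @[n --> \oo] --> Num.sqrt (0 : R).
    by apply: continuous_cvg => //; exact: sqrt_continuous.
  have H : - 2 * (Num.sqrt (b n))^-1 - - 2 * (Num.sqrt 1)^-1 @[n --> \oo] -->
      - 2 * Num.sqrt 0 - - 2 * (Num.sqrt 1)^-1.
    apply: cvgB; last exact: cvg_cst.
    apply: cvgM; first exact: cvg_cst.
    by under eq_fun do rewrite -sqrtrV ?(le_trans _ (b1 _))//.
  have e : - 2 * Num.sqrt 0 - - 2 * (Num.sqrt 1)^-1 = 2 :> R.
    by rewrite sqrtr0 sqrtr1 invr1; ring.
  by rewrite e in H.
by [].
Unshelve. all: by end_near. Qed.

End Improper.

(** * Smooth steps and test functions *)

Section Smooth.
Context {R : realType}.
Implicit Types (f g F G phi : R -> R) (a b c x y : R).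
Local Notation mu := (@lebesgue_measure R).

(** The intervals may contain the origin, so this includes integrability up to the boundary, which
    [locally_integrable (Rpos R)] does not. *)
Definition litg f := forall a b, itg (fun x => ind (a <= x <= b) * f x).

Lemma cvgn_uniq (u v : nat -> R) (l m : R) : u n @[n --> \oo] --> l ->
  v n @[n --> \oo] --> m -> (forall n, u n = v n) -> l = m.
Proof. by move=> ul vm /funext uv; rewrite uv in ul; exact: (cvg_unique _ ul vm). Qed.

Lemma litg_meas f : litg f -> measurable_fun setT f.
Proof.
move=> fi.
apply: (measurable_fun_cvg (h := fun (n : nat) (x : R) => ind (- n%:R <= x <= n%:R) * f x)).
  by move=> n; exact: itg_meas.
move=> x _; apply: cvg_near_cst; near=> n.
have : `|x| <= n%:R by near: n; exact: nbhs_infty_ger.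
by rewrite ler_norml => ->; rewrite /ind mul1r.
Unshelve. all: by end_near. Qed.

Lemma itg_litg f : itg f -> litg f.
Proof.
move=> fi a b; apply: (itgMb (C := 1)) => //; first exact: meas_cc.
by move=> x; rewrite ger0_norm ?ind_ge0// ind_le1.
Qed.

Lemma litg_bnd f : measurable_fun setT f ->
  (forall a b, exists C, forall x, a <= x <= b -> `|f x| <= C) -> litg f.
Proof. by move=> mf fC a b; have [C hC] := fC a b; exact: itg_bnd hC. Qed.

Lemma is_derive_derive1 f x l : is_derive x 1 f l -> f^`() x = l.
Proof. by move=> h; rewrite derive1E; apply: derive_val. Qed.

Lemma is_derive_aff F (k c x l : R) : is_derive (k * x + c) 1 F l ->
  is_derive x 1 (fun y => F (k * y + c)) (k * l).
Proof.
move=> dF.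
have d : is_derive x 1 (fun y : R => k * y + c) k.
  have d1 := is_deriveD (is_deriveZ k (is_derive_id x 1)) (is_derive_cst c x 1).
  by apply: (is_derive_eq d1); rewrite /GRing.scale/= mulr1 addr0.
have d2 := is_derive1_comp (f := F) (g := fun y : R => k * y + c) dF d.
by apply: (is_derive_eq d2); rewrite mulrC.
Qed.

Lemma smooth_is_derive f n x : smooth f -> is_derive x 1 f^`(n) (f^`(n.+1) x).
Proof.
by move=> sf; rewrite derive1nS derive1E; apply: derivableP; exact: sf.
Qed.

Lemma smooth_cont f n : smooth f -> continuous f^`(n).
Proof.
move=> sf x; apply: differentiable_continuous; apply/derivable1_diffP; exact: sf.
Qed.

Lemma smooth_derive f : smooth f -> smooth f^`().
Proof. by move=> sf n x; rewrite -derive1Sn; exact: sf. Qed.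

Lemma derive1n_aff f (k c : R) n : smooth f ->
  (fun x => f (k * x + c))^`(n) = (fun x => k ^+ n * derive1n n f (k * x + c)).
Proof.
move=> sf; elim: n => [|n IH].
  by apply/funext => x; rewrite !derive1n0 expr0 mul1r.
rewrite derive1nS IH; apply/funext => x; apply: is_derive_derive1.
have d := is_deriveZ (k ^+ n) (is_derive_aff (smooth_is_derive n (k * x + c) sf)).
by apply: (is_derive_eq d); rewrite /GRing.scale/= mulrA -exprSr.
Qed.

Lemma smooth_aff f (k c : R) : smooth f -> smooth (fun x => f (k * x + c)).
Proof.
move=> sf n x; rewrite derive1n_aff//.
have d := is_deriveZ (k ^+ n) (is_derive_aff (smooth_is_derive n (k * x + c) sf)).
exact: (@ex_derive _ _ _ _ _ _ _ d).
Qed.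

Lemma derive1n_lin f g (k l : R) n : smooth f -> smooth g ->
  (fun x => k * f x + l * g x)^`(n) = (fun x => k * derive1n n f x + l * derive1n n g x).
Proof.
move=> sf sg; elim: n => [|n IH]; first by rewrite !derive1n0.
rewrite derive1nS IH; apply/funext => x; apply: is_derive_derive1.
have d := is_deriveD (is_deriveZ k (smooth_is_derive n x sf))
  (is_deriveZ l (smooth_is_derive n x sg)).
exact: (is_derive_eq d).
Qed.

Lemma smooth_lin f g (k l : R) : smooth f -> smooth g ->
  smooth (fun x => k * f x + l * g x).
Proof.
move=> sf sg n x; rewrite derive1n_lin//.
have d := is_deriveD (is_deriveZ k (smooth_is_derive n x sf))
  (is_deriveZ l (smooth_is_derive n x sg)).
exact: (@ex_derive _ _ _ _ _ _ _ d).
Qed.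

Lemma smooth_cst c : smooth (fun=> c : R).
Proof.
have h n : (fun=> c : R)^`(n.+1) = (fun=> 0 : R).
  elim: n => [|n IH]; last by rewrite derive1nS IH; apply/funext => x; rewrite derive1_cst.
  by rewrite derive1n1; apply/funext => x; rewrite derive1_cst.
move=> [|n] x; first by rewrite derive1n0; exact: derivable_cst.
by rewrite h; exact: derivable_cst.
Qed.

Lemma test_lin phi psi (k l : R) : test_fun phi -> test_fun psi ->
  test_fun (fun x => k * phi x + l * psi x).
Proof.
move=> [sf [a [b [a0 fab]]]] [sg [c [d [c0 gcd]]]]; split; first exact: smooth_lin.
exists (Num.min a c), (Num.max b d); split; first by rewrite lt_min a0 c0.
move=> x /negP h; rewrite fab ?gcd ?mulr0 ?addr0//; apply/negP => /andP[h1 h2]; apply: h.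
  by rewrite ge_min h1 orbT/= le_max h2 orbT.
by rewrite ge_min h1/= le_max h2.
Qed.

Lemma test_cont phi : test_fun phi -> continuous phi.
Proof. by move=> [/(@smooth_cont _ 0) + _]; rewrite derive1n0. Qed.

Lemma test_is_derive phi x : test_fun phi -> is_derive x 1 phi (phi^`() x).
Proof. by move=> [/(@smooth_is_derive _ 0 x) + _]; rewrite derive1n0 derive1n1. Qed.

Lemma test_dcont phi : test_fun phi -> continuous phi^`().
Proof. by move=> [/(@smooth_cont _ 1) + _]; rewrite derive1n1. Qed.

Lemma near_lt x c : x < c -> \forall y \near x, y < c.
Proof. by move=> xc; apply: (open_lt (y := c)). Qed.

Lemma near_gt x c : c < x -> \forall y \near x, c < y.
Proof. by move=> xc; apply: (open_gt (y := c)). Qed.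

Lemma derive1_supp phi a b : (forall x, is_derive x 1 phi (phi^`() x)) ->
  (forall x, ~~ (a <= x <= b) -> phi x = 0) ->
  forall x, ~~ (a <= x <= b) -> phi^`() x = 0.
Proof.
move=> dphi p0 x nx; apply: is_derive_derive1.
apply: (near_eq_is_derive (f := cst 0)).
move: nx; rewrite negb_and -!ltNge => /orP[xa|bx].
  near=> y; rewrite p0// negb_and -ltNge; apply/orP; left.
  by near: y; exact: near_lt.
near=> y; rewrite p0// negb_and -!ltNge; apply/orP; right.
by near: y; exact: near_gt.
Unshelve. all: by end_near. Qed.

Lemma test_bound phi : test_fun phi -> exists a b C : R, [/\ 0 < a, a <= b, 0 <= C,
  (forall x, ~~ (a <= x <= b) -> phi x = 0 /\ phi^`() x = 0) &
  (forall x, `|phi x| <= C /\ `|phi^`() x| <= C)].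
Proof.
move=> tphi; have [sphi [a [b [a0 p0]]]] := tphi.
have p0' x : ~~ (a <= x <= Num.max a b) -> phi x = 0.
  move=> h; apply: p0; apply: contra h => /andP[->/= xb].
  by rewrite le_max xb orbT.
have d0 := derive1_supp (fun x => test_is_derive x tphi) p0'.
have [C1 C10 hC1] := cont_bnd (contT_within (A := `[a, Num.max a b]) (test_cont tphi)).
have [C2 C20 hC2] := cont_bnd (contT_within (A := `[a, Num.max a b]) (test_dcont tphi)).
exists a, (Num.max a b), (C1 + C2); split => //.
- by rewrite le_max lexx.
- exact: addr_ge0.
- by move=> x h; split; [exact: p0'|exact: d0].
- move=> x; have [h|h] := boolP (a <= x <= Num.max a b).
    by split; [rewrite (le_trans (hC1 x h))// lerDl|rewrite (le_trans (hC2 x h))// lerDr].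
  by rewrite p0'// d0// normr0 addr_ge0.
Qed.

End Smooth.

(** * Steps and mollifiers made from the cutoff *)

Section Step.
Context {R : realType}.
Implicit Types (f g F G phi : R -> R) (a b c d e x y : R).
Local Notation mu := (@lebesgue_measure R).
Variables (beta : R) (eta : R -> R).
Hypothesis (beta0 : 0 < beta) (heta : is_cutoff beta eta).

(** The cutoff [eta] is itself the source of the test functions: normalised and reversed, it rises
    from [0] to [1] on [[0, 1]], and its derivative is a nonnegative smooth bump of mass one. *)
Definition step x := 1 + - beta^-1 * eta x.
Definition dstep x := step^`() x.
(* [mollifier a e] is an approximate identity at [a], supported in [a, a + e]. *)
Definition mollifier a e x := e^-1 * dstep (e^-1 * x + - (e^-1 * a)).
Definition step_at a e x := step (e^-1 * x + - (e^-1 * a)).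

Lemma step_smooth : smooth step.
Proof.
have [se _ _ _ _] := heta.
have := @smooth_lin R (fun=> 1) eta 1 (- beta^-1) (@smooth_cst R 1) se.
by under eq_fun do rewrite mulr1.
Qed.

Lemma stp0 x : x <= 0 -> step x = 0.
Proof. by case: heta => _ _ h _ _ x0; rewrite /step h// mulNr mulVf ?subrr// gt_eqF. Qed.

Lemma stp1 x : 1 <= x -> step x = 1.
Proof. by case: heta => _ _ _ h _ x0; rewrite /step h// mulr0 addr0. Qed.

Lemma is_derive_stp x : is_derive x 1 step (dstep x).
Proof. by have := smooth_is_derive 0 x step_smooth; rewrite derive1n0 derive1n1. Qed.

Lemma cont_dstp : continuous dstep.
Proof. by have := smooth_cont (n := 1) step_smooth; rewrite derive1n1. Qed.

Lemma cont_stp : continuous step.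
Proof. by have := smooth_cont (n := 0) step_smooth; rewrite derive1n0. Qed.

Lemma dstep_ge0 x : 0 <= dstep x.
Proof.
case: heta => se _ _ _ h.
rewrite (_ : dstep x = - beta^-1 * derive1 eta x).
  by rewrite mulNr -mulrN mulr_ge0 ?oppr_ge0 ?h// invr_ge0 ltW.
have de := smooth_is_derive 0 x se; rewrite derive1n0 derive1n1 in de.
apply: is_derive_derive1.
have d := is_deriveD (is_derive_cst (1 : R) x 1) (is_deriveZ (- beta^-1) de).
by apply: (is_derive_eq d); rewrite add0r.
Qed.

Lemma step_itv x : 0 <= step x <= 1.
Proof.
case: heta => _ /(_ x)/andP[h1 h2] _ _ _.
rewrite /step mulNr subr_ge0 gerDl oppr_le0.
have -> : 0 <= beta^-1 * eta x by rewrite mulr_ge0// invr_ge0 ltW.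
by rewrite andbT mulrC ler_pdivrMr// mul1r.
Qed.

Lemma dstep_supp x : ~~ (0 <= x <= 1) -> dstep x = 0.
Proof.
move=> nx; apply: is_derive_derive1.
move: nx; rewrite negb_and -!ltNge => /orP[xa|bx].
  apply: (near_eq_is_derive (f := cst 0)).
  by near=> y; rewrite stp0//; apply: ltW; near: y; exact: near_lt.
apply: (near_eq_is_derive (f := cst (1 : R))).
by near=> y; rewrite stp1//; apply: ltW; near: y; exact: near_gt.
Unshelve. all: by end_near. Qed.

Lemma dstep_bound : exists2 C, 0 < C & forall x, `|dstep x| <= C.
Proof.
have [C C0 hC] := cont_bnd (contT_within (A := `[0, 1]) cont_dstp).
exists (C + 1) => [|x]; first by rewrite ltr_wpDl.
have [h|h] := boolP (0 <= x <= 1); first by rewrite (le_trans (hC x h))// lerDl.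
by rewrite dstep_supp// normr0 addr_ge0.
Qed.

Lemma affE a e x : 0 < e -> e^-1 * x + - (e^-1 * a) = (x - a) / e.
Proof. by move=> e0; field; rewrite gt_eqF. Qed.

Lemma mollifier_supp a e x : 0 < e -> ~~ (a <= x <= a + e) -> mollifier a e x = 0.
Proof.
move=> e0 nx; rewrite /mollifier dstep_supp ?mulr0// affE//; apply: contra nx.
by rewrite pmulr_lge0 ?invr_gt0// subr_ge0 ler_pdivrMr// mul1r lerBlDl.
Qed.

Lemma mollifier_ge0 a e x : 0 < e -> 0 <= mollifier a e x.
Proof. by move=> e0; rewrite /mollifier mulr_ge0 ?dstep_ge0// invr_ge0 ltW. Qed.

Lemma is_derive_stpa a e x : is_derive x 1 (step_at a e) (mollifier a e x).
Proof. by apply: is_derive_aff; exact: is_derive_stp. Qed.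

Lemma cont_mollifier a e : continuous (mollifier a e).
Proof.
move=> x; apply: cvgM; first exact: cvg_cst.
apply: (continuous_comp (f := fun x => e^-1 * x + - (e^-1 * a))); last exact: cont_dstp.
by apply: cvgD; [apply: cvgM; [exact: cvg_cst|exact: cvg_id]|exact: cvg_cst].
Qed.

Lemma cont_stpa a e : continuous (step_at a e).
Proof.
move=> x; apply: (continuous_comp (f := fun x => e^-1 * x + - (e^-1 * a))); last exact: cont_stp.
by apply: cvgD; [apply: cvgM; [exact: cvg_cst|exact: cvg_id]|exact: cvg_cst].
Qed.

Lemma stpa0 a e x : 0 < e -> x <= a -> step_at a e x = 0.
Proof. by move=> e0 xa; rewrite /step_at affE// stp0// pmulr_lle0 ?invr_gt0// subr_le0. Qed.

Lemma stpa1 a e x : 0 < e -> a + e <= x -> step_at a e x = 1.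
Proof. by move=> e0 xa; rewrite /step_at affE// stp1// ler_pdivlMr// mul1r lerBrDl. Qed.

Lemma step_at_itv a e x : 0 <= step_at a e x <= 1.
Proof. exact: step_itv. Qed.

Lemma smooth_stpa a e : smooth (step_at a e).
Proof. exact: smooth_aff step_smooth. Qed.

Lemma II_mollifier a e : 0 < e -> II a (a + e) (mollifier a e) = 1.
Proof.
move=> e0; transitivity (step_at a e (a + e) - step_at a e a); last first.
  by rewrite stpa1// stpa0// subr0.
apply: FTC2.
- by rewrite lerDl ltW.
- exact: contT_within (@cont_mollifier a e).
- exact: contT_within (@cont_stpa a e).
- by move=> x _; exact: is_derive_stpa.
Qed.

(** A plateau with ramps that start at [a] and at [b]. Its derivative is a difference of two
    mollifiers, so testing with it compares a function at the points [a] and [b]. *)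
Lemma test_stpd a b e d : 0 < a -> a <= b -> 0 < e -> 0 < d ->
  test_fun (fun x => 1 * step_at a e x + -1 * step_at b d x).
Proof.
move=> a0 ab e0 d0; split; first by apply: smooth_lin; exact: smooth_stpa.
exists a, (Num.max (a + e) (b + d)); split=> // x; rewrite negb_and -!ltNge => /orP[xa|bx].
  by rewrite !stpa0 ?mulr0 ?addr0// ltW// (lt_le_trans xa).
move: bx; rewrite gt_max => /andP[h1 h2].
by rewrite !stpa1 1?ltW// mulr1 mulr1 subrr.
Qed.

Lemma derive_stpd a b e d x :
  derive1 (fun x => 1 * step_at a e x + -1 * step_at b d x) x = mollifier a e x - mollifier b d x.
Proof.
apply: is_derive_derive1.
have dd := is_deriveD (is_deriveZ 1 (is_derive_stpa a e x)) (is_deriveZ (-1) (is_derive_stpa b d x)).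
by apply: (is_derive_eq dd); rewrite /GRing.scale/= mul1r mulN1r.
Qed.

Lemma test_mollifier a e : 0 < a -> 0 < e -> test_fun (mollifier a e).
Proof.
move=> a0 e0; split.
  have := @smooth_lin R _ _ e^-1 0 (@smooth_aff R _ e^-1 (- (e^-1 * a)) (smooth_derive step_smooth)) (@smooth_cst R 0).
  by under eq_fun do rewrite mulr0 addr0.
by exists a, (a + e); split => // x; exact: mollifier_supp.
Qed.

Lemma itg_mollifier f a e : 0 < e -> litg f -> itg (fun x => f x * mollifier a e x).
Proof.
move=> e0 fi; have [C C0 hC] := dstep_bound.
apply: (eq_itg (f := fun x => mollifier a e x * (ind (a <= x <= a + e) * f x))).
  move=> x; have [h|h] := boolP (a <= x <= a + e); first by rewrite /ind mul1r mulrC.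
  by rewrite mollifier_supp// mul0r mulr0.
apply: (itgMb (C := `|e^-1| * C)) => //; first exact: cont_meas (@cont_mollifier a e).
by move=> x; rewrite /mollifier normrM ler_wpM2l.
Qed.

Lemma It_mollifier a e : 0 < e -> itg (mollifier a e) /\ It (mollifier a e) = 1.
Proof.
move=> e0.
have E x : ind (a <= x <= a + e) * mollifier a e x = mollifier a e x.
  by have [h|h] := boolP (a <= x <= a + e); rewrite /ind ?mul1r// mul0r mollifier_supp.
split; last by rewrite -(II_mollifier a e0) /II; apply: eq_It => x; rewrite E.
by apply: eq_itg E _; apply: itg_cont; exact: contT_within (@cont_mollifier a e).
Qed.

(** The mollifier is one-sided but bounded by [C / d], so the error is at most [4 C] times the mean
    of [|f - f a|] over the ball of radius [2 d]. The radius [2 d] makes the open ball contain the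
    closed support [[a, a + d]]. *)
Lemma lebesgue_pt_mollifier f a : litg f -> lebesgue_pt f a ->
  forall e, 0 < e -> exists2 r, 0 < r &
    forall d, 0 < d < r -> `|It (fun x => f x * mollifier a d x) - f a| <= e.
Proof.
move=> fi la e e0; have [C C0 hC] := dstep_bound.
have C4 : 0 < 4 * C by rewrite mulr_gt0.
have e4 : 0 < e / (4 * C) by rewrite divr_gt0.
have davgE d : 0 < d -> davg f a d =
    ((2 * d)^-1 * It (fun x => ind (a - d < x < a + d) * `|f x - f a|))%:E.
  move=> d0; rewrite /davg /iavg lebesgue_measure_ball 1?ltW// inver.
  rewrite mulrn_eq0/= gt_eqF// EFinM; congr (_ * _)%E; first by rewrite mulr_natl.
  have fai : itg (fun x => ind (x \in (`]a - d, a + d[)%O) * `|f x - f a|).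
    apply: (itg_le (g := fun x => `|ind (a - d <= x <= a + d) * f x| + ind (a - d <= x <= a + d) * `|f a|)).
    - apply: measurable_funM; first exact: meas_itv.
      apply: measurableT_comp => //; apply: measurable_funB => //; exact: litg_meas.
    - move=> x; rewrite [leLHS]norm_ind normr_id in_itv/=.
      have [/andP[h1 h2]|h] := boolP (a - d < x < a + d); rewrite /ind ?mul0r ?mul1r.
        by rewrite (ltW h1) (ltW h2) /= !mul1r ler_normB.
      by rewrite addr_ge0// mulr_ge0//; case: ifP.
    - apply: itgD; first exact: itg_norm (fi _ _).
      by apply: itg_cont; apply: contT_within; exact: cst_continuous.
  rewrite ball_itv -(eq_It (f := fun x => ind (x \in (`]a - d, a + d[)%O) * `|f x - f a|)).
    by rewrite -It_itv /Rintegral fineK//; apply: integrable_fin_num => //; apply/itg_itv.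
  by move=> x; rewrite in_itv.
have /fine_cvgP[_ /cvgrPdist_lt /(_ _ e4)] := la.
move=> [r /= r0 hr]; exists (r / 2); first by rewrite divr_gt0.
move=> d /andP[d0 dr].
have [kapi kap1] := It_mollifier a d0.
have -> : It (fun x => f x * mollifier a d x) - f a = It (fun x => (f x - f a) * mollifier a d x).
  rewrite -[X in _ - X]mulr1 -kap1 -ItZ// -ItB//; last exact: itgZ.
    by apply: eq_It => x; rewrite mulrBl.
  exact: itg_mollifier.
have i2 : itg (fun x => ind (a - 2 * d < x < a + 2 * d) * `|f x - f a|).
  apply: (itg_le (g := fun x => `|ind (a - 2 * d <= x <= a + 2 * d) * f x| + ind (a - 2 * d <= x <= a + 2 * d) * `|f a|)).
  - apply: measurable_funM.
      by have := meas_itv (`]a - 2 * d, a + 2 * d[)%O; under eq_fun do rewrite in_itv.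
    apply: measurableT_comp => //; apply: measurable_funB => //; exact: litg_meas.
  - move=> x; rewrite [leLHS]norm_ind normr_id.
    have [/andP[h1 h2]|h] := boolP (a - 2 * d < x < a + 2 * d); rewrite /ind ?mul0r ?mul1r.
      by rewrite (ltW h1) (ltW h2) /= !mul1r ler_normB.
    by rewrite addr_ge0// mulr_ge0//; case: ifP.
  - apply: itgD; first exact: itg_norm (fi _ _).
    by apply: itg_cont; apply: contT_within; exact: cst_continuous.
have d2 : 0 < 2 * d by rewrite mulr_gt0.
have := hr (2 * d); rewrite /ball_/= sub0r normrN (gtr0_norm d2).
have -> : 2 * d < r by rewrite mulrC -ltr_pdivlMr.
move=> /(_ isT d2); rewrite davgE//= sub0r normrN.
set J := It _ => hJ.
have J0 : 0 <= J by apply: It_ge0 => x; rewrite mulr_ge0// ind_ge0.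
rewrite ger0_norm ?mulr_ge0 ?invr_ge0 1?mulr_ge0// 1?ltW// in hJ.
apply: (@le_trans _ _ (C / d * J)).
  rewrite /J -ItZ//; apply: It_norm_le.
  - apply: measurable_funM; last exact: cont_meas (@cont_mollifier a d).
    by apply: measurable_funB => //; exact: litg_meas.
  - exact: itgZ.
  - move=> x; rewrite normrM mulrC mulrA ler_wpM2r//.
    have [h|h] := boolP (a <= x <= a + d); last first.
      by rewrite mollifier_supp// normr0 mulr_ge0 ?ind_ge0// divr_ge0// ltW.
    have -> : a - 2 * d < x < a + 2 * d by lra.
    rewrite /ind mulr1 /mollifier normrM gtr0_norm ?invr_gt0// mulrC.
    by apply: ler_wpM2r; [rewrite invr_ge0 ltW|exact: hC].
have -> : C / d * J = 4 * C * ((2 * (2 * d))^-1 * J) by field; rewrite gt_eqF.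
by rewrite mulrC -ler_pdivlMr// ltW.
Qed.

Lemma lebesgue_pt_eq f g a r0 : 0 < r0 ->
  (forall d, 0 < d < r0 -> It (fun x => f x * mollifier a d x) = It (fun x => g x * mollifier a d x)) ->
  litg f -> litg g -> lebesgue_pt f a -> lebesgue_pt g a -> f a = g a.
Proof.
move=> r00 fg fi gi fa ga; apply/eqP; rewrite -subr_eq0 -normr_eq0.
rewrite eq_le normr_ge0 andbT; apply/ler_addgt0Pl => e e0; rewrite addr0.
have e2 : 0 < e / 2 by rewrite divr_gt0.
have [r r1 hr] := lebesgue_pt_mollifier fi fa e2; have [s s0 hs] := lebesgue_pt_mollifier gi ga e2.
pose m := Num.min r0 (Num.min r s); pose d := m / 2.
have m0 : 0 < m by rewrite !lt_min r00 r1.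
have d0 : 0 < d by rewrite divr_gt0.
have dm : d < m by rewrite ltr_pdivrMr// ltr_pMr// ltr1n.
move: dm; rewrite !lt_min => /and3P[dr0 dr ds].
have h1 := hr d; rewrite d0 dr in h1; have {}h1 := h1 isT.
have h2 := hs d; rewrite d0 ds in h2; have {}h2 := h2 isT.
have h3 := fg d; rewrite d0 dr0 in h3; have {}h3 := h3 isT.
rewrite h3 in h1; move: h1 h2; rewrite !ler_norml => /andP[? ?] /andP[? ?].
by apply/andP; split; lra.
Qed.

(** Cut off to [[1/(n+1), n+1]], both functions are integrable on the line. At a common Lebesgue
    point in the interior of this interval, mollifiers supported to the right of the point identify
    the two values. *)
Lemma test_unique f g : locally_integrable (Rpos R) f -> locally_integrable (Rpos R) g ->
  (forall phi, test_fun phi -> \int[mu]_(x in Rpos R) (f x * phi x) = \int[mu]_(x in Rpos R) (g x * phi x)) ->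
  {ae mu, forall x, 0 < x -> f x = g x}.
Proof.
move=> lf lg fg.
pose res F n x := ind (n.+1%:R^-1 <= x <= n.+1%:R) * F x.
have n0 n : 0 < n.+1%:R^-1 :> R by rewrite invr_gt0.
have res_itg F n : locally_integrable (Rpos R) F -> itg (res F n).
  move=> [mF _ hF]; apply/itg_cc/integrableP; split.
    apply/measurable_EFinP; apply: measurable_funS mF.
      exact: measurable_itv.
    by move=> x; rewrite /Rpos/= !in_itv/= andbT => /andP[+ _]; apply: lt_le_trans.
  apply: hF; last exact: segment_compact.
  by move=> x; rewrite /Rpos/= !in_itv/= andbT => /andP[+ _]; apply: lt_le_trans.
have lp F : itg F -> {ae mu, forall x, lebesgue_pt F x}.
  move=> Fi; apply: lebesgue_differentiation.
  by apply: open_integrable_locally => //; exact: openT.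
have key n : {ae mu, forall x, n.+1%:R^-1 < x < n.+1%:R -> f x = g x}.
  have fi := res_itg f n lf; have gi := res_itg g n lg.
  have := aeI (lp _ fi) (lp _ gi); apply: aeS => x [fx gx] /andP[h1 h2].
  have r0 : 0 < n.+1%:R - x by rewrite subr_gt0.
  have E : res f n x = res g n x.
    apply: (lebesgue_pt_eq r0) => //; try exact: itg_litg.
    move=> d /andP[d0 dr]; have x0 : 0 < x := lt_trans (n0 n) h1.
    have := fg _ (test_mollifier x0 d0); rewrite /Rpos !It_itv.
    have EE F y : ind (y \in (`]0, +oo[)%O) * (F y * mollifier x d y) = res F n y * mollifier x d y.
      have [/andP[k1 sq_kernel]|k] := boolP (x <= y <= x + d); last by rewrite mollifier_supp// !mulr0.
      rewrite in_itv/= (lt_le_trans x0 k1) /res.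
      rewrite (le_trans (ltW h1) k1)/= (le_trans sq_kernel) ?mul1r//.
      by rewrite addrC -lerBrDr ltW.
    by rewrite (eq_It (EE f)) (eq_It (EE g)).
  by move: E; rewrite /res (ltW h1) (ltW h2) /ind /= !mul1r.
have := ae_foralln key; apply: aeS => x hx x0.
pose N := (Num.truncn x^-1 + Num.truncn x).+1.
apply: (hx N); apply/andP; split.
  rewrite -[ltRHS]invrK ltf_pV2 ?posrE ?invr_gt0//.
  apply: (lt_le_trans (Num.Theory.truncnS_gt x^-1)); rewrite ler_nat /N.
  by rewrite ltnS leqW// leq_addr.
apply: (lt_le_trans (Num.Theory.truncnS_gt x)); rewrite ler_nat /N.
by rewrite ltnS leqW// leq_addl.
Qed.

(** Plateaus between two Lebesgue points [a <= b] of [f], with ramps of width tending to [0], turn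
    the hypothesis into [f a - f b = -] the integral of [g] over [[a, b]]. Hence [f] minus the
    primitive of [g] is constant on the Lebesgue points, which have full measure. *)
Lemma du_bois_reymond f g : litg f -> litg g ->
  (forall phi, test_fun phi -> It (fun x => f x * derive1 phi x) + It (fun x => g x * phi x) = 0) ->
  exists c, {ae mu, forall x, 0 < x -> f x = c + II 0 x g}.
Proof.
move=> fi gi fg.
pose d n : R := n.+1%:R^-1.
have d0 n : 0 < d n by rewrite invr_gt0.
have d1 n : d n <= 1 by rewrite invf_le1// ler1n.
have dcvg : d n @[n --> \oo] --> 0 by exact: cvg_invS.
have mollc a : lebesgue_pt f a -> It (fun x => f x * mollifier a (d n) x) @[n --> \oo] --> f a.
  move=> fa; apply/cvgrPdist_le => e e0; have [r r0 hr] := lebesgue_pt_mollifier fi fa e0.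
  near=> n; rewrite distrC; apply: hr; rewrite d0/=.
  by near: n; exact: (cvgr_lt 0).
have stpc a x : step_at a (d n) x @[n --> \oo] --> ind (a < x).
  apply: cvg_near_cst; have [ax|xa] := ltP a x; last first.
    by apply: nearW => n; rewrite stpa0.
  near=> n; rewrite stpa1// -lerBrDl ltW//; near: n; apply: (cvgr_lt 0) => //.
  by rewrite subr_gt0.
have stpb a b n x : a <= b -> `|step_at a (d n) x - step_at b (d n) x| <= ind (a <= x <= b + 1).
  move=> ab; have [h|] := boolP (a <= x <= b + 1).
    have /andP[? ?] := step_at_itv a (d n) x; have /andP[? ?] := step_at_itv b (d n) x.
    by rewrite /ind ler_norml; apply/andP; split; lra.
  rewrite negb_and -!ltNge => /orP[xa|bx].
    by rewrite !stpa0// ?subrr ?normr0// ltW// (lt_le_trans xa).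
  rewrite !stpa1// ?subrr ?normr0//.
    by rewrite (le_trans _ (ltW bx))// lerD.
  by rewrite (le_trans _ (ltW bx))// lerD.
have key a b : 0 < a -> a <= b -> lebesgue_pt f a -> lebesgue_pt f b ->
    f b - f a = II 0 b g - II 0 a g.
  move=> a0 ab fa fb.
  pose phi n := fun x => 1 * step_at a (d n) x + -1 * step_at b (d n) x.
  have tphi n : test_fun (phi n) by apply: test_stpd.
  have E n : It (fun x => f x * mollifier a (d n) x) - It (fun x => f x * mollifier b (d n) x) =
      - It (fun x => g x * (step_at a (d n) x - step_at b (d n) x)).
    have := fg _ (tphi n); rewrite addrC => /eqP; rewrite addr_eq0 => /eqP h.
    rewrite -ItB; [|exact: itg_mollifier|exact: itg_mollifier].
    transitivity (It (fun x => f x * derive1 (phi n) x)).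
      by apply: eq_It => x; rewrite /phi derive_stpd mulrBr.
    rewrite -[LHS]opprK -h; congr (- _); apply: eq_It => x.
    by rewrite /phi mul1r mulN1r.
  have mg := litg_meas gi.
  have gl : itg (fun x => ind (a <= x <= b + 1) * `|g x|).
    by apply: eq_itg (itg_norm (gi a (b + 1))) => x; rewrite norm_ind.
  have [i1 c1] : itg (fun x => g x * (ind (a < x) - ind (b < x))) /\
     It (fun x => g x * (step_at a (d n) x - step_at b (d n) x)) @[n --> \oo] -->
     It (fun x => g x * (ind (a < x) - ind (b < x))).
    apply: (It_dom (g := fun x => ind (a <= x <= b + 1) * `|g x|)) => //.
    - move=> n; apply: measurable_funM => //; apply: measurable_funB; exact: (cont_meas (@cont_stpa _ _)).
    - by move=> x; apply: cvgM; [exact: cvg_cst|apply: cvgB; exact: stpc].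
    - by move=> n x; rewrite normrM mulrC ler_wpM2r// stpb.
  have c2 : It (fun x => f x * mollifier a (d n) x) - It (fun x => f x * mollifier b (d n) x) @[n --> \oo] --> f a - f b.
    by apply: cvgB; exact: mollc.
  have h : f a - f b = - It (fun x => g x * (ind (a < x) - ind (b < x))).
    exact: cvgn_uniq c2 (cvgN c1) E.
  rewrite -opprB h opprK /II -ItB; [|exact: gi|exact: gi].
  apply: eq_It => x; rewrite /ind.
  have [h0|h0] := ltP x 0.
    by have [?|?] := ltP a x; have [?|?] := ltP b x; rewrite /=; lra.
  by have [?|?] := leP x a; have [?|?] := leP x b; rewrite /=; lra.
have aef : {ae mu, forall x, lebesgue_pt f x}.
  apply: lebesgue_differentiation; split; [exact: litg_meas|exact: openT|].
  move=> K _ cK; have [M [_ hM]] := compact_bounded cK.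
  have KM : K `<=` `[- (M + 1), M + 1].
    move=> x Kx; rewrite /= in_itv/= -ler_norml; apply: hM Kx; by rewrite ltrDl.
  apply: (@le_lt_trans _ _ (\int[mu]_(x in `[(- (M + 1))%R, (M + 1)%R]) `|(f x)%:E|)%E).
    apply: ge0_subset_integral => //; first exact: compact_measurable.
    apply/measurable_EFinP; apply: measurable_funTS; apply: measurableT_comp => //.
    exact: litg_meas.
  by have /itg_cc/integrableP[] := fi (- (M + 1)) (M + 1).
have [x0 x00 fx0] : exists2 x0, 0 < x0 & lebesgue_pt f x0.
  apply: contrapT => nx.
  have : {ae mu, forall x, ~ (0 < x)}.
    by apply: aeS aef => x fx x0; apply: nx; exists x.
  move=> [N [mN N0 sN]]; have : (mu `]0%R, 1%R[ <= mu N)%E.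
    apply: le_measure; [by rewrite inE; exact: measurable_itv|by rewrite inE|].
    by move=> x /=; rewrite in_itv/= => /andP[x0 _]; apply: sN => /= h; exact: h.
  by rewrite N0 lebesgue_measure_itv/= lte01 oppr0 adde0 lee_fin ler10.
exists (f x0 - II 0 x0 g); apply: aeS aef => x fx xp.
have [h|h] := leP x0 x; first by have := key _ _ x00 h fx0 fx; lra.
by have := key _ _ xp (ltW h) fx fx0; lra.
Unshelve. all: by end_near. Qed.

End Step.

(** * Completeness of square integrable functions *)

Section L2.
Context {R : realType}.
Implicit Types (f g F G phi : R -> R) (a b c d e x y : R).
Local Notation mu := (@lebesgue_measure R).

(** Measurability of [f] is asked separately, since that of [f ^+ 2] does not imply it. *)
Definition l2_fun f : Prop := measurable_fun setT f /\ itg (fun x => f x ^+ 2).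

Lemma l2_fun_litg f : l2_fun f -> litg f.
Proof.
move=> [mf f2] a b; apply: (itg_le (g := fun x => ind (a <= x <= b) + f x ^+ 2)).
- by apply: measurable_funM => //; exact: meas_cc.
- move=> x; rewrite norm_ind; have [_|_] := boolP (a <= x <= b); rewrite /ind.
    rewrite mul1r -(real_normK (num_real (f x))).
    by have := sqr_ge0 (`|f x| - 1/2); lra.
  by rewrite mul0r add0r sqr_ge0.
- by apply: itgD => //; exact: itg_ind.
Qed.

Lemma l2_fun_norm f : l2_fun f -> l2_fun (fun x => `|f x|).
Proof.
move=> [mf f2]; split; first exact: measurableT_comp.
by apply: eq_itg f2 => x; rewrite real_normK// num_real.
Qed.

Lemma sq2D f g : l2_fun f -> l2_fun g -> l2_fun (fun x => f x + g x).
Proof.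
move=> [mf f2] [mg g2]; split; first exact: measurable_funD.
apply: (itg_le (g := fun x => 2 * f x ^+ 2 + 2 * g x ^+ 2)).
- by apply: measurable_funX; exact: measurable_funD.
- by move=> x; rewrite ger0_norm ?sqr_ge0//; have := sqr_ge0 (f x - g x); lra.
- by apply: itgD; exact: itgZ.
Qed.

Lemma sq2N f : l2_fun f -> l2_fun (fun x => - f x).
Proof.
move=> [mf f2]; split; first exact: measurable_funN.
by apply: eq_itg f2 => x; rewrite sqrrN.
Qed.

Lemma sq2B f g : l2_fun f -> l2_fun g -> l2_fun (fun x => f x - g x).
Proof. by move=> f2 g2; apply: sq2D => //; exact: sq2N. Qed.

Lemma sq2M f g : l2_fun f -> l2_fun g -> itg (fun x => f x * g x).
Proof.
move=> [mf f2] [mg g2].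
apply: (itg_le (g := fun x => f x ^+ 2 + g x ^+ 2)).
- exact: measurable_funM.
- move=> x; rewrite normrM -(real_normK (num_real (f x))) -(real_normK (num_real (g x))).
  have := sqr_ge0 (`|f x| - `|g x|); have := mulr_ge0 (normr_ge0 (f x)) (normr_ge0 (g x)); lra.
- exact: itgD.
Qed.

(** Cauchy-Schwarz against the constant one, from the nonnegativity of the integral of
    [(f - k) ^+ 2] where [k] is the mean of [f] over [[a, b]]. *)
Lemma II_CS2 f a b : a <= b -> litg f -> itg (fun x => ind (a <= x <= b) * f x ^+ 2) ->
  (II a b f) ^+ 2 <= (b - a) * II a b (fun x => f x ^+ 2).
Proof.
move=> ab fi f2; have [ab0|ab0] := eqVneq a b.
  subst b; rewrite subrr mul0r (_ : II a a f = 0) ?expr0n//.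
  by rewrite II_E set_itv1 Rintegral_set1.
have L0 : 0 < b - a by rewrite subr_gt0 lt_neqAle ab0.
set m := II a b f; pose k := m / (b - a).
have : 0 <= It (fun x => (ind (a <= x <= b) * f x ^+ 2 + (- (2 * k)) * (ind (a <= x <= b) * f x))
     + k ^+ 2 * ind (a <= x <= b)).
  apply: It_ge0 => x; have [_|_] := boolP (a <= x <= b); rewrite /ind; last by lra.
  by have := sqr_ge0 (f x - k); lra.
have i1 : itg (fun x => - (2 * k) * (ind (a <= x <= b) * f x)) by apply: itgZ; exact: fi.
have i2 : itg (fun x => k ^+ 2 * ind (a <= x <= b)) by apply: itgZ; exact: itg_ind.
rewrite ItD//; last exact: itgD.
rewrite ItD// (ItZ _ (itg_ind a b)) (ItZ _ (fi a b)).
rewrite It_ind// -/(II a b f) -/m -/(II a b (fun x => f x ^+ 2)).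
rewrite /k; set J := II a b _ => h.
have : 0 <= (b - a) * (J + - (2 * (m / (b - a))) * m + (m / (b - a)) ^+ 2 * (b - a)).
  by rewrite mulr_ge0// ltW.
have -> : (b - a) * (J + - (2 * (m / (b - a))) * m + (m / (b - a)) ^+ 2 * (b - a)) =
   (b - a) * J - m ^+ 2 by field; exact: lt0r_neq0.
by rewrite subr_ge0.
Qed.

Lemma II_le_It f a b : (forall x, 0 <= f x) -> itg f -> II a b f <= It f.
Proof.
move=> f0 fi; apply: It_le => //; first exact: itg_litg.
move=> x; have [_|_] := boolP (a <= x <= b); rewrite /ind ?mul1r//.
by rewrite mul0r.
Qed.

Lemma II_CS f a b : a <= b -> l2_fun f ->
  `|II a b f| <= Num.sqrt (b - a) * Num.sqrt (It (fun x => f x ^+ 2)).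
Proof.
move=> ab f2; rewrite -sqrtrM ?subr_ge0// -sqrtr_sqr ler_wsqrtr//.
apply: (le_trans (II_CS2 ab (l2_fun_litg f2) _)); first exact: itg_litg f2.2 _ _.
rewrite ler_wpM2l ?subr_ge0//; apply: II_le_It; last exact: f2.2.
by move=> x; exact: sqr_ge0.
Qed.

(** The increments after rank [j] sum to at most [2 C 2^-j]. Subtracting or adding this tail gives a
    nondecreasing and a nonincreasing sequence that enclose [u]. *)
Lemma geo_cvg (u : nat -> R) (C : R) :
  (forall j, `|u j.+1 - u j| <= C * (2^-1) ^+ j) -> cvgn u.
Proof.
move=> hu.
have hg : (2^-1 : R) ^+ n @[n --> \oo] --> (0 : R).
  by apply: cvg_expr; rewrite ger0_norm// invf_lt1// ltr1n.
pose v j := u j - 2 * C * (2^-1) ^+ j.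
pose z j := u j + 2 * C * (2^-1) ^+ j.
have hz j : z j.+1 <= z j /\ v j <= v j.+1.
  by have := hu j; rewrite ler_norml /z /v exprS; move=> /andP[]; lra.
have C0 : 0 <= C by have := hu 0; rewrite expr0 mulr1; apply: le_trans.
have vz j : v j <= z j.
  have : 0 <= C * 2^-1 ^+ j by rewrite mulr_ge0// exprn_ge0.
  by rewrite /v /z; lra.
have zz j : z j <= z 0%N by elim: j => // j; apply: le_trans; exact: (hz j).1.
have vc : cvgn v.
  apply: nondecreasing_is_cvgn.
    by apply/nondecreasing_seqP => j; exact: (hz j).2.
  by exists (z 0%N) => _ [j _ <-]; exact: le_trans (vz j) (zz j).
rewrite (_ : u = fun j => v j + 2 * C * (2^-1) ^+ j); last first.
  by apply/funext => j; rewrite /v subrK.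
apply: is_cvgD => //; apply: is_cvgM; first exact: is_cvg_cst.
by apply/cvg_ex; exists 0.
Qed.

(** Riesz-Fischer. Along a subsequence the squared increments [D j] have integral at most [8^-j], so
    the series of [4^j * D j ^+ 2] has integral at most the sum of the [2^-j]. It is finite almost
    everywhere, and where its sum is [S], [|D j| <= sqrt S * 2^-j] gives convergence. Fatou then
    bounds the distance to the limit. *)
Lemma l2_fun_complete (p : nat -> R -> R) : (forall n, l2_fun (p n)) ->
  (forall e, 0 < e -> exists N : nat, forall m n, (N <= m)%N -> (N <= n)%N ->
     It (fun x => (p m x - p n x) ^+ 2) < e) ->
  exists g, l2_fun g /\ forall e, 0 < e -> exists N : nat, forall n, (N <= n)%N ->
     It (fun x => (p n x - g x) ^+ 2) <= e.
Proof.
move=> p2 cp.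
have q0 j : 0 < (8^-1 : R) ^+ j by rewrite exprn_gt0// invr_gt0.
have /choice[K hK] j := cp _ (q0 j).
(* Partial sums of [(K i).+1] make the indices nondecreasing, with [k j] at least [K j] and at least
   [j]. *)
pose k j := (\sum_(i < j.+1) (K i).+1)%N.
have kK j : (K j <= k j)%N by rewrite /k big_ord_recr/= (leq_trans (leqnSn _))// leq_addl.
have second_var_kernel j : (k j <= k j.+1)%N by rewrite /k (big_ord_recr j.+1)/= leq_addr.
pose D j x := p (k j.+1) x - p (k j) x.
have D2 j : l2_fun (D j) by apply: sq2B.
have ID j : It (fun x => D j x ^+ 2) <= 8^-1 ^+ j.
  by apply/ltW/hK; [exact: leq_trans (kK j) (second_var_kernel j)|exact: kK].
pose T j x := 4 ^+ j * D j x ^+ 2.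
have T0 j x : 0 <= T j x by rewrite mulr_ge0 ?sqr_ge0// exprn_ge0.
have Ti j : itg (T j) by apply: itgZ; exact: (D2 j).2.
have IT j : It (T j) <= 2^-1 ^+ j.
  rewrite /T ItZ; last exact: (D2 j).2.
  apply: (@le_trans _ _ (4 ^+ j * 8^-1 ^+ j)); first by rewrite ler_wpM2l// exprn_ge0.
  rewrite -exprMn (_ : 4 * 8^-1 = 2^-1)//; by field.
pose S : R -> \bar R := fun x => (\sum_(0 <= j <oo) (T j x)%:E)%E.
have mT j : measurable_fun setT (EFin \o T j).
  by apply/measurable_EFinP; exact: itg_meas.
have mS : measurable_fun setT S.
  have := @ge0_emeasurable_sum _ _ R setT (fun j => EFin \o T j) xpredT.
  by apply => // j x _ _; rewrite lee_fin.
have S0 x : (0 <= S x)%E by apply: nneseries_ge0 => j _ _; rewrite lee_fin.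
have IS : (\int[mu]_x S x < +oo)%E.
  have -> : (\int[mu]_x S x = \sum_(0 <= j <oo) \int[mu]_x (T j x)%:E)%E.
    apply: (@integral_nneseries _ _ R mu setT measurableT (fun j => EFin \o T j)) => //.
    by move=> j x _; rewrite lee_fin.
  apply: (@le_lt_trans _ _ (\sum_(0 <= j <oo) ((2^-1 ^+ j)%:E))%E).
    apply: lee_nneseries.
      by move=> j _ _; apply: integral_ge0 => x _; rewrite lee_fin.
    by move=> j _; rewrite -ItE// lee_fin.
  have := @cvg_geometric_series _ (1 : R) 2^-1.
  rewrite ger0_norm// invf_lt1// ltr1n => /(_ isT) hc.
  rewrite (_ : (\sum_(0 <= j <oo) (2^-1 ^+ j)%:E)%E = (1 / (1 - 2^-1))%:E) ?ltry//.
  apply/cvg_lim => //.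
  rewrite (_ : (fun n => _) = EFin \o series (geometric 1 2^-1)); last first.
    apply/funext => n; rewrite /= /series/= -sumEFin; apply: eq_bigr => i _.
    by rewrite mul1r.
  by apply: cvg_EFin; [exact: nearW|exact: hc].
have Sfin : {ae mu, forall x, S x \is a fin_num}.
  have Si : mu.-integrable setT S.
    apply/integrableP; split=> //; rewrite (_ : (\int[mu]_x `|S x|)%E = (\int[mu]_x S x)%E)//.
    by apply: eq_integral => x _; rewrite gee0_abs.
  by have := integrable_ae measurableT Si; apply: aeS => x; apply.
have cvS x : S x \is a fin_num -> cvgn (fun j => p (k j) x).
  move=> Sx; apply: (geo_cvg (C := Num.sqrt (fine (S x)))) => j.
  rewrite -/(D j x) -sqrtr_sqr.
  have -> : 2^-1 ^+ j = Num.sqrt ((4^-1) ^+ j) :> R.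
    rewrite (_ : 4^-1 = 2^-1 * 2^-1 :> R); last by field.
    by rewrite exprMn -expr2 sqrtr_sqr ger0_norm// exprn_ge0.
  rewrite -sqrtrM ?fine_ge0// ler_wsqrtr//.
  have : ((T j x)%:E <= S x)%E.
    rewrite /S (nneseries_split 0 j.+1); last by move=> i _; rewrite lee_fin.
    rewrite add0n big_nat_recr//=.
    rewrite -[leLHS]add0e -[leLHS]adde0; apply: leeD; first apply: leeD => //.
      by apply: sume_ge0 => i _; rewrite lee_fin.
    by apply: nneseries_ge0 => i _ _; rewrite lee_fin.
  rewrite -(fineK Sx) lee_fin /T => h.
  rewrite exprVn ler_pdivlMr ?exprn_gt0//; by rewrite mulrC.
(* Setting the functions to zero where the series diverges makes the subsequence converge at every
   point, as [It_fatou] requires, and changes no integral. *)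
pose E x : R := ind (S x < +oo)%E.
have fE x : (S x \is a fin_num) = (S x < +oo)%E by rewrite ge0_fin_numE.
have mE : measurable_fun setT E.
  rewrite (_ : E = \1_([set x | (S x < +oo)%E])).
    apply: measurable_indic; have := emeasurable_fun_infty_o measurableT mS +oo%E.
    by rewrite setTI.
  apply/funext => x; rewrite indicE /E /ind; case: ifPn => h.
    by rewrite mem_set.
  by rewrite memNset//; exact/negP.
have aeE : {ae mu, forall x, E x = 1}.
  by apply: aeS Sfin => x; rewrite fE /E => ->.
pose P j x := E x * p (k j) x.
have mp n : measurable_fun setT (p n) := (p2 n).1.
have mP j : measurable_fun setT (P j) by apply: measurable_funM.
pose g x := limn (fun j => P j x).
have Pg x : P j x @[j --> \oo] --> g x.
  rewrite /g /P /E; have [h|h] := boolP (S x < +oo)%E; rewrite /ind.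
    rewrite (_ : (fun j => _) = (fun j => p (k j) x)).
      by apply: cvS; rewrite fE.
    by apply/funext => j; rewrite mul1r.
  rewrite (_ : (fun j => _) = cst 0); first exact: is_cvg_cst.
  by apply/funext => j; rewrite mul0r.
have mg : measurable_fun setT g.
  by apply: (measurable_fun_cvg (h := P)) => // x _; exact: Pg.
have key n e : (exists J, forall j, (J <= j)%N -> It (fun x => (p n x - p (k j) x) ^+ 2) <= e) ->
    itg (fun x => (p n x - g x) ^+ 2) /\ It (fun x => (p n x - g x) ^+ 2) <= e.
  move=> [J hJ].
  have EI j : itg (fun x => (p n x - P j x) ^+ 2) /\
      It (fun x => (p n x - P j x) ^+ 2) = It (fun x => (p n x - p (k j) x) ^+ 2).
    have m1 : measurable_fun setT (fun x => (p n x - P j x) ^+ 2).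
      by apply: measurable_funX; exact: measurable_funB.
    have m2 : measurable_fun setT (fun x => (p n x - p (k j) x) ^+ 2).
      by apply: measurable_funX; exact: measurable_funB.
    split.
      apply: (itg_ae_eq m1 _ (sq2B (p2 n) (p2 (k j))).2).
      by apply: aeS aeE => x Ex; rewrite /P Ex mul1r.
    by apply: ae_eq_It => //; apply: aeS aeE => x Ex; rewrite /P Ex mul1r.
  apply: (It_fatou (f_ := fun j x => (p n x - P (j + J)%N x) ^+ 2)).
  - by move=> j; exact: (EI _).1.
  - by move=> j x; exact: sqr_ge0.
  - move=> x; have h : p n x - P (j + J)%N x @[j --> \oo] --> p n x - g x.
      apply: cvgB; first exact: cvg_cst.
      by rewrite (cvg_shiftn J (fun j => P j x)).
    by rewrite expr2; under eq_fun do rewrite expr2; apply: cvgM.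
  - by move=> j; rewrite (EI _).2; apply: hJ; exact: leq_addl.
have kge j : (j <= k j)%N.
  elim: j => // j IH; rewrite /k (big_ord_recr j.+1)/= -[X in (X <= _)%N]addn1.
  by apply: leq_add.
exists g; split.
  split => //; have [N hN] := cp 1 ltr01.
  have [i _] : itg (fun x => (p N x - g x) ^+ 2) /\ It (fun x => (p N x - g x) ^+ 2) <= 1.
    by apply: key; exists N => j hj; apply/ltW/hN => //; exact: leq_trans (kge j).
  have h : l2_fun (fun x => p N x - g x) by split => //; exact: measurable_funB.
  by apply: eq_itg (sq2B (p2 N) h).2 => x; rewrite opprB addrC subrK.
move=> e e0; have [N hN] := cp e e0; exists N => n nN; apply: (key n e _).2.
by exists N => j hj; apply/ltW/hN => //; exact: leq_trans (kge j).
Qed.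

Lemma is_derive_int phi a b : test_fun phi -> a <= b -> II a b phi^`() = phi b - phi a.
Proof.
move=> tp ab; apply: FTC2 => //.
- exact: contT_within (test_dcont tp).
- exact: contT_within (test_cont tp).
- by move=> x _; exact: test_is_derive.
Qed.

Lemma test_sq2 phi : test_fun phi -> l2_fun phi^`().
Proof.
move=> tp; have [a [b [C [a0 ab C0 p0 pC]]]] := test_bound tp.
have mp : measurable_fun setT phi^`() := cont_meas (test_dcont tp).
split => //; apply: (itg_le (g := fun x => C ^+ 2 * ind (a <= x <= b))).
- exact: measurable_funX.
- move=> x; have [h|h] := boolP (a <= x <= b); rewrite /ind.
    by rewrite mulr1 normrX ler_pXn2r ?nnegrE//; exact: (pC x).2.
  by rewrite (p0 x h).2 expr0n normr0 mulr0.
- by apply: itgZ; exact: itg_ind.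
Qed.

Lemma H10normE phi : test_fun phi ->
  H10norm phi = Num.sqrt (It (fun x => (derive1 phi x) ^+ 2)).
Proof.
move=> tp; rewrite /H10norm /Rpos It_itv; congr Num.sqrt; apply: eq_It => x.
have [a [b [C [a0 ab C0 p0 pC]]]] := test_bound tp.
rewrite in_itv/= andbT; have [x0|x0] := ltP 0 x; rewrite /ind ?mul1r// mul0r.
rewrite (p0 x _).2 ?expr0n// negb_and -ltNge; apply/orP; left.
exact: le_lt_trans a0.
Qed.

Lemma testB phi psi : test_fun phi -> test_fun psi -> test_fun (phi \- psi).
Proof.
move=> t1 t2; have := @test_lin R _ _ 1 (-1) t1 t2.
by rewrite (_ : (fun x => _) = phi \- psi)//; apply/funext => x /=; rewrite mul1r mulN1r.
Qed.

Lemma derive_testB phi psi x : test_fun phi -> test_fun psi ->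
  derive1 (phi \- psi) x = derive1 phi x - derive1 psi x.
Proof.
move=> t1 t2; apply: is_derive_derive1.
exact: (is_deriveB (test_is_derive x t1) (test_is_derive x t2)).
Qed.

(** The factor [ind (0 < x)] appears because test functions vanish off the open half-line, whereas
    [u] is arbitrary at negative arguments. *)
Lemma H10_repr (u : R -> R) : H10 u -> exists (phi : nat -> R -> R) (g : R -> R),
  [/\ forall n, test_fun (phi n), l2_fun g,
      (forall e, 0 < e -> exists N : nat, forall n, (N <= n)%N ->
         It (fun x => (derive1 (phi n) x - g x) ^+ 2) <= e)
    & forall x, phi n x @[n --> \oo] --> ind (0 < x) * u x].
Proof.
move=> [phi [tphi cphi lphi]]; exists phi.
have [|e e0|g [g2 hg]] := @l2_fun_complete (fun n => derive1 (phi n)).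
- by move=> n; exact: test_sq2.
- have se0 : 0 < Num.sqrt e by rewrite sqrtr_gt0.
  have [N hN] := cphi _ se0; exists N => m n Nm Nn.
  have := hN m n Nm Nn; rewrite H10normE; last exact: testB.
  rewrite ltr_sqrt//; apply: le_lt_trans; rewrite le_eqVlt; apply/orP; left; apply/eqP.
  by apply: eq_It => x; rewrite derive_testB.
exists g; split => // x; have [x0|x0] := ltP 0 x; rewrite /ind ?mul1r ?mul0r.
  by apply: lphi; exact: ltW.
apply: cvg_near_cst; apply: nearW => n.
have [_ [a [b [a0 p0]]]] := tphi n; rewrite p0// negb_and -ltNge; apply/orP; left.
exact: le_lt_trans a0.
Qed.

End L2.

(** * The energy of a finite-energy function *)

Section Lipschitz.
Context {R : realType}.
Implicit Types (f g F G phi : R -> R) (a b c d e s t x y z : R).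
Local Notation mu := (@lebesgue_measure R).

Lemma mvt_le f (f' : R -> R) (M a b : R) :
  (forall x, is_derive x 1 f (f' x)) ->
  (forall x, Num.min a b <= x <= Num.max a b -> `|f' x| <= M) ->
  `|f a - f b| <= M * `|a - b|.
Proof.
move=> df; wlog ab : a b / a <= b.
  move=> h hM; have [ab|ba] := leP a b; first exact: h.
  rewrite distrC (distrC a); apply: h; first exact: ltW.
  by move=> x; rewrite minC maxC; exact: hM.
move=> hM; have cf : {within `[a, b], continuous f}.
  apply: contT_within => x; apply: differentiable_continuous.
  by apply/derivable1_diffP; exact: (@ex_derive _ _ _ _ _ _ _ (df x)).
have [c cab E] := MVT_segment ab (fun x _ => df x) cf.
rewrite distrC E normrM (distrC a); apply: ler_wpM2r => //; apply: hM.
by move: cab; rewrite in_itv/= min_l// max_r.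
Qed.

Lemma sin_lip a b : `|sin a - sin b| <= `|a - b|.
Proof.
rewrite -[leRHS]mul1r; apply: (mvt_le (f' := cos)) => x _.
by rewrite ler_norml cos_geN1 cos_le1.
Qed.

Lemma cos_lip a b : `|cos a - cos b| <= `|a - b|.
Proof.
rewrite -[leRHS]mul1r; apply: (mvt_le (f' := fun x => - sin x)) => x _.
by rewrite normrN ler_norml sin_geN1 sin_le1.
Qed.

Lemma sin_norm_le1 x : `|sin x| <= 1.
Proof. by rewrite ler_norml sin_geN1 sin_le1. Qed.

Lemma cos_norm_le1 x : `|cos x| <= 1.
Proof. by rewrite ler_norml cos_geN1 cos_le1. Qed.

Lemma sin_norm_le x : `|sin x| <= `|x|.
Proof. by have := sin_lip x 0; rewrite sin0 !subr0. Qed.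

Lemma cos_sub1_le x : `|cos x - 1| <= `|x|.
Proof. by have := cos_lip x 0; rewrite cos0 subr0. Qed.

Lemma minmax_le a b c x : `|a| <= c -> `|b| <= c ->
  Num.min a b <= x <= Num.max a b -> `|x| <= c.
Proof.
rewrite !ler_norml ge_min le_max => /andP[a1 a2] /andP[b1 b2] /andP[/orP h1 /orP h2].
by apply/andP; split; case: h1 => ?; case: h2 => ?; lra.
Qed.

(** On [[-c, c]] the derivative of [z -> cos (t * z)] is at most [t ^+ 2 * c]: the increment is of
    second order in [t], as the quadratic expansion of the energy demands. *)
Lemma cosM_lip t c a b : `|a| <= c -> `|b| <= c ->
  `|cos (t * a) - cos (t * b)| <= t ^+ 2 * c * `|a - b|.
Proof.
move=> ac bc; apply: (mvt_le (f := fun z => cos (t * z)) (f' := fun z => - t * sin (t * z))).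
  move=> x; have d := is_derive1_comp (f := cos) (g := *%R t) (is_derive_cos _) (is_deriveZ t (is_derive_id x 1)).
  by apply: (is_derive_eq d); rewrite /GRing.scale/= mulr1 mulrC mulrN mulNr.
move=> x /(minmax_le ac bc) xc.
rewrite normrM normrN; apply: (@le_trans _ _ (`|t| * (`|t| * c))).
  rewrite ler_wpM2l// (le_trans (sin_norm_le _))// normrM ler_wpM2l//.
by rewrite mulrA -expr2 real_normK// num_real.
Qed.

Lemma sinM_lip t c a b : `|a| <= c -> `|b| <= c ->
  `|(sin (t * a) - t * a) - (sin (t * b) - t * b)| <= t ^+ 2 * c * `|a - b|.
Proof.
move=> ac bc.
apply: (mvt_le (f := fun z => sin (t * z) - t * z) (f' := fun z => t * (cos (t * z) - 1))).
  move=> x; have dt := is_deriveZ t (is_derive_id x 1).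
  have d := is_deriveB (is_derive1_comp (f := sin) (g := *%R t) (is_derive_sin _) dt) dt.
  by apply: (is_derive_eq d); rewrite /GRing.scale/=; ring.
move=> x /(minmax_le ac bc) xc.
rewrite normrM; apply: (@le_trans _ _ (`|t| * (`|t| * c))).
  by rewrite ler_wpM2l// (le_trans (cos_sub1_le _))// normrM ler_wpM2l.
by rewrite mulrA -expr2 real_normK// num_real.
Qed.

Lemma sin2_taylor z s : `|sin (z + s) ^+ 2 - sin z ^+ 2 - 2 * s * (sin z * cos z)| <= 4 * s ^+ 2.
Proof.
pose f y := sin (z + y) ^+ 2 - (2 * (sin z * cos z)) * y.
pose f' y := 2 * sin (z + y) * cos (z + y) - 2 * (sin z * cos z).
have df y : is_derive y 1 f (f' y).
  have d1 := is_deriveD (is_derive_cst z y 1) (is_derive_id y 1).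
  have d2 := is_derive1_comp (f := sin) (g := fun y => z + y) (is_derive_sin _) d1.
  have d4 := is_deriveB (is_deriveM d2 d2) (is_deriveZ (2 * (sin z * cos z)) (is_derive_id y 1)).
  by apply: (is_derive_eq d4); rewrite /GRing.scale/= /f' add0r; ring.
have := @mvt_le f f' (4 * `|s|) s 0 df.
have e : 4 * `|s| * `|s| = 4 * s ^+ 2 by rewrite -mulrA -expr2 real_normK// num_real.
rewrite subr0 e /f addr0 mulr0 subr0.
rewrite (_ : sin (z + s) ^+ 2 - 2 * (sin z * cos z) * s - sin z ^+ 2 =
  sin (z + s) ^+ 2 - sin z ^+ 2 - 2 * s * (sin z * cos z)); last by ring.
apply => x xs.
have xs' : `|x| <= `|s| by apply: minmax_le xs => //; rewrite normr0.
have -> : f' x = 2 * ((sin (z + x) - sin z) * cos (z + x) + sin z * (cos (z + x) - cos z)).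
  by rewrite /f'; ring.
rewrite normrM ger0_norm//; have -> : 4 * `|s| = 2 * (`|s| + `|s|) by ring.
rewrite ler_wpM2l// (le_trans (ler_normD _ _))// !normrM lerD//.
- rewrite -[leRHS]mulr1 ler_pM// ?cos_norm_le1//.
  by rewrite (le_trans (sin_lip _ _))// addrC addKr.
- rewrite -[leRHS]mul1r ler_pM// ?sin_norm_le1//.
  by rewrite (le_trans (cos_lip _ _))// addrC addKr.
Qed.

End Lipschitz.

Section ShiftEnergy.
Context {R : realType}.
Implicit Types (f g v w F G phi : R -> R) (a b c d e h s t x y z : R).
Local Notation mu := (@lebesgue_measure R).

(* The finite-energy pairs: [w] vanishes on the negative axis and has the
   square integrable weak derivative [g]. *)
Definition fin_energy w g := [/\ l2_fun g, (forall x, x <= 0 -> g x = 0),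
  (forall x, x <= 0 -> w x = 0) & forall x y, x <= y -> w y - w x = II x y g].

Definition l2_norm g := Num.sqrt (It (fun x => g x ^+ 2)).

Lemma fin_energy_holder w g x y : fin_energy w g -> `|w y - w x| <= l2_norm g * Num.sqrt `|y - x|.
Proof.
move=> [g2 _ _ wg]; wlog xy : x y / x <= y.
  move=> h; have [xy|yx] := leP x y; first exact: h.
  by rewrite distrC (distrC y); apply: h; exact: ltW.
have -> : `|y - x| = y - x by rewrite ger0_norm// subr_ge0.
by rewrite wg// mulrC /l2_norm; exact: II_CS.
Qed.

Lemma fin_energy_cont w g : fin_energy w g -> continuous w.
Proof.
move=> hw x; apply/cvgrPdist_le => e e0.
pose d := (e / (l2_norm g + 1)) ^+ 2.
have n0 : 0 <= l2_norm g by exact: sqrtr_ge0.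
have n1 : 0 < l2_norm g + 1 by rewrite ltr_wpDl.
have d0 : 0 < d by rewrite exprn_gt0// divr_gt0.
near=> y; rewrite (le_trans (fin_energy_holder y x hw))//.
apply: (@le_trans _ _ (l2_norm g * Num.sqrt d)).
  rewrite ler_wpM2l// ler_wsqrtr// ltW//; near: y; exact: cvgr_dist_lt.
rewrite /d sqrtr_sqr gtr0_norm ?divr_gt0// mulrCA ger_pMr//.
by rewrite ler_pdivrMr// mul1r lerDl.
Unshelve. all: by end_near. Qed.

Lemma fin_energy_meas w g : fin_energy w g -> measurable_fun setT w.
Proof. by move=> hw; apply: cont_meas; exact: fin_energy_cont hw. Qed.

(* Integrating over the translation parameter [s] exchanges the square of the
   increment for a translate of [g ^+ 2]. *)
Lemma fin_energy_shift_sq w g h : fin_energy w g -> 0 <= h ->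
  itg (fun x => (w (x + h) - w x) ^+ 2) /\
  It (fun x => (w (x + h) - w x) ^+ 2) <= h ^+ 2 * It (fun x => g x ^+ 2).
Proof.
move=> hw h0; have [g2 _ _ wg] := hw; have mw := fin_energy_meas hw.
have m0 : measurable_fun setT (fun x => (w (x + h) - w x) ^+ 2).
  by apply: measurable_funX; apply: measurable_funB => //; exact: meas_shift.
pose G s x := ind (0 <= s <= h) * g (x + s) ^+ 2.
have mG : meas2 G.
  apply: measurable_funM; first exact: (meas2_fst (meas_cc 0 h)).
  have := meas2_add (measurable_funX 2 g2.1).
  by rewrite /meas2; under eq_fun do rewrite addrC.
have IG s : It (G s) = ind (0 <= s <= h) * It (fun x => g x ^+ 2).
  rewrite /G ItZ; last by apply: (itg_shift s (f := fun x => g x ^+ 2)); exact: g2.2.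
  by rewrite (It_shift s (f := fun x => g x ^+ 2))//; apply: measurable_funX; exact: g2.1.
have Gi : itg2 G.
  apply: (itg2_iter (g := fun s => ind (0 <= s <= h) * It (fun x => g x ^+ 2))) => //.
  - by move=> s; apply: itgZ; apply: (itg_shift s (f := fun x => g x ^+ 2)); exact: g2.2.
  - move=> s; rewrite -IG le_eqVlt; apply/orP; left; apply/eqP; apply: eq_It => x.
    by rewrite ger0_norm// mulr_ge0 ?ind_ge0// sqr_ge0.
  - apply: (eq_itg (f := fun s => It (fun x => g x ^+ 2) * ind (0 <= s <= h))).
      by move=> s; rewrite mulrC.
    by apply: itgZ; exact: itg_ind.
have E x : It (fun s => G s x) = II x (x + h) (fun y => g y ^+ 2).
  rewrite /II -[RHS](It_shift x); last first.
    by apply: measurable_funM; [exact: meas_cc|apply: measurable_funX; exact: g2.1].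
  by apply: eq_It => s; rewrite /G (addrC x s) lerDr (addrC x h) lerD2r.
have le x : (w (x + h) - w x) ^+ 2 <= h * It (fun s => G s x).
  have xh : x <= x + h by rewrite lerDl.
  rewrite wg// E; have := II_CS2 xh (l2_fun_litg g2).
  by rewrite (addrC x h) addrK; apply; exact: itg_litg g2.2 _ _.
have i1 := itg2_fst (itg2C Gi).
have i2 : itg (fun x => (w (x + h) - w x) ^+ 2).
  apply: (itg_le (g := fun x => h * It (fun s => G s x))) => //; last exact: itgZ.
  by move=> x; rewrite ger0_norm ?sqr_ge0.
split => //; apply: (le_trans (It_le i2 (itgZ h i1) le)).
rewrite ItZ// -(It_fubini Gi) expr2 -mulrA ler_wpM2l//.
under eq_fun do rewrite IG.
rewrite (eq_It (g := fun s => It (fun x => g x ^+ 2) * ind (0 <= s <= h))); last first.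
  by move=> s; rewrite mulrC.
by rewrite ItZ ?It_ind ?subr0 1?mulrC//; exact: itg_ind.
Qed.

(* Majorant of [h ^- 2] for increments that are both Lipschitz and bounded. *)
Definition maj h := ind (0 <= h <= 1) + ind (1 <= h) * h ^- 2 : R.

Lemma maj_ge0 h : 0 <= maj h.
Proof. by rewrite addr_ge0 ?ind_ge0// mulr_ge0 ?ind_ge0// invr_ge0 sqr_ge0. Qed.

Lemma itg_maj : itg maj.
Proof. by apply: itgD; [exact: itg_ind|exact: (itg_inv2 ltr01).1]. Qed.

(** Half of the nonlocal integrand, in the coordinates [x] and [h = y - x > 0]; the symmetry in [x]
    and [y] gives back a factor [2]. *)
Definition sq_kernel v x h := ind (0 < x) * (ind (0 < h) * ((v (x + h) - v x) ^+ 2 * h ^- 2)).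

Lemma meas_inv2 : measurable_fun setT (fun h : R => h ^- 2).
Proof. by apply: (measurableT_comp meas_inv); exact: exprn_measurable. Qed.

Lemma meas2_incr v : measurable_fun setT v -> meas2 (fun x h => v (x + h) - v x).
Proof.
by move=> mv; apply: measurable_funB; [exact: meas2_add|exact: (meas2_fst mv)].
Qed.

Lemma meas2_ker (F : R -> R -> R) : meas2 F ->
  meas2 (fun x h => ind (0 < x) * (ind (0 < h) * (F x h * h ^- 2))).
Proof.
move=> mF; apply: measurable_funM; first exact: (meas2_fst (meas_lt 0)).
apply: measurable_funM; first exact: (meas2_snd (meas_lt 0)).
by apply: measurable_funM => //; exact: (meas2_snd meas_inv2).
Qed.

Lemma meas2_k2 v : measurable_fun setT v -> meas2 (sq_kernel v).
Proof. by move=> mv; apply: meas2_ker; apply: measurable_funX; exact: meas2_incr. Qed.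

Lemma sq_kernel_ge0 v x h : 0 <= sq_kernel v x h.
Proof.
do 2 (apply: mulr_ge0; first exact: ind_ge0).
by rewrite mulr_ge0 ?sqr_ge0// invr_ge0 sqr_ge0.
Qed.

(** The Lipschitz bound handles [h <= 1] and the bound [B] handles [h >= 1]. For [x > M] the
    increment vanishes, [x + h] lying beyond [M] as well, so the majorant is a product of
    [ind (0 <= x <= M)] and a multiple of [maj]. *)
Lemma sq_kernel_lip v (L B M : R) : measurable_fun setT v ->
  (forall x y, 0 < x -> 0 < y -> `|v x - v y| <= L * `|x - y|) ->
  (forall x, `|v x| <= B) -> (forall x y, M <= x -> M <= y -> v x = v y) -> itg2 (sq_kernel v).
Proof.
move=> mv vL vB vM.
apply: (itg2_prod (f := fun x => ind (0 <= x <= M)) (g := fun h => (L ^+ 2 + (2 * B) ^+ 2) * maj h)).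
- exact: meas2_k2.
- exact: itg_ind.
- by apply: itgZ; exact: itg_maj.
move=> x h; rewrite ger0_norm ?sq_kernel_ge0// /sq_kernel.
have [x0|x0] := ltP 0 x; last by rewrite /ind mul0r !mulr_ge0 ?maj_ge0// ?addr_ge0 ?sqr_ge0//; case: ifP.
have [h0|h0] := ltP 0 h; last by rewrite /ind mul0r mulr0 !mulr_ge0 ?maj_ge0// ?addr_ge0 ?sqr_ge0//; case: ifP.
rewrite (ltW x0)/=; have [xM|Mx] := leP x M; last first.
  rewrite (vM (x + h) x (ltW _) (ltW Mx)) ?ltr_wpDr//; last exact: ltW.
  by rewrite subrr expr0n/= mul0r /ind !mulr0 mul0r.
rewrite /ind !mul1r; have h2 : 0 < h ^+ 2 by rewrite exprn_gt0.
have b1 : (v (x + h) - v x) ^+ 2 <= L ^+ 2 * h ^+ 2.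
  rewrite -exprMn -(real_normK (num_real (_ - _))) -[leRHS](real_normK (num_real (L * h))).
  rewrite ler_pXn2r ?nnegrE// (le_trans (vL _ _ _ x0)) ?addr_gt0//.
  by rewrite (addrC x) addrK normrM ler_wpM2r// ler_norm.
have b2 : (v (x + h) - v x) ^+ 2 <= (2 * B) ^+ 2.
  have B0 : 0 <= 2 * B by rewrite mulr_ge0// (le_trans (normr_ge0 (v 0))).
  rewrite -(real_normK (num_real (_ - _))) ler_pXn2r ?nnegrE//.
  by rewrite (le_trans (ler_normB _ _))// mulr2n mulrDl mul1r lerD.
rewrite /maj (ltW h0)/=; have [h1|h1] := leP h 1.
  rewrite /ind -[leLHS]mulr1; apply: ler_pM => //.
  - by rewrite mulr_ge0 ?sqr_ge0// invr_ge0 ltW.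
  - rewrite ler_pdivrMr// mulrDl (le_trans b1)// lerDl mulr_ge0 ?sqr_ge0//.
  - by rewrite lerDl; case: ifP => _; rewrite ?mul1r ?mul0r ?invr_ge0// ltW.
rewrite (ltW h1) /ind add0r mul1r ler_wpM2r ?invr_ge0 ?(ltW h2)//.
by rewrite (le_trans b2)// lerDr sqr_ge0.
Qed.

End ShiftEnergy.

(** * The energy in terms of the finite-energy pair *)

Section EnergyFormula.
Context {R : realType}.
Implicit Types (f g v w u F G phi : R -> R) (a b c d e h s t x y z : R).
Local Notation mu := (@lebesgue_measure R).

Lemma meas_ge a : measurable_fun setT (fun x => ind (a <= x) : R).
Proof.
by have := meas_itv (`[a, +oo[)%O; under eq_fun do rewrite in_itv/= andbT.
Qed.

Lemma meas2_ereal (F : R -> R -> R) : meas2 F ->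
  measurable_fun setT (fun z : measurableTypeR R * measurableTypeR R => (F z.1 z.2)%:E).
Proof. by move=> mF; exact/measurable_EFinP. Qed.

Lemma tonelli (F : R -> R -> R) : meas2 F -> (forall x y, 0 <= F x y) ->
  (\int[mu]_x \int[mu]_y (F x y)%:E = \int[mu]_y \int[mu]_x (F x y)%:E)%E.
Proof.
move=> mF F0.
have := @fubini_tonelli _ _ _ _ R mu mu (fun z : measurableTypeR R * measurableTypeR R => (F z.1 z.2)%:E)
  (meas2_ereal mF).
by apply => z; rewrite lee_fin.
Qed.

Lemma meas_fubini (F : R -> R -> R) : meas2 F -> (forall x y, 0 <= F x y) ->
  measurable_fun setT (fun x => \int[mu]_y (F x y)%:E)%E.
Proof.
move=> mF F0.
have := @measurable_fun_fubini_tonelli_F _ _ _ _ R mu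
  (fun z : measurableTypeR R * measurableTypeR R => (F z.1 z.2)%:E).
apply; first exact: meas2_ereal.
by move=> z; rewrite lee_fin.
Qed.

(** The integrand is symmetric and vanishes on the diagonal. It splits into the parts [x < y] and
    [y < x], which Tonelli identifies, and [y = x + h] turns one of them into [sq_kernel].
    Everything is nonnegative, so the identity also covers infinite energy. *)
Lemma nonlocalE beta u v : measurable_fun setT v -> (forall x, 0 < x -> v x = sin (u x - beta)) ->
  nonlocal_energy beta u = (2%:E * \int[mu]_x \int[mu]_h (sq_kernel v x h)%:E)%E.
Proof.
move=> mv uv.
pose K x y := ind (0 < x) * (ind (0 < y) * ((v x - v y) ^+ 2 * (x - y) ^- 2)).
have KC x y : K x y = K y x.
  by rewrite /K mulrCA -(opprB y x) sqrrN -(opprB (v y)) sqrrN.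
have K0 x y : 0 <= K x y.
  do 2 (apply: mulr_ge0; first exact: ind_ge0).
  by rewrite mulr_ge0 ?sqr_ge0// invr_ge0 sqr_ge0.
have mK : meas2 K.
  apply: measurable_funM; first exact: (meas2_fst (meas_lt 0)).
  apply: measurable_funM; first exact: (meas2_snd (meas_lt 0)).
  apply: measurable_funM; last exact: (meas2_sub meas_inv2).
  by apply: measurable_funX; apply: measurable_funB; [exact: meas2_fst|exact: meas2_snd].
pose K1 x y := ind (0 < y - x) * K x y.
have K10 x y : 0 <= K1 x y by rewrite mulr_ge0// ind_ge0.
have mK1 : meas2 K1.
  apply: measurable_funM => //.
  exact: (meas2C (meas2_sub (meas_lt 0))).
have mK1C : meas2 (fun x y => K1 y x) by exact: meas2C.
transitivity (\int[mu]_x \int[mu]_y (K x y)%:E)%E.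
  rewrite /nonlocal_energy [LHS]integral_mkcond; apply: eq_integral => x _.
  rewrite patchE; case: ifPn => [|nx].
    rewrite inE /Rpos/= in_itv/= andbT => x0.
    rewrite [LHS]integral_mkcond; apply: eq_integral => y _.
    rewrite patchE /K x0; case: ifPn => [|ny].
      by rewrite inE /Rpos/= in_itv/= andbT => y0; rewrite y0 /ind !mul1r !uv.
    suff -> : (0 < y) = false by rewrite /ind mul0r mulr0.
    by apply/negP => y0; move/negP: ny; apply; rewrite inE /Rpos/= in_itv/= andbT.
  rewrite integral0_eq// => y _; rewrite /K.
  suff -> : (0 < x) = false by rewrite /ind mul0r.
  by apply/negP => x0; move/negP: nx; apply; rewrite inE /Rpos/= in_itv/= andbT.
transitivity (\int[mu]_x (\int[mu]_y (K1 x y)%:E + \int[mu]_y (K1 y x)%:E))%E.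
  apply: eq_integral => x _; rewrite -ge0_integralD//.
  - apply: eq_integral => y _; rewrite -EFinD /K1 (KC y x) -mulrDl; congr (_%:E).
    rewrite !subr_gt0; have [xy|xy|->] := ltgtP x y; rewrite /ind ?addr0 ?add0r ?mul1r//.
    by rewrite mul0r /K !subrr expr0n/= mul0r !mulr0.
  - by move=> y _; rewrite lee_fin.
  - by apply/measurable_EFinP; exact: meas2_1.
  - by move=> y _; rewrite lee_fin.
  - by apply/measurable_EFinP; exact: (meas2_1 x mK1C).
rewrite ge0_integralD//; first last.
- exact: (meas_fubini mK1C).
- by move=> x _; apply: integral_ge0 => y _; rewrite lee_fin.
- exact: meas_fubini.
- by move=> x _; apply: integral_ge0 => y _; rewrite lee_fin.
rewrite [X in (_ + X)%E](tonelli mK1C)// -mule2n -mule_natl; congr (_ * _)%E.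
apply: eq_integral => x _.
rewrite -(ge0_integral_shift x (F := fun y => (K1 x y)%:E)).
- apply: eq_integral => h _; rewrite /K1 /K /sq_kernel addrK (addrC h x); congr (_%:E).
  rewrite opprD addrA subrr sub0r sqrrN -(opprB (v (x + h))) sqrrN.
  rewrite mulrCA; have [x0|x0] := ltP 0 x; last by rewrite /ind !mul0r.
  congr (_ * _); have [h0|h0] := ltP 0 h; last by rewrite /ind !mul0r.
  by rewrite addr_gt0// /ind !mul1r.
- by apply/measurable_EFinP; exact: meas2_1.
- by move=> y; rewrite lee_fin.
Qed.

(** Fubini on the triangle [0 <= s <= x]: the integral of [phi'] over [[s, b + 1]] is [- phi s]. The
    endpoint is [b + 1] because [phi] is only known to vanish strictly beyond [b]. *)
Lemma It_ibp g phi : litg g -> test_fun phi ->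
  It (fun x => II 0 x g * derive1 phi x) = - It (fun x => g x * phi x).
Proof.
move=> gi tphi; have [a [b [C [a0 ab C0 p0 pC]]]] := test_bound tphi.
have b0 : 0 <= b := le_trans (ltW a0) ab.
have mg := litg_meas gi.
have md : measurable_fun setT (derive1 phi) := cont_meas (test_dcont tphi).
pose F s x := ind (0 <= x - s) * (ind (0 <= s <= b) * g s * derive1 phi x).
have Fi : itg2 F.
  apply: (itg2_prod (f := fun s => `|ind (0 <= s <= b) * g s|) (g := fun x => C * ind (a <= x <= b))).
  - apply: measurable_funM; first exact: (meas2C (meas2_sub (meas_ge 0))).
    apply: measurable_funM; last exact: (meas2_snd md).
    by apply: (meas2_fst (f := fun s => ind (0 <= s <= b) * g s)); exact: itg_meas (gi 0 b).
  - exact: itg_norm (gi 0 b).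
  - by apply: itgZ; exact: itg_ind.
  move=> s x; rewrite /F normrM (ger0_norm (ind_ge0 _)) normrM; apply: (@le_trans _ _ (1 * (`|ind (0 <= s <= b) * g s| * `|derive1 phi x|))).
    by rewrite ler_wpM2r ?ind_le1// mulr_ge0.
  rewrite mul1r ler_wpM2l//; have [h|h] := boolP (a <= x <= b); rewrite /ind ?mulr1; first exact: (pC x).2.
  by rewrite (p0 x h).2 normr0 mulr0.
transitivity (It (fun x => It (fun s => F s x))).
  apply: eq_It => x; have [h|h] := boolP (a <= x <= b); last first.
    rewrite (p0 x h).2 mulr0 (eq_It (g := fun=> 0)) ?It0// => s.
    by rewrite /F (p0 x h).2 !mulr0.
  rewrite /II mulrC -ItZ; last exact: gi.
  apply: eq_It => s; rewrite /F subr_ge0.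
  move/andP: h => [ax xb]; have [s0|s0] := leP 0 s; last by rewrite /ind !mul0r !mulr0.
  have [sx|xs] := leP s x; last by rewrite /ind !mul0r !mulr0.
  by rewrite (le_trans sx xb) /ind/= !mul1r mulrC.
rewrite -(It_fubini Fi).
have -> : - It (fun x => g x * phi x) = It (fun x => - (g x * phi x)).
  rewrite ItN//; apply: (itg_le (g := fun x => C * `|ind (0 <= x <= b) * g x|)).
  - by apply: measurable_funM => //; exact: cont_meas (test_cont tphi).
  - move=> x; have [h|h] := boolP (0 <= x <= b); rewrite /ind.
      by rewrite mul1r normrM mulrC ler_wpM2r//; exact: (pC x).1.
    rewrite (p0 x _).1 ?mulr0 ?normr0 ?mul0r ?normr0 ?mulr0//.
    by apply: contra h => /andP[ax ->]; rewrite (le_trans (ltW a0) ax).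
  - by apply: itgZ; exact: itg_norm (gi 0 b).
apply: eq_It => s; have [/andP[s0 sb]|h] := boolP (0 <= s <= b); last first.
  rewrite (p0 s _).1; last by apply: contra h => /andP[ax ->]; rewrite (le_trans (ltW a0) ax).
  rewrite mulr0 oppr0 (eq_It (g := fun=> 0)) ?It0// => x.
  by rewrite /F (negbTE h) /ind !mul0r mulr0.
have sb1 : s <= b + 1 by rewrite (le_trans sb)// lerDl.
have E : II s (b + 1) (derive1 phi) = - phi s.
  rewrite is_derive_int// (p0 (b + 1) _).1 ?sub0r// negb_and -!ltNge ltrDl ltr01.
  by rewrite orbT.
rewrite -mulrN -E /II -ItZ; last exact: l2_fun_litg (test_sq2 tphi) _ _.
apply: eq_It => x; rewrite /F s0 sb subr_ge0 /=.
have [sx|xs] := leP s x; last by rewrite /ind !mul0r mulr0.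
have [xb|bx] := leP x (b + 1); first by rewrite /ind !mul1r.
rewrite (p0 x _).2 ?mulr0// negb_and -!ltNge; apply/orP; right.
by rewrite (lt_trans _ bx)// ltrDl.
Qed.

Lemma fin_energy_II w g x : fin_energy w g -> 0 <= x -> w x = II 0 x g.
Proof. by move=> [_ _ w0 wg] x0; rewrite -wg// (w0 0 (lexx 0)) subr0. Qed.

Lemma litg_locally f : litg f -> locally_integrable (Rpos R) f.
Proof.
move=> fi; split.
- by apply: measurable_funTS; exact: litg_meas.
- exact: interval_open.
move=> K _ cK; have [M [_ hM]] := compact_bounded cK.
have KM : K `<=` `[- (M + 1), M + 1].
  by move=> x Kx; rewrite /= in_itv/= -ler_norml; apply: hM Kx; rewrite ltrDl.
apply: (@le_lt_trans _ _ (\int[mu]_(x in `[(- (M + 1))%R, (M + 1)%R]) `|(f x)%:E|)%E).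
  apply: ge0_subset_integral => //; first exact: compact_measurable.
  apply/measurable_EFinP; apply: measurable_funTS; apply: measurableT_comp => //.
  exact: litg_meas.
by have /itg_cc/integrableP[] := fi (- (M + 1)) (M + 1).
Qed.

Lemma litg_cont f : continuous f -> litg f.
Proof. by move=> cf a b; apply: itg_cont; exact: contT_within. Qed.

Lemma eq_locally f g : (forall x, 0 < x -> f x = g x) ->
  locally_integrable (Rpos R) f -> locally_integrable (Rpos R) g.
Proof.
move=> fg [mf oR hK]; split => //.
  apply: eq_measurable_fun mf => x; rewrite inE /Rpos/= in_itv/= andbT => x0; exact: fg.
move=> K KR cK; rewrite (_ : (\int[mu]_(x in K) `|g x|%:E)%E = (\int[mu]_(x in K) `|f x|%:E)%E).
  exact: hK.
apply: eq_integral => x; rewrite inE => /KR; rewrite /Rpos/= in_itv/= andbT => x0.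
by rewrite fg.
Qed.

Lemma It_Rpos f : \int[mu]_(x in Rpos R) f x = It (fun x => ind (0 < x) * f x).
Proof. by rewrite /Rpos It_itv; apply: eq_It => x; rewrite in_itv/= andbT. Qed.

Lemma It_test f phi : test_fun phi ->
  It (fun x => ind (0 < x) * (f x * phi x)) = It (fun x => f x * phi x).
Proof.
move=> tp; have [_ [a [b [a0 p0]]]] := tp; apply: eq_It => x.
have [x0|x0] := ltP 0 x; rewrite /ind ?mul1r// p0 ?mulr0//.
by rewrite negb_and -ltNge (le_lt_trans x0 a0).
Qed.

Lemma fin_energy_is_wderiv beta theta w g : fin_energy w g -> (forall x, 0 < x -> theta x = beta + w x) ->
  is_wderiv theta g.
Proof.
move=> hw tw; have [g2 g0 w0 wg] := hw; split.
- apply: (eq_locally (f := fun x => beta + w x)); first by move=> x x0; rewrite tw.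
  apply: litg_locally; apply: litg_cont => x; apply: cvgD; first exact: cvg_cst.
  exact: (fin_energy_cont hw).
- by apply: litg_locally; exact: l2_fun_litg.
move=> phi tp; have [a [b [C [a0 ab C0 p0 pC]]]] := test_bound tp.
have i1 : itg (derive1 phi).
  apply: (eq_itg (f := fun x => ind (a <= x <= b) * derive1 phi x)); last exact: l2_fun_litg (test_sq2 tp) _ _.
  by move=> x; have [h|h] := boolP (a <= x <= b); rewrite /ind ?mul1r// mul0r (p0 x h).2.
have e1 : It (derive1 phi) = 0.
  have [pa pb] : phi (a - 1) = 0 /\ phi (b + 1) = 0.
    split; apply: (p0 _ _).1; rewrite negb_and -!ltNge.
      by rewrite gtrDl ltrN10.
    by rewrite ltrDl ltr01 orbT.
  have ab' : a - 1 <= b + 1 by lra.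
  have := is_derive_int tp ab'; rewrite pa pb subrr => <-.
  apply: eq_It => x; have [h|h] := boolP (a - 1 <= x <= b + 1); rewrite /ind ?mul1r// mul0r.
  by rewrite (p0 x _).2//; apply: contra h => /andP[? ?]; apply/andP; split; lra.
rewrite !It_Rpos (It_test g tp) -(It_ibp (l2_fun_litg g2) tp).
transitivity (It (fun x => beta * derive1 phi x + II 0 x g * derive1 phi x)).
  apply: eq_It => x; have [x0|x0] := ltP 0 x; rewrite /ind ?mul1r ?mul0r.
    by rewrite tw// mulrDl (fin_energy_II hw)// ltW.
  by rewrite (p0 x _).2 ?mulr0 ?addr0// negb_and -ltNge (le_lt_trans x0 a0).
rewrite ItD.
- by rewrite ItZ// e1 mulr0 add0r.
- exact: itgZ.
- apply: (eq_itg (f := fun x => w x * derive1 phi x)).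
    move=> x; have [x0|x0] := ltP 0 x; first by rewrite (fin_energy_II hw)// ltW.
    by rewrite (p0 x _).2 ?mulr0// negb_and -ltNge (le_lt_trans x0 a0).
  apply: (eq_itg (f := fun x => ind (a <= x <= b) * (w x * derive1 phi x))).
    by move=> x; have [h|h] := boolP (a <= x <= b); rewrite /ind ?mul1r// mul0r (p0 x h).2 mulr0.
  apply: itg_cont; apply: contT_within => x; apply: cvgM; first exact: (fin_energy_cont hw).
  exact: (test_dcont tp).
Qed.

Section Cutoff.
Variables (beta nu : R) (eta : R -> R).
Hypotheses (beta0 : 0 < beta) (nu0 : 0 < nu) (heta : is_cutoff beta eta).

(** [wderiv] selects some weak derivative; [g] shows that one exists, and uniqueness against test
    functions identifies the selected one almost everywhere. *)
Lemma wderivE theta w g : fin_energy w g -> (forall x, 0 < x -> theta x = beta + w x) ->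
  {ae mu, forall x, 0 < x -> wderiv theta x = g x}.
Proof.
move=> hw tw; have wg := fin_energy_is_wderiv hw tw.
have wd : is_wderiv theta (wderiv theta).
  by apply: (@xgetPex _ (cst 0) [set g | is_wderiv theta g]); exists g.
case: wg => _ lg hg; case: wd => _ lw hwd.
apply: (test_unique beta0 heta) => // phi tp.
by apply: oppr_inj; rewrite -hg// -hwd.
Qed.

(** The integrand of the single integral in the energy, for [theta = beta + w] and with [g] as the
    weak derivative. *)
Definition local_density w g x := 2^-1 * g x ^+ 2 + 2^-1 * sin (w x + beta) ^+ 2
  + nu / (4 * pi) * ((sin (w x) ^+ 2 - sin (eta x - beta) ^+ 2) / x).

Lemma eta_cont : continuous eta.
Proof. by case: heta => /(@smooth_cont _ _ 0) + _ _ _ _; rewrite derive1n0. Qed.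

Lemma cont_sin_comp f : continuous f -> continuous (fun x => sin (f x)).
Proof. by move=> cf x; apply: (continuous_comp (cf x)); exact: continuous_sin. Qed.

Lemma cont_cos_comp f : continuous f -> continuous (fun x => cos (f x)).
Proof. by move=> cf x; apply: (continuous_comp (cf x)); exact: continuous_cos. Qed.

Lemma meas_sin_eta : measurable_fun setT (fun x => sin (eta x - beta)).
Proof.
apply: cont_meas; apply: cont_sin_comp => x; apply: cvgB; last exact: cvg_cst.
exact: eta_cont.
Qed.

Lemma meas_Aw w g : measurable_fun setT w -> measurable_fun setT g -> measurable_fun setT (local_density w g).
Proof.
move=> mw mg.
have ms : measurable_fun setT (@sin R) by apply: cont_meas; exact: continuous_sin.
apply: measurable_funD; first apply: measurable_funD.
- by apply: measurable_funM => //; exact: measurable_funX.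
- apply: measurable_funM => //; apply: measurable_funX.
  by apply: (measurableT_comp ms); exact: measurable_funD.
apply: measurable_funM => //; apply: measurable_funM; last exact: meas_inv.
apply: measurable_funB; first by apply: measurable_funX; exact: (measurableT_comp ms mw).
by apply: measurable_funX; exact: meas_sin_eta.
Qed.

Let cN := nu / (8 * pi).

Lemma energyE theta w g : fin_energy w g -> (forall x, 0 < x -> theta x = beta + w x) ->
  energy beta nu eta theta =
    (\int[mu]_x (ind (0 < x) * local_density w g x)%:E
     + cN%:E * (2%:E * \int[mu]_x \int[mu]_h (sq_kernel (fun y => sin (w y)) x h)%:E)
     - cN%:E * (2%:E * \int[mu]_x \int[mu]_h (sq_kernel (fun y => sin (eta y - beta)%R) x h)%:E))%E.
Proof.
move=> hw tw; have [g2 g0 w0 wg] := hw; rewrite /energy.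
have mw := fin_energy_meas hw; have ms : measurable_fun setT (@sin R) by apply: cont_meas; exact: continuous_sin.
rewrite (nonlocalE (v := fun y => sin (w y))); last first.
- by move=> x x0; rewrite tw// addrC addKr.
- exact: (measurableT_comp ms mw).
rewrite (nonlocalE (v := fun y => sin (eta y - beta)%R)) //; last exact: meas_sin_eta.
congr (_ + _ - _)%E.
rewrite [LHS]integral_mkcond; apply: ae_eq_integral => //.
- apply/(measurable_restrictT _ _).1; first exact: measurable_itv.
  have [_ [mwd _ _] _] : is_wderiv theta (wderiv theta).
    apply: (@xgetPex _ (cst 0) [set g | is_wderiv theta g]); exists g.
    exact: fin_energy_is_wderiv hw tw.
  have [[mt _ _] _ _] := fin_energy_is_wderiv hw tw.
  have mt' : measurable_fun (Rpos R) (fun x => sin (theta x)) by exact: (measurableT_comp ms mt).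
  apply/measurable_EFinP; apply: measurable_funD; first apply: measurable_funD.
  + by apply: measurable_funM => //; exact: measurable_funX.
  + by apply: measurable_funM => //; exact: measurable_funX.
  + apply: measurable_funM => //; apply: measurable_funM; last exact: measurable_funTS meas_inv.
    apply: measurable_funB; last by apply: measurable_funX; exact: measurable_funTS meas_sin_eta.
    by apply: measurable_funX; apply: (measurableT_comp ms); exact: measurable_funB.
- apply/measurable_EFinP; apply: measurable_funM; first exact: meas_lt.
  by apply: meas_Aw => //; exact: g2.1.
- apply: aeS (wderivE hw tw) => x hx _; rewrite patchE; case: ifPn => [|nx].
    rewrite inE /Rpos/= in_itv/= andbT => x0.
    by rewrite x0 /ind mul1r /local_density hx// tw// (addrC beta) addrK.
  suff -> : (0 < x) = false by rewrite /ind mul0r.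
  by apply/negP => x0; move/negP: nx; apply; rewrite inE /Rpos/= in_itv/= andbT.
Qed.

End Cutoff.

End EnergyFormula.

(** * A lower bound for the local energy density *)

Section Finite.
Context {R : realType}.
Implicit Types (f g v w u F G phi : R -> R) (a b c d e h s t x y z : R).
Local Notation mu := (@lebesgue_measure R).

(** An integrable lower bound leaves only these two cases, so a finite total energy forces the local
    density to be integrable. *)
Lemma itg_or_pinfty f g : measurable_fun setT f -> itg g -> (forall x, - g x <= f x) ->
  itg f \/ (\int[mu]_x (f x)%:E = +oo)%E.
Proof.
move=> mf ig gf; have me : measurable_fun setT (EFin \o f) by exact/measurable_EFinP.
have [h|h] := ltP (\int[mu]_x ((EFin \o f)^\+ x))%E +oo%E.
  left; apply: (itg_le (g := fun x => Num.max (f x) 0 + `|g x|)) => //.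
    move=> x; have := gf x; have := ler_norm (g x); have := ler_norm (- g x); rewrite normrN.
    rewrite ler_norml; have [h0|h0] := leP (f x) 0; move=> ? ? ?; apply/andP; split; lra.
  apply: itgD; last exact: itg_norm.
  apply: itg_ge0P.
  - by apply: measurable_maxr.
  - by move=> x; rewrite le_max lexx orbT.
  - rewrite (_ : (\int[mu]_x _)%E = (\int[mu]_x ((EFin \o f)^\+ x))%E)//.
    by apply: eq_integral => x _; rewrite funeposE/= EFin_max.
right; rewrite [LHS]integralE.
have -> : (\int[mu]_x ((EFin \o f)^\+ x) = +oo)%E by apply/eqP; rewrite -leye_eq.
have hn : (\int[mu]_x ((EFin \o f)^\- x) < +oo)%E.
  apply: (@le_lt_trans _ _ (\int[mu]_x (`|g x|)%:E)%E); last by rewrite -ItE ?ltry//; exact: itg_norm.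
  apply: ge0_le_integral => //.
  - exact: measurable_funeneg.
  - by apply/measurable_EFinP; apply: measurableT_comp => //; exact: itg_meas.
  - move=> x _; rewrite funenegE /= ge_max !lee_fin normr_ge0 andbT.
    by have := gf x; have := ler_norm (g x); lra.
have hn0 : (0 <= \int[mu]_x ((EFin \o f)^\- x))%E by exact: integral_ge0.
by move: hn hn0; rewrite /=; case: (\int[mu]_x ((EFin \o f)^\- x))%E.
Qed.

Section Cutoff.
Variables (beta nu : R) (eta : R -> R).
Hypotheses (beta0 : 0 < beta) (nu0 : 0 < nu) (heta : is_cutoff beta eta).

Let kp := nu / (4 * pi).
Let cN := nu / (8 * pi).

Lemma kp_gt0 : 0 < kp.
Proof. by rewrite divr_gt0// mulr_gt0// pi_gt0. Qed.

Lemma cN_gt0 : 0 < cN.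
Proof. by rewrite divr_gt0// mulr_gt0// pi_gt0. Qed.

Lemma step_lip : exists2 C, 0 < C & forall x y, `|step beta eta x - step beta eta y| <= C * `|x - y|.
Proof.
have [C C0 hC] := dstep_bound beta0 heta; exists C => // x y.
apply: (mvt_le (f := step beta eta) (f' := dstep beta eta)) => z; first exact: is_derive_stp.
by move=> _; exact: hC.
Qed.

Lemma etaE x : eta x = beta * (1 - step beta eta x).
Proof. by rewrite /step; field; exact: lt0r_neq0. Qed.

Lemma eta_lip : exists2 L, 0 < L & forall x y, `|eta x - eta y| <= L * `|x - y|.
Proof.
have [C C0 hC] := step_lip; exists (beta * C); first exact: mulr_gt0.
move=> x y; rewrite !etaE -mulrBr normrM gtr0_norm// -mulrA ler_wpM2l ?(ltW beta0)//.
by have := hC y x; rewrite (distrC y); apply: le_trans; rewrite le_eqVlt; apply/orP; left; apply/eqP; congr `| _ |; ring.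
Qed.

Lemma sq_kernel_eta : itg2 (sq_kernel (fun y => sin (eta y - beta))).
Proof.
have [L L0 hL] := eta_lip.
apply: (sq_kernel_lip (L := L) (B := 1) (M := 1)).
- exact: meas_sin_eta heta.
- move=> x y _ _; apply: (le_trans (sin_lip _ _)).
  by rewrite opprB addrA subrK.
- by move=> x; exact: sin_norm_le1.
- by move=> x y x1 y1; case: heta => _ _ _ h _; rewrite !h.
Qed.

(** For [x < 1] the negative part is [sin (eta x - beta) ^+ 2 / x], at most [L ^+ 2 * x] because
    [eta 0 = beta]. For [x >= 1], [sin w ^+ 2 - sin beta ^+ 2 = sin (w + beta) * sin (w - beta)] is
    at least [- |sin (w + beta)|]. Young's inequality then spends one quarter of
    [sin (w + beta) ^+ 2], out of the available half, and costs [kp ^+ 2 / x ^+ 2]. *)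
Lemma local_density_lower : exists2 Cl, 0 <= Cl & forall w g x, 0 < x ->
  2^-1 * g x ^+ 2 + 4^-1 * (ind (1 <= x) * sin (w x + beta) ^+ 2) - Cl * maj x <= local_density beta nu eta w g x.
Proof.
have [L L0 hL] := eta_lip; have kp0 := kp_gt0.
have kL : 0 <= kp * L ^+ 2 by exact: mulr_ge0 (ltW kp0) (sqr_ge0 _).
exists (kp * L ^+ 2 + kp ^+ 2); first exact: addr_ge0 kL (sqr_ge0 _).
move=> w g x x0; rewrite /local_density -/kp -addrA -[leRHS]addrA lerD2l.
have m0 := maj_ge0 x.
have [x1|x1] := ltP x 1.
  have m1 : 1 <= maj x.
    rewrite /maj (ltW x0) (ltW x1) /ind lerDl; case: ifP; rewrite ?mul1r ?mul0r ?invr_ge0 ?sqr_ge0//.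
  rewrite /ind mul0r mulr0 add0r.
  have b1 : sin (eta x - beta) ^+ 2 <= L ^+ 2 * x ^+ 2.
    have e0 : eta 0 = beta by case: heta => _ _ h _ _; exact: h.
    rewrite -exprMn -(real_normK (num_real (sin _))) ler_pXn2r ?nnegrE ?mulr_ge0 ?(ltW L0) ?(ltW x0)//.
    rewrite (le_trans (sin_norm_le _))//; have := hL x 0; rewrite e0 subr0.
    by rewrite (gtr0_norm x0).
  have b2 : - L ^+ 2 <= (sin (w x) ^+ 2 - sin (eta x - beta) ^+ 2) / x.
    rewrite ler_pdivlMr//.
    have := sqr_ge0 (sin (w x)).
    have : L ^+ 2 * x ^+ 2 <= L ^+ 2 * x.
      by rewrite ler_wpM2l ?sqr_ge0// expr2 ger_pMr// ltW.
    lra.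
  have : - (kp * L ^+ 2) <= kp * ((sin (w x) ^+ 2 - sin (eta x - beta) ^+ 2) / x).
    by rewrite -mulrN ler_wpM2l// ltW.
  have := sqr_ge0 (sin (w x + beta)).
  have : kp * L ^+ 2 + kp ^+ 2 <= (kp * L ^+ 2 + kp ^+ 2) * maj x.
    by rewrite ler_peMr//; exact: addr_ge0 kL (sqr_ge0 _).
  have := sqr_ge0 kp.
  lra.
have m1 : x ^- 2 <= maj x by rewrite /maj x1 {2}/ind mul1r lerDr ind_ge0.
rewrite /ind mul1r.
have -> : eta x = 0 by case: heta => _ _ _ h _; exact: h.
rewrite sub0r sinN sqrrN.
set s := sin (w x + beta).
have b1 : - `|s| <= sin (w x) ^+ 2 - sin beta ^+ 2.
  have -> : sin (w x) ^+ 2 - sin beta ^+ 2 = s * sin (w x - beta).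
    rewrite /s sinD sinB; have := cos2Dsin2 (w x); have := cos2Dsin2 beta.
    move=> e1 e2; have c1 : cos beta ^+ 2 = 1 - sin beta ^+ 2 by lra.
    have c2 : cos (w x) ^+ 2 = 1 - sin (w x) ^+ 2 by lra.
    rewrite [RHS](_ : _ = sin (w x) ^+ 2 * cos beta ^+ 2 - cos (w x) ^+ 2 * sin beta ^+ 2); last by ring.
    by rewrite c1 c2; ring.
  rewrite lerNl -normrN (le_trans (ler_norm _))// -mulrN normrM normrN.
  by rewrite normrN ler_piMr// sin_norm_le1.
have xi0 : 0 < x^-1 by rewrite invr_gt0.
have b2 : - (kp * (`|s| * x^-1)) <= kp * ((sin (w x) ^+ 2 - sin beta ^+ 2) / x).
  by rewrite -mulrN ler_wpM2l ?(ltW kp0)// -mulNr ler_wpM2r// ltW.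
have b3 : kp ^+ 2 * x ^- 2 <= (kp * L ^+ 2 + kp ^+ 2) * maj x.
  apply: ler_pM => //; rewrite ?sqr_ge0 ?invr_ge0 ?sqr_ge0//; by rewrite lerDr.
have := sqr_ge0 (2^-1 * `|s| - kp * x^-1).
have -> : (2^-1 * `|s| - kp * x^-1) ^+ 2 = 4^-1 * s ^+ 2 - kp * (`|s| * x^-1) + kp ^+ 2 * x ^- 2.
  rewrite -exprVn -[s ^+ 2](real_normK (num_real s)); field; exact: lt0r_neq0.
lra.
Qed.

End Cutoff.
End Finite.

(** * Admissible functions as finite-energy functions *)

Section Representation.
Context {R : realType}.
Implicit Types (f g v w u F G phi : R -> R) (a b c d e h s t x y z : R).
Local Notation mu := (@lebesgue_measure R).

Lemma itg2E (F : R -> R -> R) : itg2 F ->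
  (\int[mu]_x \int[mu]_y (F x y)%:E = (It (fun x => It (F x)))%:E)%E.
Proof.
move=> Fi; rewrite It_itg2// fineK//; have /= h := integrable_fubini_F Fi.
by apply: (integrable_fin_num (mu := mu)).
Qed.

(* [phi] converges to [w] in the norm that defines the completion. *)
Definition approximates (ph : nat -> R -> R) w g := [/\ forall n, test_fun (ph n),
  (forall e, 0 < e -> exists N : nat, forall n, (N <= n)%N ->
     It (fun x => (derive1 (ph n) x - g x) ^+ 2) <= e)
  & forall x, ph n x @[n --> \oo] --> w x].

Lemma cvg_sqrt_It (F : nat -> R -> R) :
  (forall e, 0 < e -> exists N : nat, forall n, (N <= n)%N -> It (F n) <= e) ->
  Num.sqrt (It (F n)) @[n --> \oo] --> (0 : R).
Proof.
move=> h; apply/cvgrPdist_le => e e0.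
have [N hN] := h _ (exprn_gt0 2 e0); near=> n.
rewrite sub0r normrN ger0_norm ?sqrtr_ge0// -[leRHS](gtr0_norm e0) -sqrtr_sqr ler_wsqrtr// hN//.
by near: n; exact: nbhs_infty_ge.
Unshelve. all: by end_near. Qed.

Lemma approximates_II ph w g x y : l2_fun g -> approximates ph w g -> x <= y -> w y - w x = II x y g.
Proof.
move=> g2 [tp cg cw] xy.
have h1 : ph n y - ph n x @[n --> \oo] --> w y - w x by apply: cvgB; exact: cw.
apply: (cvg_unique _ h1) => //; apply/cvgrPdist_le => e e0.
have hs := cvg_sqrt_It cg.
have hs' : Num.sqrt (y - x) * Num.sqrt (It (fun x => (derive1 (ph n) x - g x) ^+ 2))
    @[n --> \oo] --> Num.sqrt (y - x) * 0 by apply: cvgM => //; exact: cvg_cst.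
rewrite mulr0 in hs'; move/cvgrPdist_le : hs' => /(_ _ e0).
apply: filterS => n; rewrite sub0r normrN ger0_norm ?mulr_ge0 ?sqrtr_ge0//.
apply: le_trans; rewrite distrC -is_derive_int// /II -ItB.
- rewrite (_ : It _ = II x y (fun z => derive1 (ph n) z - g z)); last first.
    by apply: eq_It => z; rewrite mulrBr.
  by apply: II_CS => //; apply: sq2B => //; exact: test_sq2.
- exact: l2_fun_litg (test_sq2 (tp n)) _ _.
- exact: l2_fun_litg.
Qed.

Lemma test_le0 phi x : test_fun phi -> x <= 0 -> phi x = 0 /\ derive1 phi x = 0.
Proof.
move=> tp x0; have [a [b [C [a0 ab C0 p0 pC]]]] := test_bound tp.
by apply: p0; rewrite negb_and -ltNge (le_lt_trans x0 a0).
Qed.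

Lemma admissible_repr beta theta : admissible beta theta -> exists w g ph,
  [/\ fin_energy w g, approximates ph w g & forall x, 0 <= x -> theta x = beta + w x].
Proof.
move=> [_ hH]; have [ph0 [tp0 _ /(_ 0 (lexx 0)) l0]] := hH; have /H10_repr[ph [g [tp g2 cg cw]]] := hH.
pose g0 x := ind (0 < x) * g x; pose w x := ind (0 < x) * (theta x - beta).
have g02 : l2_fun g0.
  split; first by apply: measurable_funM; [exact: meas_lt|exact: g2.1].
  apply: (itg_le (g := fun x => g x ^+ 2)); last exact: g2.2.
    by apply: measurable_funX; apply: measurable_funM; [exact: meas_lt|exact: g2.1].
  move=> x; rewrite ger0_norm ?sqr_ge0// /g0 /ind; case: ifP => _; first by rewrite mul1r.
  by rewrite mul0r expr0n sqr_ge0.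
have h : approximates ph w g0.
  split=> // e e0; have [N hN] := cg e e0; exists N => n /hN; apply: le_trans.
  have i1 : itg (fun x => (derive1 (ph n) x - g x) ^+ 2) := (sq2B (test_sq2 (tp n)) g2).2.
  have i2 : itg (fun x => (derive1 (ph n) x - g0 x) ^+ 2) := (sq2B (test_sq2 (tp n)) g02).2.
  apply: It_le => // x; rewrite /g0; have [x0|x0] := ltP 0 x; rewrite /ind ?mul1r// mul0r.
  by rewrite (test_le0 (tp n) x0).2 subr0 expr0n sqr_ge0.
exists w, g0, ph; split => //.
- split => //.
  + by move=> x x0; rewrite /g0 ltNge x0 /ind mul0r.
  + by move=> x x0; rewrite /w ltNge x0 /ind mul0r.
  + by move=> x y; exact: approximates_II h.
move=> x x0; rewrite /w; have [x1|x1] := ltP 0 x; first by rewrite /ind mul1r addrC subrK.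
have {x0 x1} -> : x = 0 by apply/eqP; rewrite eq_le x0 x1.
rewrite /ind mul0r addr0; apply/eqP; rewrite -subr_eq0; apply/eqP.
apply: (cvgn_uniq l0 (cvg_cst 0)) => n.
by rewrite (test_le0 (tp0 n) (lexx 0)).1.
Qed.

Lemma fin_energy_addt w g phi t : fin_energy w g -> test_fun phi ->
  fin_energy (fun x => w x + t * phi x) (fun x => g x + t * derive1 phi x).
Proof.
move=> [g2 g0 w0 wg] tp; have p2 := test_sq2 tp.
have tp2 : l2_fun (fun x => t * derive1 phi x).
  split; first by apply: measurable_funM => //; exact: p2.1.
  apply: (eq_itg (f := fun x => t ^+ 2 * derive1 phi x ^+ 2)); first by move=> x; rewrite exprMn.
  by apply: itgZ; exact: p2.2.
split.
- exact: sq2D.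
- by move=> x x0; rewrite g0// (test_le0 tp x0).2 mulr0 addr0.
- by move=> x x0; rewrite w0// (test_le0 tp x0).1 mulr0 addr0.
move=> x y xy; have := is_derive_int tp xy; rewrite opprD addrACA wg// -mulrBr => <-.
rewrite /II -ItZ; last exact: l2_fun_litg.
rewrite -ItD.
- by apply: eq_It => z; ring.
- exact: l2_fun_litg.
- by apply: itgZ; exact: l2_fun_litg.
Qed.

Lemma derive_lin f g k l x : derivable f x 1 -> derivable g x 1 ->
  derive1 (fun y => k * f y + l * g y) x = k * derive1 f x + l * derive1 g x.
Proof.
move=> df dg; apply: is_derive_derive1; rewrite !derive1E.
exact: (is_deriveD (is_deriveZ k (derivableP df)) (is_deriveZ l (derivableP dg))).
Qed.

Lemma test_derivable phi x : test_fun phi -> derivable phi x 1.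
Proof. by move=> tp; exact: (@ex_derive _ _ _ _ _ _ _ (test_is_derive x tp)). Qed.

Lemma approximates_addt (ph : nat -> R -> R) w g phi t : approximates ph w g -> test_fun phi ->
  approximates (fun n x => 1 * ph n x + t * phi x) (fun x => w x + t * phi x) (fun x => g x + t * derive1 phi x).
Proof.
move=> [tp cg cw] tphi; split.
- by move=> n; exact: test_lin.
- move=> e /cg[N hN]; exists N => n /hN; apply: le_trans; rewrite le_eqVlt; apply/orP; left; apply/eqP.
  apply: eq_It => x; rewrite derive_lin; [|exact: test_derivable|exact: test_derivable].
  by congr (_ ^+ 2); ring.
- by move=> x; under eq_fun do rewrite mul1r; apply: cvgD; [exact: cw|exact: cvg_cst].
Qed.

Lemma It_sq_triangle f1 f2 g : l2_fun f1 -> l2_fun f2 -> l2_fun g ->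
  It (fun x => (f1 x - f2 x) ^+ 2) <=
  2 * It (fun x => (f1 x - g x) ^+ 2) + 2 * It (fun x => (f2 x - g x) ^+ 2).
Proof.
move=> h1 h2 hg; have i1 := (sq2B h1 hg).2; have i2 := (sq2B h2 hg).2.
have E := ItD (itgZ 2 i1) (itgZ 2 i2).
rewrite (ItZ 2 i1) (ItZ 2 i2) in E; rewrite -E.
apply: (It_le (sq2B h1 h2).2 (itgD (itgZ 2 i1) (itgZ 2 i2))) => x.
have := sqr_ge0 ((f1 x - g x) + (f2 x - g x)); nra.
Qed.

Lemma fin_energy_admissible beta (ph : nat -> R -> R) w g : fin_energy w g -> approximates ph w g ->
  admissible beta (fun x => beta + w x).
Proof.
move=> hw [tp cg cw]; split.
  apply: continuous_subspaceT => x; apply: cvgD; first exact: cvg_cst.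
  exact: (fin_energy_cont hw).
exists ph; split => //; last first.
  by move=> x _; have := cw x; rewrite addrC addKr.
move=> e e0; have e4 : 0 < (e / 2) ^+ 2 / 4 by rewrite divr_gt0// exprn_gt0// divr_gt0.
have [N hN] := cg _ e4; exists N => m n /hN hm /hN hn.
have [g2 _ _ _] := hw.
have i k : itg (fun x => (derive1 (ph k) x - g x) ^+ 2) := (sq2B (test_sq2 (tp k)) g2).2.
rewrite H10normE; last exact: testB.
apply: (@le_lt_trans _ _ (e / 2)); last by rewrite gtr_pMr// invf_lt1// ltr1n.
rewrite -[leRHS]gtr0_norm ?divr_gt0// -sqrtr_sqr ler_wsqrtr//.
apply: le_trans (_ : _ <= It (fun x => (derive1 (ph m) x - derive1 (ph n) x) ^+ 2)) _.
  rewrite le_eqVlt; apply/orP; left; apply/eqP; apply: eq_It => x; rewrite derive_testB//.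
apply: (le_trans (It_sq_triangle (test_sq2 (tp m)) (test_sq2 (tp n)) g2)).
by move: hm hn; clear; set J1 := It _; set J2 := It _; move: J1 J2 => J1 J2; lra.
Qed.

End Representation.

(** * A competitor of finite energy *)

Section Competitor.
Context {R : realType}.
Implicit Types (f g v w u F G phi : R -> R) (a b c d e h s t x y z : R).
Local Notation mu := (@lebesgue_measure R).
Variables (beta nu : R) (eta : R -> R).
Hypotheses (beta0 : 0 < beta) (nu0 : 0 < nu) (heta : is_cutoff beta eta).
Local Notation step_at := (step_at beta eta).
Local Notation mollifier := (mollifier beta eta).

Lemma mollifier_bound : exists2 C, 0 < C & forall a e x, 0 < e -> `|mollifier a e x| <= e^-1 * C.
Proof.
have [C C0 hC] := dstep_bound beta0 heta; exists C => // a e x e0.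
by rewrite /mollifier normrM gtr0_norm ?invr_gt0// ler_wpM2l// invr_ge0 ltW.
Qed.

Lemma mollifier_sq a e : 0 < e -> l2_fun (mollifier a e).
Proof.
move=> e0; have mk := cont_meas (@cont_mollifier R beta eta heta a e); split=> //.
apply: (eq_itg (f := fun x => mollifier a e x * mollifier a e x)); first by move=> x; rewrite expr2.
by apply: itg_mollifier => //; apply: litg_cont; exact: cont_mollifier.
Qed.

Lemma It_kap_sq : exists2 C, 0 < C & forall a e, 0 < e ->
  It (fun x => mollifier a e x ^+ 2) <= e^-1 * C.
Proof.
have [C C0 hC] := mollifier_bound; exists C => // a e e0; have [ki k1] := It_mollifier beta0 heta a e0.
rewrite -[leRHS]mulr1 -k1 -ItZ//; apply: It_le.
- exact: (mollifier_sq a e0).2.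
- exact: itgZ.
move=> x; rewrite expr2 ler_wpM2r ?(mollifier_ge0 beta0 heta)//.
exact: (le_trans (ler_norm _) (hC _ _ _ e0)).
Qed.

(** [beta + wT] equals [beta] up to [1] and [0] from [2] on, so the local density vanishes beyond
    [2]. *)
Definition wT x := - beta * step_at 1 1 x.
Definition gT x := - beta * mollifier 1 1 x.

Lemma fin_energy_T : fin_energy wT gT.
Proof.
split.
- have [mk ki] := mollifier_sq 1 ltr01; split; first exact: measurable_funM.
  apply: (eq_itg (f := fun x => (- beta) ^+ 2 * mollifier 1 1 x ^+ 2)); first by move=> x; rewrite /gT; ring.
  exact: itgZ.
- move=> x x0; rewrite /gT mollifier_supp ?mulr0// negb_and -ltNge; apply/orP; left.
  exact: le_lt_trans x0 _.
- by move=> x x0; rewrite /wT stpa0 ?mulr0// (le_trans x0).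
move=> x y xy; apply/esym; apply: FTC2.
- exact: xy.
- apply: contT_within => z; apply: cvgM; [exact: cvg_cst|exact: cont_mollifier].
- apply: contT_within => z; apply: cvgM; [exact: cvg_cst|exact: cont_stpa].
- move=> z _; apply: is_deriveZ; exact: is_derive_stpa.
Qed.

(** [wT] keeps the value [- beta] at infinity. The test functions return to zero along a ramp spread
    over [[n + 1, 2 (n + 1)]], whose slope has squared norm of order [1/n]: the norm of the
    completion does not see the value at infinity. *)
Lemma approximates_T : exists ph, approximates ph wT gT.
Proof.
pose S (n : nat) x := 1 * step_at 1 1 x + -1 * step_at n.+1%:R n.+1%:R x.
have tS n : test_fun (S n) by apply: test_stpd; rewrite ?ler1n ?ltr0n.
have dS n x : derive1 (S n) x = mollifier 1 1 x - mollifier n.+1%:R n.+1%:R x by exact: derive_stpd.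
exists (fun n x => - beta * S n x + 0 * S n x); split.
- by move=> n; exact: test_lin.
- have [C C0 hC] := It_kap_sq; move=> e e0.
  have hc : beta ^+ 2 * (n.+1%:R^-1 * C) @[n --> \oo] --> beta ^+ 2 * (0 * C).
    by apply: cvgM; [exact: cvg_cst|apply: cvgM; [exact: cvg_invS|exact: cvg_cst]].
  rewrite mul0r mulr0 in hc; move/cvgrPdist_le : hc => /(_ _ e0)[N _ hN]; exists N => n nN.
  have := hN n nN; rewrite /= sub0r normrN; apply: le_trans; apply: le_trans (ler_norm _).
  have n0 : 0 < n.+1%:R :> R by rewrite ltr0n.
  apply: (@le_trans _ _ (beta ^+ 2 * It (fun x => mollifier n.+1%:R n.+1%:R x ^+ 2))); last first.
    by rewrite ler_wpM2l ?sqr_ge0// hC.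
  rewrite -ItZ; last exact: (mollifier_sq _ n0).2.
  rewrite le_eqVlt; apply/orP; left; apply/eqP; apply: eq_It => x.
  rewrite derive_lin; [|exact: test_derivable|exact: test_derivable].
  by rewrite dS /gT; ring.
move=> x; apply: cvg_near_cst; near=> n; rewrite /wT mul0r addr0 /S mul1r.
rewrite (stpa0 beta0 heta (a := n.+1%:R)) ?ltr0n// ?mulr0 ?addr0//.
apply: (@le_trans _ _ n%:R); last by rewrite ler_nat.
by near: n; exact: nbhs_infty_ger.
Unshelve. all: by end_near. Qed.

Lemma wT_2 x : 2 <= x -> wT x = - beta.
Proof. by move=> x2; rewrite /wT stpa1 ?mulr1. Qed.

Lemma itg_AT : itg (fun x => ind (0 < x) * local_density beta nu eta wT gT x).
Proof.
have [[mg _] _ _ _] := fin_energy_T; have mw := fin_energy_meas fin_energy_T.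
have mA := meas_Aw nu heta mw mg.
have [C C0 hC] := mollifier_bound; have [L L0 hL] := eta_lip beta0 heta.
apply: (eq_itg (f := fun x => ind (0 <= x <= 2) * (ind (0 < x) * local_density beta nu eta wT gT x))).
  move=> x; have [x0|x0] := ltP 0 x; last by rewrite /ind mul0r mulr0.
  rewrite (ltW x0) /=; have [x2|x2] := leP x 2; rewrite /ind !mul1r// mul0r.
  rewrite /local_density (wT_2 (ltW x2)) /gT mollifier_supp//; last first.
    by rewrite negb_and -!ltNge; apply/orP; right; rewrite -[1 + 1]/(2 : R).
  have -> : eta x = 0 by case: heta => _ _ _ h _; apply: h; rewrite (le_trans _ (ltW x2))// ler1n.
  by rewrite addNr sin0 sub0r subrr; ring.
apply: (itg_bnd (C := 2^-1 * (beta * C) ^+ 2 + 2^-1 + (nu / (4 * pi)) * (L ^+ 2 + 1))).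
  by apply: measurable_funM => //; exact: meas_lt.
move=> x /andP[x0 x2]; have kp0 : 0 < nu / (4 * pi) := kp_gt0 nu0.
have Cp : 0 <= 2^-1 * (beta * C) ^+ 2 by rewrite mulr_ge0 ?sqr_ge0.
have kp1 : 0 <= (nu / (4 * pi)) * (L ^+ 2 + 1) by rewrite mulr_ge0 ?(ltW kp0)// addr_ge0 ?sqr_ge0.
have [x1|x1] := ltP 0 x; rewrite /ind; last by rewrite mul0r normr0; apply: addr_ge0 => //; apply: addr_ge0.
rewrite mul1r /local_density (le_trans (ler_normD _ _))// lerD//.
  rewrite (le_trans (ler_normD _ _))// lerD//.
    rewrite ger0_norm; last by rewrite mulr_ge0 ?sqr_ge0.
    apply: ler_wpM2l => //; rewrite /gT -(real_normK (num_real (_ * _))).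
    rewrite ler_pXn2r ?nnegrE ?mulr_ge0 ?(ltW beta0) ?(ltW C0)// normrM normrN (gtr0_norm beta0).
    by rewrite ler_wpM2l ?(ltW beta0)//; have := hC 1 1 x ltr01; rewrite invr1 mul1r.
  rewrite ger0_norm; last by rewrite mulr_ge0 ?sqr_ge0.
  rewrite ger_pMr// -(real_normK (num_real _)) expr_le1// sin_norm_le1.
rewrite normrM (gtr0_norm kp0) ler_wpM2l ?(ltW kp0)//.
rewrite normrM normfV (gtr0_norm x1) ler_pdivrMr//.
have s1 y : 0 <= sin y ^+ 2 <= 1.
  by rewrite sqr_ge0/= -(real_normK (num_real _)) expr_le1// sin_norm_le1.
have [h1|h1] := leP x 1; last first.
  rewrite (@le_trans _ _ 1)//; first by rewrite ler_norml; have := s1 (wT x); have := s1 (eta x - beta); lra.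
  rewrite mulrDl mul1r ler_wpDl ?mulr_ge0 ?sqr_ge0//; exact: ltW.
rewrite /wT (stpa0 beta0 heta) ?mulr0 ?sin0 ?expr0n ?sub0r ?normrN//.
have e0 : eta 0 = beta by case: heta => _ _ h _ _; exact: h.
rewrite ger0_norm ?sqr_ge0// mulrDl; apply: ler_wpDr; first by rewrite mul1r ltW.
apply: (@le_trans _ _ (L ^+ 2 * x ^+ 2)); last first.
  by rewrite ler_wpM2l ?sqr_ge0// expr2 ger_pMr.
rewrite -exprMn -(real_normK (num_real (sin _))) ler_pXn2r ?nnegrE ?mulr_ge0 ?(ltW L0)//.
rewrite (le_trans (sin_norm_le _))//; have := hL x 0; rewrite e0 subr0.
by rewrite (gtr0_norm x1).
Qed.

Lemma sq_kernel_T : itg2 (sq_kernel (fun y => sin (wT y))).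
Proof.
have mw := fin_energy_meas fin_energy_T; have [C C0 hC] := mollifier_bound.
apply: (sq_kernel_lip (L := beta * C) (B := 1) (M := 2)).
- by apply: cont_meas; apply: cont_sin_comp; exact: fin_energy_cont fin_energy_T.
- move=> x y _ _; apply: (le_trans (sin_lip _ _)).
  apply: (mvt_le (f := wT) (f' := gT)).
    by move=> z; apply: is_deriveZ; exact: is_derive_stpa.
  move=> z _; rewrite normrM normrN (gtr0_norm beta0) ler_wpM2l ?(ltW beta0)//.
  by have := hC 1 1 z ltr01; rewrite invr1 mul1r.
- by move=> x; exact: sin_norm_le1.
- by move=> x y x2 y2; rewrite !wT_2.
Qed.

(** The energy as a real number, up to the constant contributed by the double integral of [eta],
    which plays no part in comparisons. *)
Definition repr_energy w g := It (fun x => ind (0 < x) * local_density beta nu eta w g x)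
  + nu / (8 * pi) * (2 * It (fun x => It (sq_kernel (fun y => sin (w y)) x))).

Lemma energyR theta w g : fin_energy w g -> (forall x, 0 < x -> theta x = beta + w x) ->
  itg (fun x => ind (0 < x) * local_density beta nu eta w g x) -> itg2 (sq_kernel (fun y => sin (w y))) ->
  energy beta nu eta theta =
    (repr_energy w g - nu / (8 * pi) * (2 * It (fun x => It (sq_kernel (fun y => sin (eta y - beta)) x))))%:E.
Proof.
move=> hw tw Ai ki; rewrite (energyE nu beta0 heta hw tw) -(ItE Ai) !itg2E//.
exact: sq_kernel_eta.
Qed.

Lemma lower_itg w g : fin_energy w g ->
  itg (fun x => ind (0 < x) * local_density beta nu eta w g x) \/
  (\int[mu]_x (ind (0 < x) * local_density beta nu eta w g x)%:E = +oo)%E.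
Proof.
move=> hw; have [Cl Cl0 hCl] := local_density_lower beta0 nu0 heta.
have [[mg _] _ _ _] := hw.
apply: (itg_or_pinfty (g := fun x => Cl * maj x)).
- by apply: measurable_funM; [exact: meas_lt|exact: (meas_Aw nu heta (fin_energy_meas hw) mg)].
- by apply: itgZ; exact: itg_maj.
move=> x; have m0 := mulr_ge0 Cl0 (maj_ge0 x); have [x0|x0] := ltP 0 x; rewrite /ind ?mul1r ?mul0r ?oppr_le0//.
apply: le_trans (hCl w g x x0); rewrite -[leLHS]add0r lerD2r.
by apply: addr_ge0; do 2?[rewrite mulr_ge0 ?sqr_ge0 ?ind_ge0//].
Qed.

Lemma energy_finite theta w g : fin_energy w g -> (forall x, 0 < x -> theta x = beta + w x) ->
  (energy beta nu eta theta < +oo)%E ->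
  itg (fun x => ind (0 < x) * local_density beta nu eta w g x) /\ itg2 (sq_kernel (fun y => sin (w y))).
Proof.
move=> hw tw; rewrite (energyE nu beta0 heta hw tw).
have c0 : 0 < nu / (8 * pi) := cN_gt0 nu0.
rewrite (itg2E (sq_kernel_eta beta0 heta)).
have ms : measurable_fun setT (fun y => sin (w y)).
  by apply: cont_meas; apply: cont_sin_comp; exact: fin_energy_cont hw.
have J0 : (0 <= \int[mu]_x \int[mu]_h (sq_kernel (fun y => sin (w y)) x h)%:E)%E.
  by apply: integral_ge0 => x _; apply: integral_ge0 => h _; rewrite lee_fin sq_kernel_ge0.
have [Ai|->] := lower_itg hw.
  rewrite -(ItE Ai) => h; split => //; apply: itg2_ge0P; first exact: meas2_k2.
    by move=> x y; exact: sq_kernel_ge0.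
  move: J0 h; case: (\int[mu]_x \int[mu]_h (sq_kernel _ x h)%:E)%E => [r| |]//; first by move=> *; rewrite ltry.
  by rewrite !gt0_muley ?lte_fin// !EFinM.
move: J0; case: (\int[mu]_x \int[mu]_h (sq_kernel _ x h)%:E)%E => [r| |]//.
by rewrite !gt0_muley ?lte_fin.
Qed.

(** Read off from the lower bound of the density for [x >= 1], and from [|sin| <= 1] on [[0, 1]]. It
    later forces [sin theta] to vanish at infinity. *)
Lemma sin_sq_itg w g : fin_energy w g -> itg (fun x => ind (0 < x) * local_density beta nu eta w g x) ->
  itg (fun x => ind (0 < x) * sin (w x + beta) ^+ 2).
Proof.
move=> hw Ai; have [Cl Cl0 hCl] := local_density_lower beta0 nu0 heta.
apply: (itg_le (g := fun x => ind (0 <= x <= 1) + 4 * (ind (0 < x) * local_density beta nu eta w g x + Cl * maj x))).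
- apply: measurable_funM; first exact: meas_lt.
  apply: measurable_funX; apply: cont_meas; apply: cont_sin_comp => x.
  by apply: cvgD; [exact: (fin_energy_cont hw)|exact: cvg_cst].
- move=> x; rewrite norm_ind ger0_norm ?sqr_ge0//.
  have m0 := mulr_ge0 Cl0 (maj_ge0 x); have [x0|x0] := ltP 0 x; rewrite /ind ?mul1r ?mul0r.
    have := hCl w g x x0; have := sqr_ge0 (g x); rewrite (ltW x0)/=.
    have s1 : sin (w x + beta) ^+ 2 <= 1 by rewrite -(real_normK (num_real _)) expr_le1// sin_norm_le1.
    have := sqr_ge0 (sin (w x + beta)); move: s1.
    rewrite /ind; have [h|h] := leP x 1; have [h'|h'] := leP 1 x; lra.
  apply: addr_ge0; first by case: ifP.
  by apply: mulr_ge0; rewrite ?add0r.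
- apply: itgD; first exact: itg_ind.
  by apply: itgZ; apply: itgD => //; apply: itgZ; exact: itg_maj.
Qed.

(** Comparison with [wT] makes the minimal energy finite. Minimality then becomes an inequality
    between real numbers against all finite competitors, in a form to which [w + t phi] can be
    submitted. *)
Lemma minimizer_repr theta : is_minimizer beta nu eta theta -> exists w g ph,
  [/\ fin_energy w g, approximates ph w g, forall x, 0 <= x -> theta x = beta + w x,
      itg (fun x => ind (0 < x) * local_density beta nu eta w g x) /\ itg2 (sq_kernel (fun y => sin (w y)))
    & forall w1 g1 ph1, fin_energy w1 g1 -> approximates ph1 w1 g1 ->
        itg (fun x => ind (0 < x) * local_density beta nu eta w1 g1 x) -> itg2 (sq_kernel (fun y => sin (w1 y))) ->
        repr_energy w g <= repr_energy w1 g1].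
Proof.
move=> [ad mi]; have [w [g [ph [hw hp tw]]]] := admissible_repr ad; exists w, g, ph.
have tw' x : 0 < x -> theta x = beta + w x by move=> x0; rewrite tw// ltW.
have le w1 g1 ph1 : fin_energy w1 g1 -> approximates ph1 w1 g1 ->
    (energy beta nu eta theta <= energy beta nu eta (fun x => (beta + w1 x)%R))%E.
  move=> h1 p1; rewrite mi; apply: ereal_inf_lbound; exists (fun x => beta + w1 x) => //.
  exact: fin_energy_admissible h1 p1.
have [phT hT] := approximates_T.
have fin : (energy beta nu eta theta < +oo)%E.
  apply: (le_lt_trans (le _ _ _ fin_energy_T hT)).
  by rewrite (energyR fin_energy_T) ?ltry//; [exact: itg_AT|exact: sq_kernel_T].
have [Ai ki] := energy_finite hw tw' fin.
split; [exact: hw|exact: hp|exact: tw|by split|].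
move=> w1 g1 ph1 h1 p1 A1 k1; have := le _ _ _ h1 p1.
rewrite (energyR hw tw' Ai ki) (energyR h1 (fun _ _ => erefl) A1 k1) lee_fin lerD2r.
exact.
Qed.

End Competitor.

(** * The Euler-Lagrange equation *)

Section FirstVariation.
Context {R : realType}.
Implicit Types (f g v w u F G phi : R -> R) (a b c d e h s t x y z : R).
Local Notation mu := (@lebesgue_measure R).

(** The flag [i] tells whether the base point lies in the support of the perturbation. If it does
    not, [pb = 0] and the terms carrying [U] or [D] drop out of the remainder; hence
    [U ^+ 2 + D ^+ 2] enters [S] only for base points in the support. This matters because the
    cosine increments [D] are integrable only locally in [x]. *)
Lemma sin_incr_taylor (t C wa wb pa pb : R) (i : bool) : `|t| <= 1 -> `|pa| <= C -> `|pb| <= C ->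
  (~~ i -> pb = 0) ->
  let U := sin wa - sin wb in let D := cos wa - cos wb in
  let Y := cos wa * pa - cos wb * pb in
  let V := sin (wa + t * pa) - sin (wb + t * pb) in
  let S := ind i * (U ^+ 2 + D ^+ 2) + (pa - pb) ^+ 2 in
  let M := 9 * (C ^+ 4 + 4 * C ^+ 2) + 4 * (C ^+ 2 + 1) in
  `|V ^+ 2 - U ^+ 2 - 2 * t * (U * Y)| <= t ^+ 2 * (U ^+ 2 + M * S) /\ Y ^+ 2 <= M * S.
Proof.
move=> t1 aC bC pb0 U D Y V S M.
have C0 : 0 <= C := le_trans (normr_ge0 _) aC.
pose P := pa - pb.
(* The exact remainder of [V] after the linear term, arranged so that each summand has a factor of
   order [t ^+ 2] multiplied by [U], [D] or [P]. *)
pose rho := U * (cos (t * pb) - 1) + sin wa * (cos (t * pa) - cos (t * pb))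
  + D * (sin (t * pb) - t * pb) + cos wa * ((sin (t * pa) - t * pa) - (sin (t * pb) - t * pb)).
have EV : V = U + t * Y + rho by rewrite /rho /V /U /Y /D !sinD; ring.
have I0 := ind_ge0 i (R := R).
pose Q := ind i * `|U| * C ^+ 2 + ind i * `|D| * C ^+ 2 + 2 * C * `|P|.
have Q0 : 0 <= Q by rewrite !addr_ge0// !mulr_ge0// sqr_ge0.
have N0 : `|0 : R| <= C by rewrite normr0.
have tt : 0 <= t ^+ 2 := sqr_ge0 t.
have tC : 0 <= t ^+ 2 * C by exact: mulr_ge0.
have c1 : `|cos (t * pb) - 1| <= t ^+ 2 * C * (ind i * C).
  have [h|/pb0->] := boolP i; last by rewrite !mulr0 cos0 subrr normr0 /ind mul0r mulr0.
  have := cosM_lip t bC N0; rewrite mulr0 cos0 subr0 => /le_trans; apply.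
  by apply: ler_wpM2l; rewrite /ind ?mul1r.
have s1 : `|sin (t * pb) - t * pb| <= t ^+ 2 * C * (ind i * C).
  have [h|/pb0->] := boolP i; last by rewrite !mulr0 sin0 subrr normr0 /ind mul0r mulr0.
  have := sinM_lip t bC N0; rewrite mulr0 sin0 !subr0 => /le_trans; apply.
  by apply: ler_wpM2l; rewrite /ind ?mul1r.
have rQ : `|rho| <= t ^+ 2 * Q.
  have -> : t ^+ 2 * Q = `|U| * (t ^+ 2 * C * (ind i * C)) + 1 * (t ^+ 2 * C * `|P|)
     + `|D| * (t ^+ 2 * C * (ind i * C)) + 1 * (t ^+ 2 * C * `|P|) by rewrite /Q; ring.
  rewrite /rho; apply: (le_trans (ler_normD _ _)); apply: lerD; [apply: (le_trans (ler_normD _ _)); apply: lerD; [apply: (le_trans (ler_normD _ _)); apply: lerD|]|]; rewrite normrM.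
  - exact: ler_wpM2l.
  - by apply: ler_pM => //; [exact: sin_norm_le1|exact: cosM_lip].
  - exact: ler_wpM2l.
  - by apply: ler_pM => //; [exact: cos_norm_le1|exact: sinM_lip].
have ii : ind i * ind i = ind i :> R by rewrite /ind; case: (i); rewrite ?mulr1 ?mulr0.
have PS : 0 <= S by rewrite addr_ge0 ?sqr_ge0// mulr_ge0 ?ind_ge0// addr_ge0// sqr_ge0.
have US : ind i * U ^+ 2 <= S by rewrite /S mulrDr -addrA lerDl addr_ge0 ?sqr_ge0// mulr_ge0 ?sqr_ge0.
have DS : ind i * D ^+ 2 <= S by rewrite /S mulrDr addrAC lerDr addr_ge0 ?sqr_ge0// mulr_ge0 ?sqr_ge0.
have PPS : P ^+ 2 <= S by rewrite /S lerDr mulr_ge0 ?ind_ge0// addr_ge0// sqr_ge0.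
have USD : ind i * U ^+ 2 + ind i * D ^+ 2 + P ^+ 2 = S by rewrite /S mulrDr.
have C4 : 0 <= C ^+ 4 by rewrite exprn_ge0.
have C2 : 0 <= C ^+ 2 by rewrite exprn_ge0.
have sq3 (x y z : R) : (x + y + z) ^+ 2 <= 3 * (x ^+ 2 + y ^+ 2 + z ^+ 2).
  have := sqr_ge0 (x - y); have := sqr_ge0 (x - z); have := sqr_ge0 (y - z); nra.
have QS : Q ^+ 2 <= 3 * (C ^+ 4 + 4 * C ^+ 2) * S.
  apply: (le_trans (sq3 _ _ _)); rewrite -[leRHS]mulrA; apply: ler_wpM2l => //.
  have -> : (ind i * `|U| * C ^+ 2) ^+ 2 + (ind i * `|D| * C ^+ 2) ^+ 2 + (2 * C * `|P|) ^+ 2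
    = C ^+ 4 * (ind i * ind i * `|U| ^+ 2 + ind i * ind i * `|D| ^+ 2) + 4 * C ^+ 2 * `|P| ^+ 2 by ring.
  rewrite ii !real_normK ?num_real// [leRHS]mulrDl; apply: lerD; apply: ler_wpM2l => //.
  - by rewrite -USD lerDl sqr_ge0.
  - by rewrite mulr_ge0.
have YS : Y ^+ 2 <= 2 * (C ^+ 2 + 1) * S.
  have -> : Y = D * pb + cos wa * P by rewrite /Y /D /P; ring.
  apply: (@le_trans _ _ (2 * ((D * pb) ^+ 2 + (cos wa * P) ^+ 2))).
    have := sqr_ge0 (D * pb - cos wa * P); nra.
  rewrite -[leRHS]mulrA; apply: ler_wpM2l => //; rewrite [leRHS]mulrDl mul1r; apply: lerD.
    have [h|/pb0->] := boolP i; last by rewrite mulr0 expr0n mulr_ge0.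
    rewrite exprMn mulrC; apply: ler_pM; rewrite ?sqr_ge0//.
      by rewrite -(real_normK (num_real pb)) ler_pXn2r ?nnegrE.
    by move: DS; rewrite h /ind mul1r.
  apply: le_trans PPS; rewrite exprMn; apply: ler_piMl; first exact: sqr_ge0.
  by rewrite -(real_normK (num_real (cos wa))) expr_le1// cos_norm_le1.
have MS1 : 3 * (C ^+ 4 + 4 * C ^+ 2) * S >= 0 := le_trans (sqr_ge0 _) QS.
have MS2 : 2 * (C ^+ 2 + 1) * S >= 0 := le_trans (sqr_ge0 _) YS.
(* The quantity to bound is [2 U rho + (t Y + rho) ^+ 2], at most [t ^+ 2] times
   [U ^+ 2 + 3 Q ^+ 2 + 2 Y ^+ 2]. Inserting the bounds of [Q ^+ 2] and [Y ^+ 2] by [S] produces the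
   two summands of [M]. *)
have EM : M * S = 3 * (3 * (C ^+ 4 + 4 * C ^+ 2) * S) + 2 * (2 * (C ^+ 2 + 1) * S) by rewrite /M; ring.
split; last by rewrite EM; lra.
have t21 : t ^+ 2 <= 1 by rewrite -(real_normK (num_real t)) expr_le1.
have b1 : `|2 * (U * rho)| <= t ^+ 2 * (U ^+ 2 + Q ^+ 2).
  rewrite !normrM ger0_norm//; apply: (@le_trans _ _ (2 * (`|U| * (t ^+ 2 * Q)))).
    by rewrite !ler_wpM2l.
  have -> : 2 * (`|U| * (t ^+ 2 * Q)) = t ^+ 2 * (2 * `|U| * Q) by ring.
  rewrite ler_wpM2l// -[U ^+ 2](real_normK (num_real U)).
  have := sqr_ge0 (`|U| - Q); nra.
have b2 : rho ^+ 2 <= t ^+ 2 * Q ^+ 2.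
  rewrite -(real_normK (num_real rho)); apply: (@le_trans _ _ ((t ^+ 2 * Q) ^+ 2)).
    by rewrite ler_pXn2r ?nnegrE// mulr_ge0.
  have -> : (t ^+ 2 * Q) ^+ 2 = t ^+ 2 * (t ^+ 2 * Q ^+ 2) by ring.
  by apply: ler_piMl => //; apply: mulr_ge0 => //; exact: sqr_ge0.
have b3 : (t * Y + rho) ^+ 2 <= t ^+ 2 * (2 * Y ^+ 2) + 2 * rho ^+ 2.
  have := sqr_ge0 (t * Y - rho); clear; nra.
have -> : V ^+ 2 - U ^+ 2 - 2 * t * (U * Y) = 2 * (U * rho) + (t * Y + rho) ^+ 2 by rewrite EV; ring.
apply: (le_trans (ler_normD _ _)); rewrite [`|_ ^+ 2|]ger0_norm ?sqr_ge0//.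
have YS' : t ^+ 2 * (2 * Y ^+ 2) <= t ^+ 2 * (2 * (2 * (C ^+ 2 + 1) * S)) by rewrite !ler_wpM2l.
have QS' : t ^+ 2 * Q ^+ 2 <= t ^+ 2 * (3 * (C ^+ 4 + 4 * C ^+ 2) * S) by rewrite !ler_wpM2l.
rewrite EM; move: b1 b2 b3 YS' QS'.
move: (t ^+ 2) => T; move: (Q ^+ 2) (Y ^+ 2) (rho ^+ 2) ((t * Y + rho) ^+ 2) (U ^+ 2) => q y r s u.
rewrite !mulrDr; clear; lra.
Qed.

(** The energy controls the increments of the sine only. For the cosine the [x] integral is taken
    before the [h] integral: when [h <= 1], the translation estimate bounds it by the integral of
    [g ^+ 2]; when [h > 1], boundedness of the cosine gives [4 (b - a) h ^- 2]. *)
Lemma sq_kernel_local w g a b : fin_energy w g -> a <= b ->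
  itg2 (fun x h => ind (a <= x <= b) * sq_kernel (fun y => cos (w y)) x h).
Proof.
move=> hw ab; have mc : measurable_fun setT (fun y => cos (w y)).
  by apply: cont_meas; apply: cont_cos_comp; exact: fin_energy_cont hw.
have mF : meas2 (fun x h => ind (a <= x <= b) * sq_kernel (fun y => cos (w y)) x h).
  by apply: measurable_funM; [exact: (meas2_fst (meas_cc a b))|exact: meas2_k2].
have N0 : 0 <= It (fun x => g x ^+ 2) by apply: It_ge0 => x; exact: sqr_ge0.
pose K := It (fun x => g x ^+ 2) + 4 * (b - a).
have K0 : 0 <= 4 * (b - a) by rewrite mulr_ge0// subr_ge0.
have F0 x h : 0 <= ind (a <= x <= b) * sq_kernel (fun y => cos (w y)) x h.
  by rewrite mulr_ge0 ?ind_ge0 ?sq_kernel_ge0.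
have F4 x h : 0 < h -> ind (a <= x <= b) * sq_kernel (fun y => cos (w y)) x h <= 4 * h ^- 2 * ind (a <= x <= b).
  move=> h0; rewrite mulrC ler_wpM2r ?ind_ge0// /sq_kernel h0 {2}/ind mul1r.
  have hi : 0 <= h ^- 2 by rewrite invr_ge0 sqr_ge0.
  apply: (@le_trans _ _ (1 * (4 * h ^- 2))); last by rewrite mul1r.
  apply: ler_pM; rewrite ?ind_ge0 ?ind_le1//; first by rewrite mulr_ge0 ?sqr_ge0.
  rewrite ler_wpM2r// (_ : 4 = 2 ^+ 2); last by rewrite expr2 -natrM.
  rewrite -(real_normK (num_real (_ - _))) ler_pXn2r ?nnegrE//.
  by rewrite (le_trans (ler_normB _ _))// -[leRHS](natrD _ 1 1) lerD ?cos_norm_le1.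
have iF h : itg (fun x => ind (a <= x <= b) * sq_kernel (fun y => cos (w y)) x h).
  have [h0|h0] := ltP 0 h; last first.
    apply: (eq_itg (f := fun=> 0)); last exact: itg0.
    by move=> x; rewrite /sq_kernel [0 < h]ltNge h0 /ind mul0r !mulr0.
  apply: (itg_le (g := fun x => 4 * h ^- 2 * ind (a <= x <= b))).
  - exact: (meas2_1 h (meas2C mF)).
  - by move=> x; rewrite ger0_norm// F4.
  - by apply: itgZ; exact: itg_ind.
apply: itg2C; apply: (itg2_iter (g := fun h => K * maj h)).
- exact: meas2C.
- exact: iF.
- move=> h; rewrite (eq_It (g := fun x => ind (a <= x <= b) * sq_kernel (fun y => cos (w y)) x h)); last first.
    by move=> x; rewrite ger0_norm.
  have [h0|h0] := ltP 0 h; last first.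
    rewrite (eq_It (g := fun=> 0)) ?It0 ?mulr_ge0 ?maj_ge0 ?addr_ge0//.
    by move=> x; rewrite /sq_kernel [0 < h]ltNge h0 /ind mul0r !mulr0.
  have h2 : 0 < h ^+ 2 by rewrite exprn_gt0.
  have [h1|h1] := leP h 1.
    apply: (@le_trans _ _ (h ^- 2 * It (fun x => (w (x + h) - w x) ^+ 2))).
      have [i1 _] := fin_energy_shift_sq hw (ltW h0).
      rewrite -ItZ//; apply: It_le => //; first exact: itgZ.
      move=> x; rewrite /sq_kernel h0 [ind true]/ind mul1r mulrA [leRHS]mulrC mulrA.
      rewrite ler_wpM2r ?invr_ge0 ?(ltW h2)//.
      have c2 : (cos (w (x + h)) - cos (w x)) ^+ 2 <= (w (x + h) - w x) ^+ 2.
        rewrite -(real_normK (num_real (_ - _))) -[leRHS](real_normK (num_real (_ - _))).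
        by rewrite ler_pXn2r ?nnegrE// cos_lip.
      apply: le_trans c2; apply: ler_piMl; first exact: sqr_ge0.
      by rewrite -[leRHS]mulr1 ler_pM ?ind_ge0 ?ind_le1.
    have [_ i2] := fin_energy_shift_sq hw (ltW h0).
    apply: (@le_trans _ _ (It (fun x => g x ^+ 2))).
      by rewrite mulrC ler_pdivrMr// mulrC.
    rewrite /maj (ltW h0) h1 /= mulrDr {1}/ind mulr1.
    apply: (@le_trans _ _ K); first by rewrite lerDl.
    by rewrite lerDl mulr_ge0 ?addr_ge0// mulr_ge0 ?ind_ge0// invr_ge0 ltW.
  apply: (@le_trans _ _ (4 * h ^- 2 * It (fun x => ind (a <= x <= b)))).
    rewrite -ItZ; last exact: itg_ind.
    by apply: It_le => //; [apply: itgZ; exact: itg_ind|move=> x; exact: F4].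
  rewrite It_ind// /maj (ltW h1) [0 <= h <= 1](_ : _ = false); last first.
    by rewrite [h <= 1]leNgt h1 andbF.
  rewrite /ind add0r mul1r -mulrA mulrCA mulrC ler_wpM2r ?invr_ge0 ?(ltW h2)//.
  by rewrite /K lerDr.
by apply: itgZ; exact: itg_maj.
Qed.

Lemma sq_kernel_test phi : test_fun phi -> itg2 (sq_kernel phi).
Proof.
move=> tp; have [a [b [C [a0 ab C0 p0 pC]]]] := test_bound tp.
apply: (sq_kernel_lip (L := C) (B := C) (M := b + 1)).
- exact: cont_meas (test_cont tp).
- move=> x y _ _; apply: (mvt_le (f := phi) (f' := derive1 phi)).
    by move=> z; exact: test_is_derive.
  by move=> z _; exact: (pC z).2.
- by move=> x; exact: (pC x).1.
- have h x : b + 1 <= x -> phi x = 0.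
    move=> bx; apply: (p0 x _).1; rewrite negb_and -!ltNge; apply/orP; right.
    by apply: lt_le_trans bx; rewrite ltrDl.
  by move=> x y /h-> /h->.
Qed.

(** The bilinear form whose quadratic form is [sq_kernel]. *)
Definition cross_kernel u v x h := ind (0 < x) * (ind (0 < h) * (((u (x + h) - u x) * (v (x + h) - v x)) * h ^- 2)).

Lemma meas2_kB u v : measurable_fun setT u -> measurable_fun setT v -> meas2 (cross_kernel u v).
Proof. by move=> mu' mv; apply: meas2_ker; apply: measurable_funM; exact: meas2_incr. Qed.

(* Dominates, up to a constant, the second variation of the nonlocal energy at [w]
   in a direction [phi] supported in [[a, b]]. *)
Definition second_var_kernel w phi a b x h := ind (a <= x <= b) * sq_kernel (fun y => sin (w y)) x h
  + ind (a <= x <= b) * sq_kernel (fun y => cos (w y)) x h + sq_kernel phi x h.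

Lemma second_var_kernel_itg w g phi a b : fin_energy w g -> test_fun phi -> a <= b -> itg2 (sq_kernel (fun y => sin (w y))) ->
  itg2 (second_var_kernel w phi a b).
Proof.
move=> hw tp ab ks; apply: itg2D; last exact: sq_kernel_test.
apply: itg2D; last exact: sq_kernel_local hw ab.
apply: itg2_le ks.
  apply: measurable_funM; first exact: (meas2_fst (meas_cc a b)).
  by apply: meas2_k2; apply: cont_meas; apply: cont_sin_comp; exact: fin_energy_cont hw.
by move=> x h; rewrite norm_ind ger0_norm ?sq_kernel_ge0// ler_piMl ?sq_kernel_ge0 ?ind_le1.
Qed.

Lemma kernel_taylor w phi a b C t x h : 0 < a -> a <= b ->
  (forall x, ~~ (a <= x <= b) -> phi x = 0) -> (forall x, `|phi x| <= C) -> `|t| <= 1 ->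
  let M := 9 * (C ^+ 4 + 4 * C ^+ 2) + 4 * (C ^+ 2 + 1) in
  let U := cross_kernel (fun y => sin (w y)) (fun y => cos (w y) * phi y) x h in
  `|sq_kernel (fun y => sin (w y + t * phi y)) x h - sq_kernel (fun y => sin (w y)) x h - 2 * t * U|
    <= t ^+ 2 * (sq_kernel (fun y => sin (w y)) x h + M * second_var_kernel w phi a b x h) /\
  `|U| <= sq_kernel (fun y => sin (w y)) x h + M * second_var_kernel w phi a b x h.
Proof.
move=> a0 ab p0 pC t1 M U.
have [h1 h2] := sin_incr_taylor (i := a <= x <= b) (w (x + h)) (w x) t1 (pC (x + h)) (pC x) (p0 x).
set c := ind (0 < x) * (ind (0 < h) * h ^- 2).
have c0 : 0 <= c by rewrite !mulr_ge0 ?ind_ge0// invr_ge0 sqr_ge0.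
set dU := sin (w (x + h)) - sin (w x) in h1 h2.
set dY := cos (w (x + h)) * phi (x + h) - cos (w x) * phi x in h1 h2.
have e1 : sq_kernel (fun y => sin (w y)) x h = c * dU ^+ 2 by rewrite /sq_kernel /c /dU; ring.
have e2 : U = c * (dU * dY) by rewrite /U /cross_kernel /c /dU /dY; ring.
rewrite e1 e2.
set S := ind _ * _ + _ in h1 h2.
have e3 : second_var_kernel w phi a b x h = c * S by rewrite /second_var_kernel /sq_kernel /c /S /dU; ring.
rewrite e3; split.
  set dV := sin (w (x + h) + t * phi (x + h)) - sin (w x + t * phi x) in h1.
  have -> : sq_kernel (fun y => sin (w y + t * phi y)) x h = c * dV ^+ 2 by rewrite /sq_kernel /c /dV; ring.
  have -> : c * dV ^+ 2 - c * dU ^+ 2 - 2 * t * (c * (dU * dY)) = c * (dV ^+ 2 - dU ^+ 2 - 2 * t * (dU * dY)) by ring.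
  have -> : t ^+ 2 * (c * dU ^+ 2 + M * (c * S)) = c * (t ^+ 2 * (dU ^+ 2 + M * S)) by ring.
  by rewrite normrM ger0_norm// ler_wpM2l.
have -> : c * dU ^+ 2 + M * (c * S) = c * (dU ^+ 2 + M * S) by ring.
rewrite normrM ger0_norm// ler_wpM2l//.
have := sqr_ge0 (`|dU| - `|dY|); rewrite normrM; rewrite -/M in h2.
rewrite -[dU ^+ 2](real_normK (num_real dU)); rewrite -[dY ^+ 2](real_normK (num_real dY)) in h2.
have := normr_ge0 dU; have := normr_ge0 dY; move: h2; clear; nra.
Qed.

Lemma It2E (F : R -> R -> R) : itg2 F ->
  It (fun x => It (F x)) = \int[(mu \x mu)%E]_z F z.1 z.2.
Proof. by move=> Fi; rewrite It_itg2// /Rintegral (integral12_prod_meas1 Fi). Qed.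

Lemma It2D (F G : R -> R -> R) : itg2 F -> itg2 G ->
  It (fun x => It (fun y => F x y + G x y)) = It (fun x => It (F x)) + It (fun x => It (G x)).
Proof. by move=> Fi Gi; rewrite !It2E//; [rewrite RintegralD|exact: itg2D]. Qed.

Lemma It2Z k (F : R -> R -> R) : itg2 F ->
  It (fun x => It (fun y => k * F x y)) = k * It (fun x => It (F x)).
Proof. by move=> Fi; rewrite !It2E//; [rewrite RintegralZl|exact: itg2Z]. Qed.

Lemma It2_le (F G : R -> R -> R) : itg2 F -> itg2 G -> (forall x y, F x y <= G x y) ->
  It (fun x => It (F x)) <= It (fun x => It (G x)).
Proof. by move=> Fi Gi FG; rewrite !It2E//; apply: le_Rintegral. Qed.

Lemma test_itg f phi K : test_fun phi -> measurable_fun setT f -> (forall x, `|f x| <= K) ->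
  itg (fun x => f x * phi x).
Proof.
move=> tp mf fK; have [a [b [C [a0 ab C0 p0 pC]]]] := test_bound tp.
apply: (itgMb (C := K)) => //.
apply: (eq_itg (f := fun x => ind (a <= x <= b) * phi x)).
  by move=> x; have [h|h] := boolP (a <= x <= b); rewrite /ind ?mul1r// (p0 x h).1 mulr0.
by apply: litg_cont; exact: test_cont.
Qed.

Lemma test_div phi : test_fun phi -> itg (fun x => phi x / x) /\ itg (fun x => phi x ^+ 2 / x).
Proof.
move=> tp; have [a [b [C [a0 ab C0 p0 pC]]]] := test_bound tp.
have mp := cont_meas (test_cont tp).
have xi x : a <= x <= b -> `|x^-1| <= a^-1.
  by move=> /andP[ax xb]; rewrite normfV lef_pV2 ?posrE ?normr_gt0 ?gt_eqF ?(lt_le_trans a0 ax)//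
    (le_trans ax)// ler_norm.
split.
  apply: (eq_itg (f := fun x => ind (a <= x <= b) * (phi x / x))).
    by move=> x; have [h|h] := boolP (a <= x <= b); rewrite /ind ?mul1r// (p0 x h).1 !mul0r.
  apply: (itg_bnd (C := C * a^-1)); first by apply: measurable_funM => //; exact: meas_inv.
  by move=> x h; rewrite normrM ler_pM// ?(pC x).1 ?xi.
apply: (eq_itg (f := fun x => ind (a <= x <= b) * (phi x ^+ 2 / x))).
  by move=> x; have [h|h] := boolP (a <= x <= b); rewrite /ind ?mul1r// (p0 x h).1 expr0n !mul0r.
apply: (itg_bnd (C := C ^+ 2 * a^-1)).
  by apply: measurable_funM; [exact: measurable_funX|exact: meas_inv].
move=> x h; rewrite normrM ler_pM//; last exact: xi.
by rewrite normrX ler_pXn2r ?nnegrE//; exact: (pC x).1.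
Qed.

Lemma test_sq phi : test_fun phi -> itg (fun x => phi x ^+ 2).
Proof.
move=> tp; have [a [b [C [a0 ab C0 p0 pC]]]] := test_bound tp.
apply: (test_itg (f := phi) tp (cont_meas (test_cont tp))) => x; exact: (pC x).1.
Qed.

Section EulerLagrange.
Variables (beta nu : R) (eta : R -> R).
Hypotheses (beta0 : 0 < beta) (nu0 : 0 < nu) (heta : is_cutoff beta eta).
Variables (w g : R -> R) (ph : nat -> R -> R).
Hypotheses (hw : fin_energy w g) (hp : approximates ph w g).
Let Awb := local_density beta nu eta.
Let kp := nu / (4 * pi).
Hypotheses (Ai : itg (fun x => ind (0 < x) * Awb w g x)) (ki : itg2 (sq_kernel (fun y => sin (w y)))).
Hypothesis hmin : forall w1 g1 ph1, fin_energy w1 g1 -> approximates ph1 w1 g1 ->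
  itg (fun x => ind (0 < x) * Awb w1 g1 x) -> itg2 (sq_kernel (fun y => sin (w1 y))) ->
  repr_energy beta nu eta w g <= repr_energy beta nu eta w1 g1.

Lemma local_density_taylor (p p' t x : R) (w1 g1 : R -> R) : 0 < x -> w1 x = w x + t * p -> g1 x = g x + t * p' ->
  `|Awb w1 g1 x - Awb w g x - t * (g x * p' + sin (w x + beta) * cos (w x + beta) * p
     + 2 * kp * (sin (w x) * cos (w x) * p / x))|
   <= t ^+ 2 * (2^-1 * p' ^+ 2 + 2 * p ^+ 2 + 4 * kp * (p ^+ 2 / x)).
Proof.
move=> x0 ew eg; have kp0 : 0 < kp by exact: kp_gt0 nu0.
have T1 := sin2_taylor (w x + beta) (t * p); have T2 := sin2_taylor (w x) (t * p).
set D1 := (X in `|X| <= _) in T1; set D2 := (X in `|X| <= _) in T2.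
have -> : Awb w1 g1 x - Awb w g x - t * (g x * p' + sin (w x + beta) * cos (w x + beta) * p
     + 2 * kp * (sin (w x) * cos (w x) * p / x))
   = 2^-1 * (t ^+ 2 * p' ^+ 2) + 2^-1 * D1 + kp * (D2 / x).
  rewrite /Awb /local_density -/kp ew eg (addrAC (w x) (t * p) beta) /D1 /D2.
  by field; exact: lt0r_neq0.
apply: (le_trans (ler_normD _ _)); have -> : t ^+ 2 * (2^-1 * p' ^+ 2 + 2 * p ^+ 2 + 4 * kp * (p ^+ 2 / x))
  = (2^-1 * (t ^+ 2 * p' ^+ 2) + 2^-1 * (4 * (t * p) ^+ 2)) + kp * (4 * (t * p) ^+ 2 / x).
  by field; exact: lt0r_neq0.
apply: lerD.
  apply: (le_trans (ler_normD _ _)); apply: lerD.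
    by rewrite ger0_norm//; apply: mulr_ge0 => //; apply: mulr_ge0; exact: sqr_ge0.
  by rewrite normrM ger0_norm// ler_wpM2l.
rewrite normrM gtr0_norm//; apply: ler_wpM2l; first exact: ltW.
by rewrite normrM normfV (gtr0_norm x0); apply: ler_wpM2r; first by rewrite invr_ge0 ltW.
Qed.

(** The choice [t = - J / (2 K)] with [K = |D| + |J| + 1] satisfies [|t| <= 1] and gives the value
    [J ^+ 2 * (D - 2 K) / (4 K ^+ 2)], negative unless [J = 0]. *)
Lemma linear_term_eq0 (J D : R) : (forall t, `|t| <= 1 -> 0 <= t * J + t ^+ 2 * D) -> J = 0.
Proof.
move=> h; apply/eqP/negPn/negP => J0; pose K : R := `|D| + `|J| + 1; have J2 : 0 < J ^+ 2 by rewrite exprn_even_gt0.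
have K1 : 0 < K by rewrite /K; have := normr_ge0 D; have := normr_ge0 J; lra.
have t1 : `|- J / (2 * K)| <= 1.
  rewrite normrM normrN normfV (gtr0_norm (mulr_gt0 _ K1))// ler_pdivrMr ?mulr_gt0// mul1r /K.
  by have := normr_ge0 D; have := normr_ge0 J; lra.
have := h _ t1; apply/negP; rewrite -ltNge.
have -> : - J / (2 * K) * J + (- J / (2 * K)) ^+ 2 * D = J ^+ 2 / (4 * K ^+ 2) * (D - 2 * K).
  by field; exact: lt0r_neq0.
rewrite pmulr_rlt0; first by rewrite /K; have := ler_norm D; have := normr_ge0 D; have := normr_ge0 J; lra.
by apply: divr_gt0 => //; apply: mulr_gt0 => //; exact: exprn_gt0.
Qed.

Definition trig_meas f : continuous f -> measurable_fun setT (fun x => sin (f x) * cos (f x)).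
Proof.
by move=> cf; apply: cont_meas => x; apply: cvgM; [exact: cont_sin_comp|exact: cont_cos_comp].
Qed.

Lemma trig_le1 x : `|sin x * cos x| <= 1.
Proof. by rewrite normrM -[leRHS]mulr1 ler_pM// ?sin_norm_le1 ?cos_norm_le1. Qed.

Lemma contwb : continuous (fun x => w x + beta).
Proof. by move=> x; apply: cvgD; [exact: (fin_energy_cont hw)|exact: cvg_cst]. Qed.

Lemma euler_lagrange_itg phi : test_fun phi ->
  [/\ itg (fun x => g x * derive1 phi x), itg (fun x => sin (w x + beta) * cos (w x + beta) * phi x),
     itg (fun x => sin (w x) * cos (w x) * phi x / x)
   & itg2 (cross_kernel (fun y => sin (w y)) (fun y => cos (w y) * phi y))].
Proof.
move=> tp; have [g2 _ _ _] := hw; split.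
- exact: sq2M g2 (test_sq2 tp).
- by apply: (test_itg (K := 1) tp); [exact: (trig_meas contwb)|move=> x; exact: trig_le1].
- apply: (eq_itg (f := fun x => (sin (w x) * cos (w x)) * (phi x / x))).
    by move=> x; rewrite mulrA.
  apply: (itgMb (C := 1)); [exact: (trig_meas (fin_energy_cont hw))|by move=> x; exact: trig_le1|].
  exact: (test_div tp).1.
have [a [b [C [a0 ab C0 p0 pC]]]] := test_bound tp.
have p0' x : ~~ (a <= x <= b) -> phi x = 0 by move=> /p0[].
have pC' x : `|phi x| <= C by case: (pC x).
have z1 : `|0 : R| <= 1 by rewrite normr0.
apply: (itg2_le (G := fun x h => sq_kernel (fun y => sin (w y)) x h +
   (9 * (C ^+ 4 + 4 * C ^+ 2) + 4 * (C ^+ 2 + 1)) * second_var_kernel w phi a b x h)).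
- apply: meas2_kB; apply: cont_meas; first by apply: cont_sin_comp; exact: fin_energy_cont hw.
  move=> x; apply: cvgM; last exact: test_cont.
  by apply: cont_cos_comp; exact: fin_energy_cont hw.
- by move=> x h; exact: (kernel_taylor w x h a0 ab p0' pC' z1).2.
- by apply: itg2D => //; apply: itg2Z; exact: (second_var_kernel_itg hw tp ab ki).
Qed.

Lemma norm_sub2_le (p q r z : R) : `|p - q - r| <= z -> p <= q + (r + z).
Proof. by rewrite ler_norml => /andP[_]; rewrite !lerBlDl addrA. Qed.

Lemma expansion_ge0 (t X1 X0 Y1 Y0 V A1 A2 c J : R) : X0 + c * (2 * Y0) <= X1 + c * (2 * Y1) ->
  X1 <= X0 + (t * A1 + t ^+ 2 * A2) -> c * Y1 <= c * (Y0 + (2 * t * J + t ^+ 2 * V)) ->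
  0 <= t * (A1 + c * (2 * (2 * J))) + t ^+ 2 * (A2 + c * (2 * V)).
Proof. lra. Qed.

(** Only upper bounds of second order along [w + t phi] are used, so nothing is differentiated under
    the integral sign: minimality gives [0 <= t J + t ^+ 2 * D] for [|t| <= 1], which forces the
    first variation [J] to vanish. *)
Theorem euler_lagrange phi : test_fun phi ->
  It (fun x => g x * derive1 phi x) + It (fun x => sin (w x + beta) * cos (w x + beta) * phi x)
  + nu / (2 * pi) * (It (fun x => sin (w x) * cos (w x) * phi x / x)
     + It (fun x => It (cross_kernel (fun y => sin (w y)) (fun y => cos (w y) * phi y) x))) = 0.
Proof.
move=> tp; have [i1 i2 i3 iU] := euler_lagrange_itg tp.
have [a [b [C [a0 ab C0 p0 pC]]]] := test_bound tp.
have p0' x : ~~ (a <= x <= b) -> phi x = 0 by move=> /p0[].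
have pC' x : `|phi x| <= C by case: (pC x).
have pi0 := pi_gt0 R; have kp0 : 0 < kp by exact: kp_gt0 nu0.
pose U := cross_kernel (fun y => sin (w y)) (fun y => cos (w y) * phi y).
pose a1 x := g x * derive1 phi x + sin (w x + beta) * cos (w x + beta) * phi x
  + 2 * kp * (sin (w x) * cos (w x) * phi x / x).
pose a2 x := 2^-1 * derive1 phi x ^+ 2 + 2 * phi x ^+ 2 + 4 * kp * (phi x ^+ 2 / x).
have ia1 : itg a1 by apply: itgD; [exact: itgD|exact: itgZ].
have ia2 : itg a2.
  apply: itgD; [apply: itgD; apply: itgZ|apply: itgZ].
  - exact: (test_sq2 tp).2.
  - exact: test_sq.
  - exact: (test_div tp).2.
have Ia1 : It a1 = It (fun x => g x * derive1 phi x) +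
    It (fun x => sin (w x + beta) * cos (w x + beta) * phi x)
    + 2 * kp * It (fun x => sin (w x) * cos (w x) * phi x / x).
  by rewrite /a1 (ItD (itgD i1 i2) (itgZ _ i3)) (ItD i1 i2) (ItZ _ i3).
pose M := 9 * (C ^+ 4 + 4 * C ^+ 2) + 4 * (C ^+ 2 + 1).
pose G x h := sq_kernel (fun y => sin (w y)) x h + M * second_var_kernel w phi a b x h.
have iG : itg2 G by apply: itg2D => //; apply: itg2Z; exact: (second_var_kernel_itg hw tp ab ki).
set JU := It (fun x => It (U x)).
(* One factor [2] is the symmetry factor in [repr_energy], the other comes from differentiating a
   square. *)
suff : It a1 + nu / (8 * pi) * (2 * (2 * JU)) = 0.
  move=> E; rewrite -[RHS]E Ia1 /kp.
  have h (p x y z : R) : p != 0 -> x + nu / (2 * p) * (y + z) = x + 2 * (nu / (4 * p)) * y + nu / (8 * p) * (2 * (2 * z)).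
    by move=> p_neq0; field.
  by apply: h; exact: lt0r_neq0.
apply: (linear_term_eq0 (D := It a2 + nu / (8 * pi) * (2 * It (fun x => It (G x))))) => t t1.
pose w1 x := w x + t * phi x; pose g1 x := g x + t * derive1 phi x.
have h1 : fin_energy w1 g1 := fin_energy_addt t hw tp; have p1 := approximates_addt t hp tp.
have mA1 : measurable_fun setT (fun x => ind (0 < x) * Awb w1 g1 x).
  apply: measurable_funM; first exact: meas_lt.
  by have [[m1 _] _ _ _] := h1; exact: (meas_Aw nu heta (fin_energy_meas h1) m1).
have zero x : x <= 0 -> a1 x = 0 /\ a2 x = 0.
  move=> x0; have [e1 e2] := test_le0 tp x0; rewrite /a1 /a2 e1 e2.
  by rewrite expr0n /= !(mulr0, mul0r, addr0).
have tay x : `|ind (0 < x) * Awb w1 g1 x - ind (0 < x) * Awb w g x - t * a1 x| <= t ^+ 2 * a2 x.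
  have [x0|x0] := ltP 0 x; rewrite /ind ?mul1r ?mul0r.
    exact: (@local_density_taylor (phi x) (derive1 phi x) t x w1 g1).
  by have [-> ->] := zero x x0; rewrite !mulr0 !subr0 normr0.
have A1i : itg (fun x => ind (0 < x) * Awb w1 g1 x).
  apply: (itg_le (g := fun x => `|ind (0 < x) * Awb w g x| + `|t * a1 x| + t ^+ 2 * a2 x)) => //.
    move=> x; have := tay x; set A := ind _ * Awb w1 g1 x; set B := ind _ * _.
    have := ler_normD (A - B - t * a1 x) (B + t * a1 x); have := ler_normD B (t * a1 x).
    by rewrite (_ : A - B - t * a1 x + (B + t * a1 x) = A); [lra|ring].
  apply: itgD; last exact: itgZ.
  by apply: itgD; apply: itg_norm => //; exact: itgZ.
have kt x h := (kernel_taylor w x h a0 ab p0' pC' t1).1.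
have iR : itg2 (fun x h => sq_kernel (fun y => sin (w y)) x h + ((2 * t) * U x h + t ^+ 2 * G x h)).
  by apply: itg2D => //; apply: itg2D; exact: itg2Z.
have k1i : itg2 (sq_kernel (fun y => sin (w1 y))).
  apply: (itg2_le (G := fun x h => sq_kernel (fun y => sin (w y)) x h + ((2 * t) * U x h + t ^+ 2 * G x h))) => //.
    by apply: meas2_k2; apply: cont_meas; apply: cont_sin_comp; exact: fin_energy_cont h1.
  by move=> x h; rewrite ger0_norm ?sq_kernel_ge0//; exact: norm_sub2_le (kt x h).
have := hmin h1 p1 A1i k1i.
have L1 : It (fun x => ind (0 < x) * Awb w1 g1 x) <= It (fun x => ind (0 < x) * Awb w g x) + (t * It a1 + t ^+ 2 * It a2).
  have j1 := itgZ t ia1; have j2 := itgZ (t ^+ 2) ia2.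
  rewrite -(ItZ t ia1) -(ItZ (t ^+ 2) ia2) -(ItD j1 j2) -(ItD Ai (itgD j1 j2)).
  apply: It_le => //; first by apply: itgD => //; exact: itgD.
  by move=> x; exact: norm_sub2_le (tay x).
have L2 : It (fun x => It (sq_kernel (fun y => sin (w1 y)) x)) <=
    It (fun x => It (sq_kernel (fun y => sin (w y)) x)) + (2 * t * JU + t ^+ 2 * It (fun x => It (G x))).
  have E1 := It2D (itg2Z (2 * t) iU) (itg2Z (t ^+ 2) iG).
  rewrite (It2Z (2 * t) iU) (It2Z (t ^+ 2) iG) in E1; rewrite /JU -E1.
  have E2 := It2D ki (itg2D (itg2Z (2 * t) iU) (itg2Z (t ^+ 2) iG)); rewrite -E2.
  by apply: It2_le => // x h; exact: norm_sub2_le (kt x h).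
rewrite /repr_energy -/Awb -/Awb => h.
have c0 : 0 < nu / (8 * pi) by rewrite divr_gt0// mulr_gt0.
move: (ler_wpM2l (ltW c0) L2); move: h L1.
exact: expansion_ge0.
Qed.

End EulerLagrange.

End FirstVariation.

(** * First regularity *)

Section Reflection.
Context {R : realType}.
Implicit Types (f g v w u F G phi : R -> R) (a b c d e h s t x y z : R).
Local Notation mu := (@lebesgue_measure R).

Lemma measurable_opp : measurable_fun setT (fun x : R => - x).
Proof. by apply: measurable_funN; exact: measurable_id. Qed.

Lemma lebesgue_measure_opp (A : set R) : measurable A ->
  pushforward mu (fun x : measurableTypeR R => (- x : measurableTypeR R)) A = mu A.
Proof.
move=> mA.
have mphi : measurable_fun [set: measurableTypeR R]
  (fun x : measurableTypeR R => (- x : measurableTypeR R)) := measurable_opp.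
pose phi : {mfun measurableTypeR R >-> measurableTypeR R} :=
  HB.pack (fun x : measurableTypeR R => (- x : measurableTypeR R))
    (isMeasurableFun.Build _ _ _ _ _ mphi).
apply/esym/(lebesgue_measure_unique (mu := pushforward mu phi)) => //=.
move=> _ [[a b]] _ <-; rewrite /pushforward.
rewrite (_ : _ @^-1` _ = `[- b, - a[%classic); last first.
  by apply/seteqP; split => x /=; rewrite !in_itv/= lerNl ltrNr andbC.
rewrite !lebesgue_measure_itv/= !lte_fin -!EFinD ltrN2.
case: ifPn => // _; congr (_%:E).
by rewrite opprK addrC.
Qed.

Lemma ge0_integral_opp (F : R -> \bar R) : measurable_fun setT F ->
  (forall x, 0 <= F x)%E ->
  (\int[mu]_x F (- x)%R = \int[mu]_x F x)%E.
Proof.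
move=> mF F0.
have ms : measurable_fun [set: measurableTypeR R]
  (fun x : measurableTypeR R => (- x : measurableTypeR R)) := measurable_opp.
have := @ge0_integral_pushforward _ _ (measurableTypeR R) (measurableTypeR R) R
  _ ms mu setT F measurableT mF (fun x _ => F0 x).
rewrite preimage_setT => <-; apply: eq_measure_integral => A mA _.
exact: lebesgue_measure_opp.
Qed.

Lemma meas_opp f : measurable_fun setT f -> measurable_fun setT (fun x : R => f (- x)).
Proof. by move=> mf; apply: (measurableT_comp mf); exact: measurable_opp. Qed.

Lemma itg_opp f : itg f -> itg (fun x => f (- x)).
Proof.
move=> fi; have mf := itg_meas fi; move/integrableP : fi => [_ foo].
apply/integrableP; split; first by apply/measurable_EFinP; exact: meas_opp.
rewrite (ge0_integral_opp (F := fun x => `|(f x)%:E|%E))//.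
by apply: measurableT_comp => //; exact/measurable_EFinP.
Qed.

Lemma It_opp f : measurable_fun setT f -> It (fun x => f (- x)) = It f.
Proof.
move=> mf; have mf' : measurable_fun setT (EFin \o f) by exact/measurable_EFinP.
have E (G H : R -> \bar R) : measurable_fun setT G -> (forall x, 0 <= G x)%E ->
    (forall x, H x = G (- x)) -> (\int[mu]_x H x = \int[mu]_x G x)%E.
  move=> mG G0 HG; rewrite -(ge0_integral_opp mG G0).
  by apply: eq_integral => x _; exact: HG.
rewrite /It /Rintegral; congr fine; rewrite [LHS]integralE [RHS]integralE.
congr (_ - _)%E.
- by apply: E => //; [exact: measurable_funepos|move=> x; rewrite !funeposE].
- by apply: E => //; [exact: measurable_funeneg|move=> x; rewrite !funenegE].
Qed.

Lemma meas2_shear (F : R -> R -> R) : meas2 F -> meas2 (fun x h => F (x + h) h).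
Proof.
move=> mF.
have mp : measurable_fun setT (fun z : measurableTypeR R * measurableTypeR R =>
    ((z.1 + z.2 : measurableTypeR R), (z.2 : measurableTypeR R))).
  apply: measurable_fun_pair; last exact: measurable_snd.
  by apply: measurable_funD; [exact: measurable_fst|exact: measurable_snd].
exact: (measurableT_comp mF mp).
Qed.

Lemma itg2_shear (F : R -> R -> R) : itg2 F -> itg2 (fun x h => F (x + h) h).
Proof.
move=> Fi; have mF := itg2_meas Fi.
have mS : measurable_fun setT
    (fun z : measurableTypeR R * measurableTypeR R => (F (z.1 + z.2) z.2)%:E).
  by apply/measurable_EFinP; exact: meas2_shear.
have mF' : measurable_fun setT
    (fun z : measurableTypeR R * measurableTypeR R => (F z.1 z.2)%:E).
  exact/measurable_EFinP.
apply/(integrable21ltyP _ _ mS); apply: le_lt_trans ((integrable21ltyP _ _ mF').1 Fi).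
rewrite le_eqVlt; apply/orP; left; apply/eqP; apply: eq_integral => h _ /=.
apply: (ge0_integral_shift h (F := fun x => `|(F x h)%:E|%E)) => //.
apply: measurableT_comp => //; apply/measurable_EFinP.
exact: (meas2_1 h (meas2C mF)).
Qed.

Lemma It_shear (F : R -> R -> R) : itg2 F ->
  It (fun x => It (fun h => F (x + h) h)) = It (fun x => It (F x)).
Proof.
move=> Fi; rewrite (It_fubini (itg2_shear Fi)) (It_fubini Fi); apply: eq_It => h.
by apply: (It_shift h (f := fun x => F x h)); exact: (meas2_1 h (meas2C (itg2_meas Fi))).
Qed.

End Reflection.

(** * The chain rule for [cos w * phi] *)

Section ChainRule.
Context {R : realType}.
Implicit Types (f g v w u F G phi : R -> R) (a b c d e h s t x y z : R).
Local Notation mu := (@lebesgue_measure R).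

(** The formula is exact for the smooth [ph n]. The error is [r - s]: [r] involves differences of
    sines and cosines and tends to zero by dominated convergence, while [s] involves [ph n' - g] and
    tends to zero by Cauchy-Schwarz. *)
Lemma approximates_cos w g (ph : nat -> R -> R) phi : fin_energy w g -> approximates ph w g -> test_fun phi ->
  let p y := cos (w y) * derive1 phi y - sin (w y) * g y * phi y in
  itg p /\ (forall x y, x <= y -> cos (w y) * phi y - cos (w x) * phi x = II x y p).
Proof.
move=> hw [tp cg cw] tphi p; have [g2 _ _ _] := hw.
have [a [b [C [a0 ab C0 p0 pC]]]] := test_bound tphi.
have mw := fin_energy_meas hw; have cwt := fin_energy_cont hw.
have mphi := cont_meas (test_cont tphi); have mdphi := cont_meas (test_dcont tphi).
have mcos f : measurable_fun setT f -> measurable_fun setT (fun x => cos (f x)).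
  by move=> mf; apply: (measurableT_comp _ mf); apply: cont_meas; exact: continuous_cos.
have msin f : measurable_fun setT f -> measurable_fun setT (fun x => sin (f x)).
  by move=> mf; apply: (measurableT_comp _ mf); apply: cont_meas; exact: continuous_sin.
have mph n := cont_meas (test_cont (tp n)).
have i1 : itg (fun x => derive1 phi x).
  apply: (eq_itg (f := fun x => ind (a <= x <= b) * derive1 phi x)).
    by move=> x; have [h|h] := boolP (a <= x <= b); rewrite /ind ?mul1r// mul0r (p0 x h).2.
  exact: litg_cont (test_dcont tphi) _ _.
have igphi : itg (fun x => g x * phi x).
  by apply: sq2M => //; split => //; exact: test_sq.
have ip : itg p.
  apply: itgB; first by apply: (itgMb (C := 1)) => //; [exact: mcos|move=> x; exact: cos_norm_le1].
  apply: (eq_itg (f := fun x => sin (w x) * (g x * phi x))); first by move=> x; rewrite mulrA.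
  by apply: (itgMb (C := 1)) => //; [exact: msin|move=> x; exact: sin_norm_le1].
split => // x y xy.
pose q n z := cos (ph n z) * derive1 phi z - sin (ph n z) * derive1 (ph n) z * phi z.
have qrt_mass n : continuous (q n).
  move=> z; have cph := test_cont (tp n); apply: cvgB.
    by apply: cvgM; [exact: cont_cos_comp|exact: test_dcont].
  apply: cvgM; last exact: test_cont.
  by apply: cvgM; [exact: cont_sin_comp|exact: test_dcont].
have E n : cos (ph n y) * phi y - cos (ph n x) * phi x = II x y (q n).
  symmetry; apply: (@FTC2 _ (fun z => cos (ph n z) * phi z)).
  - exact: xy.
  - exact: contT_within.
  - apply: contT_within => z; apply: cvgM; last exact: test_cont.
    by apply: cont_cos_comp; exact: test_cont.
  move=> z _; have d1 := is_derive1_comp (f := cos) (g := ph n) (is_derive_cos _) (test_is_derive z (tp n)).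
  apply: (is_derive_eq (is_deriveM d1 (test_is_derive z tphi))).
  by rewrite /GRing.scale/= /q; ring.
have hL : cos (ph n y) * phi y - cos (ph n x) * phi x @[n --> \oo] --> cos (w y) * phi y - cos (w x) * phi x.
  have h z : cos (ph n z) * phi z @[n --> \oo] --> cos (w z) * phi z.
    apply: cvgM; last exact: cvg_cst.
    by apply: (cvg_comp _ _ (cw z)); exact: continuous_cos.
  by apply: cvgB.
apply: (cvgn_uniq hL _ E).
pose r n z := ind (x <= z <= y) * ((cos (ph n z) - cos (w z)) * derive1 phi z - (sin (ph n z) - sin (w z)) * (g z * phi z)).
pose s n z := ind (x <= z <= y) * (sin (ph n z) * phi z * (derive1 (ph n) z - g z)).
have hr : It (r n) @[n --> \oo] --> It (fun=> 0 : R).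
  apply: (It_dom (g := fun z => 2 * `|derive1 phi z| + 2 * `|g z * phi z|) _ _ _ _).2.
  - move=> n; apply: measurable_funM; first exact: meas_cc.
    apply: measurable_funB; apply: measurable_funM => //.
    + by apply: measurable_funB; exact: mcos.
    + by apply: measurable_funB; exact: msin.
    + by apply: measurable_funM => //; exact: g2.1.
  - move=> z; rewrite /r.
    have -> : 0 = ind (x <= z <= y) * ((cos (w z) - cos (w z)) * derive1 phi z - (sin (w z) - sin (w z)) * (g z * phi z)) by ring.
    apply: cvgM; first exact: cvg_cst.
    apply: cvgB; apply: cvgM; try exact: cvg_cst; apply: cvgB; try exact: cvg_cst.
      by apply: (cvg_comp _ _ (cw z)); exact: continuous_cos.
    by apply: (cvg_comp _ _ (cw z)); exact: continuous_sin.
  - move=> n z; rewrite /r norm_ind; apply: (@le_trans _ _ (1 * (2 * `|derive1 phi z| + 2 * `|g z * phi z|))); last by rewrite mul1r.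
    apply: ler_pM; rewrite ?ind_ge0 ?ind_le1//.
    apply: (le_trans (ler_normB _ _)); rewrite [X in X + _ <= _]normrM [X in _ + X <= _]normrM.
    apply: lerD; apply: ler_wpM2r => //; apply: (le_trans (ler_normB _ _)).
      by have := cos_norm_le1 (ph n z); have := cos_norm_le1 (w z); lra.
    by have := sin_norm_le1 (ph n z); have := sin_norm_le1 (w z); lra.
  - by apply: itgD; apply: itgZ; apply: itg_norm.
have is_ n : itg (s n).
  apply: (eq_itg (f := fun z => (ind (x <= z <= y) * (sin (ph n z))) * (phi z * (derive1 (ph n) z - g z)))).
    by move=> z; rewrite /s; ring.
  apply: (itgMb (C := 1)).
  - by apply: measurable_funM; [exact: meas_cc|exact: msin].
  - by move=> z; rewrite norm_ind -[leRHS]mulr1 ler_pM ?ind_ge0 ?ind_le1 ?sin_norm_le1.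
  apply: sq2M; first by split => //; exact: test_sq.
  by apply: sq2B => //; exact: test_sq2.
have hs : It (s n) @[n --> \oo] --> (0 : R).
  apply/cvgrPdist_le => e e0.
  have hs' : C * (Num.sqrt (y - x) * Num.sqrt (It (fun z => (derive1 (ph n) z - g z) ^+ 2)))
    @[n --> \oo] --> C * (Num.sqrt (y - x) * 0).
    by apply: cvgM; [exact: cvg_cst|apply: cvgM; [exact: cvg_cst|exact: (cvg_sqrt_It cg)]].
  rewrite !mulr0 in hs'; move/cvgrPdist_le : hs' => /(_ _ e0).
  apply: filterS => n; rewrite !sub0r !normrN [`|C * _|]ger0_norm; last first.
    by rewrite !mulr_ge0 ?sqrtr_ge0.
  apply: le_trans.
  have d2 : l2_fun (fun z => derive1 (ph n) z - g z) by apply: sq2B => //; exact: test_sq2.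
  apply: (@le_trans _ _ (C * II x y (fun z => `|derive1 (ph n) z - g z|))).
    rewrite /II -ItZ; last exact: l2_fun_litg (l2_fun_norm d2) _ _.
    apply: It_norm_le; first exact: itg_meas.
      by apply: itgZ; exact: l2_fun_litg (l2_fun_norm d2) _ _.
    move=> z; rewrite /s norm_ind mulrCA; apply: ler_wpM2l; first exact: ind_ge0.
    rewrite normrM; apply: ler_wpM2r => //; rewrite normrM -[leRHS]mul1r.
    by apply: ler_pM => //; [exact: sin_norm_le1|exact: (pC z).1].
  apply: ler_wpM2l => //; apply: (le_trans (ler_norm _)).
  apply: (le_trans (II_CS xy (l2_fun_norm d2))); apply: ler_wpM2l; first exact: sqrtr_ge0.
  rewrite le_eqVlt; apply/orP; left; apply/eqP; congr Num.sqrt; apply: eq_It => z.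
  by rewrite real_normK// num_real.
have -> : II x y p = It (fun=> 0 : R) - 0 + II x y p by rewrite It0 subr0 add0r.
rewrite (_ : (fun n => II x y (q n)) = (fun n => It (r n) - It (s n) + II x y p)).
  by apply: cvgD; [exact: cvgB|exact: cvg_cst].
apply/funext => n.
have ir : itg (r n).
  apply: (itg_le (g := fun z => `|ind (x <= z <= y) * q n z| + `|ind (x <= z <= y) * p z| + `|s n z|)).
  - apply: measurable_funM; first exact: meas_cc.
    apply: measurable_funB; apply: measurable_funM => //.
    + by apply: measurable_funB; exact: mcos.
    + by apply: measurable_funB; exact: msin.
    + by apply: measurable_funM => //; exact: g2.1.
  - move=> z.
    have -> : r n z = ind (x <= z <= y) * q n z - ind (x <= z <= y) * p z + s n z by rewrite /r /s /q /p; ring.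
    by apply: (le_trans (ler_normD _ _)); rewrite lerD2r ler_normB.
  - apply: itgD; last exact: itg_norm.
    by apply: itgD; apply: itg_norm; [exact: litg_cont|exact: itg_litg].
have ip' : itg (fun z => ind (x <= z <= y) * p z) by exact: itg_litg.
rewrite -ItB// /II -ItD//; last exact: itgB.
by apply: eq_It => z; rewrite /r /s /q /p; ring.
Qed.

End ChainRule.

(** * The nonlocal term as a logarithmic potential *)

Section Bracket.
Context {R : realType}.
Implicit Types (f g v w F G phi : R -> R) (c d e h s t x y z : R).
Local Notation mu := (@lebesgue_measure R).

(* Reflecting [h] turns the principal value of the half-Laplacian into the
   absolutely convergent integral of [h ^- 2 * sym_diff u x h] over [h > 0]. *)
Definition sym_diff (u : R -> R) x h := 2 * u x - u (x + h) - u (x - h).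

Lemma meas_lc a b : measurable_fun setT (fun x => ind (a < x <= b) : R).
Proof. by have := meas_itv (`]a, b])%O; under eq_fun do rewrite in_itv. Qed.

Variables (u psi p : R -> R) (N C a b : R).
Hypotheses (mu_ : measurable_fun setT u) (u1 : forall x, `|u x| <= 1) (u0 : forall x, x <= 0 -> u x = 0).
Hypothesis N0 : 0 <= N.
Hypothesis uN : forall x y, `|u y - u x| <= N * Num.sqrt `|y - x|.

Lemma sym_diff_le4 x h : `|sym_diff u x h| <= 4.
Proof.
rewrite /sym_diff; have := u1 x; have := u1 (x + h); have := u1 (x - h).
by rewrite !ler_norml => /andP[? ?] /andP[? ?] /andP[? ?]; apply/andP; split; lra.
Qed.

Lemma meas2_del : meas2 (sym_diff u).
Proof.
apply: measurable_funB; last exact: meas2_sub.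
apply: measurable_funB; last exact: meas2_add.
by apply: (meas2_fst (f := fun x => 2 * u x)); exact: measurable_funM.
Qed.

Definition incr y s := u (y + s) - u (y - s).

Lemma meas2_incr2 : meas2 incr.
Proof. by apply: measurable_funB; [exact: meas2_add|exact: meas2_sub]. Qed.

Lemma incr_le y s : 0 < s <= 1 -> `|incr y s| <= 2 * N * qrt s.
Proof.
move=> /andP[s0 s1]; apply: (le_trans (uN _ _)).
rewrite (_ : y + s - (y - s) = 4 * s - 2 * s); last by ring.
rewrite gtr0_norm; last by lra.
rewrite -mulrA mulrCA ler_wpM2l//.
apply: (@le_trans _ _ (Num.sqrt (4 * s))).
  by rewrite ler_wsqrtr//; lra.
rewrite sqrtrM// (_ : 4 = 2 ^+ 2); last by rewrite expr2 -natrM.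
rewrite sqrtr_sqr ger0_norm// ler_wpM2l// -qrt2 expr2 ler_piMl ?qrt_ge0// qrt_le1//.
Qed.

(** Geometric mean of the bounds [2 N * sqrt |y - z|] and [4 N * sqrt s]: one half of the exponent
    is kept as regularity in [y], the other makes the weight [1/s] integrable. *)
Lemma incr_hol y z s : 0 < s -> `|incr y s - incr z s| <= 4 * N * qrt `|y - z| * qrt s.
Proof.
move=> s0; set X := `|_|.
have h1 : X <= 2 * N * Num.sqrt `|y - z|.
  rewrite /X /incr (_ : _ - _ = (u (y + s) - u (z + s)) - (u (y - s) - u (z - s))); last by ring.
  apply: (le_trans (ler_normB _ _)); rewrite -mulrA mulr_natl mulr2n; apply: lerD.
    by apply: (le_trans (uN _ _)); rewrite (_ : y + s - (z + s) = y - z)//; ring.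
  by apply: (le_trans (uN _ _)); rewrite (_ : y - s - (z - s) = y - z)//; ring.
have hs t : `|incr t s| <= 2 * N * Num.sqrt s.
  apply: (le_trans (uN _ _)); rewrite (_ : t + s - (t - s) = 2 * s); last by ring.
  rewrite gtr0_norm ?mulr_gt0// sqrtrM// mulrAC mulrA mulrC -mulrA mulrCA.
  rewrite [leRHS](_ : _ = Num.sqrt s * (N * 2)); last by ring.
  rewrite ler_wpM2l ?sqrtr_ge0// ler_wpM2l//.
  by rewrite -[leRHS]ger0_norm// -sqrtr_sqr ler_wsqrtr// expr2 ler_peMr// ler1n.
have h2 : X <= 4 * N * Num.sqrt s.
  by apply: (le_trans (ler_normB _ _)); have := hs y; have := hs z; lra.
have X0 : 0 <= X by exact: normr_ge0.
have q1 := qrt_ge0 `|y - z|; have q2 := qrt_ge0 s.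
rewrite -(ler_pXn2r (n := 2)) ?nnegrE ?mulr_ge0//.
rewrite -qrt2 in h1; rewrite -qrt2 in h2.
have := ler_pM X0 X0 h1 h2; rewrite -expr2 => /le_trans; apply.
have := mulr_ge0 (sqr_ge0 N) (mulr_ge0 (sqr_ge0 (qrt `|y - z|)) (sqr_ge0 (qrt s))); lra.
Qed.

(** On []0, 1]] this is the integral of [h ^- 2] over [[s, 1]], which appears when [s] and [h] are
    exchanged in [near_part]. *)
Definition log_weight s := ind (0 < s <= 1) * (s^-1 - 1).

Lemma meas_wk : measurable_fun setT log_weight.
Proof.
apply: measurable_funM; first exact: meas_lc.
by apply: measurable_funB => //; exact: meas_inv.
Qed.

Lemma log_weight_ge0 s : 0 <= log_weight s.
Proof.
rewrite /log_weight; have [/andP[s0 s1]|h] := boolP (0 < s <= 1); rewrite /ind ?mul0r// mul1r.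
by rewrite subr_ge0 invf_ge1.
Qed.

Lemma log_weight_le s : log_weight s * qrt s <= ind (0 < s <= 1) * (qrt s / s).
Proof.
rewrite /log_weight -mulrA; apply: ler_wpM2l; first exact: ind_ge0.
by rewrite [leRHS]mulrC mulrBl mul1r lerBlDr lerDl qrt_ge0.
Qed.

(* Truncated logarithmic potential: [F' = - \int_0^1 sym_diff u x h / h ^ 2 dh] formally. *)
Definition log_pot y := It (fun s => log_weight s * incr y s).

Definition qrt_mass : R := It (fun s => ind (0 < s <= 1) * (qrt s / s)).

Lemma qrt_mass_ge0 : 0 <= qrt_mass.
Proof.
apply: It_ge0 => s; have [/andP[s0 s1]|h] := boolP (0 < s <= 1); rewrite /ind ?mul0r//.
by rewrite mul1r divr_ge0 ?qrt_ge0// ltW.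
Qed.

Lemma log_weight_incr_itg y : itg (fun s => log_weight s * incr y s).
Proof.
apply: (itg_le (g := fun s => 2 * N * (ind (0 < s <= 1) * (qrt s / s)))).
- by apply: measurable_funM; [exact: meas_wk|exact: (meas2_1 y meas2_incr2)].
- move=> s; rewrite normrM (ger0_norm (log_weight_ge0 s)).
  have [h|h] := boolP (0 < s <= 1); last by rewrite /log_weight (negbTE h) /ind !mul0r mulr0.
  have := log_weight_le s; rewrite h /ind mul1r => hw.
  apply: (@le_trans _ _ (2 * N * (log_weight s * qrt s))).
    by rewrite mulrCA ler_wpM2l ?log_weight_ge0// incr_le.
  by rewrite ler_wpM2l ?mulr_ge0.
- by apply: itgZ; exact: itg_qrt.
Qed.

Lemma log_pot_bound y : `|log_pot y| <= 2 * N * qrt_mass.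
Proof.
rewrite /log_pot /qrt_mass -ItZ; last exact: itg_qrt.
apply: It_norm_le; first exact: itg_meas (log_weight_incr_itg y).
- by apply: itgZ; exact: itg_qrt.
move=> s; rewrite normrM (ger0_norm (log_weight_ge0 s)).
have [h|h] := boolP (0 < s <= 1); last by rewrite /log_weight (negbTE h) /ind !mul0r mulr0.
have := log_weight_le s; rewrite h /ind mul1r => hw.
apply: (@le_trans _ _ (2 * N * (log_weight s * qrt s))).
  by rewrite mulrCA ler_wpM2l ?log_weight_ge0// incr_le.
by rewrite ler_wpM2l ?mulr_ge0.
Qed.

Lemma log_pot_hol y z : `|log_pot y - log_pot z| <= 4 * N * qrt_mass * qrt `|y - z|.
Proof.
rewrite /log_pot -ItB; [|exact: log_weight_incr_itg|exact: log_weight_incr_itg].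
rewrite (_ : 4 * N * qrt_mass * _ = It (fun s => 4 * N * qrt `|y - z| * (ind (0 < s <= 1) * (qrt s / s)))); last first.
  by rewrite ItZ; [rewrite -/qrt_mass; ring|exact: itg_qrt].
apply: It_norm_le.
- by apply: itg_meas; apply: itgB; exact: log_weight_incr_itg.
- by apply: itgZ; exact: itg_qrt.
move=> s; rewrite -mulrBr normrM (ger0_norm (log_weight_ge0 s)).
have [h|h] := boolP (0 < s <= 1); last by rewrite /log_weight (negbTE h) /ind !mul0r mulr0.
have := log_weight_le s; rewrite h /ind mul1r => hw; move/andP: h => [s0 s1].
apply: (@le_trans _ _ (4 * N * qrt `|y - z| * (log_weight s * qrt s))).
  by rewrite mulrCA ler_wpM2l ?log_weight_ge0// incr_hol.
by rewrite ler_wpM2l ?mulr_ge0 ?qrt_ge0.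
Qed.

Definition far_half_lap x := It (fun h => ind (1 < h) * (h ^- 2 * sym_diff u x h)).

Lemma ind_lt_le h : ind (1 < h) <= ind (1 <= h) :> R.
Proof. by have [h1|h1] := ltP 1 h; rewrite /ind ?(ltW h1)//; case: ifP. Qed.

Lemma far_le x h : `|ind (1 < h) * (h ^- 2 * sym_diff u x h)| <= 4 * (ind (1 <= h) * h ^- 2).
Proof.
have hi : 0 <= h ^- 2 by rewrite invr_ge0 sqr_ge0.
rewrite norm_ind normrM ger0_norm// (_ : _ * _ = `|sym_diff u x h| * (ind (1 < h) * h ^- 2)); last by ring.
apply: ler_pM => //.
- by rewrite mulr_ge0 ?ind_ge0.
- exact: sym_diff_le4.
- by rewrite ler_wpM2r// ind_lt_le.
Qed.

Lemma meas2_far : meas2 (fun x h => ind (1 < h) * (h ^- 2 * sym_diff u x h)).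
Proof.
apply: measurable_funM; first exact: (meas2_snd (meas_lt 1)).
by apply: measurable_funM; [exact: (meas2_snd meas_inv2)|exact: meas2_del].
Qed.

Lemma far_itg x : itg (fun h => ind (1 < h) * (h ^- 2 * sym_diff u x h)).
Proof.
apply: (itg_le (g := fun h => 4 * (ind (1 <= h) * h ^- 2))).
- exact: (meas2_1 x meas2_far).
- by move=> h; exact: far_le.
- by apply: itgZ; exact: (itg_inv2 ltr01).1.
Qed.

Lemma far_itg2 f : itg f -> itg2 (fun x h => f x * (ind (1 < h) * (h ^- 2 * sym_diff u x h))).
Proof.
move=> fi; apply: (itg2_prod (f := fun x => `|f x|) (g := fun h => 4 * (ind (1 <= h) * h ^- 2))).
- by apply: measurable_funM; [exact: (meas2_fst (itg_meas fi))|exact: meas2_far].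
- exact: itg_norm.
- by apply: itgZ; exact: (itg_inv2 ltr01).1.
by move=> x h; rewrite normrM ler_wpM2l// far_le.
Qed.

Lemma far_half_lap_bound x : `|far_half_lap x| <= 4.
Proof.
apply: (@le_trans _ _ (It (fun h => 4 * (ind (1 <= h) * h ^- 2)))).
  apply: It_norm_le; [exact: (meas2_1 x meas2_far)| |by move=> h; exact: far_le].
  by apply: itgZ; exact: (itg_inv2 ltr01).1.
by rewrite ItZ ?(itg_inv2 ltr01).2 ?invr1 ?mulr1//; exact: (itg_inv2 ltr01).1.
Qed.

Lemma litg_Lf : litg far_half_lap.
Proof.
move=> c d; apply: eq_itg (itg2_fst (far_itg2 (itg_ind c d))) => x.
by rewrite ItZ//; exact: far_itg.
Qed.

Hypotheses (ip : itg p) (ipsi : itg psi).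
Hypothesis psip : forall x y, x <= y -> psi y - psi x = II x y p.
Hypotheses (a0 : 0 < a) (psia : forall x, x < a -> psi x = 0).
Hypothesis iux : itg (fun x => u x * psi x / x).
Hypothesis iB : itg2 (cross_kernel u psi).

Let mpsi := itg_meas ipsi.
Let mp := itg_meas ip.

Definition kF x h := ind (0 < h) * ((u (x + h) - u x) * (psi (x + h) - psi x) * h ^- 2).

(** Removing the condition [0 < x] from [cross_kernel] adds the region [x <= 0 < x + h], where [u x]
    and [psi x] vanish. With [y = x + h] the kernel there is [u y * psi y * h ^- 2] on [h >= y],
    whose [h] integral is [u y * psi y / y]. The local term thus completes the half-line form to the
    whole line; [G] is this part after the shear. *)
Lemma kF_itg : itg2 kF /\ It (fun x => It (kF x)) =
  It (fun x => u x * psi x / x) + It (fun x => It (cross_kernel u psi x)).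
Proof.
pose G y h := ind (y <= h) * (ind (0 < h) * (u y * psi y * h ^- 2)).
have mG : meas2 G.
  have m1 : meas2 (fun y h => ind (y <= h)).
    by have := meas2C (meas2_sub (meas_ge (0 : R))); rewrite /meas2; under eq_fun do rewrite subr_ge0.
  apply: measurable_funM; first exact: m1.
  apply: measurable_funM; first exact: (meas2_snd (meas_lt 0)).
  apply: measurable_funM; last exact: (meas2_snd meas_inv2).
  by apply: (meas2_fst (f := fun y => u y * psi y)); exact: measurable_funM.
have GE y : 0 < y -> G y = (fun h => u y * psi y * (ind (y <= h) * h ^- 2)).
  move=> y0; apply/funext => h; rewrite /G; have [yh|hy] := leP y h; last by rewrite /ind !mul0r mulr0.
  by rewrite (lt_le_trans y0 yh) /ind !mul1r.
have G0 y h : y <= 0 -> G y h = 0 by move=> y0; rewrite /G u0// !mul0r !mulr0.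
have Gi y : itg (G y).
  have [y0|y0] := ltP 0 y; first by rewrite GE//; apply: itgZ; exact: (itg_inv2 y0).1.
  by apply: (eq_itg (f := fun=> 0)) => [h|]; [rewrite G0|exact: itg0].
have GI y : It (G y) = u y * psi y / y.
  have [y0|y0] := ltP 0 y; first by rewrite GE// ItZ ?(itg_inv2 y0).2//; exact: (itg_inv2 y0).1.
  by rewrite u0// !mul0r (eq_It (g := fun=> 0)) ?It0// => h; rewrite G0.
have GGi : itg2 G.
  apply: (itg2_iter (g := fun y => `|u y * psi y / y|)) => //; last exact: itg_norm.
  move=> y; rewrite -GI; have [y0|y0] := ltP 0 y; last first.
    by rewrite (eq_It (g := fun=> 0)) ?It0// => h; rewrite G0// normr0.
  rewrite GE// ItZ; last exact: (itg_inv2 y0).1.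
  rewrite (itg_inv2 y0).2 (eq_It (g := fun h => `|u y * psi y| * (ind (y <= h) * h ^- 2))).
    rewrite ItZ; last exact: (itg_inv2 y0).1.
    by rewrite (itg_inv2 y0).2 [leRHS]normrM normfV (gtr0_norm y0).
  by move=> h; rewrite normrM [in LHS](ger0_norm (mulr_ge0 (ind_ge0 _) _))// invr_ge0 sqr_ge0.
have Si := itg2_shear GGi.
have E x h : kF x h = cross_kernel u psi x h + G (x + h) h.
  rewrite /kF /cross_kernel /G; have [h0|h0] := ltP 0 h; last by rewrite /ind !(mul0r, mulr0) addr0.
  rewrite gerDr; have [x0|x0] := ltP 0 x; rewrite /ind ?mul1r ?mul0r ?addr0 ?add0r//.
  by rewrite (u0 x0) (psia (le_lt_trans x0 a0)) !subr0.
have Ki := itg2D iB Si.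
have EF : kF = (fun x h => cross_kernel u psi x h + G (x + h) h).
  by apply/funext => x; apply/funext => h; exact: E.
split; first by rewrite EF.
rewrite EF (It2D iB Si) addrC (It_shear GGi); congr (_ + _).
by apply: eq_It => y; exact: GI.
Qed.

Definition Ah h := It (fun x => psi x * sym_diff u x h).

Lemma itg_usp c d : itg (fun x => u (x + c) * psi (x + d)).
Proof.
apply: (itgMb (C := 1)); [exact: meas_shift|by move=> x; exact: u1|exact: itg_shift].
Qed.

Lemma It_usp c d : It (fun x => u (x + c) * psi (x + d)) = It (fun x => u (x + (c - d)) * psi x).
Proof.
rewrite -(It_shift d (f := fun x => u (x + (c - d)) * psi x)).
  by apply: eq_It => x; rewrite -addrA (addrC d) subrK.
by apply: measurable_funM => //; exact: meas_shift.
Qed.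

Lemma itg_us c : itg (fun x => u (x + c) * psi x).
Proof. by have := itg_usp c 0; apply: eq_itg => x; rewrite addr0. Qed.

Lemma AhE h : Ah h = 2 * It (fun x => u (x + 0) * psi x) - It (fun x => u (x + h) * psi x)
  - It (fun x => u (x + - h) * psi x).
Proof.
rewrite -(ItZ 2 (itg_us 0)) -(ItB (itgZ 2 (itg_us 0)) (itg_us h)).
rewrite -(ItB (itgB (itgZ 2 (itg_us 0)) (itg_us h)) (itg_us (- h))).
by apply: eq_It => x; rewrite /sym_diff addr0; ring.
Qed.

(** The product of increments expands into four translates of [u * psi]; moving [psi] back to the
    base point by translation invariance recombines them into the symmetric difference of [u]. *)
Lemma kF_Ah h : It (fun x => kF x h) = ind (0 < h) * (h ^- 2 * Ah h).
Proof.
have i1 := itg_usp h h; have i2 := itg_us h; have i3 := itg_usp 0 h; have i4 := itg_us 0.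
have i12 := itgB i1 i2; have i123 := itgB i12 i3; have i1234 := itgD i123 i4.
rewrite (eq_It (g := fun x => ind (0 < h) * h ^- 2 * (u (x + h) * psi (x + h) - u (x + h) * psi x
  - u (x + 0) * psi (x + h) + u (x + 0) * psi x))); last by move=> x; rewrite /kF addr0; ring.
rewrite (ItZ _ i1234) (ItD i123 i4) (ItB i12 i3) (ItB i1 i2) !It_usp AhE subrr sub0r.
by ring.
Qed.

Lemma bracketE : itg (fun h => ind (0 < h) * (h ^- 2 * Ah h)) /\
  It (fun x => u x * psi x / x) + It (fun x => It (cross_kernel u psi x)) = It (fun h => ind (0 < h) * (h ^- 2 * Ah h)).
Proof.
have [Ki <-] := kF_itg; rewrite (It_fubini Ki); split.
  by apply: eq_itg (itg2_fst (itg2C Ki)) => h; rewrite kF_Ah.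
by apply: eq_It => h; rewrite kF_Ah.
Qed.

Definition Bs s := It (fun y => p y * incr y s).

Lemma itg_pu c : itg (fun y => p y * u (y + c)).
Proof.
apply: (eq_itg (f := fun y => u (y + c) * p y)); first by move=> y; rewrite mulrC.
by apply: (itgMb (C := 1)) => //; exact: meas_shift.
Qed.

Lemma incr_le2 y s : `|incr y s| <= 2.
Proof.
apply: (le_trans (ler_normB _ _)); have := u1 (y + s); have := u1 (y - s); lra.
Qed.

Lemma meas2_pincr : meas2 (fun s y => p y * incr y s).
Proof.
apply: measurable_funM; first exact: (meas2_snd mp).
exact: meas2C meas2_incr2.
Qed.

Lemma itg_Bs s : itg (fun y => p y * incr y s).
Proof.
apply: eq_itg (itgB (itg_pu s) (itg_pu (- s))) => y; rewrite /incr; ring.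
Qed.

Lemma psi_fwd x h : 0 <= h -> psi (x + h) - psi x = It (fun s => ind (0 <= s <= h) * p (x + s)).
Proof.
move=> h0; rewrite psip ?lerDl// /II -(It_shift x); last first.
  by apply: measurable_funM => //; exact: meas_cc.
by apply: eq_It => s; rewrite (addrC s) lerDl lerD2l.
Qed.

Lemma psi_bwd x h : 0 <= h -> psi x - psi (x - h) = It (fun s => ind (0 <= s <= h) * p (x - s)).
Proof.
move=> h0; rewrite psip ?gerDl ?oppr_le0// /II -(It_shift x); last first.
  by apply: measurable_funM => //; exact: meas_cc.
rewrite -It_opp; last first.
  apply: (@meas_shift R x (fun z => ind (x - h <= z <= x) * p z)).
  by apply: measurable_funM => //; exact: meas_cc.
apply: eq_It => s; rewrite (addrC (- s)); congr (ind _ * _).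
by rewrite lerD2l lerN2 gerDl oppr_le0 andbC.
Qed.

(** The symmetric difference is moved from [u] to [psi], where it equals the integral over
    [0 <= s <= h] of [p (x - s) - p (x + s)]. Translating back then puts the increment on [u], and
    only [psi] has been differentiated. *)
Lemma Ah_Bs h : 0 <= h -> Ah h = II 0 h Bs.
Proof.
move=> h0; have mps c := meas_shift c mp.
have ipm c : itg (fun x => p (x + c)) by exact: itg_shift.
pose T s x := ind (0 <= s <= h) * (u x * (p (x - s) - p (x + s))).
have iT s : itg (fun x => u x * (p (x - s) - p (x + s))).
  by apply: (itgMb (C := 1)) => //; apply: itgB.
have Ti : itg2 T.
  apply: (itg2_iter (g := fun s => It (fun x => `|p x|) *+ 2 * ind (0 <= s <= h))).
  - apply: measurable_funM; first exact: (meas2_fst (meas_cc 0 h)).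
    apply: measurable_funM; first exact: (meas2_snd mu_).
    by apply: measurable_funB; [exact: (meas2C (meas2_sub mp))|exact: (meas2C (meas2_add mp))].
  - by move=> s; apply: itgZ.
  - move=> s; apply: (@le_trans _ _ (It (fun x => ind (0 <= s <= h) * (`|p (x - s)| + `|p (x + s)|)))).
      apply: It_le; [by apply: itg_norm; exact: itgZ| |].
        by apply: itgZ; apply: itgD; exact: itg_norm.
      move=> x; rewrite norm_ind; apply: ler_wpM2l; first exact: ind_ge0.
      rewrite normrM -[leRHS]mul1r; apply: ler_pM => //; exact: ler_normB.
    have mn : measurable_fun setT (fun x => `|p x|) by exact: measurableT_comp.
    rewrite ItZ; last by apply: itgD; exact: itg_norm.
    rewrite ItD; [|exact: itg_norm|exact: itg_norm].
    by rewrite (It_shift (- s) mn) (It_shift s mn) mulrC mulr2n.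
  - by apply: itgZ; exact: itg_ind.
have E1 x : u x * (2 * psi x - psi (x + h) - psi (x - h)) = It (fun s => T s x).
  have i1 : itg (fun s => ind (0 <= s <= h) * p (x - s)).
    apply: (itgMb (C := 1)); [exact: meas_cc|by move=> s; rewrite ger0_norm ?ind_ge0 ?ind_le1|].
    by have := itg_opp (itg_shift x ip); apply: eq_itg => s; rewrite addrC.
  have i2 : itg (fun s => ind (0 <= s <= h) * p (x + s)).
    apply: (itgMb (C := 1)); [exact: meas_cc|by move=> s; rewrite ger0_norm ?ind_ge0 ?ind_le1|].
    by apply: eq_itg (itg_shift x ip) => s; rewrite addrC.
  rewrite (_ : 2 * psi x - _ - _ = (psi x - psi (x - h)) - (psi (x + h) - psi x)); last by ring.
  rewrite psi_fwd// psi_bwd// -ItB// -ItZ; last exact: itgB.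
  by apply: eq_It => s; rewrite /T; ring.
transitivity (It (fun x => u x * (2 * psi x - psi (x + h) - psi (x - h)))).
  have j c : itg (fun x => u x * psi (x + c)).
    by have := itg_usp 0 c; apply: eq_itg => x; rewrite addr0.
  have e c : It (fun x => u x * psi (x + c)) = It (fun x => u (x + - c) * psi x).
    by have := It_usp 0 c; under eq_fun do rewrite addr0; rewrite sub0r.
  have j0 := itgZ 2 (j 0).
  rewrite (eq_It (g := fun x => 2 * (u x * psi (x + 0)) - u x * psi (x + h) - u x * psi (x + - h))).
    rewrite (ItB (itgB j0 (j h)) (j (- h))) (ItB j0 (j h)) (ItZ _ (j 0)) !e AhE oppr0 opprK; ring.
  by move=> x; rewrite addr0; ring.
rewrite (eq_It E1) -(It_fubini Ti) /II; apply: eq_It => s; rewrite /T ItZ//; congr (_ * _).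
have k1 : itg (fun x => u x * p (x - s)) by apply: (itgMb (C := 1)).
have sq_kernel : itg (fun x => u x * p (x + s)) by apply: (itgMb (C := 1)).
rewrite (eq_It (g := fun x => u x * p (x - s) - u x * p (x + s))); last by move=> x; rewrite mulrBr.
rewrite (ItB k1 sq_kernel) /Bs (eq_It (f := fun y => p y * incr y s) (g := fun y => p y * u (y + s) - p y * u (y + - s))).
  rewrite (ItB (itg_pu s) (itg_pu (- s))); congr (_ - _).
    rewrite -(It_shift s (f := fun x => u x * p (x - s))); last by exact: itg_meas.
    by apply: eq_It => x; rewrite addrK mulrC.
  rewrite -(It_shift (- s) (f := fun x => u x * p (x + s))); last by exact: itg_meas.
  by apply: eq_It => x; rewrite subrK mulrC.
by move=> y; rewrite /incr mulrBr.
Qed.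

Lemma meas_Bs_cc : itg (fun s => ind (0 < s <= 1) * Bs s).
Proof.
have Bi : itg2 (fun s y => ind (0 < s <= 1) * (p y * incr y s)).
  apply: (itg2_prod (f := fun s => ind (0 <= s <= 1)) (g := fun y => 2 * `|p y|)).
  - by apply: measurable_funM; [exact: (meas2_fst (meas_lc 0 1))|exact: meas2_pincr].
  - exact: itg_ind.
  - by apply: itgZ; exact: itg_norm.
  move=> s y; rewrite norm_ind; apply: ler_pM; rewrite ?ind_ge0//.
    by rewrite /ind; case: ifPn => [/andP[/ltW-> ->]//|_]; case: ifP.
  by rewrite normrM mulrC ler_wpM2r// incr_le2.
by apply: eq_itg (itg2_fst Bi) => s; rewrite ItZ//; exact: itg_Bs.
Qed.

Lemma Bs_bound s : 0 < s <= 1 -> `|Bs s| <= 2 * N * It (fun y => `|p y|) * qrt s.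
Proof.
move=> s01; have -> : 2 * N * It (fun y => `|p y|) * qrt s = It (fun y => 2 * N * qrt s * `|p y|).
  by rewrite ItZ; [ring|exact: itg_norm].
apply: It_norm_le; first exact: itg_meas (itg_Bs s).
  by apply: itgZ; exact: itg_norm.
by move=> y; rewrite normrM mulrC ler_wpM2r// incr_le.
Qed.

(** [Ah h] is the integral of [Bs] over [[0, h]]. Exchanging [s] and [h] leaves [Bs s] with weight
    [log_weight s], which is legitimate because [|Bs s|] is at most a multiple of [qrt s]. A second
    exchange, with the [y] integral inside [Bs], brings out the potential. *)
Lemma near_part : It (fun h => ind (0 < h <= 1) * (h ^- 2 * Ah h)) = It (fun y => p y * log_pot y).
Proof.
pose b1 s := ind (0 < s <= 1) * Bs s.
have mb1 : measurable_fun setT b1 := itg_meas meas_Bs_cc.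
pose T s h := ind (0 <= h - s) * (ind (0 < h <= 1) * h ^- 2 * b1 s).
have TE s : T s = (fun h => b1 s * (ind (s <= h <= 1) * h ^- 2)).
  apply/funext => h; rewrite /T /b1 subr_ge0; have [/andP[s0 s1]|h0] := boolP (0 < s <= 1); last first.
    by rewrite /ind !mul0r !mulr0.
  have [sh|hs] := leP s h; last by rewrite /ind !mul0r mulr0.
  by rewrite (lt_le_trans s0 sh) /=; ring.
have Ti s : itg (T s) /\ It (T s) = log_weight s * Bs s.
  rewrite TE; have [s01|h0] := boolP (0 < s <= 1); last first.
    rewrite /log_weight /b1 (negbTE h0) /ind !mul0r; split.
      by apply: (eq_itg (f := fun=> 0)) => [h|]; [rewrite mul0r|exact: itg0].
    by rewrite (eq_It (g := fun=> 0)) ?It0// => h; rewrite mul0r.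
  have /andP[s0 s1] := s01; have [i1 i2] := itg_inv2_itv s0 s1.
  split; first exact: itgZ.
  by rewrite ItZ// -/(II s 1 (fun h => h ^- 2)) i2 /b1 /log_weight s01 /ind !mul1r invr1 mulrC.
pose K := 2 * N * It (fun y => `|p y|).
have K0 : 0 <= K by rewrite !mulr_ge0//; apply: It_ge0.
have TTi : itg2 T.
  apply: (itg2_iter (g := fun s => K * (ind (0 < s <= 1) * (qrt s / s)))).
  - apply: measurable_funM; first exact: (meas2C (meas2_sub (meas_ge 0))).
    apply: measurable_funM; last exact: (meas2_fst mb1).
    by apply: measurable_funM; [exact: (meas2_snd (meas_lc 0 1))|exact: (meas2_snd meas_inv2)].
  - by move=> s; exact: (Ti s).1.
  - move=> s; rewrite TE.
    have [s01|h0] := boolP (0 < s <= 1); last first.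
      rewrite /b1 (negbTE h0) /ind (eq_It (g := fun=> 0)) ?It0 ?mul0r ?mulr0// => h.
      by rewrite !mul0r normr0.
    have /andP[s0 s1] := s01; have [i1 i2] := itg_inv2_itv s0 s1.
    rewrite (eq_It (g := fun h => `|b1 s| * (ind (s <= h <= 1) * h ^- 2))); last first.
      by move=> h; rewrite normrM [X in _ * X]ger0_norm// mulr_ge0 ?ind_ge0// invr_ge0 sqr_ge0.
    rewrite ItZ// -/(II s 1 (fun h => h ^- 2)) i2 /b1 s01 /ind !mul1r invr1.
    apply: (@le_trans _ _ (K * qrt s * (s^-1 - 1))).
      by rewrite ler_wpM2r ?subr_ge0 ?invf_ge1//; exact: Bs_bound.
    by rewrite -mulrA ler_wpM2l// ler_wpM2l ?qrt_ge0// gerBl.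
  - by apply: itgZ; exact: itg_qrt.
transitivity (It (fun h => It (fun s => T s h))).
  apply: eq_It => h; have [/andP[h0 h1]|hn] := boolP (0 < h <= 1); last first.
    rewrite /ind mul0r (eq_It (g := fun=> 0)) ?It0// => s.
    by rewrite /T (negbTE hn) /ind !mul0r mulr0.
  have B0 : Bs 0 = 0.
    by rewrite /Bs (eq_It (g := fun=> 0)) ?It0// => y; rewrite /incr addr0 subr0 subrr mulr0.
  have E x : ind (0 <= h - x) * b1 x = ind (0 <= x <= h) * Bs x.
    rewrite /b1 subr_ge0; have [xh|hx] := leP x h; last by rewrite andbF /ind !mul0r.
    rewrite andbT (le_trans xh h1) andbT; have [x0|x0|x0] := ltgtP 0 x; rewrite /ind ?mul1r ?mul0r//.
    by rewrite -x0 B0.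
  have ib : itg (fun x => ind (0 <= h - x) * b1 x).
    apply: (itgMb (C := 1)); last exact: meas_Bs_cc.
      by have := meas_le h; under eq_fun do rewrite -subr_ge0.
    by move=> x; rewrite ger0_norm ?ind_ge0 ?ind_le1.
  rewrite (Ah_Bs (ltW h0)) {1}/ind mul1r /II -(eq_It E) -ItZ//.
  by apply: eq_It => x; rewrite /T h0 h1 (_ : ind (true && true) = 1 :> R)// mul1r mulrCA.
rewrite -(It_fubini TTi).
pose Y s y := log_weight s * (p y * incr y s).
have Yi : itg2 Y.
  apply: (itg2_prod (f := fun s => 2 * N * (ind (0 < s <= 1) * (qrt s / s))) (g := fun y => `|p y|)).
  - by apply: measurable_funM; [exact: (meas2_fst meas_wk)|exact: meas2_pincr].
  - by apply: itgZ; exact: itg_qrt.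
  - exact: itg_norm.
  move=> s y; rewrite /Y mulrCA [leLHS]normrM [leLHS]mulrC; apply: ler_wpM2r => //.
  rewrite [leLHS]normrM (ger0_norm (log_weight_ge0 s)).
  have [h|h] := boolP (0 < s <= 1); last by rewrite /log_weight (negbTE h) /ind !mul0r mulr0.
  have := log_weight_le s; rewrite h /ind mul1r => hw.
  apply: (@le_trans _ _ (2 * N * (log_weight s * qrt s))); last by rewrite ler_wpM2l ?mulr_ge0.
  by rewrite mulrCA ler_wpM2l ?log_weight_ge0// incr_le.
transitivity (It (fun s => It (Y s))).
  by apply: eq_It => s; rewrite (Ti s).2 /Bs -ItZ//; exact: itg_Bs.
rewrite (It_fubini Yi); apply: eq_It => y; rewrite /log_pot -ItZ; last exact: log_weight_incr_itg.
by apply: eq_It => s; rewrite /Y; ring.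
Qed.

Lemma far_part : It (fun h => ind (1 < h) * (h ^- 2 * Ah h)) = It (fun x => psi x * far_half_lap x).
Proof.
have Fi := far_itg2 ipsi.
transitivity (It (fun h => It (fun x => psi x * (ind (1 < h) * (h ^- 2 * sym_diff u x h))))).
  apply: eq_It => h; rewrite /Ah -ItZ.
    rewrite -ItZ; first by apply: eq_It => x; ring.
    apply: itgZ; apply: (eq_itg (f := fun x => sym_diff u x h * psi x)); first by move=> x; rewrite mulrC.
    apply: (itgMb (C := 4)) => //; [exact: (meas2_1 h (meas2C meas2_del))|by move=> x; exact: sym_diff_le4].
  apply: (eq_itg (f := fun x => sym_diff u x h * psi x)); first by move=> x; rewrite mulrC.
  apply: (itgMb (C := 4)) => //; [exact: (meas2_1 h (meas2C meas2_del))|by move=> x; exact: sym_diff_le4].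
rewrite -(It_fubini Fi); apply: eq_It => x; rewrite /far_half_lap ItZ//; exact: far_itg.
Qed.

Lemma bracket_weak : It (fun x => u x * psi x / x) + It (fun x => It (cross_kernel u psi x)) =
  It (fun y => p y * log_pot y) + It (fun x => psi x * far_half_lap x).
Proof.
have [Ai ->] := bracketE; rewrite -near_part -far_part -ItD.
- apply: eq_It => h; have [h0|h0] := ltP 0 h => /=; last first.
    by rewrite ltNge (le_trans h0 ler01) /ind !mul0r addr0.
  by have [h1|h1] := leP h 1; rewrite /ind !(mul1r, mul0r, addr0, add0r).
- apply: (eq_itg (f := fun h => ind (h <= 1) * (ind (0 < h) * (h ^- 2 * Ah h)))).
    by move=> h; have [h0|h0] := ltP 0 h; rewrite /ind /= ?(mul1r, mul0r, mulr0).
  apply: (itgMb (C := 1)) => //; first exact: meas_le.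
  by move=> h; rewrite ger0_norm ?ind_ge0 ?ind_le1.
- apply: (eq_itg (f := fun h => ind (1 < h) * (ind (0 < h) * (h ^- 2 * Ah h)))).
    move=> h; have [h1|h1] := ltP 1 h; rewrite /ind ?mul0r//.
    by rewrite (lt_trans ltr01 h1) !mul1r.
  apply: (itgMb (C := 1)) => //; first exact: meas_lt.
  by move=> h; rewrite ger0_norm ?ind_ge0 ?ind_le1.
Qed.

End Bracket.

(** * Hoelder continuity of the slope *)

Section FirstRegularity.
Context {R : realType}.
Implicit Types (f v u G phi : R -> R) (a b d e h s t x y z : R).
Local Notation mu := (@lebesgue_measure R).

Lemma sqrt_le_qrt d : 0 <= d <= 1 -> Num.sqrt d <= qrt d.
Proof.
by move=> /andP[d0 d1]; rewrite -qrt2 expr2 ler_piMl ?qrt_ge0// qrt_le1.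
Qed.

Lemma le_qrt d : 0 <= d <= 1 -> d <= qrt d.
Proof.
move=> /andP[d0 d1]; rewrite -{1}(qrt4 d0) exprS ler_piMr ?qrt_ge0//.
by rewrite exprn_ile1 ?qrt_ge0// qrt_le1.
Qed.

Lemma ae_neq a : {ae mu, forall x, x != a}.
Proof.
exists [set a]; split; [exact: measurable_set1|exact: lebesgue_measure_set1|].
by move=> x /= /negP; rewrite negbK => /eqP.
Qed.

Variables (beta nu : R) (eta w g : R -> R) (ph : nat -> R -> R).
Hypotheses (beta0 : 0 < beta) (nu0 : 0 < nu) (heta : is_cutoff beta eta).
Hypotheses (hw : fin_energy w g) (hp : approximates ph w g) (ki : itg2 (sq_kernel (fun y => sin (w y)))).
Hypothesis hEL : forall phi, test_fun phi ->
  It (fun x => g x * derive1 phi x) + It (fun x => sin (w x + beta) * cos (w x + beta) * phi x)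
  + nu / (2 * pi) * (It (fun x => sin (w x) * cos (w x) * phi x / x)
     + It (fun x => It (cross_kernel (fun y => sin (w y)) (fun y => cos (w y) * phi y) x))) = 0.

Let kap := nu / (2 * pi).
Let u x := sin (w x).
Let N := l2_norm g.
Let F := log_pot u.
Let L := far_half_lap u.

Lemma kap_gt0 : 0 < kap.
Proof. by rewrite divr_gt0// mulr_gt0// pi_gt0. Qed.

Let N0 : 0 <= N. Proof. exact: sqrtr_ge0. Qed.
Let mw := fin_energy_meas hw.
Let cu : continuous u. Proof. by apply: cont_sin_comp; exact: fin_energy_cont hw. Qed.
Let mu_ : measurable_fun setT u. Proof. exact: cont_meas. Qed.
Let u1 x : `|u x| <= 1. Proof. exact: sin_norm_le1. Qed.
Let u0 x : x <= 0 -> u x = 0.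
Proof. by move=> x0; have [_ _ w0 _] := hw; rewrite /u w0// sin0. Qed.
Let uN x y : `|u y - u x| <= N * Num.sqrt `|y - x|.
Proof. exact: le_trans (sin_lip _ _) (fin_energy_holder x y hw). Qed.

Lemma log_pot_cont : continuous F.
Proof.
move=> x; apply/cvgrPdist_le => e e0.
have K0 : 0 <= 4 * N * qrt_mass by rewrite !mulr_ge0// qrt_mass_ge0.
have h : 4 * N * qrt_mass * qrt (`|x - y|) @[y --> x] --> 4 * N * qrt_mass * qrt `|x - x|.
  apply: cvgM; first exact: cvg_cst.
  apply: (continuous_comp (f := fun y => `|x - y|)); last exact: qrt_continuous.
  apply: (continuous_comp (f := fun y => x - y)); last exact: norm_continuous.
  by apply: cvgB; [exact: cvg_cst|exact: cvg_id].
rewrite subrr normr0 /qrt sqrtr0 sqrtr0 mulr0 in h.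
move/cvgrPdist_le : h => /(_ _ e0); apply: filterS => y.
rewrite sub0r normrN ger0_norm; last by rewrite mulr_ge0// sqrtr_ge0.
by apply: le_trans; exact: log_pot_hol.
Qed.

Let mF := cont_meas log_pot_cont.
Let Fb x : `|F x| <= 2 * N * qrt_mass. Proof. exact: log_pot_bound. Qed.
Let mL : measurable_fun setT L. Proof. by apply: litg_meas; exact: litg_Lf. Qed.
Let Lb x : `|L x| <= 4. Proof. exact: far_half_lap_bound. Qed.
Let mcos : measurable_fun setT (fun x => cos (w x)).
Proof. by apply: cont_meas; apply: cont_cos_comp; exact: fin_energy_cont hw. Qed.
Let msc : measurable_fun setT (fun x => sin (w x + beta) * cos (w x + beta)).
Proof. by apply: trig_meas => x; apply: cvgD; [exact: (fin_energy_cont hw)|exact: cvg_cst]. Qed.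

(** [Pw] is the flux and [Qw] its weak derivative. The last term of [Qw] comes from the factor
    [cos w] of the test function [cos w * phi], whose derivative contains [- sin w * g * phi]. *)
Definition Pw x := g x + kap * (cos (w x) * F x).
Definition Qw x := sin (w x + beta) * cos (w x + beta) + kap * (cos (w x) * L x)
  - kap * (sin (w x) * F x * g x).

Lemma litgD f v : litg f -> litg v -> litg (fun x => f x + v x).
Proof.
by move=> fi vi c d; apply: eq_itg (itgD (fi c d) (vi c d)) => x; rewrite mulrDr.
Qed.

Lemma litgZ k f : litg f -> litg (fun x => k * f x).
Proof. by move=> fi c d; apply: eq_itg (itgZ k (fi c d)) => x; rewrite mulrCA. Qed.

Lemma litg_bounded f (C : R) : measurable_fun setT f -> (forall x, `|f x| <= C) -> litg f.
Proof. by move=> mf fC; apply: litg_bnd => // c d; exists C. Qed.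

Lemma litg_mulb f v (C : R) : measurable_fun setT f -> (forall x, `|f x| <= C) -> litg v ->
  litg (fun x => f x * v x).
Proof.
move=> mf fC vi c d.
by apply: eq_itg (itgMb mf fC (vi c d)) => x; rewrite mulrCA.
Qed.

Let g2 : l2_fun g. Proof. by case: hw. Qed.
Let cF x : `|cos (w x) * F x| <= 2 * N * qrt_mass.
Proof. by rewrite normrM -[leRHS]mul1r; apply: ler_pM => //; exact: cos_norm_le1. Qed.
Let cL x : `|cos (w x) * L x| <= 4.
Proof. by rewrite normrM -[leRHS]mul1r; apply: ler_pM => //; exact: cos_norm_le1. Qed.
Let uF x : `|u x * F x| <= 2 * N * qrt_mass.
Proof. by rewrite normrM -[leRHS]mul1r; apply: ler_pM. Qed.
Let msF : measurable_fun setT (fun x => sin (w x) * F x).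
Proof. exact: measurable_funM. Qed.

Lemma litg_Pw : litg Pw.
Proof.
apply: litgD; first exact: l2_fun_litg.
apply: litgZ; apply: (litg_bounded (C := 2 * N * qrt_mass)) => //; exact: measurable_funM.
Qed.

Lemma litg_Qw : litg Qw.
Proof.
apply: litgD.
  apply: litgD; first by apply: (litg_bounded (C := 1)) => // x; exact: trig_le1.
  apply: litgZ; apply: (litg_bounded (C := 4)) => //; exact: measurable_funM.
rewrite (_ : (fun x => _) = (fun x => - kap * (u x * F x * g x))); last first.
  by apply/funext => x; rewrite mulNr.
by apply: litgZ; apply: (litg_mulb (C := 2 * N * qrt_mass)) => //; exact: l2_fun_litg.
Qed.

Lemma weak_PQ phi : test_fun phi ->
  It (fun x => Pw x * derive1 phi x) + It (fun x => Qw x * phi x) = 0.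
Proof.
move=> tp; have [ip hps] := approximates_cos hw hp tp.
have [i1 i2 i3 i4] := euler_lagrange_itg beta hw ki tp.
have [a [b [C [a0 ab C0 p0 pC]]]] := test_bound tp.
have iphi : itg phi.
  by have := test_itg (f := fun=> 1) (K := 1) tp (measurable_cst _) (fun=> _); under eq_fun do rewrite mul1r; apply; rewrite normr1.
have idphi : itg (derive1 phi).
  apply: (eq_itg (f := fun x => ind (a <= x <= b) * derive1 phi x)).
    by move=> x; have [h|h] := boolP (a <= x <= b); rewrite /ind ?mul1r// mul0r (p0 x h).2.
  exact: litg_cont (test_dcont tp) _ _.
set p := fun y => _ in ip.
pose psi y := cos (w y) * phi y.
have ips : itg psi by apply: (itgMb (C := 1)) => // x; exact: cos_norm_le1.
have ps0 x : x < a -> psi x = 0.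
  by move=> xa; rewrite /psi (p0 x _).1 ?mulr0// negb_and -ltNge xa.
have i3' : itg (fun x => u x * psi x / x).
  by apply: eq_itg i3 => x; rewrite /psi /u mulrA.
have br := bracket_weak mu_ u1 u0 N0 uN ip ips hps a0 ps0 i3' i4.
have := hEL tp.
rewrite (_ : It (fun x => sin (w x) * cos (w x) * phi x / x) = It (fun x => u x * psi x / x)); last first.
  by apply: eq_It => x; rewrite /psi /u mulrA.
rewrite br -/F -/L => E; rewrite -[RHS]E.
have jA : itg (fun x => cos (w x) * F x * derive1 phi x).
  by apply: (itgMb (C := 2 * N * qrt_mass)) => //; exact: measurable_funM.
have jB : itg (fun x => u x * F x * (g x * phi x)).
  by apply: (itgMb (C := 2 * N * qrt_mass)) => //; apply: sq2M => //; split; [exact: cont_meas (test_cont tp)|exact: test_sq].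
have jC : itg (fun x => cos (w x) * L x * phi x).
  by apply: (itgMb (C := 4)) => //; exact: measurable_funM.
rewrite (eq_It (f := fun x => Pw x * derive1 phi x) (g := fun x => g x * derive1 phi x + kap * (cos (w x) * F x * derive1 phi x))); last first.
  by move=> x; rewrite /Pw; ring.
rewrite (ItD i1 (itgZ kap jA)) (ItZ _ jA).
rewrite (eq_It (f := fun x => Qw x * phi x) (g := fun x => sin (w x + beta) * cos (w x + beta) * phi x
   + kap * (cos (w x) * L x * phi x) - kap * (u x * F x * (g x * phi x)))); last first.
  by move=> x; rewrite /Qw /u; ring.
rewrite (ItB (itgD i2 (itgZ kap jC)) (itgZ kap jB)) (ItD i2 (itgZ kap jC)) (ItZ _ jC) (ItZ _ jB).
rewrite (eq_It (f := fun y => p y * F y) (g := fun x => cos (w x) * F x * derive1 phi x - u x * F x * (g x * phi x))); last first.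
  by move=> x; rewrite /p /u; ring.
rewrite (ItB jA jB) (eq_It (f := fun x => psi x * L x) (g := fun x => cos (w x) * L x * phi x)); last first.
  by move=> x; rewrite /psi; ring.
by rewrite -/kap; ring.
Qed.

(* [f] is C^{1,1/4} up to the boundary point [0], stated as a first order expansion
   so that no one-sided derivative is needed. *)
Definition c1_hoelder f G (K : R) := [/\ 0 <= K, forall x, 0 <= x -> `|G x| <= K,
  (forall x y, 0 <= x -> 0 <= y -> `|x - y| <= 1 -> `|G x - G y| <= K * qrt `|x - y|)
  & forall x y z, 0 <= x -> x <= z -> z <= y -> y - x <= 1 ->
      `|f y - f x - G z * (y - x)| <= K * (qrt (y - x) * (y - x))].

Let mQ := litg_meas litg_Qw.

(** The bounded terms contribute a multiple of [y - x] and the term with [g], by Cauchy-Schwarz, a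
    multiple of [sqrt (y - x)]; on intervals of length at most one both are dominated by
    [qrt (y - x)]. *)
Lemma II_Qw x y : x <= y -> y - x <= 1 ->
  `|II x y Qw| <= (1 + kap * 4 + kap * (2 * N * qrt_mass) * N) * qrt (y - x).
Proof.
move=> xy yx; have d0 : 0 <= y - x by rewrite subr_ge0.
have k0 := kap_gt0; have M0 : 0 <= 2 * N * qrt_mass by rewrite !mulr_ge0// qrt_mass_ge0.
have ig : itg (fun z => ind (x <= z <= y) * `|g z|) := l2_fun_litg (l2_fun_norm g2) x y.
have ii := itg_ind x y.
apply: (@le_trans _ _ (It (fun z => (1 + kap * 4) * ind (x <= z <= y) + kap * (2 * N * qrt_mass) * (ind (x <= z <= y) * `|g z|)))).
  apply: It_norm_le.
  - by apply: measurable_funM => //; exact: meas_cc.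
  - by apply: itgD; exact: itgZ.
  move=> z; rewrite norm_ind [leRHS](_ : _ = ind (x <= z <= y) * (1 + kap * 4 + kap * (2 * N * qrt_mass) * `|g z|)); last by ring.
  apply: ler_wpM2l; first exact: ind_ge0.
  rewrite /Qw; apply: (le_trans (ler_normB _ _)); apply: lerD.
    apply: (le_trans (ler_normD _ _)); apply: lerD; first exact: trig_le1.
    by rewrite normrM gtr0_norm// ler_wpM2l// ltW.
  rewrite [leLHS]normrM (gtr0_norm k0) -[leRHS]mulrA; apply: ler_wpM2l; first exact: ltW.
  by rewrite normrM; apply: ler_wpM2r => //; exact: uF.
rewrite (ItD (itgZ _ ii) (itgZ _ ig)) (ItZ _ ii) (ItZ _ ig) It_ind// [leRHS]mulrDl; apply: lerD.
  apply: ler_wpM2l; last by rewrite le_qrt// d0.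
  by apply: addr_ge0 => //; apply: mulr_ge0 => //; exact: ltW.
rewrite -[leRHS]mulrA; apply: ler_wpM2l; first by rewrite mulr_ge0// ltW.
apply: (le_trans (ler_norm _)); apply: (le_trans (II_CS xy (l2_fun_norm g2))).
rewrite mulrC; apply: ler_pM; rewrite ?sqrtr_ge0//.
  rewrite /N /l2_norm le_eqVlt; apply/orP; left; apply/eqP; congr Num.sqrt; apply: eq_It => z.
  by rewrite real_normK// num_real.
by rewrite sqrt_le_qrt// d0.
Qed.

Lemma fin_energy_ae v : fin_energy w g -> measurable_fun setT v -> {ae mu, forall x, 0 < x -> g x = v x} ->
  fin_energy w (fun x => ind (0 < x) * v x).
Proof.
move=> [_ g0 w0 wg] mv ae.
have mi : measurable_fun setT (fun x => ind (0 < x) * v x).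
  by apply: measurable_funM => //; exact: meas_lt.
have ae' : {ae mu, forall x, g x = ind (0 < x) * v x}.
  apply: aeS ae => x h; have [x0|x0] := ltP 0 x; rewrite /ind ?mul1r ?mul0r; first exact: h.
  exact: g0.
split => //.
- split => //; apply: (itg_ae_eq _ _ g2.2); first exact: measurable_funX.
  by apply: aeS ae' => x ->.
- by move=> x x0; rewrite ltNge x0 /ind mul0r.
move=> x y xy; rewrite wg// /II; apply: ae_eq_It.
- by apply: measurable_funM; [exact: meas_cc|exact: g2.1].
- by apply: measurable_funM => //; exact: meas_cc.
- by apply: aeS ae' => z ->.
Qed.

(** By du Bois-Reymond, [g] agrees almost everywhere with a constant plus the primitive of [Qw]
    minus [kap * cos w * F], and each of these is Hoelder with exponent 1/4. [G] is that
    representative. *)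
Theorem regularity1 : exists G K, [/\ measurable_fun setT G, c1_hoelder w G K,
  fin_energy w (fun x => ind (0 < x) * G x) & {ae mu, forall x, 0 < x -> g x = G x}].
Proof.
have [c hc] := du_bois_reymond beta0 heta litg_Pw litg_Qw weak_PQ.
have k0 := kap_gt0; have M0 : 0 <= 2 * N * qrt_mass by rewrite !mulr_ge0// qrt_mass_ge0.
pose G x := c + II 0 x Qw - kap * (cos (w x) * F x).
pose K1 := 1 + kap * 4 + kap * (2 * N * qrt_mass) * N.
pose K2 := kap * (2 * N * qrt_mass * N + 4 * N * qrt_mass).
have K1p : 0 <= K1.
  have k0' := ltW k0; apply: addr_ge0; [apply: addr_ge0 => //|]; first exact: mulr_ge0.
  by apply: mulr_ge0 => //; exact: mulr_ge0.
have K2p : 0 <= K2 by rewrite mulr_ge0 ?(ltW k0)// addr_ge0 ?mulr_ge0 ?qrt_mass_ge0.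
have GH x y : 0 <= x -> x <= y -> y - x <= 1 -> `|G x - G y| <= (K1 + K2) * qrt (y - x).
  move=> x0 xy yx; have d0 : 0 <= y - x by rewrite subr_ge0.
  have -> : G x - G y = - II x y Qw + kap * (cos (w y) * F y - cos (w x) * F x).
    by rewrite /G (II_split x0 xy (litg_Qw 0 y)); ring.
  apply: (le_trans (ler_normD _ _)); rewrite mulrDl; apply: lerD; first by rewrite normrN; exact: II_Qw.
  rewrite normrM (gtr0_norm k0) /K2 -[leRHS]mulrA; apply: ler_wpM2l; first exact: ltW.
  have -> : cos (w y) * F y - cos (w x) * F x = (cos (w y) - cos (w x)) * F y + cos (w x) * (F y - F x) by ring.
  apply: (le_trans (ler_normD _ _)); rewrite [leRHS]mulrDl; apply: lerD; rewrite normrM.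
    rewrite [leRHS](_ : _ = N * qrt (y - x) * (2 * N * qrt_mass)); last by ring.
    apply: ler_pM => //; apply: (le_trans (cos_lip _ _)); apply: (le_trans (fin_energy_holder x y hw)).
    by rewrite -/N ger0_norm// ler_wpM2l// sqrt_le_qrt// d0.
  rewrite -[leRHS]mul1r; apply: ler_pM => //; first exact: cos_norm_le1.
  by have := log_pot_hol mu_ N0 uN y x; rewrite (ger0_norm d0).
have mG : measurable_fun setT G.
  apply: measurable_funB; last by apply: measurable_funM => //; exact: measurable_funM.
  apply: measurable_funD => //; apply: litg_meas => p q.
  (* Measurability of the primitive of [Qw] is read off from Fubini on bounded sets. *)
  have Fi : itg2 (fun x s => ind (p <= x <= q) * (ind (0 <= x - s) * (ind (0 <= s <= q) * Qw s))).
    apply: (itg2_prod (f := fun x => ind (p <= x <= q)) (g := fun s => `|ind (0 <= s <= q) * Qw s|)).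
    - apply: measurable_funM; first exact: (meas2_fst (meas_cc p q)).
      apply: measurable_funM; first exact: (meas2_sub (meas_ge 0)).
      by apply: (meas2_snd (f := fun s => ind (0 <= s <= q) * Qw s)); exact: itg_meas (litg_Qw 0 q).
    - exact: itg_ind.
    - by apply: itg_norm; exact: litg_Qw.
    move=> x s; rewrite [leLHS]norm_ind; apply: ler_wpM2l; first exact: ind_ge0.
    by rewrite [leLHS]norm_ind ler_piMl ?ind_le1.
  apply: eq_itg (itg2_fst Fi) => x; have [/andP[px xq]|h] := boolP (p <= x <= q); last first.
    by rewrite /ind mul0r (eq_It (g := fun=> 0)) ?It0// => s; rewrite mul0r.
  rewrite /ind mul1r /II; apply: eq_It => s; rewrite mul1r subr_ge0.
  have [sx|xs] := leP s x; last by rewrite andbF /ind !mul0r.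
  by rewrite (le_trans sx xq) !andbT /ind mul1r.
have aeG : {ae mu, forall x, 0 < x -> g x = G x}.
  by apply: aeS hc => x h x0; rewrite /G -h// /Pw addrK.
have hG := fin_energy_ae hw mG aeG.
have GI x y : 0 <= x -> x <= y -> w y - w x = II x y G.
  move=> x0 xy; have [_ _ _ wG] := hG; rewrite wG// /II; apply: ae_eq_It.
  - apply: measurable_funM; first exact: meas_cc.
    by apply: measurable_funM => //; exact: meas_lt.
  - by apply: measurable_funM => //; exact: meas_cc.
  apply: aeS (ae_neq 0) => z z0; have [/andP[xz _]|h] := boolP (x <= z <= y); last by rewrite /ind !mul0r.
  by rewrite lt_def z0 (le_trans x0 xz) /ind !mul1r.
have GP x y z : 0 <= x -> x <= z -> z <= y -> y - x <= 1 ->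
    `|w y - w x - G z * (y - x)| <= (K1 + K2) * (qrt (y - x) * (y - x)).
  move=> x0 xz zy yx; have xy := le_trans xz zy; have d0 : 0 <= y - x by rewrite subr_ge0.
  have ii := itg_ind x y.
  have iG : itg (fun t => ind (x <= t <= y) * G t).
    apply: (itg_ae_eq _ _ (l2_fun_litg (let: And4 q _ _ _ := hG in q) x y)).
      by apply: measurable_funM => //; exact: meas_cc.
    apply: aeS (ae_neq 0) => t t0; have [/andP[xt _]|h] := boolP (x <= t <= y); last by rewrite /ind !mul0r.
    by rewrite lt_def t0 (le_trans x0 xt) /ind !mul1r.
  rewrite GI// -{1}(It_ind xy) -(ItZ _ ii) /II -(ItB iG (itgZ _ ii)).
  have -> : (K1 + K2) * (qrt (y - x) * (y - x)) =
      It (fun t => (K1 + K2) * qrt (y - x) * ind (x <= t <= y)) by rewrite ItZ// (It_ind xy) mulrA.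
  apply: It_norm_le.
  - by apply: itg_meas; apply: itgB => //; exact: itgZ.
  - exact: itgZ.
  move=> t; rewrite mulrC -mulrBl normrM [leRHS]mulrC [leLHS]mulrC (ger0_norm (ind_ge0 _)).
  have [/andP[xt ty]|h] := boolP (x <= t <= y); rewrite /ind ?mul0r// !mul1r.
  have dd : qrt `|z - t| <= qrt (y - x).
    apply: qrt_le; rewrite ler_norml; apply/andP; split; lra.
  apply: (@le_trans _ _ ((K1 + K2) * qrt `|z - t|)); last by rewrite ler_wpM2l// addr_ge0.
  have [tz|zt] := leP t z.
    rewrite (ger0_norm (_ : 0 <= z - t)) ?subr_ge0//; apply: GH => //; first exact: le_trans xt.
    lra.
  rewrite distrC [`|z - t|]distrC (gtr0_norm (_ : 0 < t - z)) ?subr_gt0//; apply: GH.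
  - exact: le_trans xz.
  - exact: ltW.
  - lra.
(* The increment of [w] over [[x, x + 1]] is at most [N] and differs from [G x] by at most
   [K1 + K2], which bounds [G] on the whole half-line. *)
have GB x : 0 <= x -> `|G x| <= K1 + K2 + N.
  move=> x0; have x1 : x <= x + 1 by rewrite lerDl.
  have e1 : x + 1 - x = 1 by rewrite addrC addKr.
  have := GP x (x + 1) x x0 (lexx x) x1; rewrite e1 => /(_ (lexx 1)).
  have := fin_energy_holder x (x + 1) hw; rewrite e1 normr1 sqrtr1 mulr1 -/N.
  rewrite /qrt !sqrtr1 !mulr1 => h1 h2.
  have -> : G x = (w (x + 1) - w x) - (w (x + 1) - w x - G x) by ring.
  apply: (le_trans (ler_normB _ _)); rewrite addrC; exact: lerD.
exists G, (K1 + K2 + N); split; [exact: mG| |exact: hG|exact: aeG]; split.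
- by apply: addr_ge0 => //; exact: addr_ge0.
- exact: GB.
- move=> x y x0 y0; wlog xy : x y x0 y0 / x <= y.
    by move=> h hxy; have [xy|yx] := leP x y; [exact: h|rewrite distrC [`|x - y|]distrC; apply: h => //; [exact: ltW|rewrite distrC]].
  rewrite distrC ger0_norm ?subr_ge0// => yx; apply: (le_trans _ (_ : (K1 + K2) * qrt (y - x) <= _)).
    exact: GH.
  by rewrite ler_wpM2r ?qrt_ge0// lerDl.
move=> x y z x0 xz zy yx; apply: (le_trans (GP x y z x0 xz zy yx)).
have d0 : 0 <= y - x by rewrite subr_ge0 (le_trans xz).
by rewrite ler_wpM2r ?lerDl// mulr_ge0 ?qrt_ge0.
Qed.

End FirstRegularity.

(** * Second regularity *)

Section HoelderCalculus.
Context {R : realType}.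
Implicit Types (f v w u F G U phi : R -> R) (a b c d e h s t x y z : R).
Local Notation mu := (@lebesgue_measure R).

Lemma is_derive_eps f x l :
  (forall e, 0 < e -> exists2 d, 0 < d & forall y, `|y - x| < d -> `|f y - f x - l * (y - x)| <= e * `|y - x|) ->
  is_derive x 1 f l.
Proof.
move=> hf.
have hc : h^-1 *: (f (h *: 1 + x) - f x) @[h --> (0 : R)^'] --> l.
  apply/cvgrPdist_le => e e0; have [d d0 hd] := hf e e0.
  near=> h; have h0 : h != 0 by near: h; exact: nbhs_dnbhs_neq.
  have hsm : `|h| < d by near: h; apply: dnbhs0_lt.
  have := hd (h + x); rewrite addrK => /(_ hsm).
  rewrite /GRing.scale/= mulr1 -normrN opprB => hh.
  have -> : h^-1 * (f (h + x) - f x) - l = (f (h + x) - f x - l * h) * h^-1 by field.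
  by rewrite normrM normfV ler_pdivrMr ?normr_gt0.
by split; [exact: cvgP hc|exact: cvg_lim hc].
Unshelve. all: by end_near. Qed.

Lemma ae_exists (P : R -> Prop) a b : a < b -> {ae mu, forall x, P x} -> exists2 x, a < x < b & P x.
Proof.
move=> ab [A [mA A0 hA]]; apply: contrapT => h.
have sub : `]a, b[%classic `<=` A.
  move=> x; rewrite /= in_itv/= => xab; apply: hA => Px; apply: h; by exists x.
have hle : (mu `]a, b[%classic <= mu A)%E.
  by apply: le_measure => //; rewrite inE//; exact: measurable_itv.
move: hle; rewrite A0 lebesgue_measure_itv/= lte_fin ab -EFinB lee_fin leNgt subr_gt0 ab//.
Qed.

Lemma qrt_lt_eps e : 0 < e -> forall x, 0 <= x < e ^+ 4 -> qrt x <= e.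
Proof.
move=> e0 x /andP[x0 xe]; rewrite -(ler_pXn2r (n := 4)) ?nnegrE ?qrt_ge0 ?(ltW e0)//.
by rewrite qrt4// ltW.
Qed.

Variables (f G : R -> R) (K : R).
Hypothesis hr : c1_hoelder f G K.

Lemma c1_hoelder_lip x y : 0 <= x -> x <= y -> y - x <= 1 -> `|f y - f x| <= 2 * K * (y - x).
Proof.
have [K0 Gb _ fx] := hr; move=> x0 xy yx; have d0 : 0 <= y - x by rewrite subr_ge0.
have := fx x y x x0 (lexx x) xy yx => h.
have -> : f y - f x = (f y - f x - G x * (y - x)) + G x * (y - x) by ring.
apply: (le_trans (ler_normD _ _)); rewrite -mulrA mulr_natl mulr2n; apply: lerD.
  apply: (le_trans h); apply: ler_wpM2l => //; apply: ler_piMl => //; exact: qrt_le1.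
by rewrite normrM (ger0_norm d0) ler_wpM2r// Gb.
Qed.

Lemma c1_hoelder_is_derive x : 0 < x -> is_derive x 1 f (G x).
Proof.
have [K0 Gb _ fx] := hr; move=> x0; apply: is_derive_eps => e e0.
have K1 : 0 < K + 1 by rewrite ltr_wpDl.
pose d := Num.min (Num.min x 1) ((e / (K + 1)) ^+ 4).
have ek : 0 < e / (K + 1) by rewrite divr_gt0.
have d0 : 0 < d by rewrite /d !lt_min x0 ltr01 exprn_gt0.
exists d => // y; rewrite /d !lt_min => /andP[/andP[yx y1] ye].
have hq : K * qrt `|y - x| <= e.
  apply: (@le_trans _ _ ((K + 1) * (e / (K + 1)))); last by rewrite mulrC divfK// gt_eqF.
  apply: ler_pM; rewrite ?qrt_ge0 ?lerDl//.
  by apply: qrt_lt_eps => //; rewrite normr_ge0.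
have [xy|xy] := leP x y.
  have d1 : 0 <= y - x by rewrite subr_ge0.
  move: hq y1; rewrite (ger0_norm d1) => hq y1.
  apply: (le_trans (fx x y x (ltW x0) (lexx x) xy (ltW y1))).
  by rewrite mulrA ler_wpM2r.
have d1 : 0 <= x - y by rewrite subr_ge0 ltW.
have y0 : 0 <= y by move: yx; rewrite ltr_norml => /andP[? _]; lra.
move: hq y1; rewrite distrC (ger0_norm d1) => hq y1.
have := fx y x x y0 (ltW xy) (lexx x) (ltW y1).
have -> : f y - f x - G x * (y - x) = - (f x - f y - G x * (x - y)) by ring.
by rewrite normrN => /le_trans; apply; rewrite mulrA ler_wpM2r.
Qed.

(** [c1_hoelder] does not constrain [G] at negative arguments; freezing it at its value at [0] there
    makes it continuous on the line. *)
Lemma c1_hoelder_max : c1_hoelder f (fun x => G (Num.max x 0)) K /\ continuous (fun x => G (Num.max x 0)).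
Proof.
have [K0 Gb GH fx] := hr; have mx x : 0 <= x -> Num.max x 0 = x by move=> x0; exact/max_l.
split.
  split => //.
  - by move=> x x0; rewrite mx// Gb.
  - by move=> x y x0 y0; rewrite !mx//; exact: GH.
  - by move=> x y z x0 xz zy; rewrite mx; [exact: fx|exact: le_trans xz].
move=> x; apply/cvgrPdist_le => e e0.
have K1 : 0 < K + 1 by rewrite ltr_wpDl.
have ek : 0 < e / (K + 1) by rewrite divr_gt0.
near=> y.
have h1 : `|Num.max x 0 - Num.max y 0| <= `|x - y|.
  by rewrite /Num.max; case: ltP => ?; case: ltP => ?; rewrite ?subrr ?normr0//;
    rewrite ler_normr; [apply/orP; right|apply/orP; left]; rewrite ler_norml; apply/andP; split; lra.
have h2 : `|x - y| < 1 by near: y; exact: cvgr_dist_lt.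
have h3 : `|x - y| < (e / (K + 1)) ^+ 4.
  by near: y; apply: cvgr_dist_lt; rewrite ?exprn_gt0.
have m0 z : 0 <= Num.max z 0 by rewrite le_max lexx orbT.
apply: (le_trans (GH _ _ (m0 _) (m0 _) (le_trans h1 (ltW h2)))).
apply: (@le_trans _ _ ((K + 1) * (e / (K + 1)))); last by rewrite mulrC divfK// gt_eqF.
apply: ler_pM; rewrite ?qrt_ge0 ?lerDl//.
by apply: (qrt_lt_eps ek); rewrite normr_ge0/= (le_lt_trans h1).
Unshelve. all: by end_near. Qed.

(** Subtracting the slope [cos (f z)] before using the mean value theorem leaves a product of two
    Lipschitz bounds [2 K (y - x)], the origin of [4 K ^+ 2]. The summand [K] comes from the
    expansion of [f] itself. *)
Lemma c1_hoelder_sin : c1_hoelder (fun x => sin (f x)) (fun x => cos (f x) * G x) (4 * K ^+ 2 + K).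
Proof.
have [K0 Gb GH fx] := hr; have K2 : 0 <= K ^+ 2 := sqr_ge0 K.
split.
- by rewrite addr_ge0// mulr_ge0.
- move=> x x0; rewrite normrM -[leRHS]mul1r; apply: ler_pM => //; first exact: cos_norm_le1.
  by rewrite (le_trans (Gb x x0))// lerDr mulr_ge0.
- have hh x y : 0 <= x -> x <= y -> y - x <= 1 -> `|cos (f x) * G x - cos (f y) * G y| <= (4 * K ^+ 2 + K) * qrt (y - x).
    move=> x0 xy yx; have y0 := le_trans x0 xy; have d0 : 0 <= y - x by rewrite subr_ge0.
    have -> : cos (f x) * G x - cos (f y) * G y = (cos (f x) - cos (f y)) * G x + cos (f y) * (G x - G y) by ring.
    apply: (le_trans (ler_normD _ _)); rewrite [leRHS]mulrDl; apply: lerD; rewrite normrM.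
      apply: (@le_trans _ _ ((2 * K * (y - x)) * K)).
        apply: ler_pM => //; last exact: Gb.
        by apply: (le_trans (cos_lip _ _)); rewrite distrC; exact: c1_hoelder_lip.
      rewrite (_ : 2 * K * (y - x) * K = 2 * K ^+ 2 * (y - x)); last by ring.
      apply: ler_pM; rewrite ?mulr_ge0//; last by rewrite le_qrt// d0.
      by rewrite ler_wpM2r// ler_nat.
    rewrite -[leRHS]mul1r; apply: ler_pM => //; first exact: cos_norm_le1.
    have := GH x y x0 y0; rewrite distrC (ger0_norm d0); exact.
  move=> x y x0 y0; have [xy|yx] := leP x y.
    by rewrite [`|x - y|]distrC (ger0_norm (_ : 0 <= y - x)) ?subr_ge0//; exact: hh.
  rewrite [`|x - y|]gtr0_norm ?subr_gt0// => h; rewrite distrC; apply: hh => //; exact: ltW.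
move=> x y z x0 xz zy yx; have z0 := le_trans x0 xz; have xy := le_trans xz zy.
have d0 : 0 <= y - x by rewrite subr_ge0.
have -> : sin (f y) - sin (f x) - cos (f z) * G z * (y - x) =
   ((sin (f y) - cos (f z) * f y) - (sin (f x) - cos (f z) * f x)) + cos (f z) * (f y - f x - G z * (y - x)) by ring.
apply: (le_trans (ler_normD _ _)); rewrite [leRHS]mulrDl; apply: lerD; last first.
  rewrite normrM -[leRHS]mul1r; apply: ler_pM => //; [exact: cos_norm_le1|exact: fx].
apply: (@le_trans _ _ ((2 * K * (y - x)) * `|f y - f x|)); last first.
  apply: (@le_trans _ _ ((2 * K * (y - x)) * (2 * K * (y - x)))).
    by rewrite ler_wpM2l ?mulr_ge0// c1_hoelder_lip.
  rewrite (_ : _ * _ = 4 * K ^+ 2 * ((y - x) * (y - x))); last by ring.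
  by rewrite ler_wpM2l ?mulr_ge0// ler_wpM2r// le_qrt// d0.
apply: (mvt_le (f := fun t => sin t - cos (f z) * t) (f' := fun t => cos t - cos (f z))).
  move=> t; have d := is_deriveB (is_derive_sin t) (is_deriveZ (cos (f z)) (is_derive_id t 1)).
  by apply: (is_derive_eq d); rewrite /GRing.scale/= mulr1.
move=> t ht; apply: (le_trans (cos_lip _ _)).
have ay : `|f y - f z| <= 2 * K * (y - x).
  apply: (@le_trans _ _ (2 * K * (y - z))); first by apply: c1_hoelder_lip => //; lra.
  by rewrite ler_wpM2l ?mulr_ge0//; lra.
have ax : `|f x - f z| <= 2 * K * (y - x).
  rewrite distrC; apply: (@le_trans _ _ (2 * K * (z - x))); first by apply: c1_hoelder_lip => //; lra.
  by rewrite ler_wpM2l ?mulr_ge0//; lra.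
have := minmax_le (x := t - f z) ay ax; apply.
move: ht; rewrite !ge_min !le_max !lerD2r; exact.
Qed.

End HoelderCalculus.

(** * The half-Laplacian as an absolutely convergent integral *)

Section HalfLaplacian.
Context {R : realType}.
Implicit Types (f v w F G phi : R -> R) (a b c d e h s t x y z : R).
Local Notation mu := (@lebesgue_measure R).
Variables (u U : R -> R) (K : R).
Hypotheses (hr : c1_hoelder u U K) (cu : continuous u) (u1 : forall x, `|u x| <= 1)
  (u0 : forall x, x <= 0 -> u x = 0).

Let mu_ : measurable_fun setT u := cont_meas cu.
Let K0 : 0 <= K. Proof. by case: hr. Qed.

(** Beyond distance one the increments are bounded by [2]. Across the origin [u x] may be replaced
    by [u 0], so the corner of the extension costs nothing. *)
Lemma lip_u x y : `|u y - u x| <= (2 * K + 2) * `|y - x|.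
Proof.
have L0 : 0 <= 2 * K + 2 by rewrite addr_ge0 ?mulr_ge0.
have base a b : 0 <= a -> a <= b -> `|u b - u a| <= (2 * K + 2) * (b - a).
  move=> a0 ab; have d0 : 0 <= b - a by rewrite subr_ge0.
  have [d1|d1] := leP (b - a) 1.
    by apply: (le_trans (c1_hoelder_lip hr a0 ab d1)); rewrite ler_wpM2r// lerDl.
  apply: (@le_trans _ _ 2).
    by apply: (le_trans (ler_normB _ _)); have := u1 a; have := u1 b; lra.
  apply: (@le_trans _ _ ((2 * K + 2) * 1)); last by rewrite ler_wpM2l// ltW.
  by rewrite mulr1 lerDr mulr_ge0.
wlog xy : x y / x <= y.
  by move=> h; have [xy|yx] := leP x y; [exact: h|rewrite distrC [`|y - x|]distrC; apply: h; exact: ltW].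
rewrite [`|y - x|]ger0_norm ?subr_ge0//.
have [x0|x0] := leP 0 x; first exact: base.
have [y0|y0] := leP 0 y; last by rewrite !u0 ?(ltW x0) ?(ltW y0)// subrr normr0 mulr_ge0// subr_ge0.
rewrite (u0 (ltW x0)) -(u0 (lexx 0)); apply: (le_trans (base 0 y (lexx 0) y0)).
by rewrite ler_wpM2l// subr0 lerDl oppr_ge0 ltW.
Qed.

Lemma sym_diff_lip x h : 0 <= h -> `|sym_diff u x h| <= 2 * (2 * K + 2) * h.
Proof.
move=> h0; rewrite /sym_diff (_ : _ - _ - _ = (u x - u (x + h)) - (u (x - h) - u x)); last by ring.
apply: (le_trans (ler_normB _ _)); rewrite -mulrA [2 * (_ * h)]mulr_natl mulr2n; apply: lerD.
  by apply: (le_trans (lip_u _ _)); rewrite (_ : x - (x + h) = - h); [rewrite normrN ger0_norm|ring].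
by apply: (le_trans (lip_u _ _)); rewrite (_ : x - h - x = - h); [rewrite normrN ger0_norm|ring].
Qed.

(** Both [x + h] and [x - h] lie in the half-line, so the first order terms of the two expansions
    cancel and an error of order [h ^ (5/4)] remains. *)
Lemma sym_diff_small x h : 0 < h -> h <= x -> h <= 1 -> `|sym_diff u x h| <= 2 * K * (qrt h * h).
Proof.
move=> h0 hx h1; have x0 := lt_le_trans h0 hx; have [_ _ _ fx] := hr.
have := fx x (x + h) x (ltW x0) (lexx x); rewrite addrAC subrr add0r lerDl => /(_ (ltW h0) h1) a1.
have := fx (x - h) x x; rewrite subr_ge0 gerDl oppr_le0 => /(_ hx (ltW h0) (lexx x)).
rewrite opprB addrCA subrr addr0 => /(_ h1) a2.
rewrite /sym_diff (_ : _ - _ - _ = (u x - u (x - h) - U x * h) - (u (x + h) - u x - U x * h)); last by ring.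
by apply: (le_trans (ler_normB _ _)); rewrite -mulrA mulr_natl mulr2n; exact: lerD.
Qed.

Definition lk x h := ind (0 < h) * (h ^- 2 * sym_diff u x h).
Definition half_lap x := It (lk x).

Let Lp := 2 * (2 * K + 2).
Let Lp0 : 0 <= Lp. Proof. by rewrite mulr_ge0// addr_ge0// mulr_ge0. Qed.
Definition dom1 h : R := ind (0 < h <= 1) * (qrt h / h).
Definition dom2 h : R := 4 * (ind (1 <= h) * h ^- 2).

Lemma dom1_ge0 h : 0 <= dom1 h.
Proof.
rewrite /dom1; have [/andP[h0 _]|_] := boolP (0 < h <= 1); rewrite /ind ?mul0r//.
by rewrite mul1r divr_ge0 ?qrt_ge0// ltW.
Qed.

Lemma dom2_ge0 h : 0 <= dom2 h.
Proof. by rewrite !mulr_ge0 ?ind_ge0// invr_ge0 sqr_ge0. Qed.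

Lemma itg_dom1 : itg dom1. Proof. exact: itg_qrt. Qed.
Lemma itg_dom2 : itg dom2. Proof. by apply: itgZ; exact: (itg_inv2 ltr01).1. Qed.

(** For [h <= x <= 1] the kernel is at most [2 K h ^ (-3/4)]. For [h > x] the symmetric difference
    straddles the corner and the kernel is only [O(1/h)]; then [1/h <= x ^ (-1/4) * h ^ (-3/4)]
    keeps the same majorant in [h] at the price of a coefficient that is still integrable at
    [x = 0]. *)
Definition Dx x := 2 * K + Lp * (qrt x)^-1.

Lemma Dx_ge0 x : 0 <= Dx x.
Proof.
have q0 : 0 <= (qrt x)^-1 by rewrite invr_ge0 qrt_ge0.
by apply: addr_ge0; apply: mulr_ge0.
Qed.

Lemma lk_le x h : 0 < x -> `|lk x h| <= Dx x * dom1 h + dom2 h.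
Proof.
move=> x0; have D0 := Dx_ge0 x; rewrite /lk norm_ind.
have [h0|h0] := ltP 0 h; last first.
  by rewrite /ind mul0r; apply: addr_ge0; [apply: mulr_ge0 => //; exact: dom1_ge0|exact: dom2_ge0].
have hi : 0 < h ^- 2 by rewrite invr_gt0 exprn_gt0.
rewrite {1}/ind mul1r normrM (gtr0_norm hi).
have [h1|h1] := leP h 1; last first.
  apply: (@le_trans _ _ (dom2 h)); last by rewrite lerDr mulr_ge0// dom1_ge0.
  by rewrite /dom2 (ltW h1) /ind mul1r mulrC ler_wpM2r ?(ltW hi)//; exact: sym_diff_le4.
apply: (@le_trans _ _ (Dx x * dom1 h)); last by rewrite lerDl dom2_ge0.
rewrite /dom1 h0 h1 /ind mul1r /Dx mulrDl.
have qh : 0 < qrt h := qrt_gt0 h0; have qx : 0 < qrt x := qrt_gt0 x0.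
have qhh : 0 <= qrt h / h by rewrite divr_ge0 ?(ltW qh) ?(ltW h0).
have Lq : 0 <= Lp / qrt x by apply: mulr_ge0 => //; rewrite invr_ge0 ltW.
have [hx|xh] := leP h x.
  apply: (@le_trans _ _ (2 * K * (qrt h / h))); last first.
    by rewrite lerDl; exact: mulr_ge0.
  rewrite (_ : 2 * K * (qrt h / h) = h ^- 2 * (2 * K * (qrt h * h))); last by field; exact: lt0r_neq0.
  by rewrite ler_wpM2l ?(ltW hi)//; exact: sym_diff_small.
apply: (@le_trans _ _ (Lp * (qrt x)^-1 * (qrt h / h))); last first.
  by rewrite lerDr; apply: mulr_ge0 => //; exact: mulr_ge0.
apply: (@le_trans _ _ (h ^- 2 * (Lp * h))).
  by rewrite ler_wpM2l ?(ltW hi)// /Lp; apply: sym_diff_lip; exact: ltW.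
rewrite (_ : h ^- 2 * (Lp * h) = Lp * h^-1 * 1); last by field; exact: lt0r_neq0.
rewrite (_ : Lp * (qrt x)^-1 * (qrt h / h) = Lp * h^-1 * (qrt h / qrt x)); last by ring.
apply: ler_wpM2l; first by rewrite mulr_ge0// invr_ge0 ltW.
by rewrite ler_pdivlMr// mul1r qrt_le// ltW.
Qed.

Lemma meas2_lk : meas2 lk.
Proof.
apply: measurable_funM; first exact: (meas2_snd (meas_lt 0)).
by apply: measurable_funM; [exact: (meas2_snd meas_inv2)|exact: (meas2_del mu_)].
Qed.

Lemma lk_itg x : 0 < x -> itg (lk x).
Proof.
move=> x0; apply: (itg_le (g := fun h => Dx x * dom1 h + dom2 h)).
- exact: (meas2_1 x meas2_lk).
- by move=> h; exact: lk_le.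
- by apply: itgD; [apply: itgZ; exact: itg_dom1|exact: itg_dom2].
Qed.

Lemma half_lap_bound x : 0 < x -> `|half_lap x| <= Dx x * qrt_mass + 4.
Proof.
move=> x0; have -> : Dx x * qrt_mass + 4 = It (fun h => Dx x * dom1 h + dom2 h).
  rewrite ItD; [|by apply: itgZ; exact: itg_dom1|exact: itg_dom2].
  rewrite ItZ; last exact: itg_dom1.
  rewrite /dom2 ItZ ?(itg_inv2 ltr01).2 ?invr1 ?mulr1//; exact: (itg_inv2 ltr01).1.
apply: It_norm_le; first exact: (meas2_1 x meas2_lk).
- by apply: itgD; [apply: itgZ; exact: itg_dom1|exact: itg_dom2].
- by move=> h; exact: lk_le.
Qed.

Lemma Dx_le a x : 0 < a -> a <= x -> Dx x <= Dx a.
Proof.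
move=> a0 ax; rewrite /Dx lerD2l ler_wpM2l// lef_pV2 ?posrE ?qrt_gt0//; first exact: qrt_le.
exact: lt_le_trans ax.
Qed.

Lemma half_lap_cont x : 0 < x -> {for x, continuous half_lap}.
Proof.
move=> x0; pose a := x / 2; have a0 : 0 < a by rewrite divr_gt0.
have := @continuity_under_integral R _ _ mu lk setT measurableT a (x + 1) _ _
  (fun h => Dx a * dom1 h + dom2 h) _ _.
apply.
- by move=> y; rewrite /= in_itv/= => /andP[ay _]; apply: lk_itg; exact: lt_trans ay.
- apply: aeW => h _ y _; rewrite /lk; apply: cvgM; first exact: cvg_cst.
  apply: cvgM; first exact: cvg_cst.
  rewrite /sym_diff; apply: cvgB; first apply: cvgB.
  + by apply: cvgM; [exact: cvg_cst|exact: cu].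
  + apply: (continuous_comp (f := fun y => y + h)); last exact: cu.
    by apply: cvgD; [exact: cvg_id|exact: cvg_cst].
  + apply: (continuous_comp (f := fun y => y - h)); last exact: cu.
    by apply: cvgB; [exact: cvg_id|exact: cvg_cst].
- by apply: itgD; [apply: itgZ; exact: itg_dom1|exact: itg_dom2].
- move=> y; rewrite /= in_itv/= => /andP[ay _]; apply: aeW => h _.
  have y0 := lt_trans a0 ay.
  apply: (le_trans (lk_le h y0)); rewrite lerD2r ler_wpM2r ?dom1_ge0//.
  by apply: Dx_le => //; exact: ltW.
- by rewrite inE /= in_itv/= /a; apply/andP; split; lra.
Qed.

Lemma meas_qrtV : measurable_fun setT (fun x : R => (qrt x)^-1).
Proof. by apply: (measurableT_comp meas_inv); apply: cont_meas; exact: qrt_continuous. Qed.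

Lemma itg_qrtV M : itg (fun x : R => ind (0 < x <= M) * (qrt x)^-1).
Proof.
apply: (itg_le (g := fun x => dom1 x + ind (0 <= x <= M))).
- by apply: measurable_funM; [exact: meas_lc|exact: meas_qrtV].
- move=> x; rewrite norm_ind ger0_norm ?invr_ge0 ?qrt_ge0//.
  have [/andP[x0 xM]|h] := boolP (0 < x <= M); last first.
    by rewrite {1}/ind mul0r addr_ge0 ?dom1_ge0 ?ind_ge0.
  have qx : 0 < qrt x := qrt_gt0 x0.
  rewrite (ltW x0) xM /ind mul1r /=; have [x1|x1] := leP x 1.
    apply: (@le_trans _ _ (dom1 x)); last by rewrite lerDl.
    rewrite /dom1 x0 x1 /ind mul1r ler_pdivlMr// -{2}(qrt4 (ltW x0)).
    rewrite (_ : (qrt x)^-1 * qrt x ^+ 4 = qrt x ^+ 2 * qrt x); last by field; exact: lt0r_neq0.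
    by rewrite ler_piMl ?(ltW qx)// expr_le1 ?(ltW qx)// qrt_le1.
  apply: (@le_trans _ _ 1); last by rewrite lerDr dom1_ge0.
  by rewrite invf_le1// -(ler_pXn2r (n := 4)) ?nnegrE ?(ltW qx)// expr1n qrt4 ltW// ltW.
- by apply: itgD; [exact: itg_dom1|exact: itg_ind].
Qed.

Lemma lk_itg2 f M C : measurable_fun setT f -> (forall x, `|f x| <= C) -> (forall x, M < x -> f x = 0) ->
  itg2 (fun x h => ind (0 < x) * (f x * lk x h)).
Proof.
move=> mf fC fM; have C0 : 0 <= C := le_trans (normr_ge0 _) (fC 0).
apply: (itg2_prod (f := fun x => C * (1 + 2 * K) * ind (0 <= x <= M) + C * Lp * (ind (0 < x <= M) * (qrt x)^-1))
  (g := fun h => dom1 h + dom2 h)).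
- apply: measurable_funM; first exact: (meas2_fst (meas_lt 0)).
  by apply: measurable_funM; [exact: (meas2_fst mf)|exact: meas2_lk].
- by apply: itgD; apply: itgZ; [exact: itg_ind|exact: itg_qrtV].
- by apply: itgD; [exact: itg_dom1|exact: itg_dom2].
move=> x h; rewrite norm_ind; have [x0|x0] := ltP 0 x; last first.
  have q0 : 0 <= (qrt x)^-1 by rewrite invr_ge0 qrt_ge0.
  rewrite {1}/ind mul0r; apply: mulr_ge0; last by apply: addr_ge0; [exact: dom1_ge0|exact: dom2_ge0].
  apply: addr_ge0; apply: mulr_ge0; rewrite ?ind_ge0//; apply: mulr_ge0; rewrite ?ind_ge0//.
  by apply: addr_ge0 => //; exact: mulr_ge0.
rewrite (ltW x0) {1}/ind mul1r /=; have [xM|Mx] := leP x M; last first.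
  by rewrite fM// mul0r normr0 /ind mul0r !mulr0 addr0 mul0r.
rewrite /ind mulr1 mul1r normrM (_ : C * (1 + 2 * K) + C * Lp / qrt x = C * (1 + Dx x)); last by rewrite /Dx; ring.
rewrite -mulrA; apply: ler_pM => //; apply: (le_trans (lk_le h x0)).
have := dom1_ge0 h; have := dom2_ge0 h; have := Dx_ge0 x => D0 d2 d1.
by rewrite mulrDr; apply: lerD; [rewrite ler_wpM2r// lerDr|rewrite ler_peMl// lerDl].
Qed.

Lemma litg_Lam f C : measurable_fun setT f -> (forall x, `|f x| <= C) ->
  litg (fun x => ind (0 < x) * (f x * half_lap x)).
Proof.
move=> mf fC a b; have C0 : 0 <= C := le_trans (normr_ge0 _) (fC 0).
have mi : measurable_fun setT (fun x => ind (a <= x <= b) * f x).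
  by apply: measurable_funM => //; exact: meas_cc.
have bi x : `|ind (a <= x <= b) * f x| <= C.
  by rewrite norm_ind -[leRHS]mul1r ler_pM ?ind_ge0 ?ind_le1.
have zi x : b < x -> ind (a <= x <= b) * f x = 0.
  by move=> bx; rewrite (leNgt x) bx andbF /ind mul0r.
apply: eq_itg (itg2_fst (lk_itg2 mi bi zi)) => x.
have [x0|x0] := ltP 0 x; last first.
  by rewrite /ind mul0r mulr0 (eq_It (g := fun=> 0)) ?It0// => h; rewrite mul0r.
rewrite {1}/ind (eq_It (g := fun h => ind (a <= x <= b) * f x * lk x h)); last by move=> h; rewrite mul1r.
rewrite ItZ; last exact: lk_itg.
by rewrite -/(half_lap x) [ind true]/ind mul1r mulrA.
Qed.

End HalfLaplacian.

(** * The pointwise equation *)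

Section SecondRegularity.
Context {R : realType}.
Implicit Types (f v u phi : R -> R) (a b d e h s t x y z : R).
Local Notation mu := (@lebesgue_measure R).

Variables (beta nu : R) (eta w g : R -> R) (ph : nat -> R -> R) (G : R -> R) (K : R).
Hypotheses (beta0 : 0 < beta) (nu0 : 0 < nu) (heta : is_cutoff beta eta).
Hypotheses (hw : fin_energy w g) (hp : approximates ph w g) (ki : itg2 (sq_kernel (fun y => sin (w y)))).
Hypothesis hEL : forall phi, test_fun phi ->
  It (fun x => g x * derive1 phi x) + It (fun x => sin (w x + beta) * cos (w x + beta) * phi x)
  + nu / (2 * pi) * (It (fun x => sin (w x) * cos (w x) * phi x / x)
     + It (fun x => It (cross_kernel (fun y => sin (w y)) (fun y => cos (w y) * phi y) x))) = 0.
Hypotheses (hr : c1_hoelder w G K) (cG : continuous G) (hG : fin_energy w (fun x => ind (0 < x) * G x))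
  (aeG : {ae mu, forall x, 0 < x -> g x = G x}).

Let kap := nu / (2 * pi).
Let u x := sin (w x).
Let cw : continuous w := fin_energy_cont hw.
Let cu : continuous u. Proof. exact: cont_sin_comp. Qed.
Let mu_ : measurable_fun setT u. Proof. exact: cont_meas. Qed.
Let u1 x : `|u x| <= 1. Proof. exact: sin_norm_le1. Qed.
Let w0 x : x <= 0 -> w x = 0. Proof. by case: hw => _ _ h _; exact: h. Qed.
Let u0 x : x <= 0 -> u x = 0. Proof. by move=> x0; rewrite /u w0// sin0. Qed.
Let uN x y : `|u y - u x| <= l2_norm g * Num.sqrt `|y - x|.
Proof. exact: le_trans (sin_lip _ _) (fin_energy_holder x y hw). Qed.
Let N0 : 0 <= l2_norm g. Proof. exact: sqrtr_ge0. Qed.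
Let hu := c1_hoelder_sin hr.
Let cwc : continuous (fun x => cos (w x)). Proof. exact: cont_cos_comp. Qed.
Let mcos := cont_meas cwc.
Let lam := half_lap u.

(** The right side of the equation, with the [1/x] term and the principal value merged in [lam];
    they are separated again in [is_pv_Lam]. *)
Definition el_rhs x := sin (w x + beta) * cos (w x + beta) + kap * (cos (w x) * lam x).

Lemma el_rhs_cont x : 0 < x -> {for x, continuous el_rhs}.
Proof.
move=> x0; apply: cvgD.
  have cb : continuous (fun x => w x + beta) by move=> y; apply: cvgD; [exact: cw|exact: cvg_cst].
  have c1 : continuous (fun y => sin (w y + beta)) by exact: cont_sin_comp.
  have c2 : continuous (fun y => cos (w y + beta)) by exact: cont_cos_comp.
  by apply: cvgM; [exact: c1|exact: c2].
apply: cvgM; first exact: cvg_cst.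
by apply: cvgM; [exact: cwc|exact: (half_lap_cont hu cu u1 u0 x0)].
Qed.

Lemma litg_rhs : litg (fun x => ind (0 < x) * el_rhs x).
Proof.
have h1 : litg (fun x => ind (0 < x) * (sin (w x + beta) * cos (w x + beta))).
  apply: (litg_bounded (C := 1)).
    apply: measurable_funM; first exact: meas_lt.
    by apply: trig_meas => x; apply: cvgD; [exact: cw|exact: cvg_cst].
  by move=> x; rewrite norm_ind -[leRHS]mulr1 ler_pM ?ind_ge0 ?ind_le1 ?trig_le1.
have h2 := litg_Lam hu cu u1 u0 mcos (fun x => cos_norm_le1 (w x)).
move=> a b; apply: eq_itg (litgD h1 (litgZ kap h2) a b) => x.
by rewrite /el_rhs -/lam; ring.
Qed.

(** The same bracket as in the first regularity step, but the [h] integral now converges absolutely,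
    so Fubini alone moves the nonlocal operator onto [u]. *)
Lemma weak_el_rhs phi : test_fun phi ->
  It (fun x => ind (0 < x) * G x * derive1 phi x) + It (fun x => ind (0 < x) * el_rhs x * phi x) = 0.
Proof.
move=> tp; have [ip hps] := approximates_cos hw hp tp.
have [i1 i2 i3 i4] := euler_lagrange_itg beta hw ki tp.
have [a [b [C [a0 ab C0 p0 pC]]]] := test_bound tp.
have mphi := cont_meas (test_cont tp).
set p := fun y => _ in ip.
pose psi y := cos (w y) * phi y.
have mpsi : measurable_fun setT psi by exact: measurable_funM.
have psib x : b < x -> psi x = 0.
  by move=> bx; rewrite /psi (p0 x _).1 ?mulr0// negb_and -!ltNge bx orbT.
have psiC x : `|psi x| <= C.
  by rewrite normrM -[leRHS]mul1r; apply: ler_pM => //; [exact: cos_norm_le1|exact: (pC x).1].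
have ps0 x : x < a -> psi x = 0.
  by move=> xa; rewrite /psi (p0 x _).1 ?mulr0// negb_and -ltNge xa.
have ips : itg psi.
  apply: (eq_itg (f := fun x => ind (a <= x <= b) * psi x)).
    move=> x; have [h|h] := boolP (a <= x <= b); rewrite /ind ?mul1r// mul0r /psi.
    by rewrite (p0 x h).1 mulr0.
  by apply: (itg_bnd (C := C)).
have i3' : itg (fun x => u x * psi x / x).
  by apply: eq_itg i3 => x; rewrite /psi /u mulrA.
have [bi br] := bracketE mu_ u1 u0 ips a0 ps0 i3' i4.
have Fi := lk_itg2 hu cu u1 u0 mpsi psiC psib.
have E1 : It (fun h => ind (0 < h) * (h ^- 2 * Ah u psi h)) = It (fun x => psi x * lam x).
  transitivity (It (fun h => It (fun x => ind (0 < x) * (psi x * lk u x h)))).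
    have id h : itg (fun x => psi x * sym_diff u x h).
      apply: (eq_itg (f := fun x => sym_diff u x h * psi x)); first by move=> x; rewrite mulrC.
      by apply: (itgMb (C := 4)); [exact: (meas2_1 h (meas2C (meas2_del mu_)))|move=> x; exact: sym_diff_le4|].
    apply: eq_It => h; rewrite /Ah -ItZ// -ItZ; last exact: itgZ.
    apply: eq_It => x; rewrite /lk; have [x0|x0] := ltP 0 x; last first.
      by rewrite ps0 ?(le_lt_trans x0 a0)// !(mul0r, mulr0).
    by rewrite [ind true]/ind; ring.
  rewrite -(It_fubini Fi); apply: eq_It => x; have [x0|x0] := ltP 0 x; last first.
    by rewrite ps0 ?(le_lt_trans x0 a0)// mul0r (eq_It (g := fun=> 0)) ?It0// => h; rewrite !mul0r.
  rewrite (eq_It (g := fun h => psi x * lk u x h)); last by move=> h; rewrite [ind true]/ind mul1r.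
  by rewrite ItZ//; exact: (lk_itg hu cu u1 u0 x0).
have ilam : itg (fun x => psi x * lam x).
  apply: eq_itg (itg2_fst Fi) => x; have [x0|x0] := ltP 0 x; last first.
    by rewrite ps0 ?(le_lt_trans x0 a0)// mul0r (eq_It (g := fun=> 0)) ?It0// => h; rewrite !mul0r.
  rewrite (eq_It (g := fun h => psi x * lk u x h)); last by move=> h; rewrite [ind true]/ind mul1r.
  by rewrite ItZ//; exact: (lk_itg hu cu u1 u0 x0).
have := hEL tp.
rewrite (_ : It (fun x => sin (w x) * cos (w x) * phi x / x) = It (fun x => u x * psi x / x)); last first.
  by apply: eq_It => x; rewrite /psi /u mulrA.
rewrite br E1 => E; rewrite -[RHS]E -addrA; congr (_ + _).
  have [[mG _] _ _ _] := hG; apply: ae_eq_It.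
  - by apply: measurable_funM => //; exact: cont_meas (test_dcont tp).
  - exact: itg_meas i1.
  - apply: aeS aeG => x h; have [x0|x0] := ltP 0 x; first by rewrite h// [ind true]/ind mul1r.
    by rewrite (test_le0 tp x0).2 !mulr0.
rewrite -(ItZ kap ilam) -(ItD i2 (itgZ kap ilam)); apply: eq_It => x.
have [x0|x0] := ltP 0 x; first by rewrite [ind true]/ind /el_rhs /psi; ring.
by rewrite /psi (test_le0 tp x0).1 !(mulr0, mul0r, addr0).
Qed.

Lemma el_rhs_bound a : 0 < a -> exists2 C, 0 <= C & forall x, a <= x -> `|el_rhs x| <= C.
Proof.
move=> a0; have k0 : 0 < kap by exact: kap_gt0 nu0.
have K'0 : 0 <= 4 * K ^+ 2 + K by case: hu.
exists (1 + kap * (Dx (4 * K ^+ 2 + K) a * qrt_mass + 4)).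
  apply: addr_ge0 => //; apply: mulr_ge0; first exact: ltW.
  by apply: addr_ge0 => //; apply: mulr_ge0; [exact: (Dx_ge0 hu)|exact: qrt_mass_ge0].
move=> x ax; have x0 := lt_le_trans a0 ax.
apply: (le_trans (ler_normD _ _)); apply: lerD; first exact: trig_le1.
rewrite normrM (gtr0_norm k0) ler_wpM2l ?(ltW k0)// normrM -[leRHS]mul1r.
apply: ler_pM => //; first exact: cos_norm_le1.
apply: (le_trans (half_lap_bound hu cu u1 u0 x0)); rewrite lerD2r ler_wpM2r ?qrt_mass_ge0//.
exact: (Dx_le hu).
Qed.

(** Du Bois-Reymond yields the identity almost everywhere. At a given [z] a good point [t > z] is
    taken so close that neither [G] nor the primitive changes by more than [e / 2]. *)
Lemma G_int x y : 0 < x -> x <= y -> G y - G x = II x y (fun z => ind (0 < z) * el_rhs z).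
Proof.
pose Q z := ind (0 < z) * el_rhs z.
have lG : litg (fun x => ind (0 < x) * G x).
  by case: hG => /l2_fun_litg.
have [c hc] := du_bois_reymond beta0 heta lG litg_rhs weak_el_rhs.
have key z : 0 < z -> G z = c + II 0 z Q.
  move=> z0; apply/eqP; rewrite -subr_eq0 -normr_le0; apply/ler_addgt0Pr => e e0; rewrite add0r.
  have [C C0 hC] := el_rhs_bound z0.
  have C1 : 0 < C + 1 by rewrite ltr_wpDl.
  have e2 : 0 < e / 2 by rewrite divr_gt0.
  have /cvgrPdist_lt /(_ _ e2) [/= d d0 hd] := cG (x := z).
  pose r := Num.min d (e / 2 / (C + 1)).
  have r0 : 0 < r by rewrite lt_min d0 divr_gt0.
  have zr : z < z + r by rewrite ltrDl.
  have [t /andP[zt tr] ht] := ae_exists zr hc.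
  have t0 := lt_trans z0 zt; have := ht t0; rewrite [ind _]/ind t0 mul1r => Gt.
  have sp : II 0 t Q = II 0 z Q + II z t Q.
    by apply: II_split; [exact: ltW|exact: ltW|exact: litg_rhs].
  have dt : `|z - t| < r by rewrite distrC gtr0_norm ?subr_gt0// ltrBlDl.
  have b1 : `|G z - G t| <= e / 2.
    by apply: ltW; apply: hd; rewrite /= (lt_le_trans dt)// /r ge_min lexx.
  have b2 : `|II z t Q| <= e / 2.
    apply: (@le_trans _ _ (C * (t - z))).
      rewrite -(It_ind (ltW zt)) -ItZ; last exact: itg_ind.
      apply: It_norm_le; first exact: itg_meas (litg_rhs z t).
        by apply: itgZ; exact: itg_ind.
      move=> s; rewrite norm_ind mulrC; have [/andP[zs st]|h] := boolP (z <= s <= t); last by rewrite /ind !mulr0.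
      rewrite /Q norm_ind (lt_le_trans z0 zs) /ind !mulr1 mul1r; exact: hC.
    apply: (@le_trans _ _ ((C + 1) * r)).
      apply: ler_pM => //; [by rewrite subr_ge0 ltW|by rewrite lerDl|].
      by rewrite ltW// ltrBlDl.
    by rewrite mulrC -ler_pdivlMr// /r ge_min lexx orbT.
  rewrite (_ : G z - (c + II 0 z Q) = (G z - G t) + II z t Q); last by rewrite Gt sp; ring.
  by apply: (le_trans (ler_normD _ _)); have := lerD b1 b2; rewrite -splitr.
move=> x0 xy; rewrite (key x x0) (key y (lt_le_trans x0 xy)).
rewrite (II_split (ltW x0) xy (litg_rhs 0 y)); ring.
Qed.

Lemma G_is_derive x : 0 < x -> is_derive x 1 G (el_rhs x).
Proof.
move=> x0; apply: is_derive_eps => e e0.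
have /cvgrPdist_le /(_ _ e0) [/= d d0 hd] := el_rhs_cont x0.
have x2 : 0 < x / 2 by rewrite divr_gt0.
exists (Num.min d (x / 2)); first by rewrite lt_min d0.
have base a b : 0 < a -> a <= b -> (forall t, a <= t <= b -> `|el_rhs x - el_rhs t| <= e) ->
    `|G b - G a - el_rhs x * (b - a)| <= e * (b - a).
  move=> a0 ab h; have ii := itg_ind a b.
  rewrite G_int// -{1}(It_ind ab) -(ItZ _ ii) /II -(ItB (litg_rhs a b) (itgZ _ ii)).
  rewrite -(It_ind ab) -(ItZ e ii); apply: It_norm_le.
  - by apply: itg_meas; apply: itgB; [exact: litg_rhs|exact: itgZ].
  - exact: itgZ.
  move=> t; have [/andP[at_ tb]|ht] := boolP (a <= t <= b); last by rewrite /ind !(mul0r, mulr0) subr0 normr0.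
  by rewrite (lt_le_trans a0 at_) /ind !(mul1r, mulr1) distrC h// at_ tb.
move=> y; rewrite lt_min => /andP[yd yx].
have y0 : 0 < y by move: yx; rewrite ltr_norml => /andP[? _]; lra.
have near t : `|t - x| <= `|y - x| -> `|el_rhs x - el_rhs t| <= e.
  by move=> h; apply: hd; rewrite /= distrC (le_lt_trans h).
have [xy|xy] := leP x y.
  rewrite [`|y - x|]ger0_norm ?subr_ge0//; apply: base => // t /andP[xt ty]; apply: near.
  by rewrite !ger0_norm ?subr_ge0// lerD2r.
rewrite [`|y - x|]distrC [`|x - y|]gtr0_norm ?subr_gt0//.
have -> : G y - G x - el_rhs x * (y - x) = - (G x - G y - el_rhs x * (x - y)) by ring.
rewrite normrN; apply: base => //; first exact: ltW.
move=> t /andP[yt tx]; apply: near.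
by rewrite distrC [leRHS]distrC !ger0_norm ?subr_ge0 ?(ltW xy)//; lra.
Qed.

End SecondRegularity.

(** * The slope at the boundary *)

Section Decay.
Context {R : realType}.
Implicit Types (f v u phi : R -> R) (a b d e h s t x y z : R).
Local Notation mu := (@lebesgue_measure R).

Lemma tail_small f : itg f -> forall e, 0 < e -> exists2 M, 0 < M &
  forall m, M <= m -> It (fun x => ind (m <= x) * `|f x|) <= e.
Proof.
move=> fi e e0; have mf := itg_meas fi.
have mn : measurable_fun setT (fun x => `|f x|) by exact: measurableT_comp.
have h : It (fun x => ind (n.+1%:R <= x) * `|f x|) @[n --> \oo] --> It (fun=> 0 : R).
  apply: (It_dom (g := fun x => `|f x|) _ _ _ _).2.
  - by move=> n; apply: measurable_funM => //; exact: meas_ge.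
  - move=> x; apply: cvg_near_cst; near=> n.
    rewrite leNgt (_ : x < n.+1%:R) ?/ind ?mul0r//.
    apply: (@le_lt_trans _ _ n%:R); last by rewrite ltr_nat.
    by near: n; exact: nbhs_infty_ger.
  - by move=> n x; rewrite [leLHS]norm_ind normr_id ler_piMl ?ind_le1.
  - exact: itg_norm.
rewrite It0 in h; move/cvgrPdist_le : h => /(_ _ e0)[N _ hN].
exists N.+1%:R => // m Nm; have := hN N (leqnn N); rewrite /= sub0r normrN.
move=> /(le_trans (ler_norm _)); apply: le_trans; apply: It_le.
- apply: (itg_le (g := fun x => `|f x|)) => //; last exact: itg_norm.
    by apply: measurable_funM => //; exact: meas_ge.
  by move=> x; rewrite norm_ind normr_id ler_piMl ?ind_le1.
- apply: (itg_le (g := fun x => `|f x|)) => //; last exact: itg_norm.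
    by apply: measurable_funM => //; exact: meas_ge.
  by move=> x; rewrite norm_ind normr_id ler_piMl ?ind_le1.
move=> x; have [mx|xm] := leP m x; last by rewrite /ind mul0r mulr_ge0//; case: ifP.
by rewrite (le_trans Nm mx).
Unshelve. all: by end_near. Qed.

(** If [|f x| > e], the Hoelder bound keeps [|f|] above [e / 2] on [[x, x + d]] with [d] independent
    of [x]. This contributes [d * e ^+ 2 / 4] to the integral of [f ^+ 2], more than the tail beyond
    [M] contains. *)
Lemma decay f C : 0 <= C -> measurable_fun setT f ->
  (forall x y, 0 <= x -> x <= y -> y - x <= 1 -> `|f x - f y| <= C * qrt (y - x)) ->
  itg (fun x => ind (0 < x) * f x ^+ 2) ->
  forall e, 0 < e -> exists2 M, 0 < M & forall x, M <= x -> `|f x| <= e.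
Proof.
move=> C0 mf fC fi e e0; have C1 : 0 < 2 * (C + 1) by rewrite mulr_gt0// ltr_wpDl.
have ec : 0 < e / (2 * (C + 1)) by rewrite divr_gt0.
pose d := Num.min 1 ((e / (2 * (C + 1))) ^+ 4).
have d0 : 0 < d by rewrite lt_min ltr01 exprn_gt0.
have e8 : 0 < d * e ^+ 2 / 8 by rewrite divr_gt0// mulr_gt0// exprn_gt0.
have [M M0 hM] := tail_small fi e8; exists M => // x Mx; rewrite leNgt; apply/negP => ex.
have x0 := lt_le_trans M0 Mx; have xd : x <= x + d by rewrite lerDl ltW.
have dE : x + d - x = d by rewrite addrC addKr.
have d1 : d <= 1 by rewrite /d ge_min lexx.
have := hM x Mx; apply/negP; rewrite -ltNge.
have low y : x <= y -> y <= x + d -> e / 2 <= `|f y|.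
  move=> xy yd; have yx : y - x <= d by rewrite lerBlDl.
  have := fC x y (ltW x0) xy (le_trans yx d1) => h.
  have : C * qrt (y - x) <= e / 2.
    apply: (@le_trans _ _ ((C + 1) * (e / (2 * (C + 1))))); last by rewrite le_eqVlt; apply/orP; left; apply/eqP; field; rewrite gt_eqF// ltr_wpDl.
    apply: ler_pM => //; [exact: qrt_ge0|by rewrite lerDl|].
    apply: (@le_trans _ _ (qrt ((e / (2 * (C + 1))) ^+ 4))).
      by apply: qrt_le; apply: (le_trans yx); rewrite /d ge_min lexx orbT.
    rewrite /qrt (_ : _ ^+ 4 = ((e / (2 * (C + 1))) ^+ 2) ^+ 2); last by rewrite -exprM.
    by rewrite sqrtr_sqr ger0_norm ?sqr_ge0// sqrtr_sqr ger0_norm// ltW.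
  have := ler_normB (f x - f y) (- f y); rewrite opprK subrK normrN; move: ex h; lra.
apply: (@lt_le_trans _ _ (It (fun y => (e / 2) ^+ 2 * ind (x <= y <= x + d)))).
  rewrite ItZ ?It_ind ?dE//; last exact: itg_ind.
  have : 0 < d * e ^+ 2 by rewrite mulr_gt0// exprn_gt0.
  lra.
apply: It_le; first by apply: itgZ; exact: itg_ind.
  apply: (itg_le (g := fun y => `|ind (0 < y) * f y ^+ 2|)); last exact: itg_norm.
    apply: measurable_funM; first exact: meas_ge.
    by apply: measurableT_comp => //; exact: itg_meas fi.
  by move=> y; rewrite [leLHS]norm_ind normr_id ler_piMl ?ind_le1.
move=> y; have [/andP[xy yd]|h] := boolP (x <= y <= x + d); last first.
  by rewrite [ind false]/ind mulr0 mulr_ge0 ?ind_ge0.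
rewrite xy (lt_le_trans x0 xy) /ind !mul1r mulr1 ger0_norm ?sqr_ge0//.
rewrite -[leRHS](real_normK (num_real (f y))) ler_pXn2r ?nnegrE ?low//.
by rewrite divr_ge0// ltW.
Qed.

End Decay.

(** * The Pohozaev identity *)

Section Pohozaev.
Context {R : realType}.
Implicit Types (f v phi : R -> R) (a b d e h s t x y z M : R).
Local Notation mu := (@lebesgue_measure R).
Variables (u U : R -> R) (K : R).
Hypotheses (hr : c1_hoelder u U K) (cu : continuous u) (u1 : forall x, `|u x| <= 1)
  (u0 : forall x, x <= 0 -> u x = 0) (cU : continuous U).
Hypothesis U2 : itg (fun x => ind (0 < x) * U x ^+ 2).

Let mu_ : measurable_fun setT u := cont_meas cu.
Let mU : measurable_fun setT U := cont_meas cU.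
Let K0 : 0 <= K. Proof. by case: hr. Qed.

Let cus h : continuous (fun x => u (x + h)).
Proof.
move=> x; apply: (continuous_comp (f := fun y => y + h)); last exact: cu.
by apply: cvgD; [exact: cvg_id|exact: cvg_cst].
Qed.

Let cum h : continuous (fun x => u (x - h)).
Proof.
move=> x; apply: (continuous_comp (f := fun y => y - h)); last exact: cu.
by apply: cvgB; [exact: cvg_id|exact: cvg_cst].
Qed.

Let cUs h : continuous (fun x => U (x + h)).
Proof.
move=> x; apply: (continuous_comp (f := fun y => y + h)); last exact: cU.
by apply: cvgD; [exact: cvg_id|exact: cvg_cst].
Qed.

Lemma II_U x y : 0 <= x -> x <= y -> II x y U = u y - u x.
Proof.
move=> x0 xy; apply: FTC2; [exact: xy|exact: contT_within|exact: contT_within|].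
by move=> z /andP[xz _]; apply: (c1_hoelder_is_derive hr); exact: le_lt_trans xz.
Qed.

Lemma II_Uu M : 0 <= M -> II 0 M (fun x => U x * u x + U x * u x) = u M ^+ 2.
Proof.
move=> M0; transitivity (u M * u M - u 0 * u 0); last by rewrite (u0 (lexx 0)) mul0r subr0 expr2.
apply: (@FTC2 _ (fun x => u x * u x)).
- exact: M0.
- apply: contT_within => x; apply: cvgD; by apply: cvgM; [exact: cU|exact: cu].
- by apply: contT_within => x; apply: cvgM; exact: cu.
move=> z /andP[z0 _]; have d := c1_hoelder_is_derive hr z0.
by apply: (is_derive_eq (is_deriveM d d)); rewrite /GRing.scale/= mulrC.
Qed.

Lemma is_derive_shift f h x l : is_derive (x + h) 1 f l -> is_derive x 1 (fun y => f (y + h)) l.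
Proof.
move=> d; have := @is_derive_aff R f 1 h x l; rewrite mul1r => /(_ d) d'.
have e : (fun y => f (1 * y + h)) = (fun y => f (y + h)) by apply/funext => y; rewrite mul1r.
by rewrite e mul1r in d'.
Qed.

(** The product rule for [u x * u (x + h)] on [[0, M]], the second integral being translated by [h].
    It may start at [0] instead of [h], since [u (y - h)] vanishes for [y <= h]. *)
Lemma II_Uup M h : 0 <= M -> 0 <= h ->
  II 0 M (fun x => U x * u (x + h)) + II 0 (M + h) (fun y => U y * u (y - h)) = u M * u (M + h).
Proof.
move=> M0 h0.
have -> : II 0 (M + h) (fun y => U y * u (y - h)) = II 0 M (fun x => U (x + h) * u x).
  rewrite /II -(It_shift h); last first.
    apply: measurable_funM; first exact: meas_cc.
    by apply: measurable_funM => //; exact: (meas_shift (- h) mu_).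
  apply: eq_It => x; rewrite addrK lerD2r; have [x0|x0] := leP x 0; last first.
    by rewrite (ltW x0) (le_trans (ltW x0)) ?lerDl.
  by rewrite u0// !mulr0.
have c1 : continuous (fun x => U x * u (x + h)) by move=> x; apply: cvgM; [exact: cU|exact: cus].
have c2 : continuous (fun x => U (x + h) * u x) by move=> x; apply: cvgM; [exact: cUs|exact: cu].
transitivity (II 0 M (fun x => U x * u (x + h) + U (x + h) * u x)).
  rewrite /II -ItD; [|exact: litg_cont|exact: litg_cont].
  by apply: eq_It => x; rewrite mulrDr.
transitivity (u M * u (M + h) - u 0 * u (0 + h)); last by rewrite (u0 (lexx 0)) mul0r subr0.
apply: (@FTC2 _ (fun x => u x * u (x + h))).
- exact: M0.
- by apply: contT_within => x; apply: cvgD; [exact: c1|exact: c2].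
- by apply: contT_within => x; apply: cvgM; [exact: cu|exact: cus].
move=> z /andP[z0 _]; have d := c1_hoelder_is_derive hr z0.
have d2 : is_derive z 1 (fun y => u (y + h)) (U (z + h)).
  by apply: is_derive_shift; apply: (c1_hoelder_is_derive hr); rewrite ltr_wpDr.
by apply: (is_derive_eq (is_deriveM d d2)); rewrite /GRing.scale/=; ring.
Qed.

(** The term [2 u] integrates to [u M ^+ 2], and [II_Uup] trades the forward translate for the
    backward one on the longer interval [[0, M + h]]. The backward terms then cancel on [[0, M]].
    Since [u 0 = 0], the origin contributes nothing. *)
Lemma pohozaev M h : 0 <= M -> 0 <= h ->
  II 0 M (fun x => U x * sym_diff u x h) = II M (M + h) (fun y => U y * (u (y - h) - u M)).
Proof.
move=> M0 h0; have Mh : M <= M + h by rewrite lerDl.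
have cm : continuous (fun x => U x * u (x - h)) by move=> x; apply: cvgM; [exact: cU|exact: cum].
have cp : continuous (fun x => U x * u (x + h)) by move=> x; apply: cvgM; [exact: cU|exact: cus].
have cc : continuous (fun x => U x * u x + U x * u x).
  by move=> x; apply: cvgD; apply: cvgM; [exact: cU|exact: cu|exact: cU|exact: cu].
have im := litg_cont cm; have ip := litg_cont cp; have ic := litg_cont cc; have iU := litg_cont cU.
have E1 : II 0 M (fun x => U x * sym_diff u x h) = u M ^+ 2 - II 0 M (fun x => U x * u (x + h)) - II 0 M (fun x => U x * u (x - h)).
  rewrite -(II_Uu M0) /II -(ItB (ic 0 M) (ip 0 M)) -(ItB (itgB (ic 0 M) (ip 0 M)) (im 0 M)).
  by apply: eq_It => x; rewrite /sym_diff; ring.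
have E2 : II M (M + h) (fun y => U y * (u (y - h) - u M)) =
    II M (M + h) (fun y => U y * u (y - h)) - u M * (u (M + h) - u M).
  rewrite -(II_U M0 Mh) /II -(ItZ (u M) (iU M (M + h))) -(ItB (im M (M + h)) (itgZ _ (iU M (M + h)))).
  by apply: eq_It => x; ring.
have E3 := II_Uup M0 h0; have E4 := II_split M0 Mh (im 0 (M + h)).
rewrite E1 E2; rewrite E4 in E3.
have -> : II 0 M (fun x => U x * u (x + h)) = u M * u (M + h) - (II 0 M (fun y => U y * u (y - h)) + II M (M + h) (fun y => U y * u (y - h))).
  by rewrite -E3 addrK.
by ring.
Qed.

Let Lp := 2 * K + 2.

(** Cauchy-Schwarz on [[M, M + h]] gives [sqrt h] times a tail of [U ^+ 2]. The minimum serves both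
    ends of the later integration against [h ^- 2]: it leaves [h ^ (-1/2)] near zero and
    [h ^ (-3/2)] at infinity. *)
Lemma pohozaev_bound M h : 0 < M -> 0 < h ->
  `|II 0 M (fun x => U x * sym_diff u x h)| <=
    Num.min 2 (Lp * h) * (Num.sqrt h * Num.sqrt (It (fun x => ind (M <= x) * (ind (0 < x) * U x ^+ 2)))).
Proof.
move=> M0 h0; rewrite (pohozaev (ltW M0) (ltW h0)); set m : R := Num.min 2 _; have Mh : M <= M + h by rewrite lerDl ltW.
have Lp0 : 0 <= Lp by rewrite addr_ge0// mulr_ge0.
have m0 : 0 <= m by rewrite le_min ler0n mulr_ge0// ltW.
pose V x := ind (M <= x) * U x.
have V2 : l2_fun V.
  split; first by apply: measurable_funM => //; exact: meas_ge.
  apply: (itg_le (g := fun x => `|ind (0 < x) * U x ^+ 2|)); last exact: itg_norm.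
    by apply: measurable_funX; apply: measurable_funM => //; exact: meas_ge.
  move=> x; rewrite /V; have [Mx|xM] := leP M x; last by rewrite /ind mul0r expr0n normr0.
  by rewrite (lt_le_trans M0 Mx) /ind !mul1r.
have iV := l2_fun_litg (l2_fun_norm V2) M (M + h).
apply: (@le_trans _ _ (m * II M (M + h) (fun x => `|V x|))).
  rewrite /II -ItZ//; apply: It_norm_le; last 1 first.
  - move=> y; rewrite norm_ind mulrCA; have [/andP[My yh]|hn] := boolP (M <= y <= M + h); last by rewrite /ind !mul0r.
    rewrite /V My /ind !mul1r normrM mulrC; apply: ler_wpM2r => //.
    rewrite /m le_min; apply/andP; split.
      by apply: (le_trans (ler_normB _ _)); have := u1 (y - h); have := u1 M; lra.
    apply: (le_trans (lip_u hr u1 u0 _ _)); rewrite ler_wpM2l//.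
    by rewrite ler_norml; apply/andP; split; lra.
  - apply: measurable_funM; first exact: meas_cc.
    by apply: measurable_funM => //; apply: measurable_funB => //; exact: (meas_shift (- h) mu_).
  - exact: itgZ.
apply: ler_wpM2l => //; apply: (le_trans (ler_norm _)); apply: (le_trans (II_CS Mh (l2_fun_norm V2))).
rewrite addrAC subrr add0r ler_wpM2l ?sqrtr_ge0// le_eqVlt; apply/orP; left; apply/eqP.
congr Num.sqrt; apply: eq_It => x; rewrite real_normK ?num_real// /V.
have [Mx|xM] := leP M x; last by rewrite /ind !mul0r expr0n.
by rewrite (lt_le_trans M0 Mx) /ind !mul1r.
Qed.

Definition pohozaev_const : R := Lp * qrt_mass + 2 * It (fun h => ind (1 <= h) * (Num.sqrt h * h ^- 2)).
Let UL x := ind (0 < x) * (U x * half_lap u x).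

Let Ub x : 0 <= x -> `|U x| <= K. Proof. by case: hr => _ h _ _; exact: h. Qed.

(** [U] is known to be bounded on the closed half-line only; clamping the argument extends the bound
    to the line. *)
Let Uc x := U (Num.max x 0).
Let mUc : measurable_fun setT Uc.
Proof. by apply: (measurableT_comp mU); exact: measurable_maxr. Qed.
Let Ucb x : `|Uc x| <= K. Proof. by apply: Ub; rewrite le_max lexx orbT. Qed.
Let UcE x : 0 <= x -> Uc x = U x. Proof. by move=> x0; rewrite /Uc max_l. Qed.

Lemma litg_UL : litg UL.
Proof.
move=> a b; apply: eq_itg (litg_Lam hr cu u1 u0 mUc Ucb a b) => x.
by rewrite /UL; have [x0|x0] := ltP 0 x; rewrite /ind ?mul0r// UcE// ltW.
Qed.

(** Exchanging [x] and [h] allows [pohozaev_bound] to be used at each fixed [h]. The constant does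
    not depend on [M], and the first factor tends to zero as [M] grows. *)
Lemma II_UL_bound M : 0 < M ->
  `|II 0 M UL| <= Num.sqrt (It (fun x => ind (M <= x) * (ind (0 < x) * U x ^+ 2))) * pohozaev_const.
Proof.
move=> M0; set T := Num.sqrt _.
have T0 : 0 <= T by exact: sqrtr_ge0.
have Lp0 : 0 <= Lp by rewrite addr_ge0// mulr_ge0.
pose f x := ind (0 <= x <= M) * Uc x.
have mf : measurable_fun setT f by apply: measurable_funM => //; exact: meas_cc.
have fb x : `|f x| <= K by rewrite norm_ind -[leRHS]mul1r ler_pM ?ind_ge0 ?ind_le1.
have fM x : M < x -> f x = 0 by move=> Mx; rewrite /f (leNgt x) Mx andbF /ind mul0r.
have Fi := lk_itg2 hr cu u1 u0 mf fb fM.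
have fE x : ind (0 < x) * f x = ind (0 < x) * (ind (0 <= x <= M) * U x).
  by rewrite /f; have [x0|x0] := ltP 0 x; rewrite /ind ?mul0r// UcE// ltW.
have E1 : II 0 M UL = It (fun h => It (fun x => ind (0 < x) * (f x * lk u x h))).
  rewrite -(It_fubini Fi) /II; apply: eq_It => x; rewrite /UL; have [x0|x0] := ltP 0 x; last first.
    by rewrite /ind mul0r mulr0 (eq_It (g := fun=> 0)) ?It0// => h; rewrite mul0r.
  rewrite (eq_It (g := fun h => f x * lk u x h)); last by move=> h; rewrite [ind true]/ind mul1r.
  rewrite ItZ; last exact: (lk_itg hr cu u1 u0 x0).
  by rewrite /f UcE ?(ltW x0)// -/(half_lap u x) [ind true]/ind mul1r mulrA.
have E2 h : It (fun x => ind (0 < x) * (f x * lk u x h)) = ind (0 < h) * (h ^- 2 * II 0 M (fun x => U x * sym_diff u x h)).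
  have cd : continuous (fun x => U x * sym_diff u x h).
    move=> x; apply: cvgM; first exact: cU.
    apply: cvgB; last exact: cum.
    by apply: cvgB; [apply: cvgM; [exact: cvg_cst|exact: cu]|exact: cus].
  rewrite /II -ItZ; last exact: litg_cont.
  rewrite -ItZ; last by apply: itgZ; exact: litg_cont.
  apply: ae_eq_It.
  - exact: (meas2_1 h (meas2C (itg2_meas Fi))).
  - by apply: itg_meas; apply: itgZ; apply: itgZ; exact: litg_cont.
  apply: aeS (ae_neq 0) => x x0; rewrite mulrA fE /lk.
  have [xp|xn] := ltP 0 x; first by rewrite [ind true]/ind; ring.
  have -> : (0 <= x <= M) = false by rewrite [0 <= x]leNgt lt_neqAle x0 xn.
  by rewrite /ind !(mul0r, mulr0).
rewrite E1 (eq_It E2).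
have -> : T * pohozaev_const = It (fun h => T * (Lp * dom1 h + 2 * (ind (1 <= h) * (Num.sqrt h * h ^- 2)))).
  rewrite ItZ; last by apply: itgD; apply: itgZ; [exact: itg_dom1|exact: itg_sqrt2].
  rewrite ItD; [|by apply: itgZ; exact: itg_dom1|by apply: itgZ; exact: itg_sqrt2].
  by rewrite !ItZ//; [exact: itg_sqrt2|exact: itg_dom1].
apply: It_norm_le.
- by apply: itg_meas; apply: eq_itg (itg2_fst (itg2C Fi)) => h; exact: E2.
- by apply: itgZ; apply: itgD; apply: itgZ; [exact: itg_dom1|exact: itg_sqrt2].
move=> h; have [h0|h0] := ltP 0 h; last first.
  rewrite {1}/ind mul0r normr0 mulr_ge0// addr_ge0// mulr_ge0 ?dom1_ge0//.
  by rewrite mulr_ge0 ?ind_ge0// mulr_ge0 ?sqrtr_ge0// invr_ge0 sqr_ge0.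
have hi : 0 < h ^- 2 by rewrite invr_gt0 exprn_gt0.
have hs : 0 <= Num.sqrt h := sqrtr_ge0 h.
have hq : 0 <= h ^- 2 * Num.sqrt h by rewrite mulr_ge0// ltW.
rewrite {1}/ind mul1r normrM (gtr0_norm hi).
apply: (@le_trans _ _ (h ^- 2 * (Num.min 2 (Lp * h) * (Num.sqrt h * T)))).
  by rewrite ler_wpM2l ?(ltW hi)//; exact: pohozaev_bound.
rewrite (_ : h ^- 2 * _ = T * (Num.min 2 (Lp * h) * (h ^- 2 * Num.sqrt h))); last by ring.
apply: ler_wpM2l => //; have [h1|h1] := leP h 1.
  apply: (@le_trans _ _ (Lp * dom1 h)); last first.
    by rewrite lerDl mulr_ge0 ?mulr_ge0 ?ind_ge0 ?hs// invr_ge0 sqr_ge0.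
  apply: (@le_trans _ _ (Lp * h * (h ^- 2 * Num.sqrt h))).
    by rewrite ler_wpM2r// ge_min lexx orbT.
  rewrite /dom1 h0 h1 /ind mul1r (_ : Lp * h * (h ^- 2 * Num.sqrt h) = Lp * (Num.sqrt h / h)); last by field; exact: lt0r_neq0.
  by rewrite ler_wpM2l// ler_wpM2r ?invr_ge0 ?(ltW h0)// sqrt_le_qrt// (ltW h0).
apply: (@le_trans _ _ (2 * (ind (1 <= h) * (Num.sqrt h * h ^- 2)))); last first.
  by rewrite lerDr mulr_ge0 ?dom1_ge0.
rewrite (ltW h1) /ind mul1r [Num.sqrt h * _]mulrC ler_wpM2r// ge_min lexx//.
Qed.

(** The equation holds on the open half-line, so the energy balance is written on [[a, M]] with
    [a > 0]; integrability of [UL] up to the origin makes the missing piece small. *)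
Lemma II_UL_0 e : 0 < e -> exists2 d, 0 < d & forall a, 0 < a < d -> `|II 0 a UL| <= e.
Proof.
move=> e0; have iU := litg_UL 0 1; have mUL := litg_meas litg_UL.
have h : It (fun x => ind (0 <= x <= n.+1%:R^-1) * `|ind (0 <= x <= 1) * UL x|) @[n --> \oo] --> It (fun=> 0 : R).
  apply: (It_dom (g := fun x => `|ind (0 <= x <= 1) * UL x|) _ _ _ _).2.
  - move=> n; apply: measurable_funM; first exact: meas_cc.
    by apply: measurableT_comp => //; exact: itg_meas iU.
  - move=> x; have [x0|x0] := ltP 0 x; last first.
      apply: cvg_near_cst; apply: nearW => n; rewrite /UL [0 < x]ltNge x0 [ind (~~ true)]/ind mul0r mulr0 normr0 mulr0//.
    apply: cvg_near_cst.
    have := @cvg_invS R => /cvgrPdist_lt /(_ _ x0); apply: filterS => n.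
    rewrite sub0r normrN => /(le_lt_trans (ler_norm _)) hn.
    by rewrite [x <= _]leNgt hn andbF /ind mul0r.
  - by move=> n x; rewrite [leLHS]norm_ind normr_id ler_piMl ?ind_le1.
  - exact: itg_norm.
rewrite It0 in h; move/cvgrPdist_le : h => /(_ _ e0)[N _ /(_ N (leqnn N))] /=.
rewrite sub0r normrN => /(le_trans (ler_norm _)) hN.
have N1 : N.+1%:R^-1 <= 1 :> R by rewrite invf_le1// ler1n.
exists N.+1%:R^-1; first by rewrite invr_gt0.
move=> a /andP[a0 aN]; apply: le_trans hN; rewrite /II; apply: It_norm_le.
- exact: itg_meas (litg_UL 0 a).
- apply: (itgMb (C := 1)); [exact: meas_cc|by move=> x; rewrite ger0_norm ?ind_ge0 ?ind_le1|exact: itg_norm].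
move=> x; rewrite norm_ind; have [/andP[x0 xa]|hn] := boolP (0 <= x <= a); last first.
  by rewrite [ind false]/ind mul0r mulr_ge0 ?ind_ge0.
have xN := le_trans xa (ltW aN).
by rewrite x0 xN (le_trans xN N1) /ind !mul1r.
Qed.

End Pohozaev.

(** * The energy balance on the half-line *)

Section Boundary.
Context {R : realType}.
Implicit Types (f v phi : R -> R) (a b d e h s t x y z M : R).
Local Notation mu := (@lebesgue_measure R).
Variables (beta nu : R) (w G : R -> R) (K : R).
Hypotheses (nu0 : 0 < nu) (hr : c1_hoelder w G K) (cG : continuous G)
  (hG : fin_energy w (fun x => ind (0 < x) * G x)).
Hypotheses (dG : forall x, 0 < x -> is_derive x 1 G (el_rhs beta nu w x))
  (isn : itg (fun x => ind (0 < x) * sin (w x + beta) ^+ 2)).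

Let kap := nu / (2 * pi).
Let u x := sin (w x).
Let U x := cos (w x) * G x.
Let cw : continuous w := fin_energy_cont hG.
Let cu : continuous u. Proof. exact: cont_sin_comp. Qed.
Let u1 x : `|u x| <= 1. Proof. exact: sin_norm_le1. Qed.
Let w0 x : x <= 0 -> w x = 0. Proof. by case: hG => _ _ h _; exact: h. Qed.
Let u0 x : x <= 0 -> u x = 0. Proof. by move=> x0; rewrite /u w0// sin0. Qed.
Let hu := c1_hoelder_sin hr.
Let cwc : continuous (fun x => cos (w x)). Proof. exact: cont_cos_comp. Qed.
Let cU : continuous U.
Proof. by move=> x; apply: cvgM; [exact: cwc|exact: cG]. Qed.
Let K0 : 0 <= K. Proof. by case: hr. Qed.

Let G2 : itg (fun x => ind (0 < x) * G x ^+ 2).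
Proof.
have [[_ g2] _ _ _] := hG; apply: eq_itg g2 => x.
by rewrite exprMn /ind; case: ifP; rewrite ?expr1n ?expr0n.
Qed.

Let U2 : itg (fun x => ind (0 < x) * U x ^+ 2).
Proof.
apply: (itg_le (g := fun x => ind (0 < x) * G x ^+ 2)) => //.
  by apply: measurable_funM; [exact: meas_lt|apply: measurable_funX; exact: cont_meas].
move=> x; rewrite norm_ind; apply: ler_wpM2l; first exact: ind_ge0.
rewrite ger0_norm ?sqr_ge0// exprMn; apply: ler_piMl; first exact: sqr_ge0.
by rewrite -(real_normK (num_real (cos (w x)))) expr_le1// cos_norm_le1.
Qed.

(** The first integral of [theta'' = sin theta * cos theta]. The nonlocal term changes it at the
    rate [kap * UL]. *)
Let en x := 2^-1 * G x ^+ 2 - 2^-1 * sin (w x + beta) ^+ 2.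
Let UL x := ind (0 < x) * (U x * half_lap u x).

Let cb : continuous (fun x => w x + beta).
Proof. by move=> x; apply: cvgD; [exact: cw|exact: cvg_cst]. Qed.

Let cen : continuous en.
Proof.
move=> x; apply: cvgB; apply: cvgM; try exact: cvg_cst.
  by rewrite expr2; under eq_fun do rewrite expr2; apply: cvgM; exact: cG.
have c1 : continuous (fun y => sin (w y + beta)) by exact: cont_sin_comp.
by rewrite expr2; under eq_fun do rewrite expr2; apply: cvgM; exact: c1.
Qed.

Lemma energy_identity a M : 0 < a -> a <= M -> en M - en a = kap * II a M UL.
Proof.
move=> a0 aM; have iUL := litg_UL hu cu u1 u0 cU.
rewrite /II -(ItZ kap (iUL a M)).
transitivity (II a M (fun x => kap * (U x * half_lap u x))); last first.
  apply: eq_It => x; have [/andP[ax xM]|h] := boolP (a <= x <= M); last by rewrite /ind !mul0r mulr0.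
  by rewrite /UL (lt_le_trans a0 ax) /ind !mul1r.
symmetry; apply: FTC2.
- exact: aM.
- apply: continuous_in_subspaceT => x; rewrite inE /= in_itv/= => /andP[ax _].
  have x0 := lt_le_trans a0 ax.
  apply: cvgM; first exact: cvg_cst.
  by apply: cvgM; [exact: cU|exact: (half_lap_cont hu cu u1 u0 x0)].
- exact: contT_within.
move=> x /andP[ax _]; have x0 := lt_trans a0 ax.
have d1 := dG x0; have dw := c1_hoelder_is_derive hr x0.
have ds := is_derive1_comp (f := sin) (g := fun y => w y + beta) (is_derive_sin _) (is_deriveD dw (is_derive_cst beta x 1)).
have d := is_deriveB (is_deriveZ 2^-1 (is_deriveM d1 d1)) (is_deriveZ 2^-1 (is_deriveM ds ds)).
rewrite (_ : en = (2^-1 \*: (G * G) - 2^-1 \*: ((sin \o (fun y => w y + beta)) * (sin \o (fun y => w y + beta))))%R); last first.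
  by apply/funext => y; rewrite /en !expr2.
by apply: (is_derive_eq d); rewrite /GRing.scale/= /el_rhs -/kap /U; field.
Qed.

Lemma slope_sq : G 0 ^+ 2 = sin beta ^+ 2.
Proof.
have k0 : 0 < kap by exact: kap_gt0 nu0.
have iUL := litg_UL hu cu u1 u0 cU.
suff : en 0 = 0.
  by rewrite /en w0// add0r => /eqP; rewrite -mulrBr mulf_eq0 invr_eq0 pnatr_eq0/= subr_eq0 => /eqP.
apply/eqP; rewrite -normr_le0; apply/ler_addgt0Pr => e e0; rewrite add0r.
have e4 : 0 < e / 4 by rewrite divr_gt0.
pose r := Num.min 1 (e / 4).
have r0 : 0 < r by rewrite lt_min ltr01.
have r2 : r ^+ 2 <= e / 4.
  apply: (@le_trans _ _ (1 * (e / 4))); last by rewrite mul1r.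
  by rewrite expr2; apply: ler_pM; rewrite ?(ltW r0)// /r ge_min lexx ?orbT.
have [_ _ GH _] := hr.
have [M1 M10 hM1] : exists2 M, 0 < M & forall x, M <= x -> `|G x| <= r.
  apply: (decay K0 (cont_meas cG) _ G2 r0) => x y x0 xy yx.
  have d0 : 0 <= y - x by rewrite subr_ge0.
  by have := GH x y x0 (le_trans x0 xy); rewrite distrC (ger0_norm d0); apply.
have K20 : 0 <= 2 * K by exact: mulr_ge0.
have mS : measurable_fun setT (fun x => sin (w x + beta)).
  by apply: cont_meas; exact: cont_sin_comp.
have [M2 M20 hM2] : exists2 M, 0 < M & forall x, M <= x -> `|sin (w x + beta)| <= r.
  apply: (decay K20 mS _ isn r0) => x y x0 xy yx.
  have d0 : 0 <= y - x by rewrite subr_ge0.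
  apply: (le_trans (sin_lip _ _)); rewrite opprD addrACA subrr addr0 distrC.
  apply: (le_trans (c1_hoelder_lip hr x0 xy yx)); rewrite ler_wpM2l// le_qrt// d0//.
pose c := pohozaev_const (4 * K ^+ 2 + K) + 1 : R.
have c0 : 0 <= pohozaev_const (4 * K ^+ 2 + K).
  rewrite /pohozaev_const; apply: addr_ge0; apply: mulr_ge0; rewrite ?qrt_mass_ge0//.
    by apply: addr_ge0 => //; apply: mulr_ge0 => //; case: hu.
  by apply: It_ge0 => h; rewrite mulr_ge0 ?ind_ge0// mulr_ge0 ?sqrtr_ge0// invr_ge0 sqr_ge0.
have c1 : 0 < c by rewrite ltr_wpDl.
(* The tail of [U ^+ 2] is required below the square of [e / 4 / (kap * c)], so that its root
   multiplied by [kap * c] is at most [e / 4]. *)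
have ck : 0 < (e / 4 / (kap * c)) ^+ 2 by rewrite exprn_gt0// divr_gt0// mulr_gt0.
have [M3 M30 hM3] := tail_small U2 ck.
pose M := M1 + M2 + M3.
have M0 : 0 < M by rewrite !addr_gt0.
have [d1 d10 hd1] := II_UL_0 hu cu u1 u0 cU (divr_gt0 e4 k0).
have /cvgrPdist_lt /(_ _ e4) [/= d2 d20 hd2] := cen (x := 0).
pose a := Num.min M (Num.min (d1 / 2) (d2 / 2)).
have a0 : 0 < a by rewrite !lt_min M0 !divr_gt0.
have aM : a <= M by rewrite /a ge_min lexx.
have ad1 : a < d1.
  by apply: (@le_lt_trans _ _ (d1 / 2)); [rewrite /a !ge_min lexx !orbT|lra].
have ad2 : a < d2.
  by apply: (@le_lt_trans _ _ (d2 / 2)); [rewrite /a !ge_min lexx !orbT|lra].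
have b1 : `|en 0 - en a| <= e / 4.
  by apply/ltW/hd2; rewrite /= sub0r normrN gtr0_norm.
have b2 : `|en M| <= e / 4.
  have h1 : G M ^+ 2 <= e / 4.
    apply: le_trans r2; rewrite -(real_normK (num_real _)) ler_pXn2r ?nnegrE ?(ltW r0)//.
    by apply: hM1; rewrite /M -addrA lerDl addr_ge0// ltW.
  have h2 : sin (w M + beta) ^+ 2 <= e / 4.
    apply: le_trans r2; rewrite -(real_normK (num_real _)) ler_pXn2r ?nnegrE ?(ltW r0)//.
    by apply: hM2; rewrite /M addrAC lerDr addr_ge0// ltW.
  rewrite /en ler_norml; have := sqr_ge0 (G M); have := sqr_ge0 (sin (w M + beta)).
  by move=> p q; apply/andP; split; lra.
have b3 : `|kap * II 0 M UL| <= e / 4.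
  rewrite normrM (gtr0_norm k0); apply: (@le_trans _ _ (kap * (e / 4 / (kap * c) * c))); last first.
    by rewrite le_eqVlt; apply/orP; left; apply/eqP; field; rewrite !gt_eqF.
  rewrite ler_wpM2l ?(ltW k0)//; apply: (le_trans (II_UL_bound hu cu u1 u0 cU U2 M0)).
  apply: ler_pM; rewrite ?sqrtr_ge0//; last by rewrite lerDl.
  have q0 : 0 <= e / 4 / (kap * c) by rewrite divr_ge0 ?(ltW e4)// mulr_ge0 ?(ltW k0)// ltW.
  rewrite -[leRHS](ger0_norm q0) -sqrtr_sqr ler_wsqrtr//.
  have MM : M3 <= M by rewrite /M lerDr addr_ge0// ltW.
  apply: le_trans (hM3 M MM); rewrite le_eqVlt; apply/orP; left; apply/eqP.
  by apply: eq_It => x; rewrite [`|_|]ger0_norm// mulr_ge0 ?ind_ge0 ?sqr_ge0.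
have b4 : `|kap * II 0 a UL| <= e / 4.
  rewrite normrM (gtr0_norm k0) mulrC -ler_pdivlMr//; apply: hd1; by rewrite a0.
have sp : II 0 M UL = II 0 a UL + II a M UL.
  by apply: II_split; [exact: ltW|exact: aM|exact: iUL].
have E := energy_identity a0 aM.
have -> : en 0 = (en 0 - en a) + en M - kap * II 0 M UL + kap * II 0 a UL.
  rewrite sp mulrDr -E; ring.
have s1 := ler_normD (en 0 - en a + en M - kap * II 0 M UL) (kap * II 0 a UL).
have s2 := ler_normB (en 0 - en a + en M) (kap * II 0 M UL).
have s3 := ler_normD (en 0 - en a) (en M).
rewrite (_ : e = e / 4 + e / 4 + e / 4 + e / 4); last by field.
apply: (le_trans s1); apply: lerD => //; apply: (le_trans s2); apply: lerD => //.
by apply: (le_trans s3); exact: lerD.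
Qed.

End Boundary.

(** * Principal values and the boundary blow-up *)

Section PrincipalValue.
Context {R : realType}.
Implicit Types (f v phi : R -> R) (a b d e h s t x y z M : R).
Local Notation mu := (@lebesgue_measure R).

Lemma It_set (D : set R) f : measurable D ->
  \int[mu]_(x in D) f x = It (fun x => ind (x \in D) * f x).
Proof.
move=> mD; rewrite Rintegral_mkcond; apply: eq_It => x; rewrite patchE.
by case: ifP; rewrite /ind ?mul1r ?mul0r.
Qed.

Lemma itg_set (D : set R) f : measurable D ->
  itg (fun x => ind (x \in D) * f x) -> mu.-integrable D (EFin \o f).
Proof.
move=> mD; have -> : (fun x => ind (x \in D) * f x) = f \_ D.
  by apply/funext => x; rewrite patchE /ind; case: ifP => _; rewrite ?mul1r ?mul0r.
rewrite /itg -restrict_EFin.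
by move/integrable_restrict => /=; rewrite setTI; apply.
Qed.

Lemma small_at0 f : itg f -> forall e, 0 < e -> exists2 d, 0 < d &
  forall a, 0 < a < d -> It (fun x => ind (0 < x <= a) * `|f x|) <= e.
Proof.
move=> fi e e0; have mn : measurable_fun setT (fun x => `|f x|).
  by apply: measurableT_comp => //; exact: itg_meas.
have dom a x : `| (ind (0 < x <= a) * `|f x|) | <= `|f x|.
  by rewrite norm_ind normr_id ler_piMl ?ind_le1.
have h : It (fun x => ind (0 < x <= n.+1%:R^-1) * `|f x|) @[n --> \oo] --> It (fun=> 0 : R).
  apply: (It_dom (g := fun x => `|f x|) _ _ _ _).2.
  - by move=> n; apply: measurable_funM => //; exact: meas_lc.
  - move=> x; have [x0|x0] := ltP 0 x; last first.
      by apply: cvg_near_cst; apply: nearW => n; rewrite /ind mul0r.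
    apply: cvg_near_cst.
    have := @cvg_invS R => /cvgrPdist_lt /(_ _ x0); apply: filterS => n.
    rewrite sub0r normrN => /(le_lt_trans (ler_norm _)) hn.
    by rewrite [x <= _]leNgt hn /ind mul0r.
  - by move=> n x; exact: dom.
  - exact: itg_norm.
rewrite It0 in h; move/cvgrPdist_le : h => /(_ _ e0)[N _ /(_ N (leqnn N))] /=.
rewrite sub0r normrN => /(le_trans (ler_norm _)) hN.
have iN a : itg (fun x => ind (0 < x <= a) * `|f x|).
  apply: (itg_le (g := fun x => `|f x|)); last exact: itg_norm.
    by apply: measurable_funM => //; exact: meas_lc.
  by move=> x; exact: dom.
exists N.+1%:R^-1; first by rewrite invr_gt0.
move=> a /andP[a0 aN]; apply: le_trans hN; apply: It_le => // x.
apply: ler_wpM2r => //; have [/andP[x0 xa]|h] := boolP (0 < x <= a); last by rewrite [ind false]/ind ind_ge0.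
by rewrite x0 (le_trans xa (ltW aN)).
Qed.

Variables (u U : R -> R) (K : R).
Hypotheses (hr : c1_hoelder u U K) (cu : continuous u) (u1 : forall x, `|u x| <= 1)
  (u0 : forall x, x <= 0 -> u x = 0).

Let mu_ : measurable_fun setT u := cont_meas cu.

(** The part [y >= x + e] is [g1]. The part [y <= x - e], reflected, is [g2] without [h >= x], since
    the half-line stops at the origin. On the missing range [u (x - h) = 0], so it contributes
    [u x * h ^- 2], with integral [u x / x]: this is [g3]. *)
Lemma pv_It f x e : 0 < x -> 0 < e -> e <= x ->
  (forall y, 0 < y -> f y = (u x - u y) * (y - x) ^- 2) ->
  let g y := ind ((0 < y) && (e <= `|y - x|)) * f y in
  itg g /\ It g = It (fun h => ind (e <= h) * lk u x h) - u x / x.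
Proof.
move=> x0 e0 ex fE g.
pose g1 h := ind (e <= h) * h ^- 2 * (u x - u (x + h)).
pose g2 h := ind (e <= h) * h ^- 2 * (u x - u (x - h)).
pose g3 h := ind (x <= h) * h ^- 2 * u x.
have i0 : itg (fun h => ind (e <= h) * h ^- 2) := (itg_inv2 e0).1.
have mx : measurable_fun setT (fun h => u (x + h)).
  by have := meas_shift x mu_; under eq_fun do rewrite addrC.
have mxm : measurable_fun setT (fun h => u (x - h)).
  by have := meas_opp (meas_shift x mu_); under eq_fun do rewrite addrC.
have b2 s t : `|u s - u t| <= 2.
  by apply: (le_trans (ler_normB _ _)); have := u1 s; have := u1 t; lra.
have i1 : itg g1.
  apply: (eq_itg (f := fun h => (u x - u (x + h)) * (ind (e <= h) * h ^- 2))); first by move=> h; rewrite mulrC.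
  by apply: (itgMb (C := 2)) => //; exact: measurable_funB.
have i2 : itg g2.
  apply: (eq_itg (f := fun h => (u x - u (x - h)) * (ind (e <= h) * h ^- 2))); first by move=> h; rewrite mulrC.
  by apply: (itgMb (C := 2)) => //; exact: measurable_funB.
have i3 : itg g3.
  apply: (eq_itg (f := fun h => u x * (ind (x <= h) * h ^- 2))); first by move=> h; rewrite mulrC.
  by apply: itgZ; exact: (itg_inv2 x0).1.
have I3 : It g3 = u x / x.
  rewrite (eq_It (g := fun h => u x * (ind (x <= h) * h ^- 2))); last by move=> h; rewrite /g3 mulrC.
  by rewrite ItZ ?(itg_inv2 x0).2//; exact: (itg_inv2 x0).1.
have gE y : g y = g1 (y - x) + (g2 (- (y - x)) - g3 (- (y - x))).
  have e1 : x + (y - x) = y by rewrite addrC subrK.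
  have e2 : x - - (y - x) = y by rewrite opprK addrC subrK.
  rewrite /g /g1 /g2 /g3 e1 e2 sqrrN.
  have [yp|yn] := ltP 0 y; last first.
    rewrite /ind mul0r (u0 yn) !subr0.
    have -> : (e <= y - x) = false by apply/negbTE; rewrite -ltNge; lra.
    have -> : e <= - (y - x) by lra.
    have -> : x <= - (y - x) by lra.
    by rewrite !mul0r !mul1r subrr addr0.
  have -> : (x <= - (y - x)) = false by apply/negbTE; rewrite -ltNge; lra.
  rewrite [ind false]/ind !mul0r subr0 (fE y yp) /=.
  have [yx|xy] := leP 0 (y - x).
    have -> : (e <= - (y - x)) = false by apply/negbTE; rewrite -ltNge; lra.
    by rewrite [ind false]/ind !mul0r addr0 (ger0_norm yx); ring.
  have -> : (e <= (y - x)) = false by apply/negbTE; rewrite -ltNge; lra.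
  by rewrite [ind false]/ind !mul0r add0r (ltr0_norm xy); ring.
have i23 := itgB i2 i3.
have j1 : itg (fun y => g1 (y - x)) by exact: itg_shift.
have j2 : itg (fun y => g2 (- (y - x)) - g3 (- (y - x))).
  exact: (itg_shift (- x) (itg_opp i23)).
split; first by apply: (eq_itg (f := fun y => g1 (y - x) + (g2 (- (y - x)) - g3 (- (y - x))))); [move=> y; rewrite gE|exact: itgD].
rewrite (eq_It gE) (ItD j1 j2) (It_shift (- x) (itg_meas i1)).
rewrite (It_shift (- x) (f := fun z => g2 (- z) - g3 (- z)) (itg_meas (itg_opp i23))).
rewrite (It_opp (f := fun z => g2 z - g3 z) (itg_meas i23)) (ItB i2 i3) I3 addrA -(ItD i1 i2).
congr (_ - _); apply: eq_It => h; rewrite /g1 /g2 /lk /sym_diff.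
have [eh|he] := leP e h; last by rewrite [ind false]/ind !mul0r addr0.
by rewrite (lt_le_trans e0 eh) [ind true]/ind; ring.
Qed.

Lemma is_pv_Lam f x : 0 < x -> (forall y, 0 < y -> f y = (u x - u y) * (y - x) ^- 2) ->
  is_pv f x (half_lap u x - u x / x).
Proof.
move=> x0 fE; rewrite /is_pv.
have mD e : measurable (Rpos R `&` [set y | e <= `|y - x|]).
  apply: measurableI; first exact: measurable_itv.
  rewrite (_ : [set y | e <= `|y - x|] = `[x + e, +oo[%classic `|` `]-oo, x - e]%classic).
    by apply: measurableU; exact: measurable_itv.
  apply/seteqP; split => y /=; rewrite !in_itv/= andbT ler_normr.
    by move=> /orP[h|h]; [left|right]; lra.
  by move=> [h|h]; apply/orP; [left|right]; lra.
have memD e y : (y \in (Rpos R `&` [set y | e <= `|y - x|])) = (0 < y) && (e <= `|y - x|).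
  apply/idP/idP.
    by rewrite inE => -[]; rewrite /Rpos/= in_itv/= andbT => -> ->.
  by move=> /andP[y0 ey]; rewrite inE; split => //; rewrite /Rpos/= in_itv/= andbT.
have ge e : (fun y => ind (y \in (Rpos R `&` [set y | e <= `|y - x|])) * f y) =
   (fun y => ind ((0 < y) && (e <= `|y - x|)) * f y) by apply/funext => y; rewrite memD.
split => [e e0|].
  apply: itg_set => //; rewrite ge.
  have m0 : 0 < Num.min e x by rewrite lt_min e0.
  have mx : Num.min e x <= x by rewrite ge_min lexx orbT.
  have [i _] := pv_It x0 m0 mx fE.
  apply: (eq_itg (f := fun y => ind (e <= `|y - x|) * (ind ((0 < y) && (Num.min e x <= `|y - x|)) * f y))).
    move=> y; have [h|h] := leP e `|y - x|; last by rewrite andbF /ind !mul0r.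
    by rewrite ge_min h orTb !andbT (_ : ind true = 1 :> R)// mul1r.
  apply: (itgMb (C := 1)) => //; last by move=> y; rewrite ger0_norm ?ind_ge0 ?ind_le1.
  apply: (measurableT_comp (meas_ge e)); apply: measurableT_comp => //.
  by apply: measurable_funB => //; exact: measurable_id.
apply/cvgrPdist_le => e e0.
have [d d0 hd] := small_at0 (lk_itg hr cu u1 u0 x0) e0.
near=> a.
have a0 : 0 < a by near: a; exact: nbhs_right_gt.
have ax : a <= x by near: a; exact: nbhs_right_le.
have ad : a < d by near: a; exact: nbhs_right_lt.
have [ig Eg] := pv_It x0 a0 ax fE.
rewrite (It_set f (mD a)) ge Eg.
have il := lk_itg hr cu u1 u0 x0.
have ila : itg (fun h => ind (a <= h) * lk u x h).
  apply: (itgMb (C := 1)) => //; first exact: meas_ge.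
  by move=> h; rewrite ger0_norm ?ind_ge0 ?ind_le1.
rewrite (_ : _ - _ = half_lap u x - It (fun h => ind (a <= h) * lk u x h)); last by ring.
rewrite /half_lap -(ItB il ila).
apply: le_trans (hd a _); last by rewrite a0.
apply: It_norm_le; first by apply: itg_meas; exact: itgB.
  apply: (itg_le (g := fun h => `|lk u x h|)); last exact: itg_norm.
    apply: measurable_funM; first exact: meas_lc.
    by apply: measurableT_comp => //; exact: itg_meas.
  by move=> h; rewrite norm_ind normr_id ler_piMl ?ind_le1.
move=> h; have [ah|ha] := leP a h; first by rewrite /ind mul1r subrr normr0 mulr_ge0//; case: ifP.
rewrite /ind mul0r subr0 (ltW ha) andbT; have [h0|h0] := ltP 0 h; first by rewrite mul1r.
by rewrite /lk [0 < h]ltNge h0 /ind !mul0r normr0.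
Unshelve. all: by end_near. Qed.

(** The expansion at the origin gives this for [z <= 1]; for larger [z] the boundedness of [u] and
    of [U 0] suffices, which is where the added [1] comes from. *)
Lemma lin_bound z : 0 <= z -> `|u z - U 0 * z| <= (1 + K) * (qrt z * z).
Proof.
have [K0 Ub _ fx] := hr; move=> z0; have [z1|z1] := leP z 1.
  have := fx 0 z 0 (lexx 0) (lexx 0) z0; rewrite subr0 => /(_ z1).
  rewrite (u0 (lexx 0)) subr0 => /le_trans; apply.
  by rewrite ler_wpM2r ?lerDr// mulr_ge0 ?qrt_ge0.
have zq : 1 <= qrt z.
  by rewrite -(ler_pXn2r (n := 4)) ?nnegrE ?qrt_ge0// expr1n qrt4// ltW.
have zz : z <= qrt z * z by rewrite ler_peMl.
apply: (le_trans (ler_normB _ _)); rewrite mulrDl mul1r; apply: lerD.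
  by apply: (le_trans (u1 z)); apply: (le_trans (ltW z1)).
by rewrite normrM (ger0_norm z0); apply: ler_pM => //; exact: Ub.
Qed.

Lemma log_int x : 0 < x -> x <= 1 -> II x 1 (fun h => h ^- 2 * (x - h)) = 1 - x + ln x.
Proof.
move=> x0 x1; transitivity ((- x * 1^-1 - ln 1) - (- x * x^-1 - ln x)); last first.
  by rewrite ln1 invr1 !mulNr mulfV ?gt_eqF//; ring.
apply: (@FTC2 _ (fun h => - x * h^-1 - ln h)).
- exact: x1.
- apply: continuous_in_subspaceT => h; rewrite inE /= in_itv/= => /andP[xh _].
  have h0 := lt_le_trans x0 xh; apply: cvgM; last by apply: cvgB; [exact: cvg_cst|exact: cvg_id].
  apply: cvgV; first by rewrite gt_eqF// exprn_gt0.
  by rewrite expr2; under eq_fun do rewrite expr2; apply: cvgM; exact: cvg_id.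
- apply: continuous_in_subspaceT => h; rewrite inE /= in_itv/= => /andP[xh _].
  have h0 := lt_le_trans x0 xh; apply: cvgB; last exact: continuous_ln.
  by apply: cvgM; [exact: cvg_cst|apply: cvgV; [rewrite gt_eqF|exact: cvg_id]].
move=> h /andP[xh _]; have h0 := lt_trans x0 xh.
have dV : is_derive h 1 (fun y : R => y^-1) (- h ^- 2).
  have := is_deriveV (f := id) (lt0r_neq0 h0) (is_derive_id h 1).
  by rewrite /GRing.scale/= mulr1.
have d := is_deriveB (is_deriveZ (- x) dV) (is_derive1_ln h0).
by apply: (is_derive_eq d); rewrite /GRing.scale/=; field; exact: lt0r_neq0.
Qed.

(** For [h > x] the point [x - h] is negative, so [sym_diff u x h] is [2 u x - u (x + h)], close to
    [U 0 * (x - h)]. Integrated against [h ^- 2] over [[x, 1]] this gives [U 0 * (1 - x + ln x)],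
    and all other contributions stay bounded. *)
Lemma half_lap_log : exists C : R, forall x, 0 < x < 1 -> `|half_lap u x - U 0 * ln x| <= C.
Proof.
have [K0 Ub _ _] := hr.
(* [2 K] comes from [h <= x]. For [x < h <= 1] the linearisation costs [2 (1 + K)] at [x], which
   enters twice, and [4 (1 + K)] at [x + h], since [x + h <= 2 h] and [qrt (x + h) <= 2 * qrt h]. *)
pose C3 := 2 * K + 6 * (1 + K).
exists (C3 * qrt_mass + 4 + K) => x /andP[x0 x1].
pose m h := ind (x <= h <= 1) * (h ^- 2 * (x - h)).
have C30 : 0 <= C3 by apply: addr_ge0; apply: mulr_ge0 => //; exact: addr_ge0.
have bound h : `|lk u x h - U 0 * m h| <= C3 * dom1 h + dom2 h.
  have D1 := mulr_ge0 C30 (dom1_ge0 h); have D2 := dom2_ge0 h.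
  have [h0|h0] := ltP 0 h; last first.
    rewrite /lk /m [0 < h]ltNge h0 [x <= h]leNgt (le_lt_trans h0 x0) /= /ind !mul0r mulr0 subr0 normr0.
    exact: addr_ge0.
  have hi : 0 < h ^- 2 by rewrite invr_gt0 exprn_gt0.
  have [h1|h1] := leP h 1; last first.
    rewrite /m [h <= 1]leNgt h1 andbF [ind (~~ true)]/ind mul0r mulr0 subr0.
    apply: (@le_trans _ _ (dom2 h)); last by rewrite lerDr.
    rewrite /lk h0 /dom2 (ltW h1) /ind !mul1r normrM (gtr0_norm hi) mulrC ler_wpM2r ?(ltW hi)//.
    exact: sym_diff_le4.
  apply: (@le_trans _ _ (C3 * dom1 h)); last by rewrite lerDl.
  have qh := qrt_ge0 h.
  have Edom : C3 * dom1 h = h ^- 2 * (C3 * (qrt h * h)).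
    by rewrite /dom1 h0 h1 (_ : ind (true && true) = 1 :> R)// mul1r; field; exact: lt0r_neq0.
  rewrite Edom; have [hx|xh] := leP h x.
    have m0 : m h = 0.
      rewrite /m; move: hx; rewrite le_eqVlt => /orP[/eqP->|hx]; first by rewrite subrr !mulr0.
      by rewrite [x <= h]leNgt hx /ind mul0r.
    rewrite m0 mulr0 subr0 /lk h0 [ind true]/ind mul1r normrM (gtr0_norm hi) ler_wpM2l ?(ltW hi)//.
    apply: (le_trans (sym_diff_small hr h0 hx h1)); rewrite ler_wpM2r ?mulr_ge0 ?(ltW h0)//.
    by rewrite lerDl mulr_ge0// addr_ge0.
  have E : lk u x h - U 0 * m h = h ^- 2 * (2 * (u x - U 0 * x) - (u (x + h) - U 0 * (x + h))).
    rewrite /lk /m /sym_diff h0 (ltW xh) h1 /= (u0 (_ : x - h <= 0)); last by rewrite subr_le0 ltW.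
    by ring.
  rewrite E normrM (gtr0_norm hi) ler_wpM2l ?(ltW hi)//.
  apply: (le_trans (ler_normB _ _)).
  have l1 := lin_bound (ltW x0); have l2 := lin_bound (addr_ge0 (ltW x0) (ltW h0)).
  have K1 : 0 <= 1 + K by rewrite addr_ge0.
  have t1 : `|2 * (u x - U 0 * x)| <= 2 * ((1 + K) * (qrt h * h)).
    rewrite normrM ger0_norm// ler_wpM2l//; apply: (le_trans l1); rewrite ler_wpM2l//.
    by apply: ler_pM; rewrite ?qrt_ge0 ?(ltW x0) ?(ltW xh)//; apply: qrt_le; exact: ltW.
  have q2 : qrt (x + h) <= 2 * qrt h.
    rewrite -(ler_pXn2r (n := 4)) ?nnegrE ?qrt_ge0 ?mulr_ge0// exprMn (qrt4 (ltW h0)) qrt4 ?addr_ge0 ?(ltW x0) ?(ltW h0)//.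
    by rewrite (_ : 2 ^+ 4 = 16 :> R); [lra|ring].
  have t2 : `|u (x + h) - U 0 * (x + h)| <= 4 * ((1 + K) * (qrt h * h)).
    apply: (le_trans l2); rewrite [leRHS]mulrCA; apply: ler_wpM2l => //.
    rewrite (_ : 4 * (qrt h * h) = (2 * qrt h) * (2 * h)); last by ring.
    by apply: ler_pM; rewrite ?qrt_ge0 ?addr_ge0 ?(ltW x0) ?(ltW h0)//; lra.
  have K2 := mulr_ge0 K0 (mulr_ge0 qh (ltW h0)).
  by rewrite /C3; move: t1 t2; lra.
have il := lk_itg hr cu u1 u0 x0.
have idom : itg (fun h => C3 * dom1 h + dom2 h).
  by apply: itgD; [apply: itgZ; exact: itg_dom1|exact: itg_dom2].
have cm : {within `[x, 1], continuous (fun h => h ^- 2 * (x - h))}.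
  apply: continuous_in_subspaceT => h; rewrite inE /= in_itv/= => /andP[xh _].
  have h0 := lt_le_trans x0 xh; apply: cvgM; last by apply: cvgB; [exact: cvg_cst|exact: cvg_id].
  apply: cvgV; first by rewrite gt_eqF// exprn_gt0.
  by rewrite expr2; under eq_fun do rewrite expr2; apply: cvgM; exact: cvg_id.
have im : itg m := itg_cont cm.
have Im : It m = 1 - x + ln x := log_int x0 (ltW x1).
have h1 : `|half_lap u x - U 0 * It m| <= C3 * qrt_mass + 4.
  rewrite /half_lap -(ItZ (U 0) im) -(ItB il (itgZ (U 0) im)).
  have -> : C3 * qrt_mass + 4 = It (fun h => C3 * dom1 h + dom2 h).
    rewrite ItD; [|by apply: itgZ; exact: itg_dom1|exact: itg_dom2].
    rewrite ItZ; last exact: itg_dom1.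
    by rewrite /dom2 ItZ ?(itg_inv2 ltr01).2 ?invr1 ?mulr1//; exact: (itg_inv2 ltr01).1.
  apply: It_norm_le => //; apply: itg_meas; apply: itgB => //; exact: itgZ.
have -> : half_lap u x - U 0 * ln x = (half_lap u x - U 0 * It m) + U 0 * (1 - x) by rewrite Im; ring.
apply: (le_trans (ler_normD _ _)); apply: lerD => //.
rewrite normrM -[leRHS]mulr1; apply: ler_pM => //; first exact: Ub.
by rewrite ler_norml; apply/andP; split; lra.
Qed.

Lemma half_lap_blowup : U 0 != 0 -> forall A : R, exists2 d, 0 < d & forall x, 0 < x < d -> A <= `|half_lap u x|.
Proof.
move=> U0 A; have [C hC] := half_lap_log.
have Up : 0 < `|U 0| by rewrite normr_gt0.
pose B := (`|A| + `|C|) / `|U 0|.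
exists (Num.min 1 (expR (- B))); first by rewrite lt_min ltr01 expR_gt0.
move=> x /andP[x0]; rewrite lt_min => /andP[x1 xe].
have lx : ln x <= - B.
  by rewrite -[leRHS]expRK ler_ln ?posrE ?expR_gt0// ltW.
have B0 : 0 <= B by rewrite divr_ge0// addr_ge0.
have h1 : `|A| + `|C| <= `|U 0 * ln x|.
  rewrite normrM mulrC -ler_pdivrMr// -/B ler0_norm; last by apply: (le_trans lx); rewrite oppr_le0.
  by rewrite lerNr.
have x01 : 0 < x < 1 by rewrite x0.
have := hC x x01; have := ler_normB (half_lap u x) (half_lap u x - U 0 * ln x).
rewrite opprB addrCA subrr addr0.
have := ler_norm A; have := ler_norm C; move: h1; lra.
Qed.

End PrincipalValue.

Section Bounded.
Context {R : realType}.
Implicit Types (f v phi : R -> R) (a b d e h s t x y z M : R).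

(** Finite energy alone allows growth like a square root. Here [|cos (v M)| > 1/2], so [|sin| > 1/2]
    at [v M + pi / 2] and at [v M - pi / 2]. By the intermediate value theorem [v] cannot reach
    these values after [M]. *)
Lemma bounded_of_sin v M : 0 <= M -> continuous v -> (forall x, M <= x -> `|sin (v x)| <= 2^-1) ->
  exists C, forall x, 0 <= x -> `|v x| <= C.
Proof.
move=> M0 cv hs; have [C C0 hC] := cont_bnd (contT_within (A := `[0, M]) cv).
have cM : 2^-1 < `|cos (v M)|.
  have s1 := hs M (lexx M); have e := cos2Dsin2 (v M).
  rewrite -[cos _ ^+ 2](real_normK (num_real _)) -[sin _ ^+ 2](real_normK (num_real _)) in e.
  have := normr_ge0 (cos (v M)); have := normr_ge0 (sin (v M)); move: s1 e.
  move: `|sin (v M)| `|cos (v M)| => p q; nra.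
have sp z : z = pi / 2 \/ z = - (pi / 2) -> 2^-1 < `|sin (v M + z)|.
  move=> hz; rewrite sinD.
  have -> : cos z = 0 by case: hz => ->; rewrite ?cosN cos_pihalf.
  rewrite mulr0 add0r normrM (_ : `|sin z| = 1) ?mulr1//.
  by case: hz => ->; rewrite ?sinN ?normrN sin_pihalf normr1.
have no x z : M <= x -> z = pi / 2 \/ z = - (pi / 2) ->
    ~~ (Num.min (v M) (v x) <= v M + z <= Num.max (v M) (v x)).
  move=> Mx hz; apply/negP => hb.
  have [c] := IVT Mx (contT_within (A := `[M, x]) cv) hb.
  rewrite in_itv/= => /andP[Mc _] E; have := hs c Mc; rewrite E.
  by move/(lt_le_trans (sp z hz)); rewrite ltxx.
exists (C + pi / 2) => x x0; have p0 : 0 <= pi / 2 :> R by rewrite divr_ge0// pi_ge0.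
have [xM|Mx] := leP x M; first by rewrite (le_trans (hC x _)) ?x0// lerDl.
have l1 : v x < v M + pi / 2.
  rewrite ltNge; apply/negP => hh; move/negP: (no x _ (ltW Mx) (or_introl erefl)); apply.
  by rewrite ge_min le_max hh orbT lerDl p0.
have l2 : v M - pi / 2 < v x.
  rewrite ltNge; apply/negP => hh; move/negP: (no x _ (ltW Mx) (or_intror erefl)); apply.
  by rewrite ge_min le_max hh orbT gerDl oppr_le0 p0.
have := hC M _; rewrite lexx M0 => /(_ isT); rewrite !ler_norml => /andP[m1 m2].
by move: l1 l2 m1 m2; move: (pi / 2) => q *; apply/andP; split; lra.
Qed.

End Bounded.

(** * One-sided derivatives and conclusion *)

Section Assembly.
Context {R : realType}.
Implicit Types (f v phi : R -> R) (a b d e h s t x y z M : R).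
Local Notation mu := (@lebesgue_measure R).

Lemma c1_hoelder_quot f G K x y : c1_hoelder f G K -> 0 <= x -> 0 <= y -> y != x -> `|y - x| <= 1 ->
  `|(f y - f x) / (y - x) - G x| <= K * qrt `|y - x|.
Proof.
move=> [_ _ _ fx] x0 y0 yx y1; have d0 : y - x != 0 by rewrite subr_eq0.
rewrite (_ : (f y - f x) / (y - x) - G x = (f y - f x - G x * (y - x)) / (y - x)); last by field.
rewrite normrM normfV ler_pdivrMr ?normr_gt0//.
have [xy|xy] := leP x y.
  have dd : 0 <= y - x by rewrite subr_ge0.
  by move: y1; rewrite (ger0_norm dd) -mulrA => y1; exact: fx.
have dd : 0 <= x - y by rewrite subr_ge0 ltW.
have -> : f y - f x - G x * (y - x) = - (f x - f y - G x * (x - y)) by ring.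
move: y1; rewrite normrN distrC (ger0_norm dd) -mulrA => y1.
by apply: fx => //; exact: ltW.
Qed.

(** Properness makes the limit that defines [derive_nneg] unique; at the origin it holds because the
    half-line accumulates there from the right. *)
Lemma within_dnbhs_proper x : 0 <= x -> ProperFilter (within (Rnneg R) x^').
Proof.
move=> x0; apply: Build_ProperFilter_ex => P.
move=> hP; have /nbhs_ballP[e /= e0 he] : nbhs x (fun y => y != x -> Rnneg R y -> P y) := hP.
exists (x + e / 2).
have e2 : 0 < e / 2 by rewrite divr_gt0.
apply: he.
- by rewrite /ball/= opprD addrA subrr sub0r normrN gtr0_norm//; lra.
- by rewrite gt_eqF// ltrDl.
- by rewrite /Rnneg/= in_itv/= andbT addr_ge0// ltW.
Qed.

Lemma c1_hoelder_diff_quot f theta G K c x : c1_hoelder f G K -> (forall y, 0 <= y -> theta y = c + f y) ->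
  0 <= x -> diff_quot_nneg theta x --> G x.
Proof.
move=> hr tw x0; have K0 : 0 <= K by case: hr.
have K1 : 0 < K + 1 by rewrite ltr_wpDl.
apply/cvgrPdist_le => e e0; have ek : 0 < e / (K + 1) by rewrite divr_gt0.
have hn d (d0 : 0 < d) : \forall y \near x^', `|x - y| < d.
  by apply: (@nbhs_dnbhs R x); exact: (nbhsx_ballx x d d0).
rewrite near_withinE; near=> y => yD.
have y0 : 0 <= y by move: yD; rewrite /Rnneg/= in_itv/= andbT.
have yx : y != x by near: y; exact: nbhs_dnbhs_neq.
have y1 : `|y - x| < 1.
  by rewrite distrC; near: y; exact: hn.
have y2 : `|y - x| < (e / (K + 1)) ^+ 4.
  by rewrite distrC; near: y; apply: hn; exact: exprn_gt0.
rewrite !tw// distrC opprD addrACA subrr add0r.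
apply: (le_trans (c1_hoelder_quot hr x0 y0 yx (ltW y1))).
apply: (@le_trans _ _ ((K + 1) * (e / (K + 1)))); last by rewrite mulrC divfK// gt_eqF.
apply: ler_pM; rewrite ?qrt_ge0 ?lerDl//.
by apply: (qrt_lt_eps ek); rewrite normr_ge0.
Unshelve. all: by end_near. Qed.

End Assembly.

Unset Implicit Arguments.
Set Strict Implicit.

Theorem theorem2 (R : realType) (beta nu : R) (eta theta : R -> R)
    (hbeta0 : 0 < beta) (hbeta : beta <= pi / 2) (hnu : 0 < nu)
    (heta : is_cutoff beta eta)
    (htheta : is_minimizer beta nu eta theta) :
  (C2_pos theta /\ C1_nneg theta /\ W1infty_pos theta) /\
  (forall x : R, 0 < x ->
    exists2 P : R,
      is_pv (fun y => (sin (theta x - beta) - sin (theta y - beta))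
                      / (x - y) ^+ 2) x P
    & theta^`(2) x =
        sin (theta x) * cos (theta x)
        + nu / (2 * pi)
          * (sin (theta x - beta) * cos (theta x - beta) / x)
        + nu / (2 * pi) * cos (theta x - beta) * P) /\
  `|derive_nneg theta 0| = sin beta /\
  `|theta^`(2) x| @[x --> 0^'+] --> +oo.
Proof.
have [w [g [ph [hw hp tw [Ai ki] hmin]]]] := minimizer_repr hbeta0 hnu heta htheta.
have isn := sin_sq_itg hbeta0 hnu heta hw Ai.
have hEL := euler_lagrange hnu heta hw hp Ai ki hmin.
have [G0 [K [mG0 hr0 hG0 aeG0]]] := regularity1 hbeta0 hnu heta hw hp ki hEL.
(* The slope is extended to the negative axis by its value at [0], so that continuity on the line is
   available. *)
pose G (x : R) := G0 (Num.max x 0).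
have [hr cG] : c1_hoelder w G K /\ continuous G := c1_hoelder_max hr0.
have GE (x : R) : 0 < x -> G x = G0 x by move=> x0; rewrite /G max_l// ltW.
have hG : fin_energy w (fun x => ind (0 < x) * G x).
  rewrite (_ : (fun x => _) = (fun x => ind (0 < x) * G0 x))//; apply/funext => x.
  by have [x0|x0] := ltP 0 x; rewrite /ind ?mul0r// GE.
have aeG : {ae @lebesgue_measure R, forall x, 0 < x -> g x = G x}.
  by apply: aeS aeG0 => x h x0; rewrite GE// h.
have dG (x : R) (x0 : 0 < x) : is_derive x 1 G (el_rhs beta nu w x) :=
  G_is_derive hbeta0 hnu heta hw hp ki hEL hr cG hG aeG x0.
have cR (x : R) (x0 : 0 < x) : {for x, continuous (el_rhs beta nu w)}
  := @el_rhs_cont R beta nu w g G K hw hr x x0.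
have slope := slope_sq hnu hr cG hG dG isn.
pose u (x : R) := sin (w x).
have cw : continuous w := fin_energy_cont hw.
have cu : continuous u by exact: cont_sin_comp.
have u1 (x : R) : `|u x| <= 1 by exact: sin_norm_le1.
have w0 (x : R) : x <= 0 -> w x = 0 by case: hw => _ _ h _; exact: h.
have u0 (x : R) : x <= 0 -> u x = 0 by move=> x0; rewrite /u w0// sin0.
have hu := c1_hoelder_sin hr.
have nearT (x : R) : 0 < x -> \forall y \near x, theta y = beta + w y.
  move=> x0; near=> y; apply: tw; apply: ltW; near: y; exact: near_gt.
have dT (x : R) : 0 < x -> is_derive x 1 theta (G x).
  move=> x0; apply: (near_eq_is_derive (f := fun y => beta + w y)).
    by apply: filterS (nearT x x0) => y ->.
  have dw := c1_hoelder_is_derive hr x0.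
  by apply: (is_derive_eq (is_deriveD (is_derive_cst beta x 1) dw)); rewrite add0r.
have T1 (x : R) : 0 < x -> derive1 theta x = G x by move=> x0; apply: is_derive_derive1; exact: dT.
have dT1 (x : R) : 0 < x -> is_derive x 1 (derive1 theta) (el_rhs beta nu w x).
  move=> x0; have dGx := dG x x0; apply: (near_eq_is_derive (f := G)).
  by near=> y; rewrite T1//; near: y; exact: near_gt.
have T2 (x : R) : 0 < x -> derive1n 2 theta x = el_rhs beta nu w x.
  by move=> x0; rewrite derive1nS derive1n1; apply: is_derive_derive1; exact: dT1.
have lG (x : R) : 0 <= x -> diff_quot_nneg theta x --> G x by exact: c1_hoelder_diff_quot hr tw.
have dN (x : R) : 0 <= x -> derive_nneg theta x = G x.
  move=> x0; have pf := within_dnbhs_proper x0; apply: cvg_lim => //; exact: lG.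
have pi0 : 0 < pi :> R := pi_gt0 R.
(* Positivity is used twice: to pass from equal squares to [|theta'(0)| = sin beta], and to have a
   nonzero slope, hence a corner, for the blow-up. *)
have sb : 0 < sin beta.
  apply: sin_gt0_pi; rewrite hbeta0 /=; apply: (le_lt_trans hbeta).
  by rewrite ltr_pdivrMr// ltr_pMr// ltr1n.
have [K0 Gb _ _] := hr.
split; [split; [|split]|split; [|split]].
- move=> x x0; split.
  + exact: (@ex_derive _ _ _ _ _ _ _ (dT x x0)).
  + exact: (@ex_derive _ _ _ _ _ _ _ (dT1 x x0)).
  suff h : theta^`(2) y @[y --> x] --> theta^`(2) x by exact: h.
  rewrite T2//; have h : el_rhs beta nu w y @[y --> x] --> el_rhs beta nu w x := cR x x0.
  apply: cvg_trans h; apply: near_eq_cvg.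
  by near=> y; rewrite T2//; near: y; exact: near_gt.
- split; first by move=> x x0; apply: cvgP; exact: lG.
  apply: (subspace_eq_continuous (f := G)); last exact: continuous_subspaceT.
  by move=> x; rewrite inE /Rnneg/= in_itv/= andbT => x0; exact: (esym (dN x x0)).
(* Square integrability of [sin theta] and Lipschitz continuity make [sin theta] small at infinity,
   which confines [theta] to a bounded range. *)
- have [M M0 hM] : exists2 M : R, 0 < M & forall x, M <= x -> `|sin (w x + beta)| <= 2^-1.
    have K20 : 0 <= 2 * K by exact: mulr_ge0.
    have cb : continuous (fun x => w x + beta) by move=> x; apply: cvgD; [exact: cw|exact: cvg_cst].
    apply: (decay K20 _ _ isn) => //; first by apply: cont_meas; exact: cont_sin_comp.
    move=> x y x0 xy yx; have d0 : 0 <= y - x by rewrite subr_ge0.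
    apply: (le_trans (sin_lip _ _)); rewrite opprD addrACA subrr addr0 distrC.
    by apply: (le_trans (c1_hoelder_lip hr x0 xy yx)); rewrite ler_wpM2l// le_qrt// d0.
  have cb : continuous (fun x => w x + beta) by move=> x; apply: cvgD; [exact: cw|exact: cvg_cst].
  have [C hC] := bounded_of_sin (ltW M0) cb hM.
  split.
    split.
      apply: (eq_measurable_fun (fun x => beta + w x)).
        by move=> x; rewrite inE /Rpos/= in_itv/= andbT => x0; rewrite tw// ltW.
      by apply: measurable_funTS; apply: measurable_funD => //; exact: cont_meas.
    exists C; apply: aeW => x; rewrite /Rpos/= in_itv/= andbT => x0.
    by rewrite tw ?(ltW x0)// addrC hC// ltW.
  exists (fun x => ind (0 < x) * G x).
    by apply: (fin_energy_is_wderiv hG (beta := beta)) => x x0; rewrite tw// ltW.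
  split; first by apply: measurable_funTS; case: hG => -[].
  exists K; apply: aeW => x; rewrite /Rpos/= in_itv/= andbT => x0.
  by rewrite x0 /ind mul1r Gb// ltW.
- move=> x x0; exists (half_lap u x - u x / x).
    apply: (is_pv_Lam hu cu u1 u0 x0) => y y0.
    rewrite !tw ?(ltW x0) ?(ltW y0)// !(addrC beta) !addrK.
    by rewrite -(opprB x y) sqrrN.
  rewrite T2// /el_rhs tw ?(ltW x0)// (addrC beta) addrK -/(u x).
  by move: (nu / (2 * pi)) => k; rewrite /u; ring.
- rewrite dN//; apply/eqP; rewrite -(eqrXn2 (n := 2)) ?normr_ge0 ?(ltW sb)//.
  by rewrite real_normK ?num_real// slope.
have k0 : 0 < nu / (2 * pi) by rewrite divr_gt0// mulr_gt0.
have U0 : cos (w 0) * G 0 != 0.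
  rewrite w0// cos0 mul1r -sqrf_eq0 slope sqrf_eq0; exact: lt0r_neq0.
have cc : continuous (fun x => cos (w x)) by exact: cont_cos_comp.
have half : (0 : R) < 2^-1 by rewrite invr_gt0.
have /cvgrPdist_lt /(_ _ half) [/= d1 d10 hd1] := cc 0.
apply/cvgryPge => A.
(* The factor [2] compensates for [cos (w x) >= 1/2] near the origin, and the added [1] absorbs the
   bounded term [sin theta * cos theta]. *)
have [d2 d20 hd2] := half_lap_blowup hu cu u1 u0 U0 ((`|A| + 1) * 2 / (nu / (2 * pi))).
near=> x.
have x0 : 0 < x by near: x; exact: nbhs_right_gt.
have xd1 : x < d1 by near: x; exact: nbhs_right_lt.
have xd2 : x < d2 by near: x; exact: nbhs_right_lt.
have -> : derive1 (derive1 theta) x = el_rhs beta nu w x by exact: T2.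
rewrite /el_rhs -/u.
have cx : 2^-1 <= `|cos (w x)|.
  have := hd1 x; rewrite /= sub0r normrN gtr0_norm// => /(_ xd1); rewrite w0// cos0.
  have := ler_norm (cos (w x)); rewrite ltr_norml => h /andP[h1 h2]; lra.
have lx : (`|A| + 1) * 2 / (nu / (2 * pi)) <= `|half_lap u x| by apply: hd2; rewrite x0.
have big : `|A| + 1 <= `|nu / (2 * pi) * (cos (w x) * half_lap u x)|.
  rewrite [leRHS]normrM (gtr0_norm k0) [in leRHS]normrM.
  rewrite (_ : `|A| + 1 = nu / (2 * pi) * (2^-1 * ((`|A| + 1) * 2 / (nu / (2 * pi))))); last first.
    by move: k0; move: (nu / (2 * pi)) => k k0; field; exact: lt0r_neq0.
  rewrite ler_wpM2l ?(ltW k0)//; apply: ler_pM => //.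
  by rewrite divr_ge0 ?(ltW k0)// mulr_ge0// addr_ge0.
have t1 := trig_le1 (w x + beta).
have := ler_normB (sin (w x + beta) * cos (w x + beta) + nu / (2 * pi) * (cos (w x) * half_lap u x)) (sin (w x + beta) * cos (w x + beta)).
rewrite addrAC subrr add0r.
have := ler_norm A; move: big t1; lra.
Unshelve. all: by end_near. Qed.
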